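(* Let $X$ be a reflexive Banach space, $(\Omega,\beta,\mu)$ a finite measure space, $\{T_t,\,t\ge 0\}$ a strongly continuous semigroup of linear $L_1$-$L_\infty$ contractions on $L_1(\Omega,X)$, and $F_s\uparrow F_\infty$ an increasing family of sub-$\sigma$-algebras of $\beta$. Let $1\le p<\infty$ and $f\in L_p(\Omega,X)$. Then: (1) $E(A_tf|F_s)\to f^*$ in the norm of $L_p(\Omega,X)$ as $t,s\to\infty$; (2) $A_tE(f|F_s)\to f_*$ in the norm of $L_p(\Omega,X)$ as $t,s\to\infty$.
   Context: $L_p(\Omega,X)$, $1\le p<\infty$, is the Banach space of $X$-valued (strongly) measurable functions $f$ on $\Omega$ with $\|f\|_p=\left(\int_\Omega\|f(\omega)\|_X^p\,d\mu\right)^{1/p}<\infty$; $\|f\|_\infty=\inf\{\lambda:\|f(\omega)\|_X\le\lambda\text{ a.e.}\}$. A linear operator $T$ on $L_1(\Omega,X)$ is an $L_1$-$L_\infty$ contraction if $\|Tf\|_1\le\|f\|_1$ and $\|Tf\|_\infty\le\|f\|_\infty$. A family $\{T_t,t\ge0\}$ of linear operators on $L_1(\Omega,X)$ is a strongly continuous semigroup if $T_0=\mathrm{id}$, $T_{t_1}T_{t_2}=T_{t_1+t_2}$ for all $t_1,t_2>0$, and $\lim_{t_1\to t_2}\|T_{t_1}f-T_{t_2}f\|_1=0$ for every $f\in L_1(\Omega,X)$ and $t_2>0$. The ergodic average is $A_tf(\omega)=\frac1t\int_0^tT_\tau f(\omega)\,d\tau$, $t>0$. $E(\cdot|F)$ is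 the (Bochner) conditional expectation operator with respect to the sub-$\sigma$-algebra $F$. $F_s\uparrow F_\infty$ means $F_{s_1}\subset F_{s_2}$ for $s_1<s_2$ and $F_\infty$ is the $\sigma$-algebra generated by $\bigcup_sF_s$. The limit functions are $$f_\infty(\omega)=\lim_{t\to\infty}A_tf(\omega),\qquad f^*(\omega)=\lim_{s\to\infty}E(f_\infty|F_s)(\omega),\qquad f_*(\omega)=\lim_{t\to\infty}A_tE(f|F_\infty)(\omega).$$ Limits as $t,s\to\infty$ are joint limits with $t$ and $s$ tending to infinity independently. *)

(* Defs.v *)
From mathcomp Require Import all_boot all_order all_algebra.
From mathcomp Require Import all_classical all_reals all_analysis.
Set Implicit Arguments.
Unset Strict Implicit.
Unset Printing Implicit Defensive.
Import Order.TTheory GRing.Theory Num.Theory.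
Import numFieldNormedType.Exports.
Local Open Scope classical_set_scope.
Local Open Scope ring_scope.

Section reflexivity.
Context {R : realType} (X : normedModType R).

Definition dual : set (X -> R) := [set x' | linear (x' : X -> R^o) /\ continuous x'].

Definition dual_norm (x' : X -> R) : R :=
  sup [set `|x' x| | x in [set x : X | `|x| <= 1]].

(* An element of the bidual is represented by a function on all of [X -> R];
   only its values on [dual] are constrained. *)
Definition bidual : set ((X -> R) -> R) :=
  [set x'' |
    (forall (a : R) (x' y' : X -> R), dual x' -> dual y' ->
       x'' (fun x => a * x' x + y' x) = a * x'' x' + x'' y') /\
    (exists C : R, forall x', dual x' -> `|x'' x'| <= C * dual_norm x')].

Definition reflexive_space :=
  forall x'', bidual x'' -> exists x : X, forall x', dual x' -> x'' x' = x' x.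

End reflexivity.

Section bochner.
Context {R : realType} {X : normedModType R} {d : measure_display}
  {T : measurableType d} (mu : {measure set T -> \bar R}).

Definition simple_fun (F : set (set T)) (h : T -> X) :=
  finite_set (range h) /\ forall y, F (h @^-1` [set y]).

(* Closed under equality mu-a.e., so that it is a property of classes.  For a
   sub-sigma-algebra F it says that f agrees a.e. with an F-measurable map. *)
Definition strongly_measurable (F : set (set T)) (f : T -> X) :=
  exists h : nat -> T -> X, (forall n, simple_fun F (h n)) /\
    (\forall w \ae mu, h n w @[n --> \oo] --> f w).

Definition Xnorm (p : \bar R) (f : T -> X) : \bar R :=
  Lnorm mu p (fun w => (`|f w|)%:E).

Definition Lp (p : \bar R) : set (T -> X) :=
  [set f | strongly_measurable measurable f /\ (Xnorm p f < +oo)%E].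

(* When mu (D `&` h @^-1` [set 0]) = +oo the term of y = 0 is still 0. *)
Definition simple_integral (D : set T) (h : T -> X) : X :=
  \sum_(y \in range h) fine (mu (D `&` h @^-1` [set y])) *: y.

Definition is_bochner_integral (D : set T) (f : T -> X) (x : X) :=
  strongly_measurable measurable f /\
  exists h : nat -> T -> X,
    [/\ forall n, simple_fun measurable (h n),
        forall n y, y != 0 -> (mu (D `&` h n @^-1` [set y]) < +oo)%E,
        (\int[mu]_(w in D) (`|f w - h n w|)%:E)%E @[n --> \oo] --> 0%E &
        simple_integral D (h n) @[n --> \oo] --> x].

Definition bochner_integrable (D : set T) (f : T -> X) :=
  exists x, is_bochner_integral D f x.

Definition bochner_integral (D : set T) (f : T -> X) : X :=
  xget 0 (is_bochner_integral D f).

Definition is_cond_exp (F : set (set T)) (f g : T -> X) :=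
  [/\ strongly_measurable F g, bochner_integrable setT f,
      bochner_integrable setT g &
      forall A, F A -> bochner_integral A g = bochner_integral A f].

(* E(f|F): a representative of the class, unique up to equality a.e. *)
Definition cond_exp (F : set (set T)) (f : T -> X) : T -> X :=
  xget (cst 0) (is_cond_exp F f).

(* E(f|F_s)(w) --> g(w) for a.e. w as s --> +oo.  Each E(f|F_s) is defined only
   up to a null set depending on s, and s is a real parameter, so the pointwise
   limit is taken along a suitable choice of representatives e s; g does not
   depend on that choice up to equality a.e. *)
Definition cond_exp_ae_cvg (F : R -> set (set T)) (f g : T -> X) :=
  exists e : R -> T -> X,
    (forall s, 0 <= s -> e s = cond_exp (F s) f %[ae mu]) /\
    (\forall w \ae mu, e s w @[s --> +oo] --> g w).

End bochner.

Section filtrations.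
Context {R : realType} {d : measure_display} {T : measurableType d}.

Definition filtration (F : R -> set (set T)) :=
  [/\ forall s, 0 <= s -> sigma_algebra setT (F s),
      forall s, 0 <= s -> F s `<=` measurable &
      forall s1 s2, 0 <= s1 -> s1 < s2 -> F s1 `<=` F s2].

Definition filtration_infty (F : R -> set (set T)) : set (set T) :=
  <<s \bigcup_(s in [set s | 0 <= s]) F s >>.

End filtrations.

(* Operators on L_1 are represented by maps on functions compatible with
   equality mu-a.e. *)
Section operators.
Context {R : realType} {X : normedModType R} {d : measure_display}
  {W : measurableType d} (mu : {finite_measure set W -> \bar R}).

Definition L1_linear (T : (W -> X) -> (W -> X)) :=
  [/\ forall f, Lp mu 1 f -> Lp mu 1 (T f),
      forall f g, Lp mu 1 f -> Lp mu 1 g ->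
        f = g %[ae mu] -> T f = T g %[ae mu] &
      forall (a : R) f g, Lp mu 1 f -> Lp mu 1 g ->
        T (fun w => a *: f w + g w) = (fun w => a *: T f w + T g w) %[ae mu]].

Definition L1_Linfty_contraction (T : (W -> X) -> (W -> X)) :=
  forall f, Lp mu 1 f -> (Xnorm mu 1 (T f) <= Xnorm mu 1 f)%E /\
    (Xnorm mu +oo (T f) <= Xnorm mu +oo f)%E.

Definition strongly_continuous_semigroup (T : R -> (W -> X) -> (W -> X)) :=
  [/\ forall t, 0 <= t -> L1_linear (T t),
      forall f, Lp mu 1 f -> T 0 f = f %[ae mu],
      forall t1 t2 f, 0 < t1 -> 0 < t2 -> Lp mu 1 f ->
        T t1 (T t2 f) = T (t1 + t2) f %[ae mu] &
      forall t2 f, 0 < t2 -> Lp mu 1 f ->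
        Xnorm mu 1 (T t1 f \- T t2 f) @[t1 --> t2] --> 0%E].

(* The pointwise integral of T_tau f (w) in tau is that of a jointly measurable
   choice g of representatives of the classes T_tau f.  Such a g exists, and by
   Fubini's theorem any two of them give, for a.e. w, the same averages for
   all t > 0 at once. *)
Definition is_ergodic_average (T : R -> (W -> X) -> (W -> X)) (f : W -> X)
    (a : R -> W -> X) :=
  exists g : R -> W -> X,
    [/\ strongly_measurable (lebesgue_measure \x mu)%E measurable
          (fun z => g z.1 z.2),
        forall t, 0 <= t -> g t = T t f %[ae mu] &
        \forall w \ae mu, forall t, 0 < t ->
           bochner_integrable (@lebesgue_measure R) `[0, t] (g ^~ w) /\
           a t w = t^-1 *: bochner_integral (@lebesgue_measure R) `[0, t] (g ^~ w)].

Definition ergodic_average (T : R -> (W -> X) -> (W -> X)) (f : W -> X) :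
    R -> W -> X :=
  xget (fun=> cst 0) (is_ergodic_average T f).

Definition ergodic_average_ae_cvg (T : R -> (W -> X) -> (W -> X))
    (f g : W -> X) :=
  (\forall w \ae mu, ergodic_average T f t w @[t --> +oo] --> g w).

(* h t s --> g in L_p as t and s tend to infinity independently. *)
Definition Lp_joint_cvg (p : \bar R) (h : R -> R -> W -> X) (g : W -> X) :=
  Xnorm mu p (h ts.1 ts.2 \- g)
    @[ts --> filter_prod (pinfty_nbhs R) (pinfty_nbhs R)] --> 0%E.

End operators.

(* Main.v *)
(** Conditional expectations and ergodic averages contract both L_1 and L_oo; testing
    against the convex functions (x - a)^+ bounds them on L_p uniformly in t and s, so
    that L_p convergence follows from L_1 convergence of all f in L_1.  In L_1 the two
    limits decouple: |E(A_t f|F_s) - E(f_oo|F_s)|_1 <= |A_t f - f_oo|_1, and likewise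
    with the two operators exchanged.

    Martingales: density of the union of the L_1(F_s), Doob's inequality on finite sets
    of times and an essential union over the uncountably many times.  Averages: by
    reflexivity of X, bounded convex sets of X-valued functions are weakly compact in
    L_1 (Smulian), whence f = u + v up to a small L_1 error with u invariant and
    A_t v = O(1/t); as no positivity is available, the error is controlled by a maximal
    inequality obtained from a filling scheme.  Properties of A_t are read off dyadic
    Riemann sums, t |-> A_t f(w) being continuous for almost every w. *)

From HB Require Import structures.
Require Import Defs.
From mathcomp Require Import all_boot all_order all_algebra.
From mathcomp Require Import all_classical all_reals all_analysis.
From mathcomp Require Import measurable_realfun ess_sup_inf.
From mathcomp Require Import ring lra.
Set Implicit Arguments.
Unset Strict Implicit.
Unset Printing Implicit Defensive.
Import Order.TTheory GRing.Theory Num.Theory.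
Import numFieldNormedType.Exports.
Local Open Scope classical_set_scope.
Local Open Scope ring_scope.

(** * Hahn-Banach *)

Section hahn_banach.
Context {R : realType} {V : lmodType R}.
Implicit Types (S : set V) (p q : V -> R).

(** Operators and conditional expectations act on classes, so the argument is run on
    everywhere-defined representatives ([smeas], [inL1]) with a real-valued [norm1]; the passage
    from and to the classes of the statement is confined to a few lemmas such as [semigroup_rep],
    [cond_expE] and [ergodic_averageE]. [X] may be nonseparable: each function carries a sequence to
    which its values adhere, and a countable family of functionals norming the closed span of such a
    sequence replaces the dual space wherever only countably many tests are allowed. Almost
    everywhere convergence mostly comes from one pattern: an [L_1] error of [4^-k], Markov's
    inequality at level [2^-k], Borel-Cantelli; hence the powers of 1/4 and 1/2. Strong continuity
    is available at times [t > 0] only, so that [T_t f] may fail to converge as [t] tends to 0: near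
    time 0, Riemann sums are estimated by size and not by continuity. *)

Definition linear_set S := S 0 /\ forall (a : R) x y, S x -> S y -> S (a *: x + y).

Definition linear_on S (phi : V -> R) :=
  forall (a : R) x y, S x -> S y -> phi (a *: x + y) = a * phi x + phi y.

Definition sublinear_on S p :=
  (forall x y, S x -> S y -> p (x + y) <= p x + p y) /\
  (forall a x, 0 <= a -> S x -> p (a *: x) = a * p x).

Lemma linear_setD S x y : linear_set S -> S x -> S y -> S (x + y).
Proof. by move=> [_ h] Sx Sy; rewrite -[x]scale1r; exact: h. Qed.

Lemma linear_setZ S a x : linear_set S -> S x -> S (a *: x).
Proof. by move=> [S0 h] Sx; rewrite -[a *: x]addr0; exact: h. Qed.

Lemma linear_setN S x : linear_set S -> S x -> S (- x).
Proof. by move=> lS Sx; rewrite -scaleN1r; exact: linear_setZ. Qed.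

Lemma linear_setB S x y : linear_set S -> S x -> S y -> S (x - y).
Proof. by move=> lS Sx Sy; apply: linear_setD => //; exact: linear_setN. Qed.

(** The reverse inequality for a factor [a > 0] is the given one applied to [a^-1] and [a *: x]. *)
Lemma sublinear_onP S p : linear_set S ->
  (forall x y, S x -> S y -> p (x + y) <= p x + p y) ->
  p 0 = 0 -> (forall a x, 0 < a -> S x -> p (a *: x) <= a * p x) ->
  sublinear_on S p.
Proof.
move=> lS pD p0 pZ; split => // a x; rewrite le_eqVlt => /orP[/eqP<-|a0] Sx.
  by rewrite scale0r mul0r.
apply/eqP; rewrite eq_le pZ//=.
have := pZ a^-1 (a *: x).
rewrite invr_gt0 a0 => /(_ isT (linear_setZ _ lS Sx)).
by rewrite scalerA mulVf ?gt_eqF// scale1r ler_pdivlMl.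
Qed.

Lemma sublinear_on0 S p : linear_set S -> sublinear_on S p -> p 0 = 0.
Proof. by move=> [S0 _] [_ /(_ 0 0 (lexx _) S0)]; rewrite scale0r mul0r. Qed.

Lemma sublinear_on_ge S p x : linear_set S -> sublinear_on S p -> S x ->
  - p (- x) <= p x.
Proof.
move=> lS sp Sx; rewrite -subr_ge0 opprK.
rewrite -(sublinear_on0 lS sp) -(subrr x).
by apply: sp.1 => //; exact: linear_setN.
Qed.

(* A minimal sublinear functional below [p] is linear: replacing [q] by
   [x |-> inf_(t >= 0) (q (x + t y) - t q y)] cannot make it smaller. *)
Lemma sublinear_minorant S p : linear_set S -> sublinear_on S p ->
  exists2 phi, linear_on S phi & forall x, S x -> phi x <= p x.
Proof.
move=> lS sp.
pose Q := {q : V -> R | sublinear_on S q /\ forall x, S x -> q x <= p x}.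
have pp : sublinear_on S p /\ forall x, S x -> p x <= p x by [].
pose le (q r : Q) := `[< forall x, S x -> sval r x <= sval q x >].
have Qlb (q : Q) x : S x -> - p (- x) <= sval q x.
  move=> Sx; case: q => q [sq qp] /=.
  apply: le_trans (sublinear_on_ge lS sq Sx).
  by rewrite lerN2; apply: qp; exact: linear_setN.
(* Zorn's lemma for the reversed pointwise order. A nonempty chain is bounded by its pointwise
   infimum, finite by [Qlb] and subadditive because two members of a chain can be compared before
   they are added. *)
have [||A Atot|q qmin] := @ZL_preorder Q (exist _ p pp) le.
- by move=> q; apply/asboolP.
- move=> q r s /asboolP rq /asboolP qs; apply/asboolP => x Sx.
  exact: le_trans (qs _ Sx) (rq _ Sx).
- have [[q0 Aq0]|] := pselect (A !=set0); last first.
    move=> A0; exists (exist _ p pp) => s As; exfalso; apply: A0.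
    by exists s.
  pose E x := [set sval q x | q in A].
  have E0 x : E x !=set0 by exists (sval q0 x); exists q0.
  have Elb x : S x -> has_lbound (E x).
    by move=> Sx; exists (- p (- x)) => _ [r Ar <-]; exact: Qlb.
  pose m x := inf (E x).
  have mle x r : S x -> A r -> m x <= sval r x.
    by move=> Sx Ar; apply: ge_inf; [exact: Elb|exists r].
  have msub : sublinear_on S m.
    apply: sublinear_onP => //.
    + move=> x y Sx Sy; rewrite -lerBlDl.
      apply: lb_le_inf => // _ [r Ar <-]; rewrite lerBlDr -lerBlDl.
      apply: lb_le_inf => // _ [s As <-]; rewrite lerBlDr.
      have Sxy := linear_setD lS Sx Sy.
      have [/asboolP rs|/asboolP sr] := Atot _ _ Ar As.
      * have := mle _ _ Sxy As; have := (svalP s).1.1 _ _ Sx Sy.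
        have := rs _ Sy; lra.
      * have := mle _ _ Sxy Ar; have := (svalP r).1.1 _ _ Sx Sy.
        have := sr _ Sx; lra.
    + rewrite /m; have -> : E 0 = [set 0].
        apply/seteqP; split => [_ [r _ <-]|_ ->] /=.
          exact: sublinear_on0 lS (svalP r).1.
        by exists q0 => //; exact: sublinear_on0 lS (svalP q0).1.
      exact: inf1.
    + move=> a x a0 Sx; rewrite -ler_pdivrMl//.
      apply: lb_le_inf => // _ [r Ar <-]; rewrite ler_pdivrMl//.
      rewrite -(svalP r).1.2 ?(ltW a0)//.
      exact: mle (linear_setZ a lS Sx) Ar.
  have mp : sublinear_on S m /\ forall x, S x -> m x <= p x.
    split => // x Sx; apply: le_trans (mle _ _ Sx Aq0) _.
    exact: (svalP q0).2.
  exists (exist _ m mp) => s As; apply/asboolP => x Sx /=; exact: mle.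
- exists (sval q); last by move=> x Sx; exact: (svalP q).2.
  have [sq qp] := svalP q.
  have q0 := sublinear_on0 lS sq.
  have qN y : S y -> sval q (- y) = - sval q y.
    move=> Sy; apply/eqP; rewrite eq_le; apply/andP; split; last first.
      rewrite lerNl; have := sublinear_on_ge lS sq Sy; lra.
    pose E x := [set sval q (x + t *: y) - t * sval q y | t in [set t | 0 <= t]].
    pose m x := inf (E x).
    have E0 x : E x !=set0.
      by exists (sval q (x + 0 *: y) - 0 * sval q y); exists 0 => /=.
    have Elb x : S x -> has_lbound (E x).
      move=> Sx; exists (- sval q (- x)) => _ [t t0 <-].
      have Sty : S (t *: y) by exact: linear_setZ.
      have := sq.1 _ _ (linear_setD lS Sx Sty) (linear_setN lS Sx).
      rewrite addrAC subrr add0r sq.2//; lra.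
    have mle x t : S x -> 0 <= t -> m x <= sval q (x + t *: y) - t * sval q y.
      by move=> Sx t0; apply: ge_inf; [exact: Elb|exists t].
    have mq : sublinear_on S m.
      apply: sublinear_onP => //.
      + move=> x z Sx Sz; rewrite -lerBlDl.
        apply: lb_le_inf => // _ [t t0 <-]; rewrite lerBlDr -lerBlDl.
        apply: lb_le_inf => // _ [s s0 <-]; rewrite lerBlDr.
        have Sxz := linear_setD lS Sx Sz.
        apply: le_trans (mle _ (t + s) Sxz (addr_ge0 t0 s0)) _.
        have Sty : S (t *: y) by exact: linear_setZ.
        have Ssy : S (s *: y) by exact: linear_setZ.
        have := sq.1 _ _ (linear_setD lS Sx Ssy) (linear_setD lS Sz Sty).
        rewrite scalerDl addrACA (addrC (s *: y)); lra.
      + rewrite /m; have -> : E 0 = [set 0].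
          apply/seteqP; split => [_ [t t0 <-]|_ ->] /=.
            by rewrite add0r sq.2// subrr.
          by exists 0 => //=; rewrite scale0r addr0 q0 mul0r subr0.
        exact: inf1.
      + move=> a x a0 Sx; rewrite -ler_pdivrMl//.
        apply: lb_le_inf => // _ [t t0 <-]; rewrite ler_pdivrMl//.
        have Sty : S (t *: y) by exact: linear_setZ.
        rewrite mulrBr -(sq.2 _ _ (ltW a0) (linear_setD lS Sx Sty)).
        rewrite scalerDr scalerA mulrA.
        exact: (mle _ _ (linear_setZ a lS Sx) (mulr_ge0 (ltW a0) t0)).
    have mleq x : S x -> m x <= sval q x.
      by move=> Sx; have := mle x 0 Sx (lexx _); rewrite scale0r addr0 mul0r subr0.
    have mQ : sublinear_on S m /\ forall x, S x -> m x <= p x.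
      by split => // x Sx; apply: le_trans (mleq _ Sx) (qp _ Sx).
    (* Minimality of [q] is used at the point [- y], where [t = 1] bounds the infimum by
       [q 0 - q y]. *)
    have /asboolP : le (exist _ m mQ) q.
      by apply: qmin; apply/asboolP => x Sx /=; exact: mleq.
    move=> /(_ _ (linear_setN lS Sy)) /= /le_trans; apply.
    have := mle _ 1 (linear_setN lS Sy) ler01.
    by rewrite scale1r addNr q0 mul1r sub0r.
  have qD x y : S x -> S y -> sval q (x + y) = sval q x + sval q y.
    move=> Sx Sy; apply/eqP; rewrite eq_le sq.1//=.
    have := sq.1 _ _ (linear_setD lS Sx Sy) (linear_setN lS Sy).
    rewrite addrK qN//; lra.
  move=> a x y Sx Sy; rewrite qD//; last exact: linear_setZ.
  congr (_ + _); have [a0|a0] := leP 0 a; first by rewrite sq.2.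
  rewrite -[a in LHS]opprK scaleNr qN; last exact: linear_setZ.
  by rewrite sq.2 ?oppr_ge0 ?(ltW a0)// mulNr opprK.
Qed.

(* The functional exists as soon as the requirements [r <= phi v] are compatible
   with [phi <= N]: minimise [N (x + v) - r] over the cone [G]. *)
Lemma hahn_banach_cone S (N : V -> R) (G : set (V * R)) :
  linear_set S -> sublinear_on S N -> (forall x, S x -> N (- x) = N x) ->
  G (0, 0) ->
  (forall v r w s, G (v, r) -> G (w, s) -> G (v + w, r + s)) ->
  (forall a v r, 0 < a -> G (v, r) -> G (a *: v, a * r)) ->
  (forall v r, G (v, r) -> S v /\ r <= N v) ->
  exists phi, [/\ linear_on S phi, forall x, S x -> phi x <= N x &
    forall v r, G (v, r) -> r <= phi v].
Proof.
move=> lS sN NN G0 GD GZ GN.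
pose E x := [set N (x + vr.1) - vr.2 | vr in G].
pose p x := inf (E x).
have E0 x : E x !=set0 by exists (N (x + 0) - 0); exists (0, 0).
have Elb x : S x -> has_lbound (E x).
  move=> Sx; exists (- N x) => _ [[v r] Gvr <-] /=.
  have [Sv rv] := GN _ _ Gvr.
  have := sN.1 _ _ (linear_setD lS Sx Sv) (linear_setN lS Sx).
  rewrite addrAC subrr add0r NN//; lra.
have ple x v r : S x -> G (v, r) -> p x <= N (x + v) - r.
  by move=> Sx Gvr; apply: ge_inf; [exact: Elb|exists (v, r)].
have sp : sublinear_on S p.
  apply: sublinear_onP => //.
  - move=> x y Sx Sy; rewrite -lerBlDl.
    apply: lb_le_inf => // _ [[v r] Gvr <-]; rewrite lerBlDr -lerBlDl.
    apply: lb_le_inf => // _ [[w s] Gws <-]; rewrite lerBlDr /=.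
    have Sxy := linear_setD lS Sx Sy.
    apply: le_trans (ple _ _ _ Sxy (GD _ _ _ _ Gvr Gws)) _.
    have [Sv _] := GN _ _ Gvr; have [Sw _] := GN _ _ Gws.
    have := sN.1 _ _ (linear_setD lS Sx Sw) (linear_setD lS Sy Sv).
    rewrite addrACA (addrC w); lra.
  - have le0 := ple 0 0 0 lS.1 G0.
    apply/eqP; rewrite eq_le; apply/andP; split.
      by rewrite (le_trans le0)// addr0 subr0 (sublinear_on0 lS sN).
    apply: lb_le_inf => // _ [[v r] Gvr <-] /=.
    by rewrite add0r subr_ge0; exact: (GN _ _ Gvr).2.
  - move=> a x a0 Sx; rewrite -ler_pdivrMl//.
    apply: lb_le_inf => // _ [[v r] Gvr <-] /=; rewrite ler_pdivrMl//.
    have [Sv _] := GN _ _ Gvr.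
    rewrite mulrBr -(sN.2 _ _ (ltW a0) (linear_setD lS Sx Sv)).
    rewrite scalerDr; apply: ple; last exact: GZ.
    exact: linear_setZ.
have [phi lphi phip] := sublinear_minorant lS sp.
exists phi; split => //.
- move=> x Sx; apply: le_trans (phip _ Sx) _.
  by rewrite (le_trans (ple _ _ _ Sx G0))//= addr0 subr0.
- move=> v r Gvr; have [Sv _] := GN _ _ Gvr.
  have SNv := linear_setN lS Sv.
  have := le_trans (phip _ SNv) (ple _ _ _ SNv Gvr).
  rewrite addNr (sublinear_on0 lS sN) sub0r.
  have -> : phi (- v) = - phi v.
    have phi0 : phi 0 = 0.
      have := lphi (-1) 0 0 lS.1 lS.1; rewrite scaler0 addr0; lra.
    have := lphi (-1) v 0 Sv lS.1; rewrite addr0 scaleN1r phi0; lra.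
  by rewrite lerN2.
Qed.

End hahn_banach.

(** * Continuous functionals, separable subspaces, weak limits *)

Section dual_space.
Context {R : realType} {X : normedModType R}.
Implicit Types (c e : nat -> X).

Lemma linear_setT : linear_set [set: X]. Proof. by []. Qed.

Lemma sublinear_norm (S : set X) : sublinear_on S (fun x : X => `|x|).
Proof.
split=> [x y _ _|a x a0 _]; first exact: ler_normD.
by rewrite normrZ ger0_norm.
Qed.

Lemma dual_linear_on (x' : X -> R) : dual x' -> linear_on setT x'.
Proof. by move=> [lx _] a x y _ _; rewrite lx. Qed.

Lemma dual_bounded (x' : X -> R) : dual x' -> exists2 C : R, 0 < C & forall x, `|x' x| <= C * `|x|.
Proof.
move=> dx'; have lx := dual_linear_on dx'; have [_ cx] := dx'.
have x0 : x' 0 = 0.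
  by have := lx (-1) 0 0 I I; rewrite scaler0 addr0 => h; lra.
have xZ a x : x' (a *: x) = a * x' x.
  by have := lx a x 0 I I; rewrite !addr0 x0 addr0.
have /cvgrPdist_lt /(_ _ ltr01) := cx (0 : X).
rewrite x0 -filter_from_ballE => -[r /= r0 hr].
(* Rescaled to norm [r / 2], [x] lies in the ball on which [x'] stays below 1. *)
exists (2 / r); first by rewrite divr_gt0.
move=> x; have [->|xn0] := eqVneq x 0; first by rewrite x0 !normr0 mulr0.
have nx : 0 < `|x| by rewrite normr_gt0.
have := hr ((r / 2 / `|x|) *: x).
rewrite -ball_normE /= sub0r normrN normrZ ger0_norm; last first.
  by rewrite divr_ge0// divr_ge0// ltW.
rewrite divfK ?gt_eqF// ltr_pdivrMr// ltr_pMr// ltrDl ltr01 => /(_ isT).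
rewrite sub0r normrN xZ normrM ger0_norm; last first.
  by rewrite divr_ge0// divr_ge0// ltW.
move=> h; rewrite mulrAC ler_pdivlMr//.
move: h; rewrite mulrAC ltr_pdivrMr// mul1r => h.
have := h; rewrite mulrAC ltr_pdivrMr//; lra.
Qed.

Lemma linear_on_dual (x' : X -> R) : linear_on setT x' -> (forall x, x' x <= `|x|) ->
  dual x' /\ forall x, `|x' x| <= `|x|.
Proof.
move=> lx' xle.
have xlin : linear (x' : X -> R^o) by move=> a x y; rewrite lx'.
have xN x : x' (- x) = - x' x.
  have x0 : x' 0 = 0.
    by have := lx' (-1) 0 0 I I; rewrite scaler0 addr0 => h; lra.
  by have := lx' (-1) x 0 I I; rewrite addr0 scaleN1r x0 => h; lra.
have xabs x : `|x' x| <= `|x|.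
  by rewrite ler_norml xle andbT lerNl -xN -normrN.
split=> //; split => // x; apply/cvgrPdist_lt => eps eps0.
near=> y; have -> : x' x - x' y = x' (x - y).
  by have := lx' (-1) y x I I; rewrite scaleN1r (addrC (- y)) => ->; lra.
apply: le_lt_trans (xabs _) _.
near: y; exact: cvgr_dist_lt.
Unshelve. all: by end_near. Qed.

Lemma dual0 (x' : X -> R) : dual x' -> x' 0 = 0.
Proof.
move=> /dual_linear_on lx; have := lx (-1) 0 0 I I.
by rewrite scaler0 addr0 => h; lra.
Qed.

Lemma dualB (x' : X -> R) x y : dual x' -> x' (x - y) = x' x - x' y.
Proof.
move=> /dual_linear_on lx; have := lx (-1) y x I I.
by rewrite scaleN1r (addrC (- y)) => ->; lra.
Qed.

Lemma dualD (x' : X -> R) x y : dual x' -> x' (x + y) = x' x + x' y.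
Proof. by move=> /dual_linear_on lx; have := lx 1 x y I I; rewrite scale1r mul1r. Qed.

Lemma dualZ (x' : X -> R) a x : dual x' -> x' (a *: x) = a * x' x.
Proof.
move=> dx; have := dual_linear_on dx a (y := 0) (x := x) I I.
by rewrite !addr0 dual0// addr0.
Qed.

Lemma norming_functional x :
  exists x' : X -> R, [/\ dual x', forall y, `|x' y| <= `|y| & x' x = `|x|].
Proof.
(* The cone is the ray spanned by [(x, |x|)]: requiring [|x| <= phi x] is compatible with [phi]
   being below the norm. *)
pose G : set (X * R) := [set vr | exists2 l, 0 <= l & vr = (l *: x, l * `|x|)].
have [|v r w s|a v r a0|v r|phi [lphi phile phiG]] :=
    @hahn_banach_cone R X setT (fun x : X => `|x|) G linear_setT (sublinear_norm _)
    (fun x _ => normrN x).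
- by exists 0; rewrite // scale0r mul0r.
- move=> [l l0 [-> ->]] [m m0 [-> ->]]; exists (l + m); first exact: addr_ge0.
  by rewrite scalerDl mulrDl.
- move=> [l l0 [-> ->]]; exists (a * l); first by rewrite mulr_ge0// ltW.
  by rewrite scalerA mulrA.
- by move=> [l l0 [-> ->]]; split => //; rewrite normrZ ger0_norm.
have phix x0 := phile x0 I.
have [dphi phiabs] := linear_on_dual lphi phix.
exists phi; split => //; apply/eqP; rewrite eq_le phix /=.
by apply: phiG; exists 1; rewrite // scale1r mul1r.
Qed.

(** The closure of the range of [c]. Closed separable sets are handled through such a sequence; a
    closed separable subspace is given by a [c] with [linear_set (adherent c)]. *)
Definition adherent c : set X := [set x | forall eps : R, 0 < eps -> exists n, `|x - c n| < eps].

Lemma adherent_closed c x :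
  (forall eps : R, 0 < eps -> exists2 z, adherent c z & `|x - z| < eps) -> adherent c x.
Proof.
move=> h eps e0; have e20 : 0 < eps / 2 by rewrite divr_gt0.
have [z /(_ _ e20)[n hn] hz] := h _ e20.
exists n; rewrite -(subrK z x) -addrA.
by rewrite (le_lt_trans (ler_normD _ _))//; lra.
Qed.

Lemma adherent_mem c n : adherent c (c n).
Proof. by move=> eps e0; exists n; rewrite subrr normr0. Qed.

(** [x] has a positive distance [d] to the closed subspace, so that asking
    [phi (z + l *: x) >= l * d] for all [l >= 0] is compatible with the norm. The case [l = 0]
    forces [phi] to be nonnegative on the subspace, hence zero there. *)
Lemma separation c x : linear_set (adherent c) -> ~ adherent c x ->
  exists x' : X -> R, [/\ dual x', forall z, adherent c z -> x' z = 0 & 0 < x' x].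
Proof.
move=> lc nx.
have [d d0 hd] : exists2 d : R, 0 < d & forall z, adherent c z -> d <= `|x - z|.
  apply: contrapT => h; apply: nx; apply: adherent_closed => eps e0.
  apply: contrapT => h2; apply: h; exists eps => // z cz.
  by rewrite leNgt; apply/negP => h3; apply: h2; exists z.
pose G : set (X * R) :=
  [set vr | exists2 z, adherent c z & exists2 l, 0 <= l & vr = (z + l *: x, l * d)].
have [|v r w s|a v r a0|v r|phi [lphi phile phiG]] :=
    @hahn_banach_cone R X setT (fun x : X => `|x|) G linear_setT (sublinear_norm _)
    (fun x _ => normrN x).
- by exists 0; [exact: lc.1|exists 0; rewrite // scale0r mul0r addr0].
- move=> [z cz [l l0 [-> ->]]] [t ct [m m0 [-> ->]]]; exists (z + t).
    exact: linear_setD lc cz ct.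
  exists (l + m); first exact: addr_ge0.
  by rewrite scalerDl mulrDl addrACA.
- move=> [z cz [l l0 [-> ->]]]; exists (a *: z).
    exact: (linear_setZ a lc cz).
  exists (a * l); first by rewrite mulr_ge0// ltW.
  by rewrite scalerDr scalerA mulrA.
- move=> [z cz [l l0 [-> ->]]]; split => //.
  move: l0; rewrite le_eqVlt => /orP[/eqP<-|l0]; first by rewrite mul0r.
  have -> : z + l *: x = l *: (x - (- l^-1) *: z).
    rewrite scalerBr scalerA mulrN mulfV ?gt_eqF// scaleN1r opprK addrC //.
  rewrite normrZ gtr0_norm// ler_pM2l//; apply: hd; exact: (linear_setZ _ lc cz).
have phix x0 := phile x0 I.
have [dphi phiabs] := linear_on_dual lphi phix.
have phiz z : adherent c z -> 0 <= phi z.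
  move=> cz; apply: phiG; exists z => //; exists 0 => //.
  by rewrite scale0r mul0r addr0.
exists phi; split => //.
- move=> z cz; apply/eqP; rewrite eq_le phiz// andbT.
  have := phiz _ (linear_setN lc cz).
  by rewrite -sub0r dualB// dual0// sub0r oppr_ge0.
- rewrite (lt_le_trans d0)//; apply: phiG; exists 0; first exact: lc.1.
  by exists 1; rewrite // scale1r mul1r add0r.
Qed.

(** Rational combinations of the [e n] are enumerated through the countable type [{poly rat}];
    density of the rationals makes their closure a real subspace. The enumeration is shifted by one
    to reserve index 0 for the vector 0, the starting value of the greedy approximations. *)
Lemma rational_span e : exists c,
  [/\ c 0%N = 0, forall n, adherent c (e n) & linear_set (adherent c)].
Proof.
pose comb (p : {poly rat}) : X := \sum_(i < size p) ratr p`_i *: e i.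
have combE (p : {poly rat}) N : (size p <= N)%N ->
    comb p = \sum_(i < N) ratr p`_i *: e i.
  move=> pN; rewrite /comb (big_ord_widen _ (fun i : nat => ratr p`_i *: e i) pN).
  rewrite big_mkcond /=; apply: eq_bigr => i _; case: ifPn => //.
  by rewrite -leqNgt => h; rewrite nth_default// rmorph0 scale0r.
have combD p q : comb (p + q) = comb p + comb q.
  set N := maxn (size p) (size q).
  have pN : (size p <= N)%N by rewrite leq_maxl.
  have qN : (size q <= N)%N by rewrite leq_maxr.
  have pqN : (size (p + q)%R <= N)%N by apply: size_polyD.
  rewrite (combE _ _ pN) (combE _ _ qN) (combE _ _ pqN) -big_split /=.
  by apply: eq_bigr => i _; rewrite coefD rmorphD/= scalerDl.
have combZ (a : rat) p : comb (a *: p) = ratr a *: comb p.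
  have pN : (size (a *: p)%R <= size p)%N by rewrite size_scale_leq.
  rewrite (combE _ _ pN) /comb scaler_sumr.
  by apply: eq_bigr => i _; rewrite coefZ rmorphM scalerA.
pose c n : X := if n is m.+1 then if unpickle m is Some p then comb p else 0 else 0.
have cp p : c (pickle p).+1 = comb p by rewrite /c pickleK.
have cE n : exists p, c n = comb p.
  have c0 : exists p, 0 = comb p by exists 0; rewrite /comb size_poly0 big_ord0.
  by rewrite /c; case: n => [|n] //; case: unpickle => [p|] //; exists p.
exists c; split => // [n eps e0|].
  exists (pickle ('X^n : {poly rat})).+1; rewrite cp.
  rewrite (combE _ n.+1) ?size_polyXn// big_ord_recr /= big1; last first.
    by move=> i _; rewrite coefXn ltn_eqF// rmorph0 scale0r.
  by rewrite coefXn eqxx rmorph1 scale1r add0r subrr normr0.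
split.
  by move=> eps e0; exists 0%N; rewrite subrr normr0.
move=> a x y cx cy eps e0.
have e30 : 0 < eps / 3 by rewrite divr_gt0.
have x1 : 0 < `|x| + 1 by rewrite ltr_wpDl.
have d0 : 0 < eps / 3 / (`|x| + 1) by rewrite divr_gt0.
have [q] : exists q : rat, ratr q \in `]a - eps / 3 / (`|x| + 1), a + eps / 3 / (`|x| + 1)[.
  by apply: rat_in_itvoo; lra.
rewrite in_itv /= => hq.
have {}hq : `|a - ratr q| < eps / 3 / (`|x| + 1) by rewrite ltr_norml; lra.
have q1 : 0 < `|ratr q : R| + 1 by rewrite ltr_wpDl.
have [n hn] := cx _ (divr_gt0 e30 q1).
have [m hm] := cy _ e30.
have [p pE] := cE n; have [r rE] := cE m.
exists (pickle (q *: p + r)).+1; rewrite cp combD combZ -pE -rE.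
have -> : a *: x + y - (ratr q *: c n + c m) =
    (a - ratr q) *: x + ratr q *: (x - c n) + (y - c m).
  rewrite scalerBl scalerBr subrKA opprD addrACA //.
apply: le_lt_trans (ler_normD _ _) _.
have := ler_normD ((a - ratr q) *: x) (ratr q *: (x - c n)).
rewrite (normrZ (a - ratr q)) (normrZ (ratr q)) => h.
have h1 : `|a - ratr q| * `|x| <= eps / 3.
  apply: (@le_trans _ _ (eps / 3 / (`|x| + 1) * (`|x| + 1))).
    by rewrite ler_pM// ?ltW// ltrDl.
  by rewrite divfK ?gt_eqF.
have h2 : `|ratr q : R| * `|x - c n| <= eps / 3.
  apply: (@le_trans _ _ ((`|ratr q| + 1) * (eps / 3 / (`|ratr q : R| + 1)))).
    by rewrite ler_pM// ?ltW// ltrDl.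
  by rewrite mulrC divfK ?gt_eqF.
lra.
Qed.

(** If [y j] has norm at most 1 and norms [c j], then [y j x] is at least [|x| - 2 |x - c j|].
    Countably many functionals thus compute the norm on all of [adherent c]. *)
Lemma norming_sequence c : exists y : nat -> X -> R,
  [/\ forall j, dual (y j), forall j x, `|y j x| <= `|x| &
   forall x, adherent c x -> forall eps : R, 0 < eps -> exists j, `|x| - eps < y j x].
Proof.
have /choice[y hy] : forall j, exists x' : X -> R, [/\ dual x', forall y, `|x' y| <= `|y| & x' (c j) = `|c j|].
  by move=> j; exact: norming_functional.
exists y; split => [j|j x|x cx eps e0]; first by have [] := hy j.
  by have [] := hy j.
have e20 : 0 < eps / 2 by rewrite divr_gt0.
have [n hn] := cx _ e20.
exists n; have [dy yle yn] := hy n.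
have := yle (x - c n); rewrite dualB// yn => h.
have := ler_normD (x - c n) (c n); rewrite subrK => h2.
move: h; rewrite ler_norml => /andP[]; lra.
Qed.

Lemma dual_norm_ubound (x' : X -> R) x : dual x' -> `|x| <= 1 -> `|x' x| <= dual_norm x'.
Proof.
move=> dx x1; have [C C0 hC] := dual_bounded dx.
apply: sup_ubound; last by exists x.
exists C => _ [z /= z1 <-].
by rewrite (le_trans (hC z))// -[leRHS]mulr1 ler_pM2l.
Qed.

Lemma dual_norm_ge0 (x' : X -> R) : dual x' -> 0 <= dual_norm x'.
Proof.
move=> dx; rewrite -(@normr0 _ R) -(dual0 dx).
by apply: dual_norm_ubound; rewrite ?normr0.
Qed.

Lemma dual_norm_le (x' : X -> R) x : dual x' -> `|x' x| <= dual_norm x' * `|x|.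
Proof.
move=> dx; have [->|xn0] := eqVneq x 0; first by rewrite dual0// !normr0 mulr0.
have nx : 0 < `|x| by rewrite normr_gt0.
rewrite -ler_pdivrMr//.
have -> : `|x' x| / `|x| = `|x' (`|x|^-1 *: x)|.
  by rewrite dualZ// normrM mulrC normfV normr_id.
apply: dual_norm_ubound => //.
by rewrite normrZ normfV normr_id mulVf ?gt_eqF.
Qed.

Lemma ultra_cvg_bounded (U : set_system nat) (u : nat -> R) (M : R) :
  UltraFilter U -> (forall k, `|u k| <= M) -> exists l : R, u @ U --> l.
Proof.
move=> UU uM; have Fu : (u @ U) `[- M, M]%classic.
  rewrite /= /fmap /=; apply: filterE => k /=.
  by rewrite in_itv /= -ler_norml.
have [p [_ pcl]] := @segment_compact R (- M) M _ _ Fu.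
exists p => B nB; rewrite /fmap /=.
have [//|UB] := in_ultra_setVsetC (u @^-1` B) UU.
have [z [+ Bz]] := pcl (~` B) B UB nB.
by [].
Qed.

(* Any weak cluster point along an ultrafilter is determined by its values
   under the separating sequence [y], so the whole sequence converges weakly. *)
Lemma weak_limit c (y : nat -> X -> R) (g : nat -> X) (M : R) :
  reflexive_space X -> linear_set (adherent c) -> (forall j, dual (y j)) ->
  (forall x, adherent c x -> (forall j, y j x = 0) -> x = 0) ->
  (forall k, adherent c (g k)) -> (forall k, `|g k| <= M) ->
  (forall j, cvg (y j (g k) @[k --> \oo])) ->
  exists2 u, adherent c u &
    forall x', dual x' -> x' (g k) @[k --> \oo] --> x' u.
Proof.
move=> Xr lc dy ysep gc gM gcvg.
have ulim (U : set_system nat) : UltraFilter U -> \oo `<=` U ->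
    exists2 u, adherent c u & forall x', dual x' -> x' (g k) @[k --> U] --> x' u.
  move=> UU oU.
  have ex x' : exists l : R, dual x' -> x' (g k) @[k --> U] --> l.
    have [dx|ndx] := pselect (dual x'); last by exists 0.
    have [C C0 hC] := dual_bounded dx.
    have [l hl] : exists l : R, x' (g k) @[k --> U] --> l.
      apply: (@ultra_cvg_bounded U (fun k => x' (g k)) (C * M)) => k.
      by rewrite (le_trans (hC _))// ler_pM2l.
    by exists l.
  have [L hL] := choice ex.
  (* The limits along [U] form a bounded linear functional on the dual; reflexivity turns it into a
     point of [X]. *)
  have bL : bidual L.
    split.
      move=> a x' y' dx' dy'.
      have dxy : dual (fun x => a * x' x + y' x).
        have [lx cx] := dx'; have [ly cy] := dy'; split.
          move=> b v w; rewrite !dualD// !dualZ//.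
          rewrite /GRing.scale /=; ring.
        move=> z; apply: cvgD; [apply: cvgM; [exact: cvg_cst|exact: cx]|exact: cy].
      apply: (@cvg_unique _ (@Rhausdorff R) _ _ _ _ (hL _ dxy)).
      apply: cvgD; last exact: hL.
      by apply: cvgM; [exact: cvg_cst|exact: hL].
    exists M => x' dx'.
    have cvgn : `|x' (g k)| @[k --> U] --> `|L x'|.
      by apply: cvg_norm; exact: hL.
    rewrite leNgt; apply/negP => hlt.
    have : \forall k \near U, M * dual_norm x' < `|x' (g k)|.
      exact: (cvgr_gt _ cvgn _ hlt).
    move=> /filter_ex[k]; apply/negP; rewrite -leNgt.
    have := dual_norm_le (g k) dx'; rewrite mulrC => /le_trans; apply.
    by rewrite ler_wpM2r// dual_norm_ge0.
  have [u hu] := Xr _ bL.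
  (* A closed subspace is weakly closed. *)
  have uc : adherent c u.
    apply: contrapT => nu; have [x' [dx' x0 xu]] := separation lc nu.
    have := hL _ dx'; rewrite hu// => h.
    have : \forall k \near U, 0 < x' (g k) by exact: (cvgr_gt _ h _ xu).
    by move=> /filter_ex[k]; rewrite x0// ltxx.
  by exists u => // x' dx'; rewrite -hu//; exact: hL.
have [U0 [UU0 oU0]] := ultraFilterLemma eventually_filter.
have [u uc hu] := ulim _ UU0 oU0.
exists u => // x' dx'.
apply/cvgrPdist_lt => eps e0; apply: contrapT => nfar.
(* An ultrafilter [V] living on the set [B] of bad indices has a limit [v] equal to [u], although
   [x' (g k)] stays [eps] away from [x' u] on [B]. *)
pose B := [set k | eps <= `|x' u - x' (g k)|].
have [V [UV oV BV]] : exists V, [/\ UltraFilter V, \oo `<=` V & V B].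
  have PF : ProperFilter (within B \oo).
    apply: Build_ProperFilter_ex => A hA; apply: contrapT => nA; apply: nfar.
    move: hA; rewrite /within /=; apply: filterS => k hk.
    by rewrite ltNge; apply/negP => Bk; apply: nA; exists k; exact: hk.
  have [V [UV sV]] := ultraFilterLemma PF.
  exists V; split => //; last by apply: sV; rewrite /within /=; apply: filterE.
  move=> A oA; apply: sV; rewrite /within /=.
  by apply: filterS oA.
have [v vc hv] := ulim _ UV oV.
have uv : u = v.
  apply/eqP; rewrite -subr_eq0; apply/eqP; apply: ysep.
    exact: linear_setB lc uc vc.
  move=> j; rewrite dualB//; have [l hl] := (cvg_ex _).1 (gcvg j).
  have lim (W : set_system nat) w : UltraFilter W -> \oo `<=` W ->
      (forall x', dual x' -> x' (g k) @[k --> W] --> x' w) -> y j w = l.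
    move=> UW oW hw; apply: (@cvg_unique _ (@Rhausdorff R) _ _ _ _ (hw _ (dy j))).
    by move=> A nA; apply: oW; exact: hl.
  by rewrite (lim _ _ UU0 oU0 hu) (lim _ _ UV oV hv) subrr.
have /cvgrPdist_lt/(_ _ e0) hfar := hv _ dx'.
have : V (B `&` [set k | `|x' v - x' (g k)| < eps]) by apply: filterI.
by move=> /filter_ex[k [Bk /= hk]]; move: Bk; rewrite /B /= uv leNgt hk.
Qed.

End dual_space.

(** * Strongly measurable functions *)

Section measurable_sets.
Context {R : realType} {d : measure_display} {T : measurableType d}.
Implicit Types (a b : T -> R).

Lemma measurable_fun_preimage {d'} {Y : measurableType d'} (f : T -> Y) B :
  measurable_fun setT f -> measurable B -> measurable (f @^-1` B).
Proof. by move=> mf mB; rewrite -[X in measurable X]setTI; exact: mf. Qed.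

Lemma measurable_lt_set a b : measurable_fun setT a -> measurable_fun setT b ->
  measurable [set w | a w < b w].
Proof.
move=> ma mb; rewrite (_ : [set _ | _] = (b \- a) @^-1` `]0, +oo[%classic).
  by apply: measurable_fun_preimage => //; exact: measurable_funB.
by apply/seteqP; split=> w /=; rewrite in_itv/= andbT subr_gt0.
Qed.

Lemma measurable_le_set a b : measurable_fun setT a -> measurable_fun setT b ->
  measurable [set w | a w <= b w].
Proof.
move=> ma mb; rewrite (_ : [set _ | _] = (b \- a) @^-1` `[0, +oo[%classic).
  by apply: measurable_fun_preimage => //; exact: measurable_funB.
by apply/seteqP; split=> w /=; rewrite in_itv/= andbT subr_ge0.
Qed.

Lemma measurable_fun_gt_sets a :
  (forall r, measurable [set w | r < a w]) -> measurable_fun setT a.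
Proof.
move=> h; apply: (measurability _ (RGenOInfty.measurableE R)).
move=> _ [_ [r ->] <-]; rewrite setTI.
rewrite (_ : _ @^-1` _ = [set w | r < a w]); first exact: h.
by apply/seteqP; split=> w /=; rewrite in_itv/= andbT.
Qed.

Lemma measurable_bool_set (b : T -> bool) : measurable [set w | b w] -> measurable_fun setT b.
Proof.
move=> mb; apply: (@measurable_fun_bool _ _ _ _ true).
by rewrite setTI (_ : _ @^-1` _ = [set w | b w]).
Qed.

End measurable_sets.

Section finitely_valued.
Context {d : measure_display} {T : measurableType d}.

Definition finitely_valued {Y : Type} (h : T -> Y) :=
  finite_set (range h) /\ forall y, measurable (h @^-1` [set y]).

Lemma finitely_valued_preimage {Y : Type} (h : T -> Y) B :
  finitely_valued h -> measurable (h @^-1` B).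
Proof.
move=> [fh mh].
rewrite (_ : h @^-1` B = \bigcup_(y in range h `&` B) h @^-1` [set y]).
  by apply: fin_bigcup_measurable => //; exact: finite_setIl.
apply/seteqP; split => [w Bw|w [y [_ By] /= ->] //].
by exists (h w) => //; split => //; exists w.
Qed.

Lemma finitely_valued_comp {Y Z : Type} (phi : Y -> Z) (h : T -> Y) :
  finitely_valued h -> finitely_valued (phi \o h).
Proof.
move=> fh; split; last by move=> z; rewrite comp_preimage; exact: finitely_valued_preimage.
rewrite (_ : range _ = phi @` range h); first exact: (finite_image phi fh.1).
by rewrite image_comp.
Qed.

Lemma finitely_valued_pair {Y Z : Type} (h : T -> Y) (k : T -> Z) :
  finitely_valued h -> finitely_valued k -> finitely_valued (fun w => (h w, k w)).
Proof.
move=> [fh mh] [fk mk]; split.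
  apply: sub_finite_set (finite_setX fh fk) => _ [w _ <-] /=.
  by split; exists w.
move=> [y z]; rewrite (_ : _ @^-1` _ = h @^-1` [set y] `&` k @^-1` [set z]).
  exact: measurableI.
by apply/seteqP; split => w /= [-> ->].
Qed.

Lemma finitely_valued_comp2 {Y Z V : Type} (phi : Y -> Z -> V) (h : T -> Y) (k : T -> Z) :
  finitely_valued h -> finitely_valued k -> finitely_valued (fun w => phi (h w) (k w)).
Proof.
move=> fh fk.
exact: (finitely_valued_comp (fun yz => phi yz.1 yz.2) (finitely_valued_pair fh fk)).
Qed.

Lemma finitely_valued_cst {Y : Type} (y : Y) : finitely_valued (fun=> y : Y).
Proof.
split; first by apply: sub_finite_set (finite_set1 y) => _ [w _ <-].
by move=> z; rewrite preimage_cst; case: ifP.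
Qed.

Lemma finitely_valued_bool (b : T -> bool) : measurable [set w | b w] -> finitely_valued b.
Proof.
move=> mb; split; first exact: finite_finset.
move=> [|]; first by rewrite (_ : _ @^-1` _ = [set w | b w]).
rewrite (_ : _ @^-1` _ = ~` [set w | b w]); first exact: measurableC.
by apply/seteqP; split => w /=; case: (b w).
Qed.

Lemma finitely_valued_if {Y : Type} (b : T -> bool) (h k : T -> Y) :
  measurable [set w | b w] -> finitely_valued h -> finitely_valued k ->
  finitely_valued (fun w => if b w then h w else k w).
Proof.
move=> mb fh fk.
exact: (finitely_valued_comp2 (fun (b : bool) yz => if b then yz.1 else yz.2)
  (finitely_valued_bool mb) (finitely_valued_pair fh fk)).
Qed.

Lemma finitely_valued_measurable {d'} {Y : measurableType d'} (h : T -> Y) :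
  finitely_valued h -> measurable_fun setT h.
Proof. by move=> fh _ B mB; rewrite setTI; exact: finitely_valued_preimage. Qed.

End finitely_valued.

Section smeas.
Context {R : realType} {X : normedModType R} {d : measure_display} {T : measurableType d}.
Implicit Types (f g : T -> X).

(* The everywhere version of strong measurability: separable range and
   measurable distance to a dense sequence. *)
Definition smeas f := exists c : nat -> X,
  (forall n, measurable_fun setT (fun w => `|f w - c n|)) /\ forall w, adherent c (f w).

(** [r < |f w - x|] holds exactly when some [c n] is so close to [f w] that
    [|f w - c n| < |c n - x| - r], which is a countable union of measurable conditions. *)
Lemma smeas_dist f x : smeas f -> measurable_fun setT (fun w => `|f w - x|).
Proof.
move=> [c [mc fc]]; apply: measurable_fun_gt_sets => r.
rewrite (_ : [set _ | _] = \bigcup_n [set w | `|f w - c n| < `|c n - x| - r]).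
  by apply: bigcup_measurable => n _; apply: measurable_lt_set => //; exact: mc.
apply/seteqP; split => [w /= rw|w [n _ /=]].
  have e0 : 0 < (`|f w - x| - r) / 2 by rewrite divr_gt0// subr_gt0.
  have [n hn] := fc w _ e0; exists n => //=.
  have := ler_distD (c n) (f w) x; lra.
have := ler_distD (f w) (c n) x; rewrite (distrC (c n) (f w)); lra.
Qed.

Lemma smeas_norm f : smeas f -> measurable_fun setT (fun w => `|f w|).
Proof. by move=> /(smeas_dist 0); under eq_fun do rewrite subr0. Qed.

Lemma smeas_lim (h : nat -> T -> X) f : (forall n, smeas (h n)) ->
  (forall w, h n w @[n --> \oo] --> f w) -> smeas f.
Proof.
move=> mh hf; have [c hc] := choice mh.
pose e k := if unpickle k is Some (n, m) then c n m else 0.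
exists e; split.
  move=> k; apply: (@measurable_fun_cvg _ _ _ _ (fun n w => `|h n w - e k|)).
    by move=> n; exact: smeas_dist.
  by move=> w _; apply: cvg_norm; apply: cvgB => //; exact: cvg_cst.
move=> w eps e0; have e20 : 0 < eps / 2 by rewrite divr_gt0.
have /cvgrPdist_lt/(_ _ e20) [N _ hN] := hf w.
have [m hm] := (hc N).2 w _ e20.
exists (pickle (N, m)); rewrite /e pickleK.
have := ler_distD (h N w) (f w) (c N m); have := hN N (leqnn N); rewrite /=; lra.
Qed.

Lemma finitely_valued_smeas (h : T -> X) : finitely_valued h -> smeas h.
Proof.
move=> fh.
have /finite_set_countable/countable_injP[i /= iinj] := fh.1.
have [c hc] : exists c : nat -> X, forall w, exists n, c n = h w.
  exists (fun n => xget 0 (range h `&` i @^-1` [set n])) => w.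
  exists (i (h w)); case: xgetP => [y -> [/= ry iy]|/(_ (h w))[]]; last by split; [exists w|].
  by apply: iinj; rewrite ?inE//; exists w.
exists c; split; last first.
  by move=> w eps e0; have [n hn] := hc w; exists n; rewrite hn subrr normr0.
move=> n; apply: finitely_valued_measurable.
exact: (finitely_valued_comp (fun x => `|x - c n|)).
Qed.

(** Greedy approximation: the current value is replaced by [c m] whenever [c m] is strictly closer
    to [f w]. The error never increases, and the start at 0 bounds it by [|f w|], the domination on
    which all later density arguments rely. *)
Lemma smeas_approx f : smeas f -> exists h : nat -> T -> X,
  [/\ forall n, finitely_valued (h n), forall w, h n w @[n --> \oo] --> f w &
      forall n w, `|f w - h n w| <= `|f w|].
Proof.
move=> mf; have [c [mc fc]] := mf.
pose h := fix h n := if n is m.+1 then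
  (fun w => if `|f w - c m| < `|f w - h m w| then c m else h m w) else fun=> 0 : X.
have hS n w : `|f w - h n.+1 w| <= `|f w - h n w|.
  by rewrite /=; case: ifPn => // /ltW.
have hS2 n w : `|f w - h n.+1 w| <= `|f w - c n|.
  by rewrite /=; case: ifPn => //; rewrite -leNgt.
have hle n m w : (n <= m)%N -> `|f w - h m w| <= `|f w - h n w|.
  move=> /subnK <-; elim: (m - n)%N => [//|k ih].
  by rewrite addSn (le_trans (hS _ _)).
have fh n : finitely_valued (h n) /\ measurable_fun setT (fun w => `|f w - h n w|).
  elim: n => [|n [ih1 ih2]].
    split; first exact: finitely_valued_cst.
    by rewrite /=; exact: smeas_dist.
  split.
    apply: finitely_valued_if => //; last exact: finitely_valued_cst.
    by apply: measurable_lt_set => //; exact: smeas_dist.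
  rewrite (_ : (fun _ => _) = fun w => Num.min `|f w - c n| `|f w - h n w|); last first.
    apply/funext => w /=; rewrite /Num.min; by case: ifPn.
  by apply: measurable_minr => //; exact: smeas_dist.
exists h; split; first by move=> n; exact: (fh n).1.
- move=> w; apply/cvgrPdist_lt => eps e0; have [n hn] := fc w _ e0.
  exists n.+1 => // m /= nm.
  exact: le_lt_trans (hle _ _ _ nm) (le_lt_trans (hS2 _ _) hn).
- by move=> n w; have := hle 0%N n w (leq0n n); rewrite /= subr0.
Qed.

Lemma smeas_cst (x : X) : smeas (fun=> x).
Proof. exact/finitely_valued_smeas/finitely_valued_cst. Qed.

Lemma smeasD f g : smeas f -> smeas g -> smeas (fun w => f w + g w).
Proof.
move=> /smeas_approx[h [fh hf _]] /smeas_approx[k [fk kg _]].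
apply: (@smeas_lim (fun n w => h n w + k n w)).
  by move=> n; apply: finitely_valued_smeas; exact: finitely_valued_comp2.
by move=> w; exact: cvgD.
Qed.

Lemma smeasN f : smeas f -> smeas (fun w => - f w).
Proof.
move=> /smeas_approx[h [fh hf _]].
apply: (@smeas_lim (fun n w => - h n w)).
  by move=> n; apply: finitely_valued_smeas; exact: finitely_valued_comp.
by move=> w; exact: cvgN.
Qed.

Lemma smeasB f g : smeas f -> smeas g -> smeas (fun w => f w - g w).
Proof. by move=> mf mg; apply: smeasD => //; exact: smeasN. Qed.

Lemma smeasZ (a : R) f : smeas f -> smeas (fun w => a *: f w).
Proof.
move=> /smeas_approx[h [fh hf _]].
apply: (@smeas_lim (fun n w => a *: h n w)).
  by move=> n; apply: finitely_valued_smeas; exact: (finitely_valued_comp (fun x => a *: x)).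
by move=> w; exact: cvgZr.
Qed.

Lemma smeas_if (b : T -> bool) f g : measurable [set w | b w] -> smeas f -> smeas g ->
  smeas (fun w => if b w then f w else g w).
Proof.
move=> mb /smeas_approx[h [fh hf _]] /smeas_approx[k [fk kg _]].
apply: (@smeas_lim (fun n w => if b w then h n w else k n w)).
  by move=> n; apply: finitely_valued_smeas; exact: finitely_valued_if.
by move=> w; case: (b w).
Qed.

Definition cut0 (A : set T) f : T -> X := fun w => if w \in A then f w else 0.

Lemma smeas_cut0 A f : measurable A -> smeas f -> smeas (cut0 A f).
Proof.
move=> mA mf; apply: smeas_if => //; last exact: smeas_cst.
by rewrite (_ : [set _ | _] = A)//; apply/seteqP; split => w /=; rewrite inE.
Qed.

Lemma smeas_sum (I : Type) (r : seq I) (f : I -> T -> X) : (forall i, smeas (f i)) ->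
  smeas (fun w => \sum_(i <- r) f i w).
Proof.
move=> mf; elim: r => [|i r ih].
  by under eq_fun do rewrite big_nil; exact: smeas_cst.
by under eq_fun do rewrite big_cons; exact: smeasD.
Qed.

Lemma smeas_continuous (phi : X -> R) f : continuous phi -> smeas f ->
  measurable_fun setT (phi \o f).
Proof.
move=> cphi /smeas_approx[h [fh hf _]].
apply: (@measurable_fun_cvg _ _ _ _ (fun n => phi \o h n)).
  by move=> n; apply: finitely_valued_measurable; exact: finitely_valued_comp.
by move=> w _; apply: continuous_cvg => //; exact: cphi.
Qed.

End smeas.

Lemma smeas_comp {R : realType} {X : normedModType R} {d d'} {T : measurableType d}
  {T' : measurableType d'} (f : T -> X) (m : T' -> T) :
  measurable_fun setT m -> smeas f -> smeas (f \o m).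
Proof.
move=> mm [c [mc fc]]; exists c; split => [n|w]; last exact: fc.
exact: (measurableT_comp (mc n) mm).
Qed.

Lemma measurable_fun_smeas {R : realType} {d} {T : measurableType d} (a : T -> R) :
  measurable_fun setT a -> smeas (a : T -> R^o).
Proof.
move=> ma; pose c n : R^o := if unpickle n is Some q then ratr q else 0.
exists c; split => [n|w eps e0].
  by apply: measurableT_comp => //; exact: measurable_funB.
have [q] : exists q : rat, ratr q \in `]a w - eps, a w + eps[.
  by apply: rat_in_itvoo; lra.
rewrite in_itv /= => hq; exists (pickle q); rewrite /c pickleK.
by rewrite ltr_norml; lra.
Qed.

Lemma smeasM {R : realType} {X : normedModType R} {d} {T : measurableType d}
    (a : T -> R) (f : T -> X) :
  measurable_fun setT a -> smeas f -> smeas (fun w => a w *: f w).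
Proof.
move=> /measurable_fun_smeas/smeas_approx[h [fh hf _]] /smeas_approx[k [fk kg _]].
apply: (@smeas_lim _ _ _ _ (fun n w => (h n w : R) *: k n w)).
  move=> n; apply: finitely_valued_smeas.
  exact: (finitely_valued_comp2 (fun (a : R) x => a *: x)).
by move=> w; apply: cvgZ => //; exact: hf.
Qed.

Lemma geometric_half_sum {R : realType} n :
  \sum_(0 <= k < n) (2^-1 : R) ^+ k <= 2.
Proof.
suff -> : \sum_(0 <= k < n) (2^-1 : R) ^+ k = 2 - 2 * (2^-1) ^+ n.
  by rewrite lerBlDr lerDl mulr_ge0// exprn_ge0.
elim: n => [|n ih]; first by rewrite big_nil expr0 mulr1 subrr.
by rewrite big_nat_recr//= ih exprS; field.
Qed.

Import HBNNSimple.

Section almost_everywhere_integral.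
Context {R : realType} {d : measure_display} {T : measurableType d}
  (mu : {measure set T -> \bar R}).

(* No measurability is assumed: the integral of a nonnegative function is a
   supremum over simple functions below it, and these can be killed on a null set. *)
Lemma ge0_ae_le_integral D (f g : T -> \bar R) : measurable D ->
  (forall w, 0 <= f w)%E -> (forall w, 0 <= g w)%E ->
  (\forall w \ae mu, D w -> (f w <= g w)%E) ->
  (\int[mu]_(w in D) f w <= \int[mu]_(w in D) g w)%E.
Proof.
move=> mD f0 g0 [N [mN N0 fgN]].
have r0 (h : T -> \bar R) : (forall w, 0 <= h w)%E -> (forall w, 0 <= (h \_ D) w)%E.
  by move=> h0 w; apply: erestrict_ge0.
rewrite integral_mkcond [leRHS]integral_mkcond.
rewrite (ge0_integralTE _ (r0 _ f0)) (ge0_integralTE _ (r0 _ g0)).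
apply: ge_ereal_sup => _ [h /= hf <-].
have mNC := measurableC mN.
have mnn (k : {nnsfun T >-> R}) : measurable_fun setT (fun w => (k w)%:E).
  exact/measurable_EFinP/measurable_funP.
apply: ereal_sup_ubound; exists (mul_nnsfun h (indic_nnsfun R mNC)) => /=.
  move=> w; rewrite mindicE.
  have [Nw|nNw] := pselect (N w).
    by rewrite memNset /= ?mulr0; [exact: r0|move=> /(_ Nw)].
  rewrite mem_set// mulr1; apply: le_trans (hf w) _.
  rewrite !patchE; case: ifPn => // /set_mem Dw.
  by apply: contrapT => fgw; apply: nNw; apply: fgN => /=; apply: contra_not fgw; exact.
rewrite -!integralT_nnsfun; apply: ge0_ae_eq_integral => //.
- by move=> w _; rewrite lee_fin.
- by move=> w _; rewrite lee_fin.
exists N; split => //= w /= nw; apply: contrapT => nNw; apply: nw => _.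
  by rewrite mindicE mem_set// mulr1.
Qed.

Lemma ge0_ae_eq_integral_nonmeasurable D (f g : T -> \bar R) : measurable D ->
  (forall w, 0 <= f w)%E -> (forall w, 0 <= g w)%E ->
  (\forall w \ae mu, f w = g w) ->
  (\int[mu]_(w in D) f w = \int[mu]_(w in D) g w)%E.
Proof.
move=> mD f0 g0 fg; apply/eqP; rewrite eq_le; apply/andP; split;
  by apply: ge0_ae_le_integral => //; apply: filterS fg => w ->.
Qed.

Lemma borel_cantelli (c : R) (B : nat -> set T) : 0 <= c -> (forall k, measurable (B k)) ->
  (forall k, mu (B k) <= (c * (2^-1) ^+ k)%:E)%E ->
  \forall w \ae mu, exists m, forall k, (m <= k)%N -> ~ B k w.
Proof.
move=> c0 mB muB.
have s0 : (\sum_(k <oo) mu (B k) < +oo)%E.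
  apply: (@le_lt_trans _ _ (c * 2)%:E); last by rewrite ltry.
  apply: lime_le; first by apply: is_cvg_nneseries.
  apply: nearW => n; apply: (@le_trans _ _ (\sum_(0 <= k < n) (c * (2^-1) ^+ k)%:E)%E).
    by apply: lee_sum => k _; exact: muB.
  by rewrite sumEFin lee_fin -mulr_sumr ler_wpM2l// geometric_half_sum.
have l0 : mu (lim_sup_set B) = 0 by apply: lim_sup_set_cvg0.
exists (lim_sup_set B); split => //.
  by apply: bigcap_measurable => // n _; apply: bigcup_measurable.
move=> w /= nw n _; apply: contrapT => h; apply: nw; exists n => k nk Bk; apply: h.
by exists k.
Qed.

End almost_everywhere_integral.

Section smeas_limits.
Context {R : realType} {X : completeNormedModType R} {d : measure_display}
  {T : measurableType d}.

Lemma cauchy_sequence_cvg (u : nat -> X) :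
  (forall eps : R, 0 < eps -> exists n, forall m, (n <= m)%N -> `|u m - u n| < eps) ->
  cvg (u @ \oo).
Proof.
move=> h; apply/cauchy_cvgP/cauchy_exP => eps e0.
have [n hn] := h _ e0; exists (u n); exists n => // m /= nm.
by rewrite /fmap /= -ball_normE /= distrC; exact: hn.
Qed.

Lemma cvg_sequence_cauchy (u : nat -> X) : cvg (u @ \oo) ->
  forall eps : R, 0 < eps -> exists n, forall m, (n <= m)%N -> `|u m - u n| < eps.
Proof.
move=> /cvg_ex[l /cvgrPdist_lt ul] eps e0.
have e20 : 0 < eps / 2 by rewrite divr_gt0.
have [n _ hn] := ul _ e20; exists n => m nm.
have := hn _ nm; have := hn _ (leqnn n); rewrite /=.
have := ler_distD l (u m) (u n); rewrite (distrC (u m) l); lra.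
Qed.

(** Convergence is not assumed anywhere: the set [C] of points where the sequence is Cauchy has a
    countable description, hence is measurable, and the limit is put equal to 0 outside [C]. *)
Lemma smeas_limit (h : nat -> T -> X) : (forall n, smeas (h n)) ->
  exists2 f, smeas f & forall w, cvg (h n w @[n --> \oo]) -> h n w @[n --> \oo] --> f w.
Proof.
move=> mh.
pose C := \bigcap_k \bigcup_n \bigcap_(m in [set m | (n <= m)%N])
  [set w | `|h m w - h n w| < k.+1%:R^-1].
have mC : measurable C.
  apply: bigcap_measurableType => k _; apply: bigcup_measurable => n _.
  apply: bigcap_measurableType => m _; apply: measurable_lt_set => //.
  by apply: smeas_norm; exact: smeasB.
have CP w : C w <-> cvg (h n w @[n --> \oo]).
  split => [Cw|/cvg_sequence_cauchy cw k _]; last first.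
    have [|n hn] := cw k.+1%:R^-1; first by rewrite invr_gt0.
    by exists n => // m nm; exact: hn.
  apply: cauchy_sequence_cvg => eps e0.
  have [k ke] : exists k : nat, k.+1%:R^-1 < eps.
    by have [k] := ltr_add_invr e0; rewrite add0r => ke; exists k.
  have [n _ hn] := Cw k I; exists n => m nm; exact: lt_trans (hn m nm) ke.
pose f w := if w \in C then lim (h n w @[n --> \oo]) else 0.
exists f; last by move=> w cw; rewrite /f mem_set//; exact/CP.
apply: (@smeas_lim _ _ _ _ (fun n => cut0 C (h n))).
  by move=> n; exact: smeas_cut0.
move=> w; rewrite /cut0 /f; case: ifPn => [/set_mem/CP//|_]; exact: cvg_cst.
Qed.

End smeas_limits.

(** * The space L_1 *)

Section L1_theory.
Context {R : realType} {X : normedModType R} {d : measure_display} {T : measurableType d}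
  (mu : {finite_measure set T -> \bar R}).
Implicit Types (f g h : T -> X).

Definition inL1 f := smeas f /\ (\int[mu]_w (`|f w|)%:E < +oo)%E.

(** A real number, so that estimates can be closed by linear arithmetic. An infinite integral is
    sent to 0 by [fine], whence the assumption [inL1] in the estimates. *)
Definition norm1 f : R := fine (\int[mu]_w (`|f w|)%:E).

Definition mass : R := fine (mu setT).

Lemma massE : mass%:E = mu setT.
Proof. by rewrite /mass fineK// fin_num_measure. Qed.

Lemma mass_ge0 : 0 <= mass.
Proof. by rewrite -lee_fin massE. Qed.

Lemma smeas_normE f : smeas f -> measurable_fun setT (fun w => (`|f w|)%:E).
Proof. by move=> mf; apply/measurable_EFinP; exact: smeas_norm. Qed.

Lemma norm1_ge0 f : 0 <= norm1 f.
Proof. by apply: fine_ge0; apply: integral_ge0. Qed.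

Lemma norm1E f : inL1 f -> (norm1 f)%:E = (\int[mu]_w (`|f w|)%:E)%E.
Proof.
move=> [_ fi]; rewrite /norm1 fineK// ge0_fin_numE//.
exact: integral_ge0.
Qed.

Lemma inL1_smeas f : inL1 f -> smeas f. Proof. by case. Qed.
Hint Resolve inL1_smeas : core.

Lemma integral_norm_le f g : (\forall w \ae mu, `|f w| <= `|g w|) ->
  (\int[mu]_w (`|f w|)%:E <= \int[mu]_w (`|g w|)%:E)%E.
Proof.
move=> fg; apply: ge0_ae_le_integral => //.
by apply: filterS fg => w fg _; rewrite lee_fin.
Qed.

Lemma inL1_le f g : smeas f -> inL1 g -> (\forall w \ae mu, `|f w| <= `|g w|) -> inL1 f.
Proof. by move=> mf [_ ig] fg; split => //; exact: le_lt_trans (integral_norm_le fg) ig. Qed.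

Lemma norm1_ae f g : (\forall w \ae mu, f w = g w) -> norm1 f = norm1 g.
Proof.
move=> fg; congr fine; apply: ge0_ae_eq_integral_nonmeasurable => //.
by apply: filterS fg => w ->.
Qed.

Lemma inL1_ae f g : smeas g -> inL1 f -> (\forall w \ae mu, f w = g w) -> inL1 g.
Proof. by move=> mg ig fg; apply: (inL1_le _ ig) => //; apply: filterS fg => w ->. Qed.

Lemma integral_normD f g : smeas f -> smeas g ->
  (\int[mu]_w (`|f w + g w|)%:E <= \int[mu]_w (`|f w|)%:E + \int[mu]_w (`|g w|)%:E)%E.
Proof.
move=> mf mg; rewrite -ge0_integralD//; [|exact: smeas_normE|exact: smeas_normE].
apply: ge0_ae_le_integral => //; first by move=> w; rewrite adde_ge0.
by apply: nearW => w _; rewrite -EFinD lee_fin ler_normD.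
Qed.

Lemma inL1D f g : inL1 f -> inL1 g -> inL1 (f \+ g).
Proof.
move=> [mf fi] [mg gi]; split; first exact: smeasD.
by rewrite (le_lt_trans (integral_normD mf mg))// lte_add_pinfty.
Qed.

Lemma norm1D f g : inL1 f -> inL1 g -> norm1 (f \+ g) <= norm1 f + norm1 g.
Proof.
move=> lf lg; rewrite -lee_fin EFinD !norm1E//; last exact: inL1D.
by apply: integral_normD; [case: lf|case: lg].
Qed.

Lemma norm1Z (a : R) f : smeas f -> norm1 (fun w => a *: f w) = `|a| * norm1 f.
Proof.
move=> mf; rewrite /norm1; under eq_integral do rewrite normrZ EFinM.
rewrite ge0_integralZl_EFin//; last exact: smeas_normE.
have [->|a0] := eqVneq a 0; first by rewrite normr0 mul0e mul0r.
have [fi|fi] := ltP (\int[mu]_w (`|f w|)%:E)%E +oo%E.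
  by rewrite fineM// ge0_fin_numE ?integral_ge0.
have -> : (\int[mu]_w (`|f w|)%:E = +oo)%E by apply/eqP; rewrite -leye_eq.
by rewrite gt0_muley ?lte_fin ?normr_gt0//= mulr0.
Qed.

Lemma inL1Z (a : R) f : inL1 f -> inL1 (fun w => a *: f w).
Proof.
move=> [mf fi]; split; first exact: smeasZ.
under eq_integral do rewrite normrZ EFinM.
rewrite ge0_integralZl_EFin//; last exact: smeas_normE.
by rewrite lte_mul_pinfty.
Qed.

Lemma norm1N f : norm1 (\- f) = norm1 f.
Proof. by congr fine; apply: eq_integral => w _; rewrite normrN. Qed.

Lemma inL1N f : inL1 f -> inL1 (\- f).
Proof.
move=> [mf fi]; split; first exact: smeasN.
by under eq_integral do rewrite normrN.
Qed.

Lemma inL1B f g : inL1 f -> inL1 g -> inL1 (f \- g).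
Proof. by move=> lf lg; apply: inL1D => //; exact: inL1N. Qed.

Lemma norm1B f g : inL1 f -> inL1 g -> norm1 (f \- g) <= norm1 f + norm1 g.
Proof. by move=> lf lg; rewrite -(norm1N g); apply: norm1D => //; exact: inL1N. Qed.

Lemma norm1_sym f g : norm1 (f \- g) = norm1 (g \- f).
Proof. by congr fine; apply: eq_integral => w _; rewrite /= distrC. Qed.

Lemma norm1_triangle g f h : inL1 f -> inL1 g -> inL1 h ->
  norm1 (f \- h) <= norm1 (f \- g) + norm1 (g \- h).
Proof.
move=> lf lg lh.
rewrite (_ : f \- h = (f \- g) \+ (g \- h)); first by apply: norm1D; exact: inL1B.
by apply/funext => w /=; rewrite subrKA.
Qed.

Lemma norm1_dist f g : inL1 f -> inL1 g -> norm1 f <= norm1 (f \- g) + norm1 g.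
Proof.
move=> lf lg; rewrite [X in norm1 X <= _](_ : f = (f \- g) \+ g).
  by apply: norm1D => //; exact: inL1B.
by apply/funext => w /=; rewrite subrK.
Qed.

Lemma inL1_sum (I : Type) (r : seq I) (f : I -> T -> X) : (forall i, inL1 (f i)) ->
  inL1 (fun w => \sum_(i <- r) f i w).
Proof.
move=> lf; elim: r => [|i r ih].
  split; first by apply: smeas_sum => i; case: (lf i).
  by under eq_integral do rewrite big_nil normr0; rewrite integral0.
by under eq_fun do rewrite big_cons; exact: inL1D.
Qed.

Lemma inL1_bounded f (M : R) : smeas f -> (\forall w \ae mu, `|f w| <= M) ->
  inL1 f /\ norm1 f <= M * mass.
Proof.
move=> mf fM.
(* An almost everywhere bound by a negative [M] is possible only if [mu] is the zero measure; then
   both sides vanish. *)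
have [M0|M0] := leP 0 M; last first.
  have le : (\int[mu]_w (`|f w|)%:E <= \int[mu]_w (cst 0) w)%E.
    apply: ge0_ae_le_integral => //; apply: filterS fM => w fM _.
    by rewrite /= lee_fin (le_trans fM)// ltW.
  have mu0 : mass = 0.
    apply/eqP; rewrite -eqe massE; apply/eqP.
    apply/negligibleP => //; apply: negligibleS fM => w _ /=.
    by apply/negP; rewrite -ltNge (lt_le_trans M0).
  rewrite integral_cst// mul0e in le.
  split; first by split => //; rewrite (le_lt_trans le)//.
  rewrite mu0 mulr0 /norm1 (_ : integral _ _ _ = 0)%E//.
  by apply/eqP; rewrite eq_le le integral_ge0.
have le : (\int[mu]_w (`|f w|)%:E <= \int[mu]_w (cst M%:E) w)%E.
  apply: ge0_ae_le_integral => //.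
  by apply: filterS fM => w fM _; rewrite /= lee_fin.
rewrite integral_cst// in le.
have {}le : (\int[mu]_w (`|f w|)%:E <= (M * mass)%:E)%E by rewrite EFinM massE.
have lf : inL1 f by split => //; rewrite (le_lt_trans le)// ltry.
by split => //; rewrite -lee_fin norm1E.
Qed.

Lemma inL1_cst (x : X) : inL1 (cst x).
Proof. by apply: (@inL1_bounded _ `|x| _ _).1; [exact: smeas_cst|exact: nearW]. Qed.

Lemma inL1_cut0 A f : measurable A -> inL1 f -> inL1 (cut0 A f).
Proof.
move=> mA lf; apply: (inL1_le _ lf); first by apply: smeas_cut0 => //; case: lf.
by apply: nearW => w; rewrite /cut0; case: ifP => // _; rewrite normr0.
Qed.

Lemma markov1 f (a : R) : inL1 f -> 0 < a ->
  (mu [set w | (a <= `|f w|)%R] <= (norm1 f / a)%:E)%E.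
Proof.
move=> lf a0; have mf : measurable [set w | a <= `|f w|].
  by apply: measurable_le_set => //; apply: smeas_norm; case: lf.
have : (a%:E * mu [set w | (a <= `|f w|)%R] <= (norm1 f)%:E)%E.
  rewrite norm1E//; have := @le_integral_abse _ _ _ mu setT measurableT
    (fun w => (`|f w|)%:E) a (smeas_normE lf.1) a0.
  under eq_integral do rewrite abse_EFin normr_id.
  rewrite (_ : setT `&` _ = [set w | a <= `|f w|])//.
  by rewrite setTI; apply/seteqP; split => w /=; rewrite lee_fin normr_id.
rewrite -(fineK (fin_num_measure mu _ mf)).
by rewrite -EFinM !lee_fin ler_pdivlMr// mulrC.
Qed.

Lemma norm1_eq0 f : inL1 f -> norm1 f = 0 -> \forall w \ae mu, f w = 0.
Proof.
move=> lf f0; have := norm1E lf; rewrite f0 => /esym.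
under eq_integral do rewrite -(normr_id (f _)) -abse_EFin.
have /(ae_eq_integral_abs mu measurableT) := smeas_normE lf.1.
move=> [+ _] => /[apply]; apply: filterS => w /(_ I) /= [] /eqP.
by rewrite normr_eq0 => /eqP.
Qed.

Lemma norm1_eqP f g : inL1 f -> inL1 g -> norm1 (f \- g) = 0 -> \forall w \ae mu, f w = g w.
Proof.
move=> lf lg /(norm1_eq0 (inL1B lf lg)); apply: filterS => w /= /eqP.
by rewrite subr_eq0 => /eqP.
Qed.

(** The set where the distance is at least [2^-k] has measure at most [4^-k / 2^-k = 2^-k], so
    almost every point lies in finitely many of these sets. *)
Lemma fast_ae_cvg (u : nat -> T -> X) f : (forall k, inL1 (u k)) -> inL1 f ->
  (forall k, norm1 (u k \- f) <= (4^-1) ^+ k) ->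
  \forall w \ae mu, u k w @[k --> \oo] --> f w.
Proof.
move=> lu lf uf.
pose B k := [set w | (2^-1 : R) ^+ k <= `|(u k \- f) w|].
have : \forall w \ae mu, exists m, forall k, (m <= k)%N -> ~ B k w.
  apply: (borel_cantelli ler01) => k; last rewrite mul1r.
    apply: measurable_le_set => //; apply: smeas_norm.
    by case: (inL1B (lu k) lf).
  have p0 : 0 < (2^-1 : R) ^+ k by rewrite exprn_gt0.
  apply: le_trans (markov1 (inL1B (lu k) lf) p0) _.
  rewrite lee_fin ler_pdivrMr// (le_trans (uf k))// -exprMn.
  by rewrite (_ : (2^-1 * 2^-1) = 4^-1 :> R)//; field.
apply: filterS => w [m hm]; apply/cvgrPdist_lt => eps e0.
have : (2^-1 : R) ^+ k @[k --> \oo] --> (0 : R).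
  by apply: cvg_expr; rewrite ger0_norm// invf_lt1 ?ltr1n.
move=> /cvgrPdist_lt/(_ _ e0) [N _ hN]; exists (maxn m N) => // k /=.
rewrite geq_max => /andP[mk Nk].
have := hN _ Nk; rewrite sub0r normrN ger0_norm ?exprn_ge0//.
apply: lt_trans; have /negP := hm _ mk; rewrite -ltNge /= distrC; exact.
Qed.

(** The approximations can be taken at distance [4^-k]; they then converge almost everywhere, which
    preserves the pointwise bound. *)
Lemma ae_bounded_closure f (M : R) : inL1 f ->
  (forall eps : R, 0 < eps -> exists g, [/\ inL1 g, norm1 (g \- f) <= eps &
     \forall w \ae mu, `|g w| <= M]) ->
  \forall w \ae mu, `|f w| <= M.
Proof.
move=> lf h.
have /choice[g hg] : forall k : nat, exists g, [/\ inL1 g, norm1 (g \- f) <= (4^-1) ^+ k &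
     \forall w \ae mu, `|g w| <= M].
  by move=> k; apply: h; rewrite exprn_gt0.
have gf : \forall w \ae mu, g k w @[k --> \oo] --> f w.
  by apply: fast_ae_cvg => // k; case: (hg k).
have gM : \forall w \ae mu, forall k, `|g k w| <= M.
  by apply: ae_foralln => k; case: (hg k).
apply: filterS2 gf gM => w gw gwM.
have gw' : `|g k w| @[k --> \oo] --> `|f w| by exact: cvg_norm.
rewrite -(cvg_lim (@Rhausdorff R) gw').
by apply: limr_le; [exact: cvgP gw'|exact: nearW].
Qed.

Lemma L1_cvg_unique (I : Type) (F : set_system I) (u : I -> T -> X) f g :
  ProperFilter F -> inL1 f -> inL1 g ->
  (\forall i \near F, inL1 (u i)) ->
  norm1 (u i \- f) @[i --> F] --> (0 : R) -> norm1 (u i \- g) @[i --> F] --> (0 : R) ->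
  \forall w \ae mu, f w = g w.
Proof.
move=> FF lf lg lu uf ug; apply: norm1_eqP => //; apply/eqP.
rewrite eq_le norm1_ge0 andbT; apply/ler_addgt0Pr => eps e0; rewrite add0r.
have e20 : 0 < eps / 2 by rewrite divr_gt0.
have {}uf := cvgr_lt _ uf _ e20; have {}ug := cvgr_lt _ ug _ e20.
near F => i.
have li : inL1 (u i) by near: i.
have := norm1_triangle lf li lg; rewrite (norm1_sym f (u i)).
have : norm1 (u i \- f) < eps / 2 by near: i; exact: uf.
have : norm1 (u i \- g) < eps / 2 by near: i; exact: ug.
lra.
Unshelve. all: by end_near. Qed.

Lemma finitely_valued_bounded f : finitely_valued f -> exists M : R, forall w, `|f w| <= M.
Proof.
move=> [/finite_seqP[s hs] _]; exists (\sum_(x <- s) `|x|) => w.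
have : range f (f w) by exists w.
rewrite hs /= => sw; rewrite (big_rem _ sw) /= lerDl.
by apply: sumr_ge0.
Qed.

Lemma finitely_valued_inL1 f : finitely_valued f -> inL1 f.
Proof.
move=> ff; have [M fM] := finitely_valued_bounded ff.
apply: (@inL1_bounded _ M _ _).1; first exact: finitely_valued_smeas.
exact: nearW.
Qed.

Lemma inL1_approx f : inL1 f -> exists h : nat -> T -> X,
  [/\ forall n, finitely_valued (h n), forall n w, `|f w - h n w| <= `|f w|,
   forall w, h n w @[n --> \oo] --> f w & norm1 (f \- h n) @[n --> \oo] --> (0 : R)].
Proof.
move=> lf; have [h [fh hf hle]] := smeas_approx lf.1.
exists h; split => //.
have lh n : inL1 (f \- h n).
  apply: (inL1_le _ lf); last by apply: nearW => w; exact: hle.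
  by apply: smeasB; [case: lf|exact: finitely_valued_smeas].
have : (\int[mu]_w (`|(f \- h n) w|)%:E)%E @[n --> \oo] --> (\int[mu]_w (cst 0 w))%E.
  apply: (@dominated_cvg _ _ _ mu setT measurableT _ _ (fun w => (`|f w|)%:E)) => //.
  - by move=> n; exact: smeas_normE (lh n).1.
  - move=> w _; apply: (@cvg_trans _ (EFin @ (`|(f \- h n) w| @[n --> \oo]))) => //.
    apply: cvg_EFin; first exact: nearW.
    rewrite -(normr0 X) -(subrr (f w)); apply: cvg_norm => /=.
    by apply: cvgB => //; exact: cvg_cst.
  - apply/integrableP; split; first exact: smeas_normE lf.1.
    by under eq_integral do rewrite abse_EFin normr_id; exact: lf.2.
  - by move=> n w _; rewrite abse_EFin normr_id lee_fin; exact: hle.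
rewrite integral_cst// mul0e => /fine_cvg; exact.
Qed.

Lemma norm1_approx f (eps : R) : inL1 f -> 0 < eps ->
  exists h, finitely_valued h /\ norm1 (f \- h) < eps.
Proof.
move=> lf e0; have [h [fh _ _ hf]] := inL1_approx lf.
have := cvgr_lt _ hf _ e0 => -[N _ /(_ N (leqnn N)) hN].
by exists (h N).
Qed.

End L1_theory.
#[global] Hint Resolve inL1_smeas : core.

Section L1_complete.
Context {R : realType} {X : completeNormedModType R} {d : measure_display}
  {T : measurableType d} (mu : {finite_measure set T -> \bar R}).
Implicit Types (f g h : T -> X).

Lemma fatou_norm1 (u : nat -> T -> X) f (c : R) : (forall k, inL1 mu (u k)) -> smeas f ->
  (\forall w \ae mu, u k w @[k --> \oo] --> f w) ->
  (\forall k \near \oo, norm1 mu (u k) <= c) -> inL1 mu f /\ norm1 mu f <= c.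
Proof.
move=> lu mf uf uc.
suff le : (\int[mu]_w (`|f w|)%:E <= c%:E)%E.
  have lf : inL1 mu f by split => //; rewrite (le_lt_trans le)// ltry.
  by split => //; rewrite -lee_fin norm1E.
apply: (@le_trans _ _ (\int[mu]_w limn_einf (fun k => (`|u k w|)%:E))%E).
  apply: ge0_ae_le_integral => //.
    move=> w; rewrite limn_einf_lim; apply: lime_ge; first exact: is_cvg_einfs.
    by apply: nearW => n; apply: le_ereal_inf_tmp => _ [m _ <-]; rewrite lee_fin.
  apply: filterS uf => w uw _.
  have cw : (`|u k w|)%:E @[k --> \oo] --> (`|f w|)%:E.
    by apply: cvg_EFin; [exact: nearW|exact: cvg_norm].
  rewrite is_cvg_limn_einfE; last by apply/cvg_ex; eexists; exact: cw.
  by rewrite (cvg_lim _ cw).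
apply: le_trans (@fatou _ _ _ mu setT measurableT _ _ _) _ => //.
  by move=> n; exact: smeas_normE (lu n).1.
rewrite limn_einf_lim; apply: lime_le; first exact: is_cvg_einfs.
case: uc => N _ hN; near=> n.
have Nn : (N <= n)%N by near: n; exact: nbhs_infty_ge.
apply: (@le_trans _ _ (\int[mu]_w (`|u n w|)%:E)%E).
  by apply: ereal_inf_lbound; exists n => /=.
by rewrite -norm1E// lee_fin; exact: hN.
Unshelve. all: by end_near. Qed.

Lemma geometric_increments {V : normedModType R} (u : nat -> V) (c q : R) k j : 0 <= q < 1 ->
  (forall i, (k <= i)%N -> `|u i.+1 - u i| <= c * q ^+ i) ->
  `|u (k + j)%N - u k| <= c / (1 - q) * (q ^+ k - q ^+ (k + j)).
Proof.
move=> /andP[q0 q1] h; elim: j => [|j ih]; first by rewrite addn0 !subrr normr0 mulr0.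
have := ler_distD (u (k + j)%N) (u (k + j).+1) (u k).
have := h _ (leq_addr j k); rewrite addnS exprS.
have : c / (1 - q) * (q ^+ k - q * q ^+ (k + j)) =
   c / (1 - q) * (q ^+ k - q ^+ (k + j)) + c * q ^+ (k + j).
  by field; rewrite subr_eq0 gt_eqF.
lra.
Qed.

Lemma geometric_cvg {V : completeNormedModType R} (u : nat -> V) m :
  (forall k, (m <= k)%N -> `|u k.+1 - u k| < (2^-1) ^+ k) -> cvg (u @ \oo).
Proof.
move=> hm; apply: cauchy_sequence_cvg => eps e0.
have : (2^-1 : R) ^+ k @[k --> \oo] --> (0 : R).
  by apply: cvg_expr; rewrite ger0_norm// invf_lt1 ?ltr1n.
have e40 : 0 < eps / 4 by rewrite divr_gt0.
move=> /cvgrPdist_lt/(_ _ e40) [N _ hN]; exists (maxn m N) => k.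
set n := maxn m N => nk.
have Nn : (N <= n)%N by rewrite leq_maxr.
have mn : (m <= n)%N by rewrite leq_maxl.
have := hN _ Nn; rewrite sub0r normrN ger0_norm ?exprn_ge0// => hn.
rewrite -(subnKC nk).
apply: (@le_lt_trans _ _ (1 / (1 - 2^-1) * (2^-1 ^+ n - 2^-1 ^+ (n + (k - n))))).
  apply: (@geometric_increments _ u).
    by rewrite invr_ge0 ler0n/= invf_lt1 ?ltr1n.
  by move=> i ni; rewrite mul1r; exact/ltW/hm/(leq_trans mn ni).
have : 0 <= (2^-1 : R) ^+ (n + (k - n)) by rewrite exprn_ge0.
rewrite (_ : 1 / (1 - 2^-1) = 2 :> R); last by field.
lra.
Qed.

Lemma L1_complete_fast (u : nat -> T -> X) : (forall k, inL1 mu (u k)) ->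
  (forall k, norm1 mu (u k.+1 \- u k) <= (4^-1) ^+ k) ->
  exists2 f, inL1 mu f & forall k, norm1 mu (u k \- f) <= 2 * (4^-1) ^+ k.
Proof.
move=> lu hu.
have ae : \forall w \ae mu, cvg (u k w @[k --> \oo]).
  pose B k := [set w | (2^-1 : R) ^+ k <= `|(u k.+1 \- u k) w|].
  have : \forall w \ae mu, exists m, forall k, (m <= k)%N -> ~ B k w.
    apply: (borel_cantelli ler01) => k; last rewrite mul1r.
      apply: measurable_le_set => //; apply: smeas_norm.
      by case: (inL1B (lu k.+1) (lu k)).
    have p0 : 0 < (2^-1 : R) ^+ k by rewrite exprn_gt0.
    apply: le_trans (markov1 (inL1B (lu k.+1) (lu k)) p0) _.
    rewrite lee_fin ler_pdivrMr// (le_trans (hu k))// -exprMn.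
    by rewrite (_ : (2^-1 * 2^-1) = 4^-1 :> R)//; field.
  apply: filterS => w [m hm]; apply: (@geometric_cvg _ (fun i => u i w) m) => k mk.
  by rewrite ltNge; apply/negP; exact: hm.
have [f mf hf] := smeas_limit (fun k => inL1_smeas (lu k)).
(* The tail of the geometric series of ratio 1/4 is [4 / 3 * 4^-k]; the conclusion rounds the factor
   up to 2. *)
have inc k j : norm1 mu (u (k + j)%N \- u k) <= 4 / 3 * ((4^-1) ^+ k - (4^-1) ^+ (k + j)).
  elim: j => [|j ih].
    rewrite addn0 subrr mulr0 /norm1.
    by under eq_integral do rewrite /= subrr normr0; rewrite integral0.
  have := norm1_triangle (lu (k + j.+1)%N) (lu (k + j)%N) (lu k).
  rewrite addnS; have := hu (k + j)%N; rewrite exprS; lra.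
have h k : inL1 mu (u k \- f) /\ norm1 mu (u k \- f) <= 2 * (4^-1) ^+ k.
  apply: (@fatou_norm1 (fun m => u k \- u m)).
  - by move=> m; exact: inL1B.
  - by apply: smeasB => //; case: (lu k).
  - apply: filterS ae => w /hf cw /=.
    by apply: cvgB => //; exact: cvg_cst.
  - exists k => // m /= km; rewrite norm1_sym -(subnKC km).
    apply: le_trans (inc _ _) _.
    have : 0 <= (4^-1 : R) ^+ (k + (m - k)) by rewrite exprn_ge0.
    have : 0 <= (4^-1 : R) ^+ k by rewrite exprn_ge0.
    lra.
exists f; last by move=> k; case: (h k).
have := inL1B (lu 0) (h 0%N).1; rewrite (_ : _ \- _ = f)//.
by apply/funext => w /=; rewrite opprB addrC subrK.
Qed.

Lemma L1_complete (u : nat -> T -> X) : (forall k, inL1 mu (u k)) ->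
  (forall eps : R, 0 < eps -> exists N, forall m n, (N <= m)%N -> (N <= n)%N ->
     norm1 mu (u m \- u n) < eps) ->
  exists2 f, inL1 mu f & norm1 mu (u k \- f) @[k --> \oo] --> (0 : R).
Proof.
move=> lu hu.
have /choice[N hN] : forall k : nat, exists N, forall m n, (N <= m)%N -> (N <= n)%N ->
     norm1 mu (u m \- u n) < (4^-1) ^+ k.
  by move=> k; apply: hu; rewrite exprn_gt0.
(* A sum instead of [N k] alone, so that [M k.+1] is beyond [N k] as well. *)
pose M k := (\sum_(i < k.+1) N i)%N.
have NM k : (N k <= M k)%N by rewrite /M big_ord_recr /= leq_addl.
have NMS k : (N k <= M k.+1)%N.
  by rewrite /M big_ord_recr /= (leq_trans (NM k))// leq_addr.
have [f lf hf] := @L1_complete_fast (u \o M) (fun k => lu _)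
  (fun k => ltW (hN k _ _ (NMS k) (NM k))).
exists f => //; apply/cvgrPdist_lt => eps e0.
have [k ke] : exists k, 2 * (4^-1) ^+ k < eps / 2 :> R.
  have : (4^-1 : R) ^+ k @[k --> \oo] --> (0 : R).
    by apply: cvg_expr; rewrite ger0_norm// invf_lt1 ?ltr1n.
  have e40 : 0 < eps / 4 by rewrite divr_gt0.
  move=> /cvgrPdist_lt/(_ _ e40) [k _ /(_ k (leqnn k))].
  rewrite sub0r normrN ger0_norm ?exprn_ge0// => h; exists k; lra.
exists (M k) => // m /= Mm.
rewrite sub0r normrN ger0_norm ?norm1_ge0//.
have := norm1_triangle (lu m) (lu (M k)) lf.
have := hN k _ _ (leq_trans (NM k) Mm) (NM k); have := hf k.
have : 0 < (4^-1 : R) ^+ k by rewrite exprn_gt0.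
rewrite /=; lra.
Qed.

End L1_complete.

(** * Representatives of classes and sub-sigma-algebras *)

Section representatives.
Context {R : realType} {X : completeNormedModType R} {d : measure_display}
  {T : measurableType d} (mu : {measure set T -> \bar R}).
Implicit Types (F : set (set T)) (f g : T -> X).

Lemma simple_fun_finitely_valued F (h : T -> X) :
  simple_fun F h -> @finitely_valued _ (g_sigma_algebraType F) _ h.
Proof. by move=> [fh mh]; split => // y; apply: sub_sigma_algebra; exact: mh. Qed.

Lemma finitely_valued_simple_fun F (h : T -> X) : sigma_algebra setT F ->
  @finitely_valued _ (g_sigma_algebraType F) _ h -> simple_fun F h.
Proof.
move=> sF [fh mh]; split => // y; have := mh y.
by rewrite /measurable /= sigma_algebra_id.
Qed.

Lemma measurable_id_sub F : sigma_algebra setT F -> F `<=` measurable ->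
  measurable_fun (setT : set T) (id : T -> g_sigma_algebraType F).
Proof.
move=> sF Fm _ B mB; rewrite setTI; apply: Fm.
by move: mB; rewrite /measurable /= sigma_algebra_id.
Qed.

Lemma smeas_sub F f : sigma_algebra setT F -> F `<=` measurable ->
  @smeas _ _ _ (g_sigma_algebraType F) f -> smeas f.
Proof. by move=> sF Fm mf; have := smeas_comp (measurable_id_sub sF Fm) mf. Qed.

(** Results on measurability are reused for a sub-sigma-algebra by reading them on
    [g_sigma_algebraType F], the same set with [F] as its measurable sets. The simple functions
    converge almost everywhere only, so the limit is taken by [smeas_limit], which yields a function
    that is [F]-measurable at every point. *)
Lemma strongly_measurable_rep F f : sigma_algebra setT F -> F `<=` measurable ->
  strongly_measurable mu F f ->
  exists2 f', @smeas _ _ _ (g_sigma_algebraType F) f' & \forall w \ae mu, f w = f' w.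
Proof.
move=> sF Fm [h [sh hf]].
have [f' mf' hf'] := @smeas_limit _ _ _ (g_sigma_algebraType F) h
  (fun n => finitely_valued_smeas (simple_fun_finitely_valued (sh n))).
exists f' => //; apply: filterS hf => w hw.
have cw : cvg (h n w @[n --> \oo]) by apply/cvg_ex; exists (f w).
exact: (cvg_unique _ hw (hf' _ cw)).
Qed.

Lemma rep_strongly_measurable F f f' : sigma_algebra setT F ->
  @smeas _ _ _ (g_sigma_algebraType F) f' -> (\forall w \ae mu, f w = f' w) ->
  strongly_measurable mu F f.
Proof.
move=> sF /smeas_approx[h [fh hf _]] ff'; exists h; split.
  by move=> n; exact: finitely_valued_simple_fun.
by apply: filterS ff' => w ->.
Qed.

Lemma smeas_strongly_measurable f f' : smeas f' -> (\forall w \ae mu, f w = f' w) ->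
  strongly_measurable mu measurable f.
Proof.
move=> /smeas_approx[h [fh hf _]] ff'; exists h; split.
  by move=> n; case: (fh n).
by apply: filterS ff' => w ->.
Qed.

Lemma strongly_measurable_smeas f : strongly_measurable mu measurable f ->
  exists2 f', smeas f' & \forall w \ae mu, f w = f' w.
Proof.
move=> /strongly_measurable_rep[||f' mf' ff'] //; first exact: sigma_algebra_measurable.
by exists f' => //; apply: smeas_sub mf' => //; exact: sigma_algebra_measurable.
Qed.

End representatives.

Section Lp_norms.
Context {R : realType} {X : completeNormedModType R} {d : measure_display}
  {T : measurableType d} (mu : {finite_measure set T -> \bar R}).
Implicit Types (f g : T -> X).

Lemma Xnorm1E f : Xnorm mu 1 f = (\int[mu]_w (`|f w|)%:E)%E.
Proof. by rewrite /Xnorm Lnorm1; apply: eq_integral => w _; rewrite abse_EFin normr_id. Qed.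

Lemma Lp1P f : Lp mu 1 f <-> exists2 f', inL1 mu f' & \forall w \ae mu, f w = f' w.
Proof.
split.
  move=> [/strongly_measurable_smeas[f' mf' ff']]; rewrite Xnorm1E => fi.
  exists f' => //; split => //.
  rewrite (_ : integral _ _ _ = \int[mu]_w (`|f w|)%:E)%E//.
  by apply: ge0_ae_eq_integral_nonmeasurable => //; apply: filterS ff' => w ->.
move=> [f' [mf' fi] ff']; split; first exact: smeas_strongly_measurable ff'.
rewrite Xnorm1E (_ : integral _ _ _ = \int[mu]_w (`|f' w|)%:E)%E//.
by apply: ge0_ae_eq_integral_nonmeasurable => //; apply: filterS ff' => w ->.
Qed.

Lemma inL1_Lp f : inL1 mu f -> Lp mu 1 f.
Proof. by move=> lf; apply/Lp1P; exists f => //; exact: nearW. Qed.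

Lemma norm1_Xnorm f : Lp mu 1 f -> Xnorm mu 1 f = (norm1 mu f)%:E.
Proof.
move=> [_]; rewrite Xnorm1E => fi; rewrite /norm1 fineK// ge0_fin_numE//.
exact: integral_ge0.
Qed.

Lemma Xnorm_inftyP f (M : R) : 0 <= M ->
  (Xnorm mu +oo f <= M%:E)%E <-> \forall w \ae mu, `|f w| <= M.
Proof.
move=> M0; rewrite /Xnorm unlock; case: ifPn => [m0|].
  split; [move=> /ess_supP|move=> h; apply/ess_supP; move: h]; apply: filterS => w /=;
    by rewrite ?abse_EFin lee_fin normr_id.
(* For the zero measure the [L_oo] norm is 0 by convention, and every property holds almost
   everywhere. *)
rewrite -leNgt => m0; split => _; last by rewrite lee_fin.
have mu0 : mu setT = 0%E by apply/eqP; rewrite eq_le m0 measure_ge0.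
by exists setT; split => //.
Qed.

End Lp_norms.

(** * Bochner integrals *)

Section bochner_integrals.
Context {R : realType} {X : completeNormedModType R} {d : measure_display}
  {T : measurableType d} (mu : {measure set T -> \bar R}).
Implicit Types (f g h : T -> X) (D : set T).

(** For an arbitrary measure and relative to a set, unlike [inL1]: it serves both [mu] and Lebesgue
    measure on the intervals [[0, t]], the latter being infinite on the whole line. *)
Definition norm_integrable D f := smeas f /\ (\int[mu]_(w in D) (`|f w|)%:E < +oo)%E.

Lemma dual_sum (I : Type) (r : seq I) (x' : X -> R) (F : I -> X) : dual x' ->
  x' (\sum_(i <- r) F i) = \sum_(i <- r) x' (F i).
Proof.
move=> dx; elim: r => [|i r ih]; first by rewrite !big_nil dual0.
by rewrite !big_cons dualD// ih.
Qed.

(** Identities between Bochner integrals are checked on functionals, which reduces them to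
    identities between real integrals. *)
Lemma dual_separates (x y : X) : (forall x' : X -> R, dual x' -> x' x = x' y) -> x = y.
Proof.
move=> h; apply/eqP; rewrite -subr_eq0 -normr_eq0.
have [x' [dx _ <-]] := norming_functional (x - y).
by rewrite dualB// h// subrr.
Qed.

Lemma smeas_dual (x' : X -> R) f : dual x' -> smeas f -> measurable_fun setT (x' \o f).
Proof. by move=> [_ cx]; exact: smeas_continuous. Qed.

Lemma norm_integrableS D D' f : measurable D -> measurable D' -> D' `<=` D ->
  norm_integrable D f -> norm_integrable D' f.
Proof.
move=> mD mD' DD' [mf fi]; split => //; apply: le_lt_trans fi.
apply: ge0_subset_integral => //.
by apply/measurable_funTS/measurable_EFinP; exact: smeas_norm.
Qed.

Lemma integrable_dual D (x' : X -> R) f : measurable D -> dual x' -> norm_integrable D f ->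
  mu.-integrable D (EFin \o (x' \o f)).
Proof.
move=> mD dx [mf fi]; have [C C0 hC] := dual_bounded dx.
apply/integrableP; split.
  by apply/measurable_funTS/measurable_EFinP; exact: smeas_dual.
apply: (@le_lt_trans _ _ (\int[mu]_(w in D) (C%:E * (`|f w|)%:E))%E).
  apply: ge0_le_integral => //.
  - by apply/measurable_funTS/measurableT_comp => //; apply/measurable_EFinP; exact: smeas_dual.
  - by apply/measurable_funTS/measurable_funeM/measurable_EFinP; exact: smeas_norm.
  - by move=> w _; rewrite /= -EFinM lee_fin.
rewrite ge0_integralZl_EFin ?ltW//; first by rewrite lte_mul_pinfty// lee_fin ltW.
by apply/measurable_funTS/measurable_EFinP; exact: smeas_norm.
Qed.

Lemma le_Rintegral_dual D (x' : X -> R) f (C : R) : measurable D -> dual x' -> 0 <= C ->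
  (forall x, `|x' x| <= C * `|x|) -> norm_integrable D f ->
  `|\int[mu]_(w in D) (x' (f w))| <= C * fine (\int[mu]_(w in D) (`|f w|)%:E).
Proof.
move=> mD dx C0 hC fi; have ix := integrable_dual mD dx fi.
have nf : mu.-integrable D (EFin \o (fun w => `|f w|)).
  apply/integrableP; split.
    by apply/measurable_funTS/measurable_EFinP/smeas_norm; case: fi.
  by under eq_integral do rewrite /= normr_id; case: fi.
apply: le_trans (le_normr_Rintegral mD ix) _.
rewrite -[X in _ <= _ * X]/(\int[mu]_(w in D) `|f w|) -RintegralZl//.
apply: le_Rintegral => //.
- rewrite (_ : EFin \o _ = abse \o (EFin \o (x' \o f))); last exact/funext.
  exact: integrable_abse.
- rewrite (_ : EFin \o _ = fun w => (C%:E * (EFin \o (fun w => `|f w|%R)) w)%E).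
    exact: integrableZl.
  by apply/funext => w /=; rewrite EFinM.
- by move=> w _; exact: hC.
Qed.

Lemma simple_integral_dual D (x' : X -> R) h : measurable D -> (mu D < +oo)%E ->
  finitely_valued h -> dual x' ->
  x' (simple_integral mu D h) = \int[mu]_(w in D) (x' (h w)).
Proof.
move=> mD Doo [fh mh] dx.
pose s : seq X := finmap.enum_fset (fset_set (range h)).
have Doo' y : mu (D `&` h @^-1` [set y]) \is a fin_num.
  rewrite ge0_fin_numE//; apply: le_lt_trans Doo; apply: le_measure => //.
  - by rewrite inE; apply: measurableI => //; exact: mh.
  - by rewrite inE.
rewrite /simple_integral fsbig_finite// dual_sum// /Rintegral.
under eq_bigr do rewrite dualZ//.
have -> : (\int[mu]_(w in D) (x' (h w))%:E)%E =
  (\int[mu]_(w in D) (\sum_(y <- s) (x' y)%:E * (\1_(h @^-1` [set y]) w)%:E))%E.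
  apply: eq_integral => w _; under eq_bigr do rewrite -EFinM.
  rewrite sumEFin; congr EFin; have hs : h w \in s.
    by rewrite in_fset_set// inE; exists w.
  rewrite (bigD1_seq (h w)) ?finmap.fset_uniq//= big1 => [|y /eqP yh].
    by rewrite indicE mem_set// mulr1 addr0.
  by rewrite indicE memNset ?mulr0//= => /esym.
have ii y : mu.-integrable D (fun w => (\1_(h @^-1` [set y]) w)%:E : \bar R).
  apply/integrableP; split.
    by apply/measurable_funTS/measurable_EFinP; exact: measurable_indic.
  under eq_integral do rewrite gee0_abs//.
  rewrite integral_indic// setIC; apply: le_lt_trans Doo; apply: le_measure => //.
  - by rewrite inE; apply: measurableI => //; exact: mh.
  - by rewrite inE.
rewrite integral_sum//; last by move=> y; exact: integrableZl.
under [X in _ = fine X]eq_bigr => y _.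
  rewrite integralZl// integral_indic// setIC -(fineK (Doo' y)) -EFinM.
  over.
by rewrite sumEFin /=; apply: eq_bigr => y _; rewrite mulrC.
Qed.

Lemma norm_integrable_finitely_valued D h : measurable D -> (mu D < +oo)%E ->
  finitely_valued h -> norm_integrable D h.
Proof.
move=> mD Doo fh; have [M hM] := finitely_valued_bounded fh.
split; first exact: finitely_valued_smeas.
apply: (@le_lt_trans _ _ (\int[mu]_(w in D) (cst M%:E w))%E).
  apply: ge0_le_integral => //.
  - by apply/measurable_funTS/measurable_EFinP/smeas_norm; exact: finitely_valued_smeas.
  - by move=> w _; rewrite lee_fin.
rewrite integral_cst// -(fineK (_ : mu D \is a fin_num)) ?ge0_fin_numE//.
by rewrite -EFinM ltry.
Qed.

Lemma norm_integrableB D f g : measurable D -> norm_integrable D f -> norm_integrable D g ->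
  norm_integrable D (f \- g).
Proof.
move=> mD [mf fi] [mg gi]; split; first exact: smeasB.
have m h : smeas h -> measurable_fun D (fun w => (`|h w|)%:E).
  by move=> mh; apply/measurable_funTS/measurable_EFinP; exact: smeas_norm.
apply: (@le_lt_trans _ _ (\int[mu]_(w in D) ((`|f w|)%:E + (`|g w|)%:E))%E).
  apply: ge0_le_integral => //.
  - by apply: m; exact: smeasB.
  - by apply: emeasurable_funD; exact: m.
  - by move=> w _; rewrite -EFinD lee_fin ler_normB.
by rewrite ge0_integralD//; [rewrite lte_add_pinfty|exact: m|exact: m].
Qed.

Lemma norm_integrable_fin D f : norm_integrable D f ->
  (\int[mu]_(w in D) (`|f w|)%:E)%E \is a fin_num.
Proof. by move=> [_ fi]; rewrite ge0_fin_numE// integral_ge0. Qed.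

(** Both sides are the limit of [x'] applied to the simple integrals. As functionals separate
    points, this contains the uniqueness of the Bochner integral. *)
Lemma is_bochner_integral_dual D f x : measurable D -> (mu D < +oo)%E ->
  norm_integrable D f -> is_bochner_integral mu D f x ->
  forall x' : X -> R, dual x' -> x' x = \int[mu]_(w in D) (x' (f w)).
Proof.
move=> mD Doo fi [_ [h [sh _ hf hx]]] x' dx.
have fh n : finitely_valued (h n) by have [] := sh n.
have [C C0 hC] := dual_bounded dx.
have xh : x' (simple_integral mu D (h n)) @[n --> \oo] --> x' x.
  by apply: continuous_cvg => //; case: dx => _; exact.
apply: (@cvg_unique _ (@Rhausdorff R) _ _ _ _ xh).
have lim0 : C * fine (\int[mu]_(w in D) (`|f w - h n w|)%:E) @[n --> \oo] --> (0 : R).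
  rewrite -[X in _ --> X](mulr0 C); apply: cvgM; first exact: cvg_cst.
  exact: (fine_cvg hf).
apply/cvgrPdist_le => eps e0.
apply: filterS (cvgr_lt _ lim0 _ e0) => n hn.
have ih := norm_integrable_finitely_valued mD Doo (fh n).
rewrite simple_integral_dual// -RintegralB//; [|exact: integrable_dual..].
under eq_Rintegral do rewrite -dualB//.
apply: le_trans (ltW hn).
apply: (le_Rintegral_dual mD dx (ltW C0) hC (f := f \- h n)).
exact: norm_integrableB.
Qed.

Lemma integral_approx D f : measurable D -> norm_integrable D f ->
  exists h : nat -> T -> X, (forall n, finitely_valued (h n)) /\
  (\int[mu]_(w in D) (`|f w - h n w|)%:E)%E @[n --> \oo] --> 0%E.
Proof.
move=> mD [mf fi]; have [h [fh hf hle]] := smeas_approx mf.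
have m g : smeas g -> measurable_fun D (fun w => (`|g w|)%:E).
  by move=> mg; apply/measurable_funTS/measurable_EFinP; exact: smeas_norm.
exists h; split => //.
have : (\int[mu]_(w in D) (`|(f \- h n) w|)%:E)%E @[n --> \oo] --> (\int[mu]_(w in D) (cst 0 w))%E.
  apply: (@dominated_cvg _ _ _ mu D mD _ _ (fun w => (`|f w|)%:E)) => //.
  - by move=> n; apply: m; apply: smeasB => //; exact: finitely_valued_smeas.
  - move=> w _; apply: (@cvg_trans _ (EFin @ (`|(f \- h n) w| @[n --> \oo]))) => //.
    apply: cvg_EFin; first exact: nearW.
    rewrite -(normr0 X) -(subrr (f w)); apply: cvg_norm => /=.
    by apply: cvgB => //; exact: cvg_cst.
  - apply/integrableP; split; first exact: m.
    by under eq_integral do rewrite abse_EFin normr_id; exact: fi.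
  - by move=> n w _; rewrite abse_EFin normr_id lee_fin; exact: hle.
by rewrite integral_cst// mul0e.
Qed.

(** A functional norming the difference reduces the estimate to real integrals. It makes the simple
    integrals of an approximating sequence a Cauchy sequence. *)
Lemma le_simple_integralB D f h k : measurable D -> (mu D < +oo)%E -> norm_integrable D f ->
  finitely_valued h -> finitely_valued k ->
  `|simple_integral mu D h - simple_integral mu D k| <=
  fine (\int[mu]_(w in D) (`|f w - h w|)%:E) + fine (\int[mu]_(w in D) (`|f w - k w|)%:E).
Proof.
move=> mD Doo fi fh fk.
have [x' [dx xle <-]] := norming_functional (simple_integral mu D h - simple_integral mu D k).
have ih := norm_integrable_finitely_valued mD Doo fh.
have ik := norm_integrable_finitely_valued mD Doo fk.
rewrite dualB// !simple_integral_dual//.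
have xle1 x : `|x' x| <= 1 * `|x| by rewrite mul1r.
have := le_Rintegral_dual mD dx ler01 xle1 (norm_integrableB mD fi ih).
have := le_Rintegral_dual mD dx ler01 xle1 (norm_integrableB mD fi ik).
under eq_Rintegral do rewrite /= dualB//.
rewrite RintegralB//; [|exact: integrable_dual..].
under [in X in _ -> X -> _]eq_Rintegral do rewrite /= dualB//.
rewrite RintegralB//; [|exact: integrable_dual..].
rewrite !mul1r !ler_norml => /andP[? ?] /andP[? ?]; lra.
Qed.

Lemma bochner_exists D f : measurable D -> (mu D < +oo)%E -> norm_integrable D f ->
  exists x, is_bochner_integral mu D f x.
Proof.
move=> mD Doo fi; have [h [fh hf]] := integral_approx mD fi.
have hf' : fine (\int[mu]_(w in D) (`|f w - h n w|)%:E) @[n --> \oo] --> (0 : R).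
  exact: (fine_cvg hf).
have : cvg (simple_integral mu D (h n) @[n --> \oo]).
  apply: cauchy_sequence_cvg => eps e0.
  have e20 : 0 < eps / 2 by rewrite divr_gt0.
  have [N _ hN] := cvgr_lt _ hf' _ e20; exists N => m Nm.
  apply: le_lt_trans (le_simple_integralB mD Doo fi (fh m) (fh N)) _.
  have := hN _ Nm; have := hN _ (leqnn N); rewrite /=; lra.
move=> /cvg_ex[x hx]; exists x; split.
  by apply: smeas_strongly_measurable; [case: fi => mf _; exact: mf|exact: nearW].
exists h; split => //.
move=> n y _; apply: le_lt_trans Doo; apply: le_measure => //.
- by rewrite inE; apply: measurableI => //; case: (fh n).
- by rewrite inE.
Qed.

Lemma is_bochner_integral_ae D f g x : measurable D -> (\forall w \ae mu, f w = g w) ->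
  is_bochner_integral mu D f x -> is_bochner_integral mu D g x.
Proof.
move=> mD fg [[s [ss sf]] [h [sh hoo hf hx]]]; split.
  by exists s; split => //; apply: filterS2 fg sf => w ->.
exists h; split => //.
rewrite -(_ : (fun n => (\int[mu]_(w in D) (`|f w - h n w|)%:E)%E) =
  fun n => (\int[mu]_(w in D) (`|g w - h n w|)%:E)%E)//.
apply/funext => n; apply: ge0_ae_eq_integral_nonmeasurable => //.
by apply: filterS fg => w ->.
Qed.

Lemma bochner_integral_ae D f g : measurable D -> (\forall w \ae mu, f w = g w) ->
  bochner_integral mu D f = bochner_integral mu D g.
Proof.
move=> mD fg; rewrite /bochner_integral; congr xget; apply/seteqP; split => x.
  exact: is_bochner_integral_ae.
by apply: is_bochner_integral_ae => //; apply: filterS fg => w ->.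
Qed.

Lemma bochner_integralP D f : measurable D -> (mu D < +oo)%E -> norm_integrable D f ->
  is_bochner_integral mu D f (bochner_integral mu D f).
Proof.
move=> mD Doo fi; rewrite /bochner_integral; case: xgetP => [x _|h] //.
by have [x hx] := bochner_exists mD Doo fi; have := h x.
Qed.

Lemma bochner_integral_dual D f (x' : X -> R) : measurable D -> (mu D < +oo)%E ->
  norm_integrable D f -> dual x' ->
  x' (bochner_integral mu D f) = \int[mu]_(w in D) (x' (f w)).
Proof.
move=> mD Doo fi dx.
exact: (is_bochner_integral_dual mD Doo fi (bochner_integralP mD Doo fi)).
Qed.

(** Over a piece where [f] is nearly constant, the integral is nearly measure times constant. With
    [D'] empty this serves conditional expectations; with [[0, a]] inside [[0, b]] it serves Riemann
    sums in time. *)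
Lemma bochner_integral_setD D D' f x : measurable D -> (mu D < +oo)%E ->
  measurable D' -> D' `<=` D -> norm_integrable D f ->
  `|bochner_integral mu D f - bochner_integral mu D' f - fine (mu (D `\` D')) *: x| <=
  fine (\int[mu]_(w in D `\` D') (`|f w - x|)%:E).
Proof.
move=> mD Doo mD' DD fi.
have Doo' : (mu D' < +oo)%E.
  by apply: le_lt_trans Doo; apply: le_measure; rewrite ?inE.
have mDD : measurable (D `\` D') by exact: measurableD.
have DDoo : (mu (D `\` D') < +oo)%E.
  by apply: le_lt_trans Doo; apply: le_measure; rewrite ?inE//; exact: subDsetl.
set y := (X in `|X|); have [x' [dx xle <-]] := norming_functional y.
have fiD' := norm_integrableS mD mD' DD fi.
have fiDD := norm_integrableS mD mDD (@subDsetl _ _ _) fi.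
have ix : norm_integrable (D `\` D') (cst x).
  by apply: norm_integrable_finitely_valued => //; exact: finitely_valued_cst.
have xle1 z : `|x' z| <= 1 * `|z| by rewrite mul1r.
have := le_Rintegral_dual mDD dx ler01 xle1 (norm_integrableB mDD fiDD ix).
rewrite mul1r; apply: le_trans; apply: le_trans (ler_norm _).
rewrite /y !dualB// dualZ// !bochner_integral_dual//.
under [in leRHS]eq_Rintegral do rewrite /= dualB//.
rewrite RintegralB//; [|exact: integrable_dual..].
rewrite Rintegral_cst// (mulrC (x' x)) lerD2r.
rewrite -[in leLHS](setDUK DD) Rintegral_setU//.
- by rewrite addrAC subrr add0r.
- by rewrite setDUK//; exact: integrable_dual.
- by apply/disj_setPS => w [? []].
Qed.

End bochner_integrals.

(** * Densities and functionals on L_1 *)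

Section densities.
Context {R : realType} {d : measure_display} {T : measurableType d}
  (mu : {measure set T -> \bar R}).
Hypothesis muoo : (mu setT < +oo)%E.

Lemma fin_measure A : measurable A -> mu A \is a fin_num.
Proof.
move=> mA; rewrite ge0_fin_numE//; apply: le_lt_trans muoo.
by apply: le_measure; rewrite ?inE.
Qed.

(** The same set function, equipped with the structure of a finite measure on the strength of
    [muoo], as Radon-Nikodym requires. *)
Definition finite_copy : set T -> \bar R := mu.

HB.instance Definition _ := isMeasure.Build _ T R finite_copy (measure0 mu)
  (measure_ge0 mu) (@measure_semi_sigma_additive _ _ _ mu).

Let finite_copy_fin : fin_num_fun finite_copy.
Proof. exact: fin_measure. Qed.

HB.instance Definition _ := Measure_isFinite.Build _ T R finite_copy finite_copy_fin.

Lemma integrable_bounded_real (f : T -> R) (C : R) A : measurable A ->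
  measurable_fun setT f -> (forall w, `|f w| <= C) -> mu.-integrable A (EFin \o f).
Proof.
move=> mA mf fC; apply/integrableP; split; first exact/measurable_funTS/measurable_EFinP.
apply: (@le_lt_trans _ _ (\int[mu]_(w in A) (cst C%:E w))%E).
  apply: ge0_le_integral => //.
  - by apply/measurable_funTS/measurableT_comp => //; exact/measurable_EFinP.
  - by move=> w _; rewrite lee_fin.
by rewrite integral_cst// -(fineK (fin_measure mA)) -EFinM ltry.
Qed.

(** Only the level sets of [f] are tested. For an [F]-measurable [f] these lie in [F], the only sets
    on which the integrals of a conditional expectation are known. *)
Lemma ae_le_cst_levels (f : T -> R) (C : R) : mu.-integrable setT (EFin \o f) ->
  (forall r, \int[mu]_(w in [set w | r < f w]) f w <= C * fine (mu [set w | r < f w])) ->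
  \forall w \ae mu, f w <= C.
Proof.
move=> fi hf.
have mf : measurable_fun setT f by case/integrableP : fi => /measurable_EFinP.
have : \forall w \ae mu, forall k : nat, f w <= C + k.+1%:R^-1.
  apply: ae_foralln => k; pose A := [set w | C + k.+1%:R^-1 < f w].
  have mA : measurable A by exact: measurable_lt_set.
  have fA := integrableS measurableT mA (@subsetT _ _) fi.
  have := hf (C + k.+1%:R^-1).
  have : (C + k.+1%:R^-1) * fine (mu A) <= \int[mu]_(w in A) f w.
    rewrite -Rintegral_cst//; apply: le_Rintegral => //.
    - by apply: (integrable_bounded_real (C := `|C + k.+1%:R^-1|)).
    - by move=> w /ltW.
  move=> h1 h2; have := le_trans h1 h2; rewrite mulrDl gerDl.
  rewrite pmulr_rle0 ?invr_gt0// => muA.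
  exists A; split => //; last by move=> w /= /negP; rewrite -ltNge.
  apply/eqP; rewrite eq_le measure_ge0 andbT -(fineK (fin_measure mA)).
  by rewrite lee_fin.
apply: filterS => w hw; rewrite leNgt; apply/negP => /ltr_add_invr[k].
by apply/negP; rewrite -leNgt.
Qed.

Lemma ae_le_cst (f : T -> R) (C : R) : mu.-integrable setT (EFin \o f) ->
  (forall A, measurable A -> \int[mu]_(w in A) f w <= C * fine (mu A)) ->
  \forall w \ae mu, f w <= C.
Proof.
move=> fi hf; apply: ae_le_cst_levels => // r; apply: hf.
by apply: measurable_lt_set => //; case/integrableP : fi => /measurable_EFinP.
Qed.

(** Domination by [C * mu] turns finite additivity into countable additivity and gives absolute
    continuity, so Radon-Nikodym applies. The density lies between [-C] and [C] almost everywhere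
    and is truncated to do so everywhere. *)
Lemma bounded_density (nu : set T -> R) (C : R) :
  0 <= C ->
  (forall A B, measurable A -> measurable B -> A `&` B = set0 ->
     nu (A `|` B) = nu A + nu B) ->
  (forall A, measurable A -> `|nu A| <= C * fine (mu A)) ->
  exists f : T -> R, [/\ measurable_fun setT f, forall w, `|f w| <= C &
    forall A, measurable A -> nu A = \int[mu]_(w in A) f w].
Proof.
move=> C0 nuD nuC.
pose nu' A := (nu A)%:E.
have nu0 : nu set0 = 0.
  apply/eqP; rewrite -normr_eq0 eq_le normr_ge0 andbT.
  by rewrite (le_trans (nuC _ measurable0))// measure0 mulr0.
have nu'0 : nu' set0 = 0 by rewrite /nu' nu0.
have nu'fin A : measurable A -> nu' A \is a fin_num by [].
have nu'sa : semi_sigma_additive nu'.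
  move=> B mB tB mUB; pose S n := \big[setU/set0]_(i < n) B i.
  have mS n : measurable (S n) by exact: bigsetU_measurable.
  have nuS n : \sum_(0 <= i < n) nu (B i) = nu (S n).
    elim: n => [|n ih]; first by rewrite big_nil /S big_ord0 nu0.
    rewrite big_nat_recr//= ih {2}/S big_ord_recr/= -/(S n) nuD//.
    rewrite setIC; apply/seteqP; split => // w [Bnw].
    rewrite /S -bigcup_mkord => -[i /= ni Biw].
    have := tB n i I I (ex_intro _ w (conj Bnw Biw)) => ni'.
    by rewrite ni' ltnn in ni.
  have SU n : S n `<=` \bigcup_n B n.
    by rewrite /S -bigcup_mkord; apply: bigcup_sub => i _; exact: bigcup_sup.
  have dist n : `|nu (\bigcup_n B n) - nu (S n)| <=
      C * (fine (mu (\bigcup_n B n)) - fine (mu (S n))).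
    have mD : measurable (\bigcup_n B n `\` S n) by exact: measurableD.
    have D0 : S n `&` (\bigcup_n B n `\` S n) = set0 by rewrite setDIK.
    have -> : nu (\bigcup_n B n) - nu (S n) = nu (\bigcup_n B n `\` S n).
      by rewrite -[in X in X - _](setDUK (SU n)) nuD// addrAC subrr add0r.
    apply: le_trans (nuC _ mD) _.
    rewrite measureD// ?ltey_eq ?fin_measure// (setIidr (SU n)).
    by rewrite fineB ?fin_measure.
  have cS : fine (mu (S n)) @[n --> \oo] --> fine (mu (\bigcup_n B n)).
    have := @measure_semi_sigma_additive _ _ _ mu B mB tB mUB.
    rewrite -(fineK (fin_measure mUB)) => /fine_cvg.
    apply: cvg_trans; apply: near_eq_cvg; apply: nearW => n /=.
    by rewrite /S measure_bigsetU// big_mkord.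
  rewrite (_ : (fun n => _) = fun n => (nu (S n))%:E); last first.
    by apply/funext => n; rewrite /nu' sumEFin nuS.
  apply: cvg_EFin; first exact: nearW.
  apply/cvgrPdist_le => eps e0.
  have C10 : 0 < C + 1 by rewrite ltr_wpDl.
  have /cvgrPdist_le/(_ _ (divr_gt0 e0 C10)) := cS.
  apply: filterS => n hn; apply: le_trans (dist n) _.
  apply: (@le_trans _ _ ((C + 1) * `|fine (mu (\bigcup_n B n)) - fine (mu (S n))|)).
    apply: (@le_trans _ _ (C * `|fine (mu (\bigcup_n B n)) - fine (mu (S n))|)).
      by rewrite ler_wpM2l// ler_norm.
    by rewrite ler_wpM2r// lerDl.
  by rewrite mulrC -ler_pdivlMr.
pose ch : {charge set T -> \bar R} := HB.pack nu' (isCharge.Build _ T R nu' nu'0 nu'fin nu'sa).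
pose m : {finite_measure set T -> \bar R} := finite_copy.
have dom : ch `<< m.
  apply/null_content_dominatesP => A mA /= muA0.
  rewrite /nu'; congr EFin; apply/eqP; rewrite -normr_eq0 eq_le normr_ge0 andbT.
  by rewrite (le_trans (nuC _ mA))// [mu A](_ : _ = 0%E)// mulr0.
pose g := Radon_Nikodym ch m.
have gfin w : g w \is a fin_num by exact: Radon_Nikodym_fin_num.
have gint : mu.-integrable setT g by exact: Radon_Nikodym_integrable dom.
pose f w := fine (g w).
have fg : EFin \o f = g by apply/funext => w /=; rewrite fineK.
have fi : mu.-integrable setT (EFin \o f) by rewrite fg.
have mf : measurable_fun setT f by case/integrableP : fi => /measurable_EFinP.
have nuf A : measurable A -> nu A = \int[mu]_(w in A) f w.
  move=> mA; rewrite /Rintegral.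
  under eq_integral do rewrite -[(f _)%:E]/((EFin \o f) _) fg.
  by have := Radon_Nikodym_integral dom mA; rewrite /= /nu' => <-.
have f1 : \forall w \ae mu, f w <= C.
  apply: ae_le_cst => // A mA; rewrite -nuf//.
  by rewrite (le_trans (ler_norm _))// nuC.
have f2 : \forall w \ae mu, - f w <= C.
  apply: ae_le_cst => [|A mA].
    by rewrite (_ : EFin \o _ = \- (EFin \o f))%E; [exact: integrableN|exact/funext].
  have -> : \int[mu]_(w in A) - f w = - nu A.
    have fA := integrableS measurableT mA (@subsetT _ _) fi.
    rewrite nuf// -mulN1r -RintegralZl//; apply: eq_Rintegral => w _.
    by rewrite mulN1r.
  by rewrite (le_trans (ler_norm _))// normrN nuC.
pose h w := Num.max (- C) (Num.min (f w) C).
have hf : \forall w \ae mu, f w = h w.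
  apply: filterS2 f1 f2 => w f1 f2; rewrite /h (min_idPl _)//.
  by rewrite (max_idPr _)// lerNl.
have mh : measurable_fun setT h.
  by apply: measurable_maxr => //; exact: measurable_minr.
exists h; split => //.
- move=> w; rewrite /h ler_norml le_max lexx/= ge_max ge_min lexx orbT andbT.
  by rewrite (le_trans _ C0)// oppr_le0.
- move=> A mA; rewrite nuf//; congr fine; apply: ae_eq_integral => //.
  + exact/measurable_funTS/measurable_EFinP.
  + exact/measurable_funTS/measurable_EFinP.
  + by apply: filterS hf => w + _ => ->.
Qed.

End densities.

Section combinations.
Context {R : realType} {V : lmodType R}.

(** A polynomial serves as a finitely supported sequence of coefficients: over [rat] there are
    countably many of them, over [R] they form a vector space. *)
Definition pcomb (c : nat -> V) (p : {poly R}) : V := \sum_(i < size p) p`_i *: c i.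

Lemma pcomb_widen c (p : {poly R}) N : (size p <= N)%N -> pcomb c p = \sum_(i < N) p`_i *: c i.
Proof.
move=> pN; rewrite /pcomb (big_ord_widen N (fun i : nat => p`_i *: c i) pN).
rewrite big_mkcond /=; apply: eq_bigr => i _; case: ifPn => //.
by rewrite -leqNgt => h; rewrite nth_default// scale0r.
Qed.

Lemma pcomb_linear c (a : R) p q : pcomb c (a *: p + q) = a *: pcomb c p + pcomb c q.
Proof.
set N := maxn (size p) (size q).
have pN : (size p <= N)%N by rewrite leq_maxl.
have qN : (size q <= N)%N by rewrite leq_maxr.
have pqN : (size (a *: p + q)%R <= N)%N.
  rewrite (leq_trans (size_polyD _ _))// geq_max qN andbT.
  by rewrite (leq_trans (size_scale_leq _ _)).
rewrite (pcomb_widen _ pN) (pcomb_widen _ qN) (pcomb_widen _ pqN).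
rewrite scaler_sumr -big_split /=.
by apply: eq_bigr => i _; rewrite coefD coefZ scalerDl scalerA.
Qed.

Lemma pcomb0 c : pcomb c 0 = 0.
Proof. by rewrite /pcomb size_poly0 big_ord0. Qed.

Lemma pcombX c n : pcomb c 'X^n = c n.
Proof.
rewrite (@pcomb_widen _ _ n.+1) ?size_polyXn// big_ord_recr /= big1.
  by rewrite coefXn eqxx scale1r add0r.
by move=> i _; rewrite coefXn ltn_eqF// scale0r.
Qed.

End combinations.

Section extension.
Context {R : realType} {X : normedModType R}.
Implicit Types (c : nat -> X) (delta : nat -> R).

Local Notation ratp q := (map_poly (ratr : rat -> R) q).

Lemma pcomb_rat_approx c delta (p : {poly R}) (eps : R) : 0 < eps ->
  exists q : {poly rat}, `|pcomb c p - pcomb c (ratp q)| <= eps /\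
    `|pcomb (delta : nat -> R^o) p - pcomb (delta : nat -> R^o) (ratp q)| <= eps.
Proof.
move=> e0; set N := size p.
pose K := \sum_(i < N) (`|c i| + `|delta i|).
have K0 : 0 <= K by apply: sumr_ge0 => i _; rewrite addr_ge0.
have K1 : 0 < K + 1 by rewrite ltr_wpDl.
pose eta := eps / (K + 1).
have eta0 : 0 < eta by rewrite divr_gt0.
have /choice[q hq] : forall i : nat, exists q : rat, `|p`_i - ratr q| < eta.
  move=> i; have [q] : exists q : rat, ratr q \in `]p`_i - eta, p`_i + eta[.
    by apply: rat_in_itvoo; lra.
  by rewrite in_itv /= => h; exists q; rewrite ltr_norml; lra.
pose Q := \poly_(i < N) q i.
have sQ : (size (ratp Q) <= N)%N by rewrite size_map_poly size_poly.
have main (Y : normedModType R) (u : nat -> Y) : (forall i, `|u i| <= `|c i| + `|delta i|) ->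
    `|pcomb u p - pcomb u (ratp Q)| <= eps.
  move=> hu; rewrite (pcomb_widen _ (leqnn N)) (pcomb_widen _ sQ) -sumrB.
  apply: le_trans (ler_norm_sum _ _ _) _.
  apply: (@le_trans _ _ (eta * K)).
    rewrite mulr_sumr; apply: ler_sum => i _.
    rewrite -scalerBl normrZ coef_map coef_poly ltn_ord /= ler_pM//.
    exact: ltW.
  rewrite /eta mulrAC ler_pdivrMr// ler_pM2l//.
  by rewrite lerDl.
exists Q; split; apply: main => i; first by rewrite lerDl.
by rewrite /= lerDr.
Qed.

(** The hypothesis consists of countably many inequalities, so it can be secured at almost every
    point. By density it extends to real combinations, and Hahn-Banach applies with the graph of
    [c i |-> delta i] as cone; opposite combinations turn the one-sided requirement into an
    equality. *)
Lemma extend_functional c delta :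
  (forall q : {poly rat}, pcomb (delta : nat -> R^o) (ratp q) <= `|pcomb c (ratp q)|) ->
  exists x' : X -> R, [/\ dual x', forall x, `|x' x| <= `|x| & forall i, x' (c i) = delta i].
Proof.
move=> h.
have hR p : pcomb (delta : nat -> R^o) p <= `|pcomb c p|.
  apply/ler_addgt0Pr => eps e0; have e20 : 0 < eps / 2 by rewrite divr_gt0.
  have [q [hq1 hq2]] := pcomb_rat_approx c delta p e20.
  have := h q; have := ler_distD 0 (pcomb c p) (pcomb c (ratp q)).
  have := lerB_dist (pcomb c (ratp q)) (pcomb c p).
  move: hq2; rewrite (distrC (pcomb c (ratp q))) ler_norml => /andP[]; lra.
pose G : set (X * R) := [set vr | exists p, vr = (pcomb c p, pcomb (delta : nat -> R^o) p)].
have [|v r w s|a v r a0|v r|phi [lphi phile phiG]] :=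
    @hahn_banach_cone R X setT (fun x : X => `|x|) G linear_setT (sublinear_norm _)
    (fun x _ => normrN x).
- by exists 0; rewrite !pcomb0.
- move=> [p [-> ->]] [q [-> ->]]; exists (1 *: p + q).
  by rewrite !pcomb_linear !scale1r.
- move=> [p [-> ->]]; exists (a *: p + 0).
  by rewrite !pcomb_linear !pcomb0 !addr0.
- by move=> [p [-> ->]]; split.
have phix x0 := phile x0 I.
have [dphi phiabs] := linear_on_dual lphi phix.
exists phi; split => // i; apply/eqP; rewrite eq_le; apply/andP; split; last first.
  by apply: phiG; exists 'X^i; rewrite !pcombX.
rewrite -lerN2 -[X in _ <= X](_ : phi (- c i) = _); last first.
  by rewrite -scaleN1r dualZ// mulN1r.
apply: phiG; exists ((-1) *: 'X^i + 0).
by rewrite !pcomb_linear !pcombX !pcomb0 !addr0 !scaleN1r.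
Qed.

End extension.

Section index_approximation.
Context {R : realType} {X : normedModType R} {d : measure_display} {T : measurableType d}.

(** The greedy approximation of [smeas_approx], recording the index in place of the value: the same
    index selects the density [delta i] that goes with [c i]. *)
Lemma smeas_index_approx (c : nat -> X) (f : T -> X) : smeas f -> c 0%N = 0 ->
  (forall w, adherent c (f w)) -> exists iota : nat -> T -> nat,
  [/\ forall n, finitely_valued (iota n), forall n w, (iota n w <= n)%N,
      forall w, c (iota n w) @[n --> \oo] --> f w &
      forall n w, `|f w - c (iota n w)| <= `|f w|].
Proof.
move=> mf c0 fc.
pose h := fix h n := if n is m.+1 then
  (fun w => if `|f w - c m.+1| < `|f w - c (h m w)| then m.+1 else h m w) else fun=> 0%N.
have hS n w : `|f w - c (h n.+1 w)| <= `|f w - c (h n w)|.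
  by rewrite /=; case: ifPn => // /ltW.
have hS2 n w : `|f w - c (h n w)| <= `|f w - c n|.
  by case: n => [|n] //=; case: ifPn => //; rewrite -leNgt.
have hle n m w : (n <= m)%N -> `|f w - c (h m w)| <= `|f w - c (h n w)|.
  move=> /subnK <-; elim: (m - n)%N => [//|k ih].
  by rewrite addSn (le_trans (hS _ _)).
have fh n : finitely_valued (h n) /\ measurable_fun setT (fun w => `|f w - c (h n w)|).
  elim: n => [|n [ih1 ih2]].
    split; first exact: finitely_valued_cst.
    by rewrite /=; exact: smeas_dist.
  split.
    apply: finitely_valued_if => //; last exact: finitely_valued_cst.
    by apply: measurable_lt_set => //; exact: smeas_dist.
  rewrite (_ : (fun _ => _) = fun w => Num.min `|f w - c n.+1| `|f w - c (h n w)|); last first.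
    apply/funext => w /=; rewrite /Num.min; by case: ifPn.
  by apply: measurable_minr => //; exact: smeas_dist.
exists h; split; first by move=> n; exact: (fh n).1.
- by elim=> [//|n ih] w /=; case: ifPn => // _; rewrite (leq_trans (ih _)).
- move=> w; apply/cvgrPdist_lt => eps e0; have [n hn] := fc w _ e0.
  exists n => // m /= nm.
  exact: le_lt_trans (hle _ _ _ nm) (le_lt_trans (hS2 _ _) hn).
- by move=> n w; have := hle 0%N n w (leq0n n); rewrite /= c0 subr0.
Qed.

End index_approximation.

Section functionals.
Context {R : realType} {X : completeNormedModType R} {d : measure_display}
  {T : measurableType d} (mu : {finite_measure set T -> \bar R}).

Lemma inL1_linear_set : linear_set (inL1 mu : set (T -> X)).
Proof. by split=> [|a f g lf lg]; [exact: inL1_cst|apply: inL1D => //; exact: inL1Z]. Qed.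

Lemma norm1_sublinear : sublinear_on (inL1 mu : set (T -> X)) (norm1 mu).
Proof.
split => [f g lf lg|a f a0 lf]; first exact: norm1D.
by rewrite -[X in _ = X * _]ger0_norm// -norm1Z//; case: lf.
Qed.

Let muoo : (mu setT < +oo)%E.
Proof. by rewrite ltey_eq fin_num_measure. Qed.

Lemma cut0_setU A B (x : X) : A `&` B = set0 ->
  cut0 (A `|` B) (cst x) = cut0 A (cst x) \+ cut0 B (cst x) :> (T -> X).
Proof.
move=> AB; apply/funext => w /=; rewrite /cut0 in_setU.
case: ifPn => [/orP[wA|wB]|]; last by rewrite negb_or => /andP[/negbTE-> /negbTE->]; rewrite addr0.
  rewrite wA ifF ?addr0//; apply/negP => wB.
  by have : (A `&` B) w; [split; exact: set_mem|rewrite AB].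
rewrite wB ifF ?add0r//; apply/negP => wA.
by have : (A `&` B) w; [split; exact: set_mem|rewrite AB].
Qed.

Lemma norm1_cut0_cst A (x : X) : measurable A ->
  norm1 mu (cut0 A (cst x)) = `|x| * fine (mu A).
Proof.
move=> mA; rewrite /norm1 (_ : integral _ _ _ = \int[mu]_(w in A) `|x|%:E)%E; last first.
  rewrite [RHS]integral_mkcond; apply: eq_integral => w _.
  by rewrite patchE /cut0; case: ifP => //; rewrite normr0.
by rewrite integral_cst// fineM// fin_num_measure.
Qed.

Lemma inL1_cut0_cst A (x : X) : measurable A -> inL1 mu (cut0 A (cst x) : T -> X).
Proof. by move=> mA; apply: inL1_cut0 => //; exact: inL1_cst. Qed.

Variables (phi : (T -> X) -> R).
Hypotheses (lphi : linear_on (inL1 mu : set (T -> X)) phi)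
  (phile : forall f : T -> X, inL1 mu f -> phi f <= norm1 mu f).

Lemma phi0 : phi (cst 0) = 0.
Proof.
have l0 : inL1 mu (cst 0 : T -> X) by exact: inL1_cst.
have := lphi (-1) l0 l0; rewrite (_ : _ + _ = cst 0 :> (T -> X)) => [|]; first lra.
by apply/funext => w /=; rewrite /GRing.add /= /GRing.scale /= scaler0 addr0.
Qed.

Lemma phiZ a (f : T -> X) : inL1 mu f -> phi (fun w => a *: f w) = a * phi f.
Proof.
move=> lf; have l0 : inL1 mu (cst 0 : T -> X) by exact: inL1_cst.
have := lphi a lf l0; rewrite phi0 [_ * _ + 0]addr0 => <-; congr phi.
by apply/funext => w; rewrite /GRing.add /= /GRing.scale /= addr0.
Qed.

Lemma phiD (f g : T -> X) : inL1 mu f -> inL1 mu g -> phi (f \+ g) = phi f + phi g.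
Proof.
move=> lf lg; have := lphi 1 lf lg; rewrite mul1r => <-; congr phi.
by apply/funext => w; rewrite /GRing.add /= /GRing.scale /= scale1r.
Qed.

Lemma phi_sum (I : Type) (r : seq I) (f : I -> T -> X) : (forall i, inL1 mu (f i)) ->
  phi (fun w => \sum_(i <- r) f i w) = \sum_(i <- r) phi (f i).
Proof.
move=> lf; elim: r => [|i r ih].
  rewrite big_nil -phi0; congr phi; apply/funext => w.
  by rewrite big_nil.
rewrite big_cons -ih -phiD//; last exact: inL1_sum.
by congr phi; apply/funext => w; rewrite big_cons.
Qed.

Lemma phi_abs (f : T -> X) : inL1 mu f -> `|phi f| <= norm1 mu f.
Proof.
move=> lf; rewrite ler_norml phile// andbT lerNl -mulN1r -phiZ//.
by rewrite (le_trans (phile (inL1Z _ lf)))// norm1Z ?normrN1 ?mul1r//; case: lf.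
Qed.

(** A density of [phi] with values in the dual of [X], known along the sequence [c] only: [delta i]
    is the density of the set function sending [A] to the value of [phi] at [c i] times the
    indicator of [A]. At almost every point these numbers are the values at the [c i] of one
    functional of norm at most 1. *)
Lemma functional_density (c : nat -> X) : exists delta : nat -> T -> R,
  [/\ forall i, measurable_fun setT (delta i), forall i w, `|delta i w| <= `|c i|,
   forall i A, measurable A -> phi (cut0 A (cst (c i))) = \int[mu]_(w in A) delta i w &
   \forall w \ae mu, exists x' : X -> R,
     [/\ dual x', forall x, `|x' x| <= `|x| & forall i, x' (c i) = delta i w]].
Proof.
have /choice[delta hd] : forall i, exists f : T -> R, [/\ measurable_fun setT f,
    forall w, `|f w| <= `|c i| &
    forall A, measurable A -> phi (cut0 A (cst (c i))) = \int[mu]_(w in A) f w].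
  move=> i; apply: (bounded_density muoo) => //.
    by move=> A B mA mB AB; rewrite cut0_setU// phiD//; exact: inL1_cut0_cst.
  move=> A mA; apply: le_trans (phi_abs (inL1_cut0_cst _ mA)) _.
  by rewrite norm1_cut0_cst.
exists delta; split; [by move=> i; case: (hd i)..|].
(* Testing [phi <= norm1] on the constant [pcomb c q] cut to an arbitrary set [A] gives the
   inequality between the densities almost everywhere, for each of the countably many [q]. *)
have : \forall w \ae mu, forall n : nat, if unpickle n is Some q then
    pcomb (delta^~ w : nat -> R^o) (map_poly (ratr : rat -> R) q) <=
    `|pcomb c (map_poly ratr q)| else true.
  apply: ae_foralln => n; case: unpickle => [q|]; last exact: nearW.
  set p := map_poly _ q.
  have int i A : measurable A -> mu.-integrable A (EFin \o (fun w => p`_i * delta i w)).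
    move=> mA; apply: (integrable_bounded_real muoo (C := `|p`_i| * `|c i|)) => //.
      by apply: measurable_funM => //; case: (hd i).
    by move=> w; rewrite normrM ler_wpM2l//; case: (hd i).
  have sumint (s : seq nat) A : measurable A ->
     mu.-integrable A (EFin \o (fun w => \sum_(i <- s) p`_i * delta i w)) /\
     \int[mu]_(w in A) (\sum_(i <- s) p`_i * delta i w) =
     \sum_(i <- s) p`_i * \int[mu]_(w in A) delta i w.
    move=> mA; elim: s => [|i s [ih1 ih2]].
      split.
        rewrite (_ : EFin \o _ = cst 0%E); first exact: integrable0.
        by apply/funext => w /=; rewrite big_nil.
      rewrite big_nil; under eq_Rintegral do rewrite big_nil.
      by rewrite Rintegral_cst// mul0r.
    have E : EFin \o (fun w => \sum_(i <- (i :: s)) p`_i * delta i w) =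
       (EFin \o (fun w => p`_i * delta i w)) \+ (EFin \o (fun w => \sum_(i <- s) p`_i * delta i w)).
      by apply/funext => w /=; rewrite big_cons EFinD.
    split; first by rewrite E; apply: integrableD => //; exact: int.
    under eq_Rintegral do rewrite big_cons.
    rewrite RintegralD//; last exact: int.
    rewrite big_cons ih2 RintegralZl//.
    by apply: (integrable_bounded_real muoo (C := `|c i|)) => //; case: (hd i).
  have pE w : pcomb (delta^~ w : nat -> R^o) p = \sum_(i <- iota 0 (size p)) p`_i * delta i w.
    by rewrite /pcomb -[in RHS](subn0 (size p)) -/(index_iota 0 (size p)) big_mkord.
  apply: (@filterS _ _ _ (fun w => \sum_(i <- iota 0 (size p)) p`_i * delta i w <= `|pcomb c p|)).
    by move=> w; rewrite pE.
  apply: (ae_le_cst muoo) => [|A mA]; first exact: (sumint _ _ measurableT).1.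
  rewrite (sumint _ _ mA).2.
  have -> : \sum_(i <- iota 0 (size p)) p`_i * \int[mu]_(w in A) delta i w =
      phi (cut0 A (cst (pcomb c p))).
    under eq_bigr => i _.
      have [_ _ <-//] := hd i; rewrite -phiZ; last exact: inL1_cut0_cst.
      over.
    rewrite -phi_sum; last by move=> i; apply: inL1Z; exact: inL1_cut0_cst.
    congr phi; apply/funext => w; rewrite /cut0; case: ifP => _.
      by rewrite /pcomb -[in LHS](subn0 (size p)) -/(index_iota 0 (size p)) big_mkord.
    by rewrite big1// => i _; rewrite scaler0.
  apply: le_trans (phile (inL1_cut0_cst _ mA)) _.
  by rewrite norm1_cut0_cst.
apply: filterS => w hw; apply: extend_functional => q.
by have := hw (pickle q); rewrite pickleK.
Qed.

Lemma phi_finitely_valued (c : nat -> X) (delta : nat -> T -> R) (j : T -> nat) N :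
  (forall i, measurable_fun setT (delta i)) -> (forall i w, `|delta i w| <= `|c i|) ->
  (forall i A, measurable A -> phi (cut0 A (cst (c i))) = \int[mu]_(w in A) delta i w) ->
  finitely_valued j -> (forall w, (j w < N)%N) ->
  measurable_fun setT (fun w => delta (j w) w) /\
  phi (fun w => c (j w)) = \int[mu]_w delta (j w) w.
Proof.
move=> md dc phid fj jN.
have mj i : measurable (j @^-1` [set i]) by case: fj.
pose F i w := if w \in j @^-1` [set i] then delta i w else 0.
have mF i : measurable_fun setT (F i).
  apply: measurable_fun_ifT => //; apply: measurable_bool_set.
  by rewrite (_ : [set _ | _] = j @^-1` [set i])//; apply/seteqP; split => w /=; rewrite inE.
have deltaE w : delta (j w) w = \sum_(i <- iota 0 N) F i w.
  rewrite (bigD1_seq (j w)) ?iota_uniq ?mem_iota ?add0n ?jN//= big1 ?addr0.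
    by rewrite /F mem_set.
  by move=> i /eqP ij; rewrite /F memNset//= => /esym.
have Fi i : mu.-integrable setT (EFin \o F i).
  apply: (integrable_bounded_real muoo (C := `|c i|)) => // w.
  by rewrite /F; case: ifP => // _; rewrite normr0.
split.
  by rewrite (_ : (fun w => _) = fun w => \sum_(i <- iota 0 N) F i w); [exact: measurable_sum|exact/funext].
have -> : (fun w => c (j w)) = (fun w => \sum_(i <- iota 0 N) cut0 (j @^-1` [set i]) (cst (c i)) w).
  apply/funext => w; rewrite (bigD1_seq (j w)) ?iota_uniq ?mem_iota ?add0n ?jN//= big1 ?addr0.
    by rewrite /cut0 mem_set.
  by move=> i /eqP ij; rewrite /cut0 memNset//= => /esym.
rewrite phi_sum; last by move=> i; exact: inL1_cut0_cst.
under eq_bigr do rewrite phid//.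
under [RHS]eq_Rintegral do rewrite deltaE.
elim: (iota 0 N) => [|i s ih].
  by rewrite big_nil; under eq_Rintegral do rewrite big_nil; rewrite Rintegral_cst// mul0r.
rewrite big_cons ih; under [RHS]eq_Rintegral do rewrite big_cons.
rewrite RintegralD//.
  congr (_ + _); rewrite /Rintegral integral_mkcond; congr fine; apply: eq_integral => w _.
  by rewrite patchE /F /=; case: ifP.
rewrite (_ : EFin \o _ = fun w => (\sum_(i <- s) (EFin \o F i) w)%E).
  by apply: integrable_sum => //.
by apply/funext => w /=; rewrite sumEFin.
Qed.

(** Pointwise weak convergence with a uniform bound implies weak convergence in [L_1]. After
    replacing [v k] by a [c]-valued [h k] at distance [4^-k], [phi (h k)] is the integral of
    [x' (h k w)], where at almost every [w] one and the same [x'] serves all [k]; dominated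
    convergence applies. *)
Lemma weakly_null_functional (c : nat -> X) (v : nat -> T -> X) (M : R) :
  c 0%N = 0 -> (forall k, smeas (v k)) -> (forall k w, `|v k w| <= M) ->
  (forall k w, adherent c (v k w)) ->
  (forall w (x' : X -> R), dual x' -> x' (v k w) @[k --> \oo] --> (0 : R)) ->
  phi (v k) @[k --> \oo] --> (0 : R).
Proof.
move=> c0 mv vM vc vw.
have lv k : inL1 mu (v k) by apply: (inL1_bounded (M := M) (mv k) _).1; exact: nearW.
have [delta [md dc phid dae]] := functional_density c.
have /choice[j hj] : forall k : nat, exists j : T -> nat, [/\ finitely_valued j,
    exists N, forall w, (j w < N)%N, inL1 mu (fun w => c (j w)),
    forall w, `|v k w - c (j w)| <= `|v k w| &
    norm1 mu (fun w => v k w - c (j w)) <= (4^-1) ^+ k].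
  move=> k; have [i [fi iN ic ile]] := smeas_index_approx (mv k) c0 (vc k).
  have fci n : finitely_valued (c \o i n) by exact: finitely_valued_comp.
  have lci n : inL1 mu (c \o i n) by exact: finitely_valued_inL1.
  have lim0 : (\int[mu]_w (`|(v k \- (c \o i n)) w|)%:E)%E @[n --> \oo] --> (\int[mu]_w (cst 0 w))%E.
    apply: (@dominated_cvg _ _ _ mu setT measurableT _ _ (fun w => (`|v k w|)%:E)) => //.
    - by move=> n; apply: smeas_normE; case: (inL1B (lv k) (lci n)).
    - move=> w _; apply: (@cvg_trans _ (EFin @ (`|(v k \- (c \o i n)) w| @[n --> \oo]))) => //.
      apply: cvg_EFin; first exact: nearW.
      rewrite -(normr0 X) -(subrr (v k w)); apply: cvg_norm => /=.
      by apply: cvgB => //; exact: cvg_cst.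
    - apply/integrableP; split; first exact: smeas_normE (lv k).1.
      by under eq_integral do rewrite abse_EFin normr_id; exact: (lv k).2.
    - by move=> n w _; rewrite abse_EFin normr_id lee_fin; exact: ile.
  rewrite integral_cst// mul0e in lim0.
  have lim1 : norm1 mu (v k \- (c \o i n)) @[n --> \oo] --> (0 : R) by exact: (fine_cvg lim0).
  have p0 : 0 < (4^-1 : R) ^+ k by rewrite exprn_gt0.
  have [n _ /(_ n (leqnn n)) hn] := cvgr_lt _ lim1 _ p0.
  exists (i n); split; [exact: fi| |exact: lci|exact: ile|exact: ltW].
  by exists n.+1 => w; rewrite ltnS.
pose h k w := c (j k w).
have lh k : inL1 mu (h k) by case: (hj k).
pose e k w := delta (j k w) w.
have me k : measurable_fun setT (e k) /\ phi (h k) = \int[mu]_w e k w.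
  have [fj [N jN] _ _ _] := hj k; exact: phi_finitely_valued jN.
have vh0 : \forall w \ae mu, (v k w - h k w) @[k --> \oo] --> (0 : X).
  apply: (@fast_ae_cvg _ _ _ _ mu (fun k => v k \- h k) (cst 0)).
  - by move=> k; exact: inL1B.
  - exact: inL1_cst.
  - move=> k; rewrite (_ : _ \- cst 0 = v k \- h k); first by case: (hj k).
    by apply/funext => w /=; rewrite subr0.
have e0 : \forall w \ae mu, e k w @[k --> \oo] --> (0 : R).
  apply: filterS2 vh0 dae => w vw0 [x' [dx xle xc]].
  rewrite (_ : (fun k => e k w) = fun k => x' (v k w) - x' (v k w - h k w)); last first.
    by apply/funext => k; rewrite dualB// subKr /h xc.
  rewrite -[X in _ --> X](subr0 0); apply: cvgB; first exact: vw.
  apply/norm_cvg0P; apply: (@squeeze_cvgr _ _ _ _ (cst 0) (fun k => `|v k w - h k w|)).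
  - by apply: nearW => k; rewrite normr_ge0 xle.
  - exact: cvg_cst.
  - by rewrite -(@normr0 _ X); exact: cvg_norm.
(* The error of the index approximation is at most [|v k w|], so [|h k w| <= 2 M]. *)
have eM k w : `|e k w| <= 2 * M.
  rewrite /e (le_trans (dc _ _))//; have [_ _ _ hle _] := hj k.
  have := ler_distD (v k w) 0 (c (j k w)); have := hle w; have := vM k w.
  rewrite sub0r sub0r !normrN; lra.
have ie : \int[mu]_w e k w @[k --> \oo] --> (0 : R).
  have [||||| _ _] := @dominated_convergence _ _ _ mu setT measurableT (fun k w => (e k w)%:E)
    (cst 0%E) (cst (2 * M)%:E).
  - by move=> k; apply/measurable_EFinP; case: (me k).
  - exact: measurable_cst.
  - by apply: filterS e0 => w ew _; apply: cvg_EFin => //; exact: nearW.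
  - by apply: (integrable_bounded_real muoo (C := `|2 * M|)).
  - by apply: nearW => w k _; rewrite /= lee_fin.
  by rewrite integral_cst// mul0e => h0; exact: (fine_cvg h0).
rewrite (_ : (fun k => phi (v k)) = fun k => \int[mu]_w e k w + phi (v k \- h k)); last first.
  apply/funext => k; rewrite -(me k).2 -phiD//; last exact: inL1B.
  by congr phi; apply/funext => w /=; rewrite addrC subrK.
rewrite -[X in _ --> X](addr0 0); apply: cvgD => //.
apply/norm_cvg0P; apply: (@squeeze_cvgr _ _ _ _ (cst 0) (fun k => (4^-1 : R) ^+ k)).
- apply: nearW => k; rewrite normr_ge0/= (le_trans (phi_abs (inL1B (lv k) (lh k))))//.
  by case: (hj k).
- exact: cvg_cst.
- by apply: cvg_expr; rewrite ger0_norm// invf_lt1 ?ltr1n.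
Qed.

End functionals.

(** * Weak compactness in L_1 *)

Section smulian.
Context {R : realType} {X : completeNormedModType R} {d : measure_display}
  {T : measurableType d} (mu : {finite_measure set T -> \bar R}).
Implicit Types (g h : T -> X) (K M : R).

Section quadratic_form.
Variable (y : nat -> X -> R).
Hypotheses (dy : forall j, dual (y j)) (yle : forall j x, `|y j x| <= `|x|).

Definition bounded_smeas K g := smeas g /\ forall w, `|g w| <= K.

Definition qterm g j : R := (2^-1) ^+ j * \int[mu]_w (y j (g w)) ^+ 2.

(** The square of a Hilbertian seminorm built from countably many functionals. Its parallelogram law
    makes near-minimizers over decreasing convex sets a Cauchy sequence, which replaces the
    extraction of weakly convergent subsequences. *)
Definition qform g : R := limn (series (qterm g)).

Lemma bounded_smeas_sqr K g j : bounded_smeas K g ->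
  measurable_fun setT (fun w => (y j (g w)) ^+ 2) /\ forall w, `|(y j (g w)) ^+ 2| <= K ^+ 2.
Proof.
move=> [mg gK]; split.
  by apply: (@measurable_funX _ _ _ _ (y j \o g)); exact: smeas_dual.
move=> w; rewrite normrX; apply: lerXn2r; rewrite ?nnegrE//.
  by rewrite (le_trans (normr_ge0 _) (gK w)).
exact: le_trans (yle _ _) (gK w).
Qed.

Lemma integrable_sqr K g j : bounded_smeas K g ->
  mu.-integrable setT (EFin \o (fun w => (y j (g w)) ^+ 2)).
Proof.
move=> /(bounded_smeas_sqr j)[mg gK].
by apply: (integrable_bounded_real _ (C := K ^+ 2)) => //; rewrite ltey_eq fin_num_measure.
Qed.

Lemma qterm_ge0 g j : 0 <= qterm g j.
Proof.
by rewrite mulr_ge0 ?exprn_ge0//; apply: Rintegral_ge0 => w _; exact: sqr_ge0.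
Qed.

Lemma qterm_le K g j : bounded_smeas K g -> qterm g j <= K ^+ 2 * mass mu * (2^-1) ^+ j.
Proof.
move=> bg; rewrite /qterm mulrC ler_wpM2r ?exprn_ge0//.
rewrite /mass -Rintegral_cst//; apply: le_Rintegral => //.
- exact: integrable_sqr bg.
- by apply: (integrable_bounded_real _ (C := `|K ^+ 2|)) => //; rewrite ltey_eq fin_num_measure.
- move=> w _; apply: le_trans (ler_norm _) _.
  exact: (bounded_smeas_sqr j bg).2.
Qed.

Lemma qform_cvg K g : bounded_smeas K g ->
  series (qterm g) @ \oo --> qform g /\ qform g <= 2 * (K ^+ 2 * mass mu).
Proof.
move=> bg.
have sle n : series (qterm g) n <= 2 * (K ^+ 2 * mass mu).
  apply: (@le_trans _ _ (\sum_(0 <= j < n) K ^+ 2 * mass mu * (2^-1) ^+ j)).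
    by apply: ler_sum => j _; exact: qterm_le.
  rewrite -mulr_sumr mulrC ler_wpM2r//; first by rewrite mulr_ge0 ?sqr_ge0 ?mass_ge0.
  exact: geometric_half_sum.
have c : cvgn (series (qterm g)).
  apply: nondecreasing_is_cvgn.
    by apply: nondecreasing_series => j _ _; exact: qterm_ge0.
  by exists (2 * (K ^+ 2 * mass mu)) => _ [n _ <-].
by split => //; apply: limr_le => //; exact: nearW.
Qed.

Lemma qterm_le_qform K g j : bounded_smeas K g -> qterm g j <= qform g.
Proof.
move=> bg; have [c _] := qform_cvg bg.
apply: (@le_trans _ _ (series (qterm g) j.+1)).
  rewrite /series /= big_nat_recr//= lerDr.
  by apply: sumr_ge0 => i _; exact: qterm_ge0.
apply: nondecreasing_cvgn_le; last exact: cvgP c.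
by apply: nondecreasing_series => i _ _; exact: qterm_ge0.
Qed.

Lemma qform_ge0 K g : bounded_smeas K g -> 0 <= qform g.
Proof. by move=> bg; exact: le_trans (qterm_ge0 g 0%N) (qterm_le_qform 0%N bg). Qed.

Lemma bounded_smeasD K g h a b : 0 <= a -> 0 <= b -> bounded_smeas K g -> bounded_smeas K h ->
  bounded_smeas ((a + b) * K) (fun w => a *: g w + b *: h w).
Proof.
move=> a0 b0 [mg gK] [mh hK]; split; first by apply: smeasD; exact: smeasZ.
move=> w; apply: le_trans (ler_normD _ _) _; rewrite !normrZ !ger0_norm// mulrDl.
by rewrite lerD// ler_wpM2l.
Qed.

Lemma qform_parallelogram K g h : bounded_smeas K g -> bounded_smeas K h ->
  qform (fun w => 2^-1 *: g w + 2^-1 *: h w) + qform (fun w => 2^-1 *: g w - 2^-1 *: h w) =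
  (qform g + qform h) / 2.
Proof.
move=> bg bh; have h0 : 0 <= (2^-1 : R) by rewrite invr_ge0.
have bh' : bounded_smeas K (fun w => - h w).
  by case: bh => mh hK; split; [exact: smeasN|move=> w; rewrite normrN].
have b1 := bounded_smeasD h0 h0 bg bh.
have b2 : bounded_smeas ((2^-1 + 2^-1) * K) (fun w => 2^-1 *: g w - 2^-1 *: h w).
  rewrite (_ : (fun w => _) = fun w => 2^-1 *: g w + 2^-1 *: (- h w)).
    exact: bounded_smeasD.
  by apply/funext => w; rewrite scalerN.
have [c1 _] := qform_cvg b1; have [c2 _] := qform_cvg b2.
have [cg _] := qform_cvg bg; have [ch _] := qform_cvg bh.
have l : (series (qterm (fun w => 2^-1 *: g w + 2^-1 *: h w)) \+
    series (qterm (fun w => 2^-1 *: g w - 2^-1 *: h w))) @ \oo -->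
  qform (fun w => 2^-1 *: g w + 2^-1 *: h w) + qform (fun w => 2^-1 *: g w - 2^-1 *: h w).
  exact: (cvgD c1 c2).
have r : ((series (qterm g) \+ series (qterm h)) \* cst (2^-1)) @ \oo -->
    (qform g + qform h) * 2^-1.
  exact: (cvgM (cvgD cg ch) (cvg_cst (2^-1 : R))).
have E : (series (qterm g) \+ series (qterm h)) \* cst (2^-1) =
    series (qterm (fun w => 2^-1 *: g w + 2^-1 *: h w)) \+
    series (qterm (fun w => 2^-1 *: g w - 2^-1 *: h w)).
  apply/funext => n /=; apply/esym.
  rewrite /series /= -!big_split /= mulr_suml; apply: eq_bigr => j _.
  rewrite /qterm -!mulrDr -mulrA; congr (_ * _).
  have ig := integrable_sqr j bg; have ih := integrable_sqr j bh.
  have i1 := integrable_sqr j b1; have i2 := integrable_sqr j b2.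
  rewrite -(RintegralD measurableT ig ih) -(RintegralD measurableT i1 i2).
  rewrite -RintegralZr//; last first.
    rewrite (_ : EFin \o _ = (EFin \o (fun w => (y j (g w) ^+ 2)%R)) \+ (EFin \o (fun w => (y j (h w) ^+ 2)%R)))%E.
      exact: integrableD.
    by apply/funext.
  by apply: eq_Rintegral => w _; rewrite (dualB _ _ (dy j)) (dualD _ _ (dy j)) !(dualZ _ _ (dy j));
  move: (y j (g w)) (y j (h w)) => u v; field.
rewrite E in r.
exact: (cvg_unique (@Rhausdorff R) l r).
Qed.

End quadratic_form.

(** The infima of [qform] over the [C n] increase to a finite limit. If [g m] and [g n] are
    near-minimizers with [n <= m], their midpoint is in [C n], so the parallelogram law makes half
    their difference small. *)
Lemma smulian_weak (C : nat -> set (T -> X)) M (y : nat -> X -> R) :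
  (forall j, dual (y j)) -> (forall j x, `|y j x| <= `|x|) ->
  (forall n, C n !=set0) -> (forall n, C n.+1 `<=` C n) ->
  (forall n g, C n g -> bounded_smeas M g) ->
  (forall n g h, C n g -> C n h -> C n (fun w => 2^-1 *: g w + 2^-1 *: h w)) ->
  exists s : nat -> T -> X, (forall k, C k (s k)) /\
    \forall w \ae mu, forall j, cvg (y j (s k w) @[k --> \oo]).
Proof.
move=> dy yle C0 CS Cb Cmid.
have Cle m n : (n <= m)%N -> C m `<=` C n.
  move=> /subnK <-; elim: (m - n)%N => [//|k ih]; rewrite addSn.
  exact: subset_trans (CS _) ih.
have [g0 Cg0] := C0 0%N.
pose Q := qform y.
pose Inf n := inf [set Q g | g in C n].
have lb n : has_lbound [set Q g | g in C n].
  by exists 0 => _ [g /Cb bg <-]; exact: qform_ge0 bg.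
have ne n : [set Q g | g in C n] !=set0 by have [g Cg] := C0 n; exists (Q g); exists g.
have InfQ n g : C n g -> Inf n <= Q g.
  by move=> Cg; apply: ge_inf; [exact: lb|exists g].
have Infmono n m : (n <= m)%N -> Inf n <= Inf m.
  by move=> nm; apply: lb_le_inf => // _ [g /(Cle _ _ nm) Cg <-]; exact: InfQ.
have Infcvg : cvgn Inf.
  apply: nondecreasing_is_cvgn; first by move=> n m; exact: Infmono.
  exists (2 * (M ^+ 2 * mass mu)) => _ [n _ <-].
  have [g Cg] := C0 n; apply: le_trans (InfQ _ _ Cg) _.
  exact: (qform_cvg dy yle (Cb _ _ Cg)).2.
have /choice[g hg] : forall n : nat, exists g, C n g /\ Q g < Inf n + (2^-1) ^+ n.
  move=> n; have p0 : 0 < (2^-1 : R) ^+ n by rewrite exprn_gt0.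
  have hi : has_inf [set Q g | g in C n] by split.
  by have [_ [g Cg <-] hlt] := inf_adherent p0 hi; exists g.
have small (del : R) : 0 < del -> exists N, forall m n, (N <= n)%N -> (n <= m)%N ->
    Q (fun w => 2^-1 *: g m w - 2^-1 *: g n w) < del.
  move=> del0; have d20 : 0 < del / 2 by rewrite divr_gt0.
  have /cvgrPdist_lt/(_ _ d20) [N1 _ hN1] := Infcvg.
  have : (2^-1 : R) ^+ k @[k --> \oo] --> (0 : R).
    by apply: cvg_expr; rewrite ger0_norm// invf_lt1 ?ltr1n.
  move=> /cvgrPdist_lt/(_ _ d20) [N2 _ hN2].
  exists (maxn N1 N2) => m n; rewrite geq_max => /andP[N1n N2n] nm.
  have := qform_parallelogram dy yle (Cb _ _ (hg m).1) (Cb _ _ (Cle _ _ (leq0n m) _ (hg m).1)).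
  move=> _.
  have Cn : C n (g m) by apply: Cle nm _ _; case: (hg m).
  have := qform_parallelogram dy yle (Cb _ _ Cn) (Cb _ _ (hg n).1).
  have := InfQ n _ (Cmid _ _ _ Cn (hg n).1).
  have := (hg n).2; have := (hg m).2.
  have := hN2 _ N2n; rewrite sub0r normrN ger0_norm ?exprn_ge0// => h1.
  have := hN2 _ (leq_trans N2n nm); rewrite sub0r normrN ger0_norm ?exprn_ge0// => h2.
  have := hN1 _ N1n; have := nondecreasing_cvgn_le (Infmono) Infcvg n.
  have := nondecreasing_cvgn_le (Infmono) Infcvg m.
  rewrite /Q /= => i1 i2; rewrite ger0_norm ?subr_ge0// => i3 i4 i5 i6 i7; lra.
(* The form controls squares of increments: an error of [16^-k] and Markov's inequality at level
   [4^-k] leave increments below [2^-k], outside sets of measure at most a constant times [2^-k]. *)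
have /choice[N hN] : forall k : nat, exists N, forall m n, (N <= n)%N -> (n <= m)%N ->
    Q (fun w => 2^-1 *: g m w - 2^-1 *: g n w) < (16^-1) ^+ k.
  by move=> k; apply: small; rewrite exprn_gt0.
(* The summand [k] places [s k] in [C k]; the sum places both [L k] and [L k.+1] beyond [N k]. *)
pose L k := (k + \sum_(i < k.+1) N i)%N.
have NL k : (N k <= L k)%N by rewrite /L big_ord_recr /= addnA leq_addl.
have LS k : (L k <= L k.+1)%N.
  rewrite /L [in leqRHS]big_ord_recr /=.
  by apply: leq_add; [exact: leqnSn|exact: leq_addr].
pose s k := g (L k).
exists s; split.
  by move=> k; apply: (Cle (L k)); [rewrite /L leq_addr|case: (hg (L k))].
have bs k : bounded_smeas M (s k) by exact: (Cb _ _ (hg (L k)).1).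
apply: ae_foralln => j.
pose D k w : R^o := (y j (s k.+1 w - s k w)) ^+ 2.
have bD k : measurable_fun setT (fun w => y j (s k.+1 w - s k w)) /\
    forall w, `|D k w| <= (2 * M) ^+ 2.
  have [[m1 b1] [m0 b0]] := (bs k.+1, bs k); split.
    apply: (@smeas_dual _ _ _ _ (y j) (s k.+1 \- s k)) => //; exact: smeasB.
  have b : bounded_smeas (2 * M) (s k.+1 \- s k).
    split; first exact: smeasB.
    by move=> w /=; rewrite (le_trans (ler_normB _ _))// mulr_natl mulr2n lerD.
  by move=> w; have [_ h] := bounded_smeas_sqr dy yle j b; exact: h.
have lD k : inL1 mu (D k).
  apply: (@inL1_bounded _ _ _ _ mu _ ((2 * M) ^+ 2) _ _).1.
    by apply: measurable_fun_smeas; apply: measurable_funX; case: (bD k).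
  by apply: nearW; case: (bD k).
have nD k : norm1 mu (D k) <= 4 * 2 ^+ j * (16^-1) ^+ k.
  have bhalf : bounded_smeas M (fun w => 2^-1 *: s k.+1 w - 2^-1 *: s k w).
    have [[m1 b1] [m0 b0]] := (bs k.+1, bs k); split.
      by apply: smeasB; exact: smeasZ.
    move=> w; apply: le_trans (ler_normB _ _) _; rewrite !normrZ ger0_norm ?invr_ge0//.
    have := b1 w; have := b0 w; lra.
  have := qterm_le_qform dy yle j bhalf; have := ltW (hN k _ _ (NL k) (LS k)).
  move=> /[swap] /le_trans /[apply].
  rewrite /qterm => h.
  have -> : norm1 mu (D k) = 4 * \int[mu]_w (y j (2^-1 *: s k.+1 w - 2^-1 *: s k w)) ^+ 2.
    rewrite -RintegralZl//; last exact: integrable_sqr bhalf.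
    congr fine; apply: eq_integral => w _; congr EFin.
    by rewrite ger0_norm ?sqr_ge0// /D !(dualB _ _ (dy j)) !(dualZ _ _ (dy j));
    move: (y j (s k.+1 w)) (y j (s k w)) => p q; field.
  rewrite -!mulrA ler_pM2l//; move: h; rewrite -ler_pdivlMl ?exprn_gt0//.
  by rewrite exprVn invrK.
have : \forall w \ae mu, exists m, forall k, (m <= k)%N -> ~ [set w | (4^-1 : R) ^+ k <= `|D k w|] w.
  apply: (@borel_cantelli _ _ _ mu (4 * 2 ^+ j)).
  - by rewrite mulr_ge0// exprn_ge0.
  - by move=> k; apply: measurable_le_set => //; apply: smeas_norm; case: (lD k).
  - move=> k; have p0 : 0 < (4^-1 : R) ^+ k by rewrite exprn_gt0.
    apply: le_trans (markov1 (lD k) p0) _; rewrite lee_fin ler_pdivrMr//.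
    apply: le_trans (nD k) _; rewrite -[leRHS]mulrA -exprMn ler_pM2l ?mulr_gt0 ?exprn_gt0//.
    by apply: lerXn2r; rewrite ?nnegrE//; lra.
apply: filterS => w [m hm]; apply: (@geometric_cvg _ R^o (fun k => y j (s k w)) m) => k mk.
have := hm k mk; rewrite /= /D => /negP; rewrite -ltNge.
rewrite normrX (_ : 4^-1 = 2^-1 ^+ 2 :> R); last by field.
rewrite exprAC ltr_pXn2r ?nnegrE ?exprn_ge0//.
by rewrite dualB.
Qed.

(** [u] is the pointwise weak limit of the sequence of [smulian_weak]. That it lies in the norm
    closure of every [C n] is Mazur's theorem: otherwise a functional on [L_1] would keep [C n] away
    from [u], against [weakly_null_functional]. *)
Lemma smulian (C : nat -> set (T -> X)) M : reflexive_space X ->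
  (forall n, C n !=set0) -> (forall n, C n.+1 `<=` C n) ->
  (forall n g, C n g -> smeas g /\ forall w, `|g w| <= M) ->
  (forall n (a : R) g h, 0 <= a <= 1 -> C n g -> C n h ->
     C n (fun w => a *: g w + (1 - a) *: h w)) ->
  exists2 u, inL1 mu u & forall n (eps : R), 0 < eps ->
    exists2 g, C n g & norm1 mu (g \- u) < eps.
Proof.
move=> Xr C0 CS Cb Cconv.
have Cle m n : (n <= m)%N -> C m `<=` C n.
  move=> /subnK <-; elim: (m - n)%N => [//|k ih]; rewrite addSn.
  exact: subset_trans (CS _) ih.
have /choice[a0 Ca0] := C0.
have /choice[e he] : forall n : nat, exists c : nat -> X, forall w, adherent c (a0 n w).
  by move=> n; have [[c [_ hc]] _] := Cb _ _ (Ca0 n); exists c.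
have [c [c0 ec lc]] := rational_span
  (fun k => if unpickle k is Some (n, m) then e n m else 0).
have a0c n w : adherent c (a0 n w).
  apply: adherent_closed => eps e0; have [m hm] := he n w _ e0.
  by exists (e n m) => //; have := ec (pickle (n, m)); rewrite pickleK.
have [y [dy yle ynorm]] := norming_sequence c.
(* Restricting to functions with values in one closed separable subspace makes the countable family
   [y] norming. The subspace is spanned by the values of the chosen elements [a0 n], so no set
   becomes empty. *)
pose C' n := C n `&` [set g | forall w, adherent c (g w)].
have [s [C's scvg]] : exists s : nat -> T -> X, (forall k, C' k (s k)) /\
    \forall w \ae mu, forall j, cvg (y j (s k w) @[k --> \oo]).
  apply: (smulian_weak (M := M)) => //.
  - by move=> n; exists (a0 n); split => //= w.
  - by move=> n g [Cg cg]; split => //; exact: CS.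
  - by move=> n g [/Cb Cg _].
  - move=> n g h [Cg cg] [Ch ch]; split.
      rewrite (_ : (fun w => _) = fun w => 2^-1 *: g w + (1 - 2^-1) *: h w).
        by apply: Cconv => //; rewrite invr_ge0 ler0n invf_le1// ler1n.
      by apply/funext => w; congr (_ + _ *: _); field.
    by move=> w; exact: (linear_setD lc (linear_setZ _ lc (cg w)) (linear_setZ _ lc (ch w))).
have [N [mN N0 hN]] := scvg.
(* Setting the functions to 0 on the null set makes all the sequences [y j (S k w)] converge at
   every point. *)
pose S k := cut0 (~` N) (s k).
have mS k : smeas (S k).
  by apply: smeas_cut0; [exact: measurableC|have [/Cb[]] := C's k].
have cS k w : adherent c (S k w).
  by rewrite /S /cut0; case: ifP => _; [case: (C's k) => _; exact|exact: lc.1].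
have M0 (w : T) : 0 <= M by have [_ /(_ w)] := Cb _ _ (Ca0 0%N); exact: le_trans.
have SM k w : `|S k w| <= M.
  rewrite /S /cut0; case: ifP => _; last by rewrite normr0 (M0 w).
  by have [/Cb[_ h] _] := C's k; exact: h.
clear M0.
have sep x : adherent c x -> (forall j, y j x = 0) -> x = 0.
  move=> cx yx; apply/eqP; rewrite -normr_eq0 eq_le normr_ge0 andbT.
  apply/ler_addgt0Pr => eps e0; have [j] := ynorm x cx _ e0.
  rewrite yx; lra.
have /choice[u hu] : forall w, exists u, adherent c u /\
    forall x' : X -> R, dual x' -> x' (S k w) @[k --> \oo] --> x' u.
  move=> w; have [|u cu hu] := @weak_limit _ _ c y (S^~ w) M Xr lc dy sep (cS^~ w) (SM^~ w).
    move=> j; have [Nw|nNw] := pselect (N w).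
      rewrite (_ : (fun k => _) = cst (y j 0)); first exact: is_cvg_cst.
      by apply/funext => k; rewrite /S /cut0 memNset//= => /(_ Nw).
    rewrite (_ : (fun k => _) = fun k => y j (s k w)).
      by apply: contrapT => h; apply: nNw; apply: hN => /= /(_ j).
    by apply/funext => k; rewrite /S /cut0 mem_set.
  by exists u.
have yu j w : y j (S k w) @[k --> \oo] --> y j (u w) by exact: (hu w).2.
(* The norm of [u w - c n] is a supremum over the [y j], and each [y j (u w)] is a limit of
   measurable functions. *)
have mu_ : smeas u.
  exists c; split => [n|w]; last exact: (hu w).1.
  apply: measurable_fun_gt_sets => r.
  rewrite (_ : [set _ | _] = \bigcup_j [set w | r < y j (u w) - y j (c n)]).
    apply: bigcup_measurable => j _; apply: measurable_lt_set => //.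
    apply: measurable_funB => //.
    apply: (@measurable_fun_cvg _ _ _ _ (fun k w => y j (S k w))).
      by move=> k; exact: (smeas_dual (dy j) (mS k)).
    by move=> w _; exact: yu.
  apply/seteqP; split => [w /= hr|w [j _ /=]].
    have e0 : 0 < `|u w - c n| - r by rewrite subr_gt0.
    have [j hj] := ynorm _ (linear_setB lc (hu w).1 (adherent_mem c n)) _ e0.
    by exists j => //=; move: hj; rewrite (dualB _ _ (dy j)); lra.
  rewrite -(dualB _ _ (dy j)) => /lt_le_trans; apply.
  exact: le_trans (ler_norm _) (yle _ _).
have uM w : `|u w| <= M.
  apply/ler_addgt0Pr => eps e0; have [j hj] := ynorm _ (hu w).1 _ e0.
  have : y j (u w) <= M.
    rewrite -(cvg_lim (@Rhausdorff R) (yu j w)).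
    apply: limr_le; first exact: cvgP (yu j w).
    by apply: nearW => k; exact: le_trans (ler_norm _) (le_trans (yle _ _) (SM _ _)).
  lra.
have lu : inL1 mu u by apply: (inL1_bounded (M := M) mu_ _).1; exact: nearW.
exists u => // n eps e0; apply: contrapT => hno.
have far g : C n g -> eps <= norm1 mu (g \- u).
  by move=> Cg; rewrite leNgt; apply/negP => h; apply: hno; exists g.
have lC g : C n g -> inL1 mu g.
  by move=> /Cb[mg gM]; apply: (inL1_bounded (M := M) mg _).1; exact: nearW.
(* The cone spanned by [C n - u], with level [eps] at the points of [C n - u]; convexity of [C n]
   makes it stable under sums. *)
pose G : set ((T -> X) * R) := [set vr | exists2 g, C n g &
  exists2 l, 0 <= l & vr = (l *: (g - u), l * eps)].
have [|v r w t|a v r apos|v r|phi [lphi phile phiG]] :=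
    @hahn_banach_cone R (T -> X) (inL1 mu) (norm1 mu) G (inL1_linear_set mu)
      (norm1_sublinear mu) (fun f _ => norm1N mu f).
- by exists (a0 n); [exact: Ca0|exists 0; rewrite // scale0r mul0r].
- move=> [g Cg [l l0 [-> ->]]] [h Ch [m m0 [-> ->]]].
  have [lm0|lm0] := eqVneq (l + m) 0.
    have [l00 m00] : l = 0 /\ m = 0 by split; lra.
    by exists g => //; exists 0 => //; rewrite l00 m00 !scale0r !mul0r !addr0.
  have lmgt : 0 < l + m by rewrite lt_neqAle eq_sym lm0 addr_ge0.
  exists (fun w => (l / (l + m)) *: g w + (1 - l / (l + m)) *: h w).
    apply: Cconv => //; rewrite (divr_ge0 l0 (ltW lmgt))/=.
    by rewrite ler_pdivrMr// mul1r lerDl.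
  exists (l + m); first exact: ltW.
  congr pair; last by rewrite mulrDl.
  apply/funext => z; rewrite /GRing.add /GRing.opp /GRing.scale /=.
  rewrite !scalerDr !scalerA !scalerN.
  have e1 : (l + m) * (l / (l + m)) = l by rewrite mulrC divfK.
  have -> : (l + m) * (1 - l / (l + m)) = m by rewrite mulrBr mulr1 e1; lra.
  rewrite e1.
  by rewrite scalerDl opprD addrACA.
- move=> [g Cg [l l0 [-> ->]]]; exists g => //; exists (a * l).
    by rewrite mulr_ge0// ltW.
  by rewrite scalerA mulrA.
- move=> [g Cg [l l0 [-> ->]]]; split.
    by apply: linear_setZ (inL1_linear_set mu) _; exact: inL1B (lC _ Cg) lu.
  rewrite [norm1 _ _](_ : _ = norm1 mu (fun w => l *: (g \- u) w))//.
  rewrite norm1Z; last by case: (inL1B (lC _ Cg) lu).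
  by rewrite ger0_norm// ler_wpM2l//; exact: far.
have ls k : inL1 mu (s k).
  have [/Cb[ms sM] _] := C's k.
  by apply: (inL1_bounded (M := M) ms _).1; exact: nearW.
have lS k : inL1 mu (S k).
  by apply: (inL1_bounded (M := M) (mS k) _).1; exact: nearW.
have phiv : phi (S k \- u) @[k --> \oo] --> (0 : R).
  apply: (weakly_null_functional lphi phile (c := c) (M := 2 * M)) => //.
  - by move=> k; apply: smeasB.
  - move=> k w /=; apply: le_trans (ler_normB _ _) _.
    by rewrite mulr_natl mulr2n lerD.
  - by move=> k w; exact: linear_setB lc (cS k w) (hu w).1.
  - move=> w x' dx; rewrite (_ : (fun k => _) = fun k => x' (S k w) - x' (u w)).
      rewrite -[X in _ --> X](subrr (x' (u w))).
      by apply: cvgB; [exact: (hu w).2|exact: cvg_cst].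
    by apply/funext => k; rewrite /= dualB.
have : \forall k \near \oo, phi (S k \- u) < eps by exact: (cvgr_lt _ phiv _ e0).
move=> [k0 _ hk0]; pose k := maxn k0 n.
have := hk0 k (leq_maxl _ _); apply/negP; rewrite -leNgt.
have Csk : C n (s k) by apply: (Cle k); [exact: leq_maxr|case: (C's k)].
have -> : phi (S k \- u) = phi (s k \- u) + phi (S k \- s k).
  rewrite -(phiD lphi (inL1B (ls k) lu) (inL1B (lS k) (ls k))); congr phi; apply/funext => w /=.
  by rewrite [RHS]addrC subrKA.
have d0 : norm1 mu (S k \- s k) = 0.
  rewrite (norm1_ae (g := cst 0)); first by rewrite /norm1; under eq_integral do rewrite normr0; rewrite integral0.
  exists N; split => // w /= h; apply: contrapT => nNw; apply: h.
  by rewrite /S /cut0 mem_set// subrr.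
have := phi_abs lphi phile (inL1B (lS k) (ls k)); rewrite d0 normr_le0 => /eqP ->.
rewrite addr0; apply: phiG; exists (s k) => //; exists 1 => //.
by rewrite scale1r mul1r.
Qed.

End smulian.

Opaque bochner_integral.

(** * Conditional expectations *)

Section bochner_more.
Context {R : realType} {X : completeNormedModType R} {d : measure_display}
  {T : measurableType d} (mu : {finite_measure set T -> \bar R}).
Implicit Types (f g : T -> X) (A : set T).

Lemma finite_measure_lty A : measurable A -> (mu A < +oo)%E.
Proof. by move=> mA; rewrite ltey_eq fin_num_measure. Qed.

Lemma inL1_norm_integrable A f : measurable A -> inL1 mu f -> norm_integrable mu A f.
Proof. by move=> mA lf; apply: (norm_integrableS measurableT mA _ lf). Qed.

Lemma bochner_integral0 f : inL1 mu f -> bochner_integral mu set0 f = 0.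
Proof.
move=> lf; apply: dual_separates => x' dx.
rewrite bochner_integral_dual//; [|by rewrite measure0|exact: inL1_norm_integrable].
by rewrite Rintegral_set0 dual0.
Qed.

Lemma bochner_integral_dist A f x : measurable A -> inL1 mu f ->
  `|bochner_integral mu A f - fine (mu A) *: x| <= fine (\int[mu]_(w in A) (`|f w - x|)%:E).
Proof.
move=> mA lf.
have := bochner_integral_setD x mA (finite_measure_lty mA) measurable0 (@sub0set _ A)
  (inL1_norm_integrable mA lf).
by rewrite bochner_integral0// subr0 setD0.
Qed.

Lemma le_bochner_integral A f : measurable A -> inL1 mu f ->
  `|bochner_integral mu A f| <= fine (\int[mu]_(w in A) (`|f w|)%:E).
Proof.
move=> mA lf; have := bochner_integral_dist 0 mA lf.
by rewrite scaler0 subr0; under eq_integral do rewrite subr0.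
Qed.

Lemma le_norm1_cut A f : measurable A -> inL1 mu f ->
  fine (\int[mu]_(w in A) (`|f w|)%:E) <= norm1 mu f.
Proof.
move=> mA lf; have [_ fA] := inL1_norm_integrable mA lf.
apply: fine_le; rewrite ?ge0_fin_numE ?integral_ge0//; first by case: lf.
by apply: ge0_subset_integral => //; apply: smeas_normE; case: lf.
Qed.

Lemma bochner_integral_linear A (a : R) f g : measurable A -> inL1 mu f -> inL1 mu g ->
  bochner_integral mu A (fun w => a *: f w + g w) =
  a *: bochner_integral mu A f + bochner_integral mu A g.
Proof.
move=> mA lf lg; have Aoo := finite_measure_lty mA.
have [ia ig] := (inL1_norm_integrable mA lf, inL1_norm_integrable mA lg).
have il : norm_integrable mu A (fun w => a *: f w + g w).
  exact: inL1_norm_integrable mA (inL1D (inL1Z a lf) lg).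
apply: dual_separates => x' dx; rewrite (dualD _ _ dx) (dualZ _ _ dx).
have ef := bochner_integral_dual mA Aoo ia dx; have eg := bochner_integral_dual mA Aoo ig dx.
apply: etrans (bochner_integral_dual mA Aoo il dx) _.
apply: etrans _ (esym (congr2 (fun u v => a * u + v) ef eg)).
have jf := integrable_dual mA dx ia; have jg := integrable_dual mA dx ig.
rewrite -RintegralZl// -RintegralD//.
  by apply: eq_Rintegral => w _; rewrite (dualD _ _ dx) (dualZ _ _ dx).
rewrite (_ : EFin \o _ = fun w => (a%:E * (EFin \o (x' \o f)) w)%E); first exact: integrableZl.
by apply/funext => w /=; rewrite EFinM.
Qed.

Lemma bochner_integral_cvg A (u : nat -> T -> X) f : measurable A -> (forall n, inL1 mu (u n)) ->
  inL1 mu f -> norm1 mu (u n \- f) @[n --> \oo] --> (0 : R) ->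
  bochner_integral mu A (u n) @[n --> \oo] --> bochner_integral mu A f.
Proof.
move=> mA lu lf uf; apply/cvgrPdist_lt => eps e0.
apply: filterS (cvgr_lt _ uf _ e0) => n; apply: le_lt_trans.
have := bochner_integral_linear (-1) mA (lu n) lf; rewrite scaleN1r addrC => <-.
apply: le_trans (le_bochner_integral mA _) _.
  exact: (inL1D (inL1Z _ (lu n)) lf).
rewrite norm1_sym; apply: le_trans (le_norm1_cut mA _) _.
  exact: (inL1D (inL1Z _ (lu n)) lf).
by rewrite (_ : (fun w => _) = f \- u n)//; apply/funext => w; rewrite scaleN1r addrC.
Qed.

(** A single simple function at finite distance, itself integrable as [mu] is finite, bounds the
    norm. *)
Lemma is_bochner_integral_inL1 f f' x : smeas f' -> (\forall w \ae mu, f w = f' w) ->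
  is_bochner_integral mu setT f x -> inL1 mu f'.
Proof.
move=> mf' ff' /(is_bochner_integral_ae measurableT ff')[_ [h [sh _ hf _]]].
have fh n : finitely_valued (h n) by have [] := sh n.
split=> //; have /fine_cvgP[[n _ /(_ n (leqnn n)) hn] _] := hf.
have lh := finitely_valued_inL1 mu (fh n).
rewrite (_ : (fun w => _) = fun w => (`|(f' w - h n w) + h n w|)%:E); last first.
  by apply/funext => w; rewrite subrK.
apply: le_lt_trans (integral_normD mu _ _) _; [|exact: finitely_valued_smeas|].
  by apply: smeasB => //; exact: finitely_valued_smeas.
by rewrite lte_add_pinfty//; [rewrite -ge0_fin_numE ?integral_ge0|case: lh].
Qed.

End bochner_more.

Section conditional_expectation.
Context {R : realType} {X : completeNormedModType R} {d : measure_display}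
  {T : measurableType d} (mu : {finite_measure set T -> \bar R}).
Variable F : set (set T).
Hypotheses (sF : sigma_algebra setT F) (Fm : F `<=` measurable).
Implicit Types (f g : T -> X) (A : set T).

Let gF := g_sigma_algebraType F.

Lemma sub_algebra_measurable A : @measurable _ gF A -> F A.
Proof. by rewrite /measurable /= sigma_algebra_id. Qed.

Definition restricted_measure : set gF -> \bar R := mu.

Let restricted_ge0 A : (0 <= restricted_measure A)%E.
Proof. exact: measure_ge0. Qed.

Let restricted_sigma_additive : semi_sigma_additive restricted_measure.
Proof.
move=> B mB tB mUB; apply: (@measure_semi_sigma_additive _ _ _ mu) => //.
  by move=> i; exact/Fm/sub_algebra_measurable.
exact/Fm/sub_algebra_measurable.
Qed.

HB.instance Definition _ := isMeasure.Build _ gF R restricted_measure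
  (measure0 mu) restricted_ge0 restricted_sigma_additive.

Lemma conditional_probability B : measurable B -> exists phi : T -> R,
  [/\ @measurable_fun _ _ gF _ setT phi, forall w, `|phi w| <= 1 &
   forall A, F A -> \int[mu]_(w in A) phi w = fine (mu (A `&` B))].
Proof.
move=> mB.
have mA' A : @measurable _ gF A -> measurable A by move=> /sub_algebra_measurable/Fm.
have [||A B' mA mB' AB'|A mA|phi [mphi phi1 phiE]] :=
    @bounded_density R _ gF restricted_measure _ (fun A => fine (mu (A `&` B))) 1.
- by rewrite ltey_eq; apply/orP; left; exact: fin_num_measure.
- exact: ler01.
- have m1 : d.-measurable (A `&` B) by exact: (measurableI _ _ (mA' _ mA) mB).
  have m2 : d.-measurable (B' `&` B) by exact: (measurableI _ _ (mA' _ mB') mB).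
  by rewrite setIUl measureU// ?fineD ?fin_num_measure// setIACA AB' set0I.
- have m1 : d.-measurable (A `&` B) by exact: (measurableI _ _ (mA' _ mA) mB).
  rewrite mul1r ger0_norm ?fine_ge0//; apply: fine_le.
  + exact: fin_num_measure.
  + exact: fin_num_measure (mA' _ mA).
  + by apply: le_measure; rewrite ?inE; [|exact: mA'|exact: subIsetl].
exists phi; split => // A FA.
have mA : @measurable _ gF A by exact: sub_sigma_algebra.
rewrite (phiE A mA) /Rintegral; congr fine; apply/esym.
apply: (integral_pushforward (measurable_id_sub sF Fm) _ _ mA).
  exact/measurable_EFinP.
apply: (integrable_bounded_real (finite_measure_lty mu measurableT) (C := 1)) => //.
  exact: Fm.
exact: (measurableT_comp mphi (measurable_id_sub sF Fm)).
Qed.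

(** The relation [g = E(f|F)] between representatives. Here [g] is [F]-measurable at every point and
    not only up to a null set; [cond_expE] makes the link with [cond_exp]. *)
Definition condexp f g :=
  [/\ inL1 mu f, inL1 mu g, @smeas _ _ _ gF g &
   forall A, F A -> bochner_integral mu A g = bochner_integral mu A f].

(* On the F-measurable pieces where [g] is within [eps] of a constant, the norm of
   [g] and that of its integral differ by little. *)
Lemma condexp_le f g A : condexp f g -> F A ->
  (\int[mu]_(w in A) (`|g w|)%:E <= \int[mu]_(w in A) (`|f w|)%:E)%E.
Proof.
move=> [lf lg [c [mc gc]] fg] FA; have mA := Fm FA.
have mE (u : T -> X) : inL1 mu u -> measurable_fun setT (fun w => (`|u w|)%:E).
  by move=> [mu_ _]; exact: smeas_normE.
(* Two comparisons cost [eps * mu B] each on a piece [B]: that of [|g|] with [|c n|], and that of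
   [|c n| * mu B] with the norm of the integral of [g]. *)
suff main (eps : R) : 0 < eps -> (\int[mu]_(w in A) (`|g w|)%:E <=
    \int[mu]_(w in A) (`|f w|)%:E + (2 * eps * fine (mu A))%:E)%E.
  have fin (u : T -> X) : inL1 mu u -> (\int[mu]_(w in A) (`|u w|)%:E)%E \is a fin_num.
    by move=> lu; apply: norm_integrable_fin; exact: inL1_norm_integrable.
  rewrite -(fineK (fin _ lf)) -(fineK (fin _ lg)) lee_fin.
  apply/ler_addgt0Pr => eps e0.
  have m1 : 0 < 2 * (fine (mu A) + 1) by rewrite mulr_gt0// ltr_wpDl// fine_ge0.
  have := main _ (divr_gt0 e0 m1).
  rewrite -(fineK (fin _ lf)) -(fineK (fin _ lg)) -EFinD lee_fin => /le_trans; apply.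
  rewrite lerD2l.
  have m0 : 0 <= fine (mu A) by apply: fine_ge0.
  have -> : 2 * (eps / (2 * (fine (mu A) + 1))) * fine (mu A) = eps * (fine (mu A) / (fine (mu A) + 1)).
    by field; rewrite gt_eqF// ltr_wpDl.
  by rewrite ler_piMr ?(ltW e0)// ler_pdivrMr ?ltr_wpDl// mul1r lerDl.
move=> e0.
(* [P n] is where [c n] is the first term within [eps] of [g]; these sets form a partition by
   elements of [F]. *)
pose P n := [set w | `|g w - c n| < eps] `&`
  \bigcap_(m in [set m | (m < n)%N]) [set w | eps <= `|g w - c m|].
have FP n : F (P n).
  apply: sub_algebra_measurable; apply: measurableI.
    by apply: measurable_lt_set => //; exact: mc.
  apply: bigcap_measurableType => m _.
  by apply: measurable_le_set => //; exact: mc.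
have FAP n : F (A `&` P n).
  apply: sub_algebra_measurable; apply: measurableI; last exact: sub_sigma_algebra (FP n).
  exact: sub_sigma_algebra.
have mAP n : measurable (A `&` P n) by exact: Fm.
have UP : A = \bigcup_n (A `&` P n).
  rewrite -setI_bigcupr; apply/esym/setIidPl => w _.
  have [n hn] := gc w _ e0.
  have ex : exists n, `|g w - c n| < eps by exists n.
  exists (ex_minn ex) => //; case: ex_minnP => m hm hmin; split => // k /= km.
  by rewrite leNgt; apply/negP => /hmin; rewrite leqNgt km.
have tP : trivIset setT (fun n => A `&` P n).
  apply/trivIsetP => i j _ _ ij; apply/seteqP; split => // w [[_ [Pi Pi']] [_ [Pj Pj']]].
  have := ij; rewrite neq_ltn => /orP[ij'|ij'].
    by have := Pj' _ ij'; rewrite /= leNgt Pi.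
  by have := Pi' _ ij'; rewrite /= leNgt Pj.
have lfe : measurable_fun setT (fun w => ((`|f w|)%:E + (2 * eps)%:E)%E).
  by apply: emeasurable_funD => //; exact: mE.
rewrite (_ : (\int[mu]_(w in A) (`|f w|)%:E + (2 * eps * fine (mu A))%:E)%E =
    (\int[mu]_(w in A) ((`|f w|)%:E + (2 * eps)%:E))%E); last first.
  rewrite ge0_integralD//.
  - by rewrite integral_cst// EFinM fineK// fin_num_measure.
  - exact/measurable_funTS/mE.
  - by move=> w _; rewrite lee_fin mulr_ge0// ltW.
rewrite [in leLHS]UP [in leRHS]UP.
have fe0 w : (0 <= (`|f w|)%:E + (2 * eps)%:E)%E.
  by rewrite -EFinD lee_fin addr_ge0// mulr_ge0// ltW.
rewrite ge0_integral_bigcup//; last exact/measurable_funTS/mE.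
rewrite ge0_integral_bigcup//; last exact/measurable_funTS.
apply: lee_nneseries => [n _ _|n _]; first exact: integral_ge0.
set B := A `&` P n; have mB : measurable B := mAP n.
have muB0 : 0 <= fine (mu B) by apply: fine_ge0.
have gB : fine (\int[mu]_(w in B) (`|g w - c n|)%:E) <= eps * fine (mu B).
  rewrite -lee_fin fineK; last first.
    apply: norm_integrable_fin; apply: (@inL1_norm_integrable _ _ _ _ _ _ (g \- cst (c n))) => //.
    by apply: inL1B => //; exact: inL1_cst.
  rewrite EFinM fineK ?fin_num_measure// -integral_cst//.
  apply: ge0_le_integral => //.
  - apply/measurable_funTS; apply: (mE (g \- cst (c n))).
    by apply: inL1B => //; exact: inL1_cst.
  - by move=> w [_ [h _]]; rewrite lee_fin ltW.
have h1 := bochner_integral_dist (c n) mB lg.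
have h2 := le_bochner_integral mB lf; rewrite -(fg _ (FAP n)) -/B in h2.
have h3 : (\int[mu]_(w in B) (`|g w|)%:E <= ((`|c n| + eps) * fine (mu B))%:E)%E.
  rewrite EFinM fineK ?fin_num_measure// -integral_cst//.
  apply: ge0_le_integral => //; first exact/measurable_funTS/mE.
  move=> w [_ [h _]]; rewrite lee_fin -[X in `|X|](subrK (c n)).
  by rewrite (le_trans (ler_normD _ _))// addrC lerD2l ltW.
apply: le_trans h3 _; rewrite ge0_integralD//; last 2 first.
- exact/measurable_funTS/mE.
- by move=> w _; rewrite lee_fin mulr_ge0// ltW.
have -> : (\int[mu]_(w in B) (2 * eps)%:E = (2 * eps * fine (mu B))%:E)%E.
  by rewrite integral_cst// [RHS]EFinM fineK ?fin_num_measure.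
rewrite -(fineK (norm_integrable_fin (inL1_norm_integrable mB lf))) -EFinD lee_fin.
have h4 : `|fine (mu B) *: c n| <= `|bochner_integral mu B g| +
    `|bochner_integral mu B g - fine (mu B) *: c n|.
  by have := ler_distD (bochner_integral mu B g) 0 (fine (mu B) *: c n); rewrite !sub0r !normrN.
rewrite normrZ ger0_norm// in h4.
rewrite mulrDl; lra.
Qed.

Lemma condexp_norm1 f g : condexp f g -> norm1 mu g <= norm1 mu f.
Proof.
move=> fg; have [lf lg _ _] := fg; have [FT _ _] : [/\ F setT, True & True].
  by split => //; case: sF => F0 FC _; rewrite -(setD0 setT); exact: FC.
by rewrite -lee_fin !norm1E//; exact: condexp_le.
Qed.

Lemma condexp_linear (a : R) f1 g1 f2 g2 : condexp f1 g1 -> condexp f2 g2 ->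
  condexp (fun w => a *: f1 w + f2 w) (fun w => a *: g1 w + g2 w).
Proof.
move=> [lf1 lg1 mg1 e1] [lf2 lg2 mg2 e2]; split.
- exact: (inL1D (inL1Z _ lf1)).
- exact: (inL1D (inL1Z _ lg1)).
- by apply: smeasD => //; exact: smeasZ.
- by move=> A FA; rewrite !bochner_integral_linear ?e1 ?e2//; exact: Fm.
Qed.

Lemma condexpB f1 g1 f2 g2 : condexp f1 g1 -> condexp f2 g2 ->
  condexp (f1 \- f2) (g1 \- g2).
Proof.
move=> h1 h2; have := condexp_linear (-1) h2 h1.
rewrite (_ : (fun w => _) = f1 \- f2); last by apply/funext => w; rewrite scaleN1r addrC.
by rewrite (_ : (fun w => _) = g1 \- g2)//; apply/funext => w; rewrite scaleN1r addrC.
Qed.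

Lemma condexp_unique f g1 g2 : condexp f g1 -> condexp f g2 -> \forall w \ae mu, g1 w = g2 w.
Proof.
move=> h1 h2; have [_ lg1 _ _] := h1; have [_ lg2 _ _] := h2.
apply: norm1_eqP => //; apply/eqP; rewrite eq_le norm1_ge0 andbT.
apply: le_trans (condexp_norm1 (condexpB h1 h2)) _.
rewrite /norm1; under eq_integral do rewrite /= subrr normr0.
by rewrite integral0.
Qed.

(** The level sets of [|g|] belong to [F], and [condexp_le] transfers to them the bound on [|f|]. *)
Lemma condexp_bounded f g (M : R) : condexp f g -> (\forall w \ae mu, `|f w| <= M) ->
  \forall w \ae mu, `|g w| <= M.
Proof.
move=> fg fM; have [lf lg mg _] := fg.
apply: (ae_le_cst_levels (finite_measure_lty mu measurableT)).
  apply/integrableP; split; first exact: smeas_normE lg.1.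
  by under eq_integral do rewrite /= normr_id; exact: lg.2.
move=> r; set A := [set w | _].
have FA : F A.
  by apply: sub_algebra_measurable; apply: measurable_lt_set => //; exact: smeas_norm.
have mA := Fm FA.
rewrite -lee_fin /Rintegral fineK; last first.
  by apply: norm_integrable_fin; exact: inL1_norm_integrable.
apply: le_trans (condexp_le fg FA) _.
have [M0|M0] := leP 0 M.
  rewrite EFinM fineK ?fin_num_measure// -integral_cst//.
  by apply: ge0_ae_le_integral => //; apply: filterS fM => w + _; rewrite lee_fin.
apply: (@le_trans _ _ (norm1 mu f)%:E).
  rewrite norm1E//; apply: ge0_subset_integral => //.
  by apply: smeas_normE; case: lf.
rewrite lee_fin; apply: le_trans (inL1_bounded lf.1 fM).2 _.
apply: ler_wnM2l; first exact: ltW.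
by apply: fine_le; rewrite ?fin_num_measure// le_measure ?inE.
Qed.

Lemma condexp_indicator B x : measurable B -> exists g, condexp (cut0 B (cst x)) g.
Proof.
move=> mB; have [phi [mphi phi1 phiE]] := conditional_probability mB.
have mphi' : measurable_fun setT phi := measurableT_comp mphi (measurable_id_sub sF Fm).
have sg : @smeas _ _ _ gF (fun w => phi w *: x).
  by apply: smeasM => //; exact: smeas_cst.
have lg : inL1 mu (fun w => phi w *: x).
  apply: (inL1_bounded (M := `|x|) (smeas_sub sF Fm sg) _).1; apply: nearW => w.
  by rewrite normrZ ler_piMl.
have lc := inL1_cut0_cst mu x mB.
exists (fun w => phi w *: x); split; [exact: lc|exact: lg|exact: sg|move=> A FA]; have mA := Fm FA.
have Aoo := finite_measure_lty mu mA.
apply: dual_separates => x' dx.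
rewrite (bochner_integral_dual mA Aoo (inL1_norm_integrable mA lg) dx).
rewrite (bochner_integral_dual mA Aoo (inL1_norm_integrable mA lc) dx).
have iB : mu.-integrable A (EFin \o (\1_B : T -> R)).
  apply: (integrable_bounded_real (finite_measure_lty mu measurableT) (C := 1)) => //.
  by move=> w; rewrite indicE; case: (_ \in _); rewrite ?normr1 ?normr0.
transitivity (\int[mu]_(w in A) (x' x * \1_B w)); last first.
  apply: eq_Rintegral => w _; rewrite /cut0 indicE.
  by case: (w \in B); rewrite ?mulr1 ?mulr0 ?dual0.
rewrite RintegralZl// /Rintegral [in RHS]integral_indic// setIC -phiE// -RintegralZl//.
  by apply: eq_Rintegral => w _; rewrite (dualZ _ _ dx) mulrC.
exact: (integrable_bounded_real (finite_measure_lty mu measurableT) (C := 1)).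
Qed.

Lemma condexp_finitely_valued f : finitely_valued f -> exists g, condexp f g.
Proof.
move=> ff; have [/finite_seqP[s hs] mf] := ff.
have fE : f = fun w => \sum_(y <- undup s) cut0 (f @^-1` [set y]) (cst y) w.
  apply/funext => w; have fs : f w \in undup s.
    have : range f (f w) by exists w.
    by rewrite hs /= mem_undup.
  rewrite (bigD1_seq (f w)) ?undup_uniq//= big1 ?addr0.
    by rewrite /cut0 mem_set.
  by move=> y /eqP yf; rewrite /cut0 memNset//= => /esym.
rewrite fE; elim: (undup s) => [|y r [g hg]].
  exists (cst 0); under eq_fun do rewrite big_nil.
  by split; [exact: inL1_cst|exact: inL1_cst|exact: smeas_cst|].
have [h hh] := condexp_indicator y (mf y).
exists (fun w => 1 *: h w + g w).
rewrite (_ : (fun w => \sum_(_ <- _) _) = fun w => 1 *: cut0 (f @^-1` [set y]) (cst y) w +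
  \sum_(z <- r) cut0 (f @^-1` [set z]) (cst z) w); first exact: condexp_linear.
by apply/funext => w; rewrite big_cons scale1r.
Qed.

(** Finitely valued functions are dense and [condexp_norm1] preserves Cauchy sequences. The [L_1]
    limit [g0] is replaced by [g1], the pointwise limit of a fast subsequence taken in [gF], to
    recover measurability for [F]. *)
Lemma condexp_exists f : inL1 mu f -> exists g, condexp f g.
Proof.
move=> lf; have [h [fh _ _ hf]] := inL1_approx lf.
have lh n : inL1 mu (h n) by exact: finitely_valued_inL1.
have /choice[g hg] : forall n : nat, exists g, condexp (h n) g.
  by move=> n; exact: condexp_finitely_valued.
have lg n : inL1 mu (g n) by case: (hg n).
have [|g0 lg0 gg0] := L1_complete lg.
  move=> eps e0; have e20 : 0 < eps / 2 by rewrite divr_gt0.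
  have [N _ hN] := cvgr_lt _ hf _ e20; exists N => m n Nm Nn.
  apply: le_lt_trans (condexp_norm1 (condexpB (hg m) (hg n))) _.
  have := norm1_triangle (lh m) lf (lh n); rewrite (norm1_sym mu (h m) f).
  have := hN _ Nm; have := hN _ Nn; rewrite /=; lra.
have /choice[k hk] : forall n : nat, exists k, norm1 mu (g k \- g0) <= (4^-1) ^+ n.
  move=> n; have p0 : 0 < (4^-1 : R) ^+ n by rewrite exprn_gt0.
  by have [N _ /(_ N (leqnn N)) hN] := cvgr_lt _ gg0 _ p0; exists N; exact: ltW.
have ae := fast_ae_cvg (fun n => lg (k n)) lg0 hk.
have [g1 mg1 hg1] := @smeas_limit _ _ _ gF (fun n => g (k n))
  (fun n => let: And4 _ _ m _ := hg (k n) in m).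
have g01 : \forall w \ae mu, g0 w = g1 w.
  apply: filterS ae => w hw.
  have cw : cvg (g (k n) w @[n --> \oo]) by apply/cvg_ex; exists (g0 w).
  exact: (cvg_unique _ hw (hg1 _ cw)).
have lg1 : inL1 mu g1 := inL1_ae (smeas_sub sF Fm mg1) lg0 g01.
exists g1; split; [exact: lf|exact: lg1|exact: mg1|move=> A FA]; have mA := Fm FA.
rewrite -(bochner_integral_ae mA g01).
have l1 := bochner_integral_cvg mA lg lg0 gg0.
have hf' : norm1 mu (h n \- f) @[n --> \oo] --> (0 : R).
  by under eq_fun do rewrite norm1_sym.
have l2 := bochner_integral_cvg mA lh lf hf'.
have E : (fun n => bochner_integral mu A (g n)) = (fun n => bochner_integral mu A (h n)).
  by apply/funext => n; have [_ _ _ ->] := hg n.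
rewrite E in l1; exact: (cvg_unique _ l1 l2).
Qed.

Lemma is_cond_exp_condexp f0 f g0 : inL1 mu f -> (\forall w \ae mu, f0 w = f w) ->
  is_cond_exp mu F f0 g0 ->
  exists2 g, condexp f g & \forall w \ae mu, g0 w = g w.
Proof.
move=> lf ff [/(strongly_measurable_rep sF Fm)[g mg gg] _ [x gx] h].
have lg := is_bochner_integral_inL1 (smeas_sub sF Fm mg) gg gx.
exists g; last exact: gg.
split; [exact: lf|exact: lg|exact: mg|move=> A FA]; have mA := Fm FA.
by rewrite -(bochner_integral_ae mA gg) -(bochner_integral_ae mA ff); exact: h.
Qed.

Lemma condexp_is_cond_exp f0 f g : (\forall w \ae mu, f0 w = f w) -> condexp f g ->
  is_cond_exp mu F f0 g.
Proof.
move=> ff [lf lg mg e].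
have Too := finite_measure_lty mu (@measurableT _ T).
have bi (u : T -> X) : inL1 mu u -> is_bochner_integral mu setT u (bochner_integral mu setT u).
  move=> lu.
  exact: (bochner_integralP measurableT Too (inL1_norm_integrable measurableT lu)).
split.
- by apply: rep_strongly_measurable mg _ => //; exact: nearW.
- exists (bochner_integral mu setT f); apply: (is_bochner_integral_ae measurableT _ (bi _ lf)).
  by apply: filterS ff => w ->.
- by exists (bochner_integral mu setT g); exact: bi.
- move=> A FA; apply: etrans (e A FA) _; apply: bochner_integral_ae; first exact: Fm.
  by apply: filterS ff => w ->.
Qed.

Lemma cond_expE f0 f g : (\forall w \ae mu, f0 w = f w) -> condexp f g ->
  \forall w \ae mu, cond_exp mu F f0 w = g w.
Proof.
move=> ff fg; have [lf _ _ _] := fg.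
rewrite /cond_exp; case: xgetP => [g0 _ hg0|/(_ g)[]]; last exact: condexp_is_cond_exp fg.
have [g1 fg1 gg1] := is_cond_exp_condexp lf ff hg0.
by apply: filterS2 gg1 (condexp_unique fg1 fg) => w -> ->.
Qed.

End conditional_expectation.

(** * Martingale convergence *)

Section dominated_norm1.
Context {R : realType} {X : completeNormedModType R} {d : measure_display}
  {T : measurableType d} (mu : {finite_measure set T -> \bar R}).

Lemma dominated_norm1 (u : nat -> T -> X) (f g : T -> X) : (forall n, inL1 mu (u n)) ->
  inL1 mu f -> inL1 mu g -> (\forall w \ae mu, forall n, `|u n w - f w| <= `|g w|) ->
  (\forall w \ae mu, u n w @[n --> \oo] --> f w) ->
  norm1 mu (u n \- f) @[n --> \oo] --> (0 : R).
Proof.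
move=> lu lf lg ufg uf.
have [||||| _ _] := @dominated_convergence _ _ _ mu setT measurableT
  (fun n w => (`|(u n \- f) w|)%:E) (cst 0%E) (fun w => (`|g w|)%:E).
- by move=> n; exact: smeas_normE (inL1B (lu n) lf).1.
- exact: measurable_cst.
- apply: filterS uf => w uw _; apply: cvg_EFin; first exact: nearW.
  rewrite -(normr0 X) -(subrr (f w)); apply: cvg_norm => /=.
  by apply: cvgB => //; exact: cvg_cst.
- apply/integrableP; split; first exact: smeas_normE lg.1.
  by under eq_integral do rewrite abse_EFin normr_id; exact: lg.2.
- by apply: filterS ufg => w h n _; rewrite abse_EFin normr_id lee_fin; exact: h.
by rewrite integral_cst// mul0e => h0; exact: (fine_cvg h0).
Qed.

Lemma bounded_norm1 (u : nat -> T -> X) (f : T -> X) (M : R) : (forall n, smeas (u n)) ->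
  smeas f -> (\forall w \ae mu, forall n, `|u n w| <= M) ->
  (\forall w \ae mu, u n w @[n --> \oo] --> f w) ->
  norm1 mu (u n \- f) @[n --> \oo] --> (0 : R).
Proof.
move=> mun mf uM uf.
have fM : \forall w \ae mu, `|f w| <= M.
  apply: filterS2 uM uf => w h cw.
  have cw' : `|u n w| @[n --> \oo] --> `|f w| by exact: cvg_norm.
  rewrite -(cvg_lim (@Rhausdorff R) cw'); apply: limr_le; first exact: cvgP cw'.
  exact: nearW.
have lu n : inL1 mu (u n).
  by apply: (inL1_bounded (M := M) (mun n) _).1; apply: filterS uM => w.
have lf : inL1 mu f by apply: (inL1_bounded mf fM).1.
have mM : measurable_fun setT (cst (2 * M) : T -> R) by exact: measurable_cst.
have cvg_real : \forall w \ae mu, forall n, `|u n w - f w| <= 2 * M.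
  apply: filterS2 uM fM => w h1 h2 n; apply: le_trans (ler_normB _ _) _.
  by rewrite mulr_natl mulr2n lerD.
have [||||| _ _] := @dominated_convergence _ _ _ mu setT measurableT
  (fun n w => (`|(u n \- f) w|)%:E) (cst 0%E) (cst (2 * M)%:E).
- by move=> n; exact: smeas_normE (inL1B (lu n) lf).1.
- exact: measurable_cst.
- apply: filterS uf => w uw _; apply: cvg_EFin; first exact: nearW.
  rewrite -(normr0 X) -(subrr (f w)); apply: cvg_norm => /=.
  by apply: cvgB => //; exact: cvg_cst.
- apply: (integrable_bounded_real (finite_measure_lty mu measurableT) (C := `|2 * M|)) => //.
- by apply: filterS cvg_real => w h n _; rewrite abse_EFin normr_id lee_fin; exact: h.
by rewrite integral_cst// mul0e => h0; exact: (fine_cvg h0).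
Qed.

End dominated_norm1.

Section filtration_limits.
Context {R : realType} {X : completeNormedModType R} {d : measure_display}
  {T : measurableType d} (mu : {finite_measure set T -> \bar R}).
Variable F : R -> set (set T).
Hypothesis FF : filtration F.
Implicit Types (f g h : T -> X) (s : R) (A : set T).

Let sF s : 0 <= s -> sigma_algebra setT (F s).
Proof. by case: FF => h _ _; exact: h. Qed.

Let Fm s : 0 <= s -> F s `<=` measurable.
Proof. by case: FF => _ h _; exact: h. Qed.

Let Foo := filtration_infty F.

Lemma filtration_mono s t : 0 <= s -> s <= t -> F s `<=` F t.
Proof.
case: FF => _ _ h s0; rewrite le_eqVlt => /orP[/eqP -> //|st]; exact: h.
Qed.

Lemma filtration_infty_sigma : sigma_algebra setT Foo.
Proof. exact: smallest_sigma_algebra. Qed.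

Lemma filtration_infty_measurable : Foo `<=` measurable.
Proof.
apply: smallest_sub; first exact: sigma_algebra_measurable.
by apply: bigcup_sub => s /= s0; exact: Fm.
Qed.

Lemma filtration_sub_infty s : 0 <= s -> F s `<=` Foo.
Proof. by move=> s0 A FA; apply: sub_sigma_algebra; exists s. Qed.

Lemma smeas_filtration s t f : 0 <= s -> s <= t ->
  @smeas _ _ _ (g_sigma_algebraType (F s)) f -> @smeas _ _ _ (g_sigma_algebraType (F t)) f.
Proof.
move=> s0 st [c [mc fc]]; exists c; split => // n.
move=> _ B mB; have := mc n measurableT B mB; rewrite !setTI => h.
apply: sub_sigma_algebra; apply: (filtration_mono s0 st).
exact: (sub_algebra_measurable (sF s0)).
Qed.

Definition approximable (f : T -> X) := forall eps : R, 0 < eps ->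
  exists s g, [/\ 0 <= s, inL1 mu g, @smeas _ _ _ (g_sigma_algebraType (F s)) g &
    norm1 mu (f \- g) < eps].

Lemma approximableD f g : inL1 mu f -> inL1 mu g ->
  approximable f -> approximable g -> approximable (f \+ g).
Proof.
move=> lf lg hf hg eps e0; have e20 : 0 < eps / 2 by rewrite divr_gt0.
have [s [u [s0 lu mu_ fu]]] := hf _ e20; have [t [v [t0 lv mv gv]]] := hg _ e20.
have st0 : 0 <= Num.max s t by rewrite le_max s0.
exists (Num.max s t), (u \+ v); split => //.
- exact: inL1D.
- by apply: smeasD; [apply: smeas_filtration mu_|apply: smeas_filtration mv];
    rewrite // le_max lexx ?orbT.
- rewrite (_ : _ \- _ = (f \- u) \+ (g \- v)).
    by apply: le_lt_trans (norm1D (inL1B lf lu) (inL1B lg lv)) _; lra.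
  by apply/funext => w /=; rewrite opprD addrACA.
Qed.

Lemma norm1_cut0B A B (y : X) : measurable A -> measurable B ->
  norm1 mu (cut0 A (cst y) \- cut0 B (cst y)) = `|y| * norm1 mu (\1_A \- \1_B : T -> R^o).
Proof.
move=> mA mB.
have m1 : smeas (\1_A \- \1_B : T -> R^o).
  by apply: measurable_fun_smeas; apply: measurable_funB.
have := norm1Z mu `|y| m1; rewrite normr_id => <-.
congr fine; apply: eq_integral => w _; rewrite /cut0 /indic /=; congr EFin.
rewrite normrZ normr_id.
case: (w \in A); case: (w \in B); rewrite /= ?subrr ?subr0 ?sub0r ?normrN ?normr0 ?normr1 ?mulr0 ?mulr1//.
Qed.

(** The sets with this property form a sigma-algebra containing every [F s]. Finite unions use that
    the [F s] increase; a countable union is the [L_1] limit of its finite partial unions. *)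
Lemma filtration_approx_set A : Foo A -> forall eps : R, 0 < eps -> exists s B,
  [/\ 0 <= s, F s B & norm1 mu (\1_A \- \1_B : T -> R^o) < eps].
Proof.
pose G := [set A | measurable A /\ forall eps : R, 0 < eps -> exists s B,
  [/\ 0 <= s, F s B & norm1 mu (\1_A \- \1_B : T -> R^o) < eps]].
have l1 B : measurable B -> inL1 mu (\1_B : T -> R^o).
  move=> mB; apply: (inL1_bounded (M := 1) _ _).1.
    by apply: measurable_fun_smeas; exact: measurable_indic.
  by apply: nearW => w; rewrite indicE; case: (_ \in _); rewrite ?normr1 ?normr0.
have n0 : norm1 mu (cst 0 : T -> R^o) = 0.
  by rewrite /norm1; under eq_integral do rewrite normr0; rewrite integral0.
have self (eps : R) B0 s : 0 < eps -> 0 <= s -> F s B0 -> exists s B,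
    [/\ 0 <= s, F s B & norm1 mu (\1_B0 \- \1_B : T -> R^o) < eps].
  move=> e0 s0 FA; exists s, B0; split => //.
  by rewrite (_ : _ \- _ = cst 0 :> (T -> R^o)) ?n0//; apply/funext => w /=; rewrite subrr.
suff sG : sigma_algebra setT G.
  move=> FA; have : G A; last by case.
  apply: (FA G); split => // B [s /= s0 FB]; split; first exact: (Fm s0).
  by move=> eps e0; exact: self FB.
have GU A1 B1 : G A1 -> G B1 -> G (A1 `|` B1).
  move=> [mA hA] [mB hB]; split; first exact: measurableU.
  move=> eps e0; have e20 : 0 < eps / 2 by rewrite divr_gt0.
  have [s [C [s0 FC AC]]] := hA _ e20; have [t [D [t0 FD BD]]] := hB _ e20.
  have st0 : 0 <= Num.max s t by rewrite le_max s0.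
  have FC' : F (Num.max s t) C by apply: filtration_mono FC; rewrite // le_max lexx.
  have FD' : F (Num.max s t) D by apply: filtration_mono FD; rewrite // le_max lexx orbT.
  have mC := Fm s0 FC; have mD := Fm t0 FD.
  exists (Num.max s t), (C `|` D); split => //.
    apply: (sub_algebra_measurable (sF st0)).
    by apply: measurableU; exact: sub_sigma_algebra.
  apply: (@le_lt_trans _ _ (norm1 mu (\1_A1 \- \1_C : T -> R^o) + norm1 mu (\1_B1 \- \1_D : T -> R^o))); last lra.
  rewrite -lee_fin EFinD !norm1E; [|exact: inL1B (l1 _ _) (l1 _ _)..|]; last first.
    by apply: inL1B; apply: l1; exact: measurableU.
  rewrite -ge0_integralD//; last 2 first.
  - exact: smeas_normE (inL1B (l1 _ mA) (l1 _ mC)).1.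
  - exact: smeas_normE (inL1B (l1 _ mB) (l1 _ mD)).1.
  apply: ge0_ae_le_integral => //; first by move=> w; rewrite adde_ge0.
  apply: nearW => w _; rewrite -EFinD lee_fin /= !indicE !in_setU.
  case: (w \in A1); case: (w \in B1); case: (w \in C); case: (w \in D);
    rewrite /= ?subrr ?subr0 ?sub0r ?normrN ?normr0 ?normr1 ?addr0 ?add0r ?ler01//; lra.
have GC A1 : G A1 -> G (~` A1).
  move=> [mA hA]; split; first exact: measurableC.
  move=> eps e0; have [s [B [s0 FB AB]]] := hA _ e0; exists s, (~` B); split => //.
    by apply: (sub_algebra_measurable (sF s0)); apply: measurableC; exact: sub_sigma_algebra.
  apply: le_lt_trans AB; rewrite le_eqVlt; apply/orP; left; apply/eqP.
  congr fine; apply: eq_integral => w _; congr EFin; rewrite /= !indicE !in_setC.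
  by case: (w \in A1); case: (w \in B); rewrite /= ?subrr ?subr0 ?sub0r ?normrN ?normr0 ?normr1.
have G0 : G set0.
  split => // eps e0; apply: (self _ _ 0) => //.
  by have [h _ _] := sF (lexx 0).
split => // [A1|A1 hA]; first by rewrite setTD; exact: GC.
have mA n : measurable (A1 n) by case: (hA n).
split; first exact: bigcup_measurable.
pose S n := \big[setU/set0]_(i < n) A1 i.
have GS n : G (S n).
  elim: n => [|n ih]; first by rewrite /S big_ord0.
  by rewrite /S big_ord_recr; exact: GU.
move=> eps e0; have e20 : 0 < eps / 2 by rewrite divr_gt0.
have mU : measurable (\bigcup_n A1 n) by exact: bigcup_measurable.
have lim : norm1 mu (\1_(S n) \- \1_(\bigcup_n A1 n) : T -> R^o) @[n --> \oo] --> (0 : R).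
  apply: (@bounded_norm1 _ _ _ _ mu (fun n => \1_(S n) : T -> R^o) _ 1).
  - by move=> n; case: (l1 _ (GS n).1).
  - by case: (l1 _ mU).
  - by apply: nearW => w n; rewrite indicE; case: (_ \in _); rewrite ?normr1 ?normr0.
  - apply: nearW => w; have [Uw|nUw] := pselect ((\bigcup_n A1 n) w).
      have [n _ Anw] := Uw; apply: cvg_near_cst; exists n.+1 => // m /= nm.
      rewrite !indicE mem_set ?mem_set//.
      by rewrite /S -bigcup_mkord; exists n.
    apply: cvg_near_cst; apply: nearW => n; rewrite !indicE memNset ?memNset//.
    by rewrite /S -bigcup_mkord => -[i _ Ai]; apply: nUw; exists i.
have [n _ /(_ n (leqnn n)) hn] := cvgr_lt _ lim _ e20.
have [s [B [s0 FB SB]]] := (GS n).2 _ e20; exists s, B; split => //.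
have := norm1_triangle (l1 _ mU) (l1 _ (GS n).1) (l1 _ (Fm s0 FB)).
rewrite (norm1_sym mu (\1_(\bigcup_n A1 n) : T -> R^o) (\1_(S n))); move: hn SB => /=; lra.
Qed.

Lemma filtration_approx f : inL1 mu f -> @smeas _ _ _ (g_sigma_algebraType Foo) f ->
  approximable f.
Proof.
move=> lf mf.
have sFoo := filtration_infty_sigma; have Foom := filtration_infty_measurable.
have [h [fh hf hle]] := smeas_approx mf.
have fh' n : @finitely_valued _ T _ (h n).
  have [r m] := fh n; split => // y; apply: Foom.
  exact: (sub_algebra_measurable sFoo).
have lh n : inL1 mu (h n) by exact: finitely_valued_inL1.
have lim : norm1 mu (h n \- f) @[n --> \oo] --> (0 : R).
  apply: (@dominated_norm1 _ _ _ _ mu h f f) => //; last exact: nearW.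
  by apply: nearW => w n; rewrite distrC.
move=> eps e0; have e20 : 0 < eps / 2 by rewrite divr_gt0.
have [n _ /(_ n (leqnn n)) hn] := cvgr_lt _ lim _ e20.
suff /(_ _ e20) [s [g [s0 lg mg gn]]] : approximable (h n).
  exists s, g; split => //; have := norm1_triangle lf (lh n) lg.
  by rewrite (norm1_sym mu f (h n)); move: hn; rewrite /=; lra.
have [/finite_seqP[r hr] mh] := fh n.
have fE : h n = fun w => \sum_(y <- undup r) cut0 (h n @^-1` [set y]) (cst y) w.
  apply/funext => w; have fs : h n w \in undup r.
    have : range (h n) (h n w) by exists w.
    by rewrite hr /= mem_undup.
  rewrite (bigD1_seq (h n w)) ?undup_uniq//= big1 ?addr0.
    by rewrite /cut0 mem_set.
  by move=> y /eqP yf; rewrite /cut0 memNset//= => /esym.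
have Fh y : Foo (h n @^-1` [set y]) by exact: (sub_algebra_measurable sFoo).
have lc y : inL1 mu (cut0 (h n @^-1` [set y]) (cst y)) by apply: inL1_cut0_cst; exact: Foom.
rewrite fE; elim: (undup r) => [|y q ih].
  move=> e e1; exists 0, (cst 0); split => //; [exact: inL1_cst|exact: smeas_cst|].
  rewrite (norm1_ae (g := cst 0)); last by apply: nearW => w /=; rewrite big_nil subr0.
  by rewrite /norm1; under eq_integral do rewrite normr0; rewrite integral0.
rewrite (_ : (fun w => _) = cut0 (h n @^-1` [set y]) (cst y) \+
   (fun w => \sum_(z <- q) cut0 (h n @^-1` [set z]) (cst z) w)); last first.
  by apply/funext => w /=; rewrite big_cons.
apply: approximableD => //; first exact: inL1_sum.
move=> e e1; have y1 : 0 < `|y| + 1 by rewrite ltr_wpDl.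
have [s [B [s0 FB AB]]] := filtration_approx_set (Fh y) (divr_gt0 e1 y1).
have mB := Fm s0 FB.
exists s, (cut0 B (cst y)); split => //.
- exact: inL1_cut0_cst.
- by apply: smeas_cut0; [exact: sub_sigma_algebra|exact: smeas_cst].
- rewrite norm1_cut0B//; last exact: Foom.
  apply: (@le_lt_trans _ _ ((`|y| + 1) * norm1 mu (\1_(h n @^-1` [set y]) \- \1_B : T -> R^o))).
    by rewrite ler_wpM2r ?norm1_ge0// lerDl.
  by rewrite mulrC -ltr_pdivlMr.
Qed.

Lemma condexp_tower s f g h : 0 <= s -> condexp mu Foo f g -> condexp mu (F s) f h ->
  condexp mu (F s) g h.
Proof.
move=> s0 [lf lg mg fg] [_ lh mh fh]; split; [exact: lg|exact: lh|exact: mh|move=> A FA].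
exact: etrans (fh A FA) (esym (fg A (filtration_sub_infty s0 FA))).
Qed.

Lemma condexp_self s f : 0 <= s -> inL1 mu f -> @smeas _ _ _ (g_sigma_algebraType (F s)) f ->
  condexp mu (F s) f f.
Proof. by []. Qed.

(** For [s >= S] the conditional expectation given [F s] fixes an [F S]-measurable [u] close to [g];
    being a contraction, it moves [g] by at most twice the distance from [g] to [u]. *)
Lemma condexp_cvg f g : condexp mu Foo f g -> forall eps : R, 0 < eps ->
  exists2 S, 0 <= S & forall s h, S <= s -> condexp mu (F s) f h -> norm1 mu (h \- g) < eps.
Proof.
move=> fg eps e0; have [lf lg mg _] := fg.
have e20 : 0 < eps / 2 by rewrite divr_gt0.
have [S [u [S0 lu mu_ gu]]] := filtration_approx lg mg e20.
exists S => // s h Ss fh; have s0 := le_trans S0 Ss.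
have gh := condexp_tower s0 fg fh.
have uu := condexp_self s0 lu (smeas_filtration S0 Ss mu_).
have := condexp_norm1 (sF s0) (Fm s0) (condexpB (Fm s0) gh uu).
have [_ lh _ _] := fh.
have := norm1_triangle lh lu lg; rewrite (norm1_sym mu u g); lra.
Qed.

(** Induction on the times. On the part of [A] where the first time already exceeds [a], the
    estimate is [condexp_le]; the rest of [A] belongs to all later sigma-algebras, which is why the
    statement carries a set [A]. *)
Lemma doob_sorted (l : seq R) (f : T -> X) (N : R -> T -> X) (a : R) A :
  sorted <=%R l -> 0 < a -> (forall s, s \in l -> 0 <= s /\ condexp mu (F s) f (N s)) ->
  (forall s, s \in l -> F s A) -> measurable A -> inL1 mu f ->
  let U := [set w | A w /\ exists2 s, s \in l & a < `|N s w|] in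
  measurable U /\ ((a * fine (mu U))%:E <= \int[mu]_(w in U) (`|f w|)%:E)%E.
Proof.
elim: l A => [|s l ih] A /= sl a0 hN FA mA lf.
  rewrite (_ : [set w | _] = set0).
    by rewrite measure0 mulr0 integral_set0.
  by apply/seteqP; split => // w [_ [s]].
have [s0 fN] := hN s (mem_head s l); have [_ lN mN _] := fN.
set B := [set w | a < `|N s w|].
have FB : F s B.
  by apply: (sub_algebra_measurable (sF s0)); apply: measurable_lt_set => //; exact: smeas_norm.
have FsA : F s A by apply: FA; exact: mem_head.
have FAB : F s (A `&` B).
  by apply: (sub_algebra_measurable (sF s0)); apply: measurableI; exact: sub_sigma_algebra.
have FADB : F s (A `\` B).
  by apply: (sub_algebra_measurable (sF s0)); apply: measurableD; exact: sub_sigma_algebra.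
have mB := Fm s0 FB; have mAB := Fm s0 FAB; have mADB := Fm s0 FADB.
have [||||//|//|mV hV] := ih (A `\` B).
- exact: path_sorted sl.
- exact: a0.
- by move=> t tl; apply: hN; rewrite in_cons tl orbT.
- move=> t tl; apply: (filtration_mono s0) FADB.
  by have /allP := order_path_min le_trans sl; exact.
set V := [set w | _] in mV hV.
set U := [set w | _].
have UE : U = (A `&` B) `|` V.
  apply/seteqP; split => [w [Aw [t]]|w].
    rewrite in_cons => /orP[/eqP ->|tl] h; first by left.
    have [Bw|nBw] := pselect (B w); first by left.
    by right; split => //; exists t.
  move=> [[Aw Bw]|[[Aw _] [t tl h]]]; first by split => //; exists s => //; exact: mem_head.
  by split => //; exists t => //; rewrite in_cons tl orbT.
have disj : (A `&` B) `&` V = set0.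
  by apply/seteqP; split => // w [[_ Bw] [[_ nB] _]].
rewrite UE; split; first exact: measurableU.
rewrite measureU// fineD ?fin_num_measure// mulrDr EFinD.
rewrite ge0_integral_setU//; last 2 first.
- by apply/measurable_funTS; apply: smeas_normE; case: lf.
- by rewrite /disj_set disj eqxx.
apply: leeD => //.
apply: le_trans (condexp_le (sF s0) (Fm s0) fN FAB).
rewrite EFinM fineK ?fin_num_measure// -integral_cst//.
apply: ge0_le_integral => //.
- by move=> w _; rewrite lee_fin ltW.
- by apply/measurable_funTS; apply: smeas_normE; case: lN.
- by move=> w [_ h]; rewrite lee_fin ltW.
Qed.

End filtration_limits.

Section essential_union.
Context {R : realType} {d : measure_display} {T : measurableType d}
  (mu : {finite_measure set T -> \bar R}).

(** The supremum of the measures of finite unions is approached along an increasing sequence of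
    finite unions. Their union [B] has this supremum as measure, so adding one more [A i] cannot
    increase it. *)
Lemma essential_union (I : eqType) (A : I -> set T) (c : R) : (forall i, measurable (A i)) ->
  (forall l : seq I, (mu (\big[setU/set0]_(i <- l) A i) <= c%:E)%E) ->
  exists B, [/\ measurable B, (mu B <= c%:E)%E & forall i, mu (A i `\` B) = 0%E].
Proof.
move=> mA muA; pose U l := \big[setU/set0]_(i <- l) A i.
have mU l : measurable (U l) by apply: bigsetU_measurable.
have UE l w : U l w <-> exists2 i, i \in l & A i w.
  rewrite /U; elim: l => [|i l ih]; first by rewrite big_nil; split => // -[].
  rewrite big_cons; split => [[Aw|/ih[j jl Aw]]|[j]].
  - by exists i => //; exact: mem_head.
  - by exists j => //; rewrite in_cons jl orbT.
  - rewrite in_cons => /orP[/eqP -> Aw|jl Aw]; first by left.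
    by right; apply/ih; exists j.
pose V := [set fine (mu (U l)) | l in [set: seq I]].
have V0 : V !=set0 by exists (fine (mu (U [::]))), [::].
have Vb : has_ubound V.
  exists c => _ [l _ <-]; rewrite -lee_fin fineK ?fin_num_measure//; exact: muA.
have hV : has_sup V by split.
have /choice[l hl] : forall n : nat, exists l, sup V - n.+1%:R^-1 < fine (mu (U l)).
  move=> n; have n0 : 0 < n.+1%:R^-1 :> R by rewrite invr_gt0.
  by have [_ [l _ <-] hl] := sup_adherent n0 hV; exists l.
pose L n := flatten [seq l i | i <- iota 0 n].
have LS n : L n.+1 = L n ++ l n.
  by rewrite /L -addn1 iotaD map_cat flatten_cat /= cats0.
have ULS n : U (L n) `<=` U (L n.+1).
  move=> w /UE[i il Aw]; apply/UE; exists i => //; by rewrite LS mem_cat il.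
have UlS n : U (l n) `<=` U (L n.+1).
  move=> w /UE[i il Aw]; apply/UE; exists i => //; by rewrite LS mem_cat il orbT.
have mono : {homo (fun n => U (L n)) : n m / (n <= m)%N >-> (n <= m)%O}.
  by apply: homo_leq => [//|? ? ?|n]; [exact: le_trans|apply/subsetPset].
have mB : measurable (\bigcup_n U (L n)) by exact: bigcup_measurable.
exists (\bigcup_n U (L n)); split => //.
  have lim := nondecreasing_cvg_mu (mu := mu) (fun n => mU (L n)) mB mono.
  rewrite -(cvg_lim (@ereal_hausdorff R) lim); apply: lime_le; first exact: cvgP lim.
  by apply: nearW => n; exact: muA.
move=> i; apply/eqP; rewrite eq_le measure_ge0 andbT; apply/lee_addgt0Pr.
suff h (e : R) : 0 < e -> (mu (A i `\` \bigcup_n U (L n)) <= e%:E)%E.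
  by move=> e e0; rewrite add0e; exact: h.
move=> e0.
have [n ne] := ltr_add_invr e0; rewrite add0r in ne.
have Vl q : fine (mu (U q)) <= sup V by apply: ub_le_sup => //; exists q.
have h1 := hl n; have h2 := Vl (i :: L n.+1); have h0 := Vl (l n).
have h3 : fine (mu (U (l n))) <= fine (mu (U (L n.+1))).
  apply: fine_le; rewrite ?fin_num_measure//; apply: le_measure; rewrite ?inE//.
have h4 : fine (mu (A i `\` \bigcup_n U (L n))) + fine (mu (U (L n.+1))) <= fine (mu (U (i :: L n.+1))).
  rewrite -fineD ?fin_num_measure//; last exact: measurableD.
  rewrite -measureU//; last 2 first.
  - exact: measurableD.
  - by apply/seteqP; split => // w [[_ nB] UL]; apply: nB; exists n.+1.
  apply: fine_le; rewrite ?fin_num_measure//.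
    by apply: measurableU => //; exact: measurableD.
  apply: le_measure; rewrite ?inE//.
    by apply: measurableU => //; exact: measurableD.
  move=> w [[Aw _]|/UE[j jl Aw]]; apply/UE; first by exists i => //; exact: mem_head.
  by exists j => //; rewrite in_cons jl orbT.
rewrite -[leLHS]fineK ?fin_num_measure//; last exact: measurableD.
rewrite lee_fin; apply: le_trans (ltW ne).
by move: (fine _) (fine _) (fine _) (fine _) (sup V) (n.+1%:R^-1) h1 h2 h3 h4 => *; lra.
Qed.

End essential_union.

Section martingale.
Context {R : realType} {X : completeNormedModType R} {d : measure_display}
  {T : measurableType d} (mu : {finite_measure set T -> \bar R}).
Variable F : R -> set (set T).
Hypothesis FF : filtration F.
Implicit Types (f g h : T -> X) (s : R) (A : set T).

Let sF s : 0 <= s -> sigma_algebra setT (F s).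
Proof. by case: FF => h _ _; exact: h. Qed.

Let Fm s : 0 <= s -> F s `<=` measurable.
Proof. by case: FF => _ h _; exact: h. Qed.

Let Foo := filtration_infty F.

(** Doob's inequality for uncountably many times: the bound for finite sets of times passes to an
    essential union, at the price of one null set per time. *)
Lemma doob_essential (S a : R) f (N : R -> T -> X) : 0 <= S -> 0 < a ->
  (forall s, S <= s -> condexp mu (F s) f (N s)) ->
  exists B, [/\ measurable B, (mu B <= (norm1 mu f / a)%:E)%E &
    forall s, S <= s -> mu ([set w | a < `|N s w|] `\` B) = 0%E].
Proof.
move=> S0 a0 fN; have [lf _ _ _] := fN _ (lexx S).
pose A s := if S <= s then [set w | a < `|N s w|] else set0.
have mA s : measurable (A s).
  rewrite /A; case: ifP => // Ss; have [_ [mN _] _ _] := fN _ Ss.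
  by apply: measurable_lt_set => //; exact: smeas_norm.
have [|B [mB muB hB]] := @essential_union _ _ _ mu R A (norm1 mu f / a) mA; last first.
  by exists B; split => // s Ss; have := hB s; rewrite /A Ss.
move=> l; pose q := sort <=%R [seq s <- l | S <= s].
have qP s : s \in q -> S <= s by rewrite mem_sort mem_filter => /andP[].
have [||||||mU hU] := @doob_sorted _ _ _ _ mu F FF q f N a setT.
- by apply: sort_sorted; exact: le_total.
- by [].
- by move=> s /qP Ss; split; [exact: le_trans Ss|exact: fN].
- move=> s /qP Ss; case: (sF (le_trans S0 Ss)) => F0 FC _.
  by rewrite -(setD0 setT); exact: FC.
- by [].
- by [].
have sub : \big[setU/set0]_(i <- l) A i `<=` [set w | setT w /\ exists2 s, s \in q & a < `|N s w|].
  rewrite /q; elim: l {q qP mU hU} => [|s l ih]; first by rewrite big_nil.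
  rewrite big_cons => w [|/ih[_ [t tl aN]]].
    rewrite /A; case: ifP => // Ss aN; split => //; exists s => //.
    by rewrite mem_sort mem_filter Ss mem_head.
  split => //; exists t => //; move: tl; rewrite !mem_sort !mem_filter in_cons.
  by move=> /andP[-> ->]; rewrite orbT.
apply: le_trans (le_measure _ _ _ sub) _; rewrite ?inE//.
  by apply: bigsetU_measurable.
rewrite -[leLHS]fineK ?fin_num_measure// lee_fin ler_pdivlMr// mulrC -lee_fin norm1E//.
apply: le_trans hU _; apply: ge0_subset_integral => //.
exact: smeas_normE lf.1.
Qed.

(** Along the times [S k] convergence is fast. Between them, [doob_essential] applied to
    [g - M (S k)] controls [M s - M (S k)] for all [s >= S k] outside a set [B k] of measure at most
    [2^-k]. *)
Lemma martingale_ae f g (M : R -> T -> X) : condexp mu Foo f g ->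
  (forall s, 0 <= s -> condexp mu (F s) f (M s)) ->
  exists e : R -> T -> X, (forall s, 0 <= s -> \forall w \ae mu, e s w = M s w) /\
    \forall w \ae mu, e s w @[s --> +oo] --> g w.
Proof.
move=> fg fM; have [lf lg _ _] := fg.
have /choice[S hS] : forall k : nat, exists S, 0 <= S /\
    forall s h, S <= s -> condexp mu (F s) f h -> norm1 mu (h \- g) < (4^-1) ^+ k.
  move=> k; have e0 : 0 < (4^-1 : R) ^+ k by rewrite exprn_gt0// invr_gt0.
  by have [S S0 h] := condexp_cvg FF fg e0; exists S.
have S0 k : 0 <= S k by case: (hS k).
have lM s : 0 <= s -> inL1 mu (M s) by move=> /fM[].
have mg k : norm1 mu (M (S k) \- g) <= (4^-1) ^+ k.
  exact: ltW ((hS k).2 _ _ (lexx _) (fM _ (S0 k))).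
have aeM := fast_ae_cvg (fun k => lM _ (S0 k)) lg mg.
have a0 k : 0 < (2^-1 : R) ^+ k by rewrite exprn_gt0// invr_gt0.
have /choice[B hB] : forall k : nat, exists B, [/\ measurable B, (mu B <= (1 * 2^-1 ^+ k)%:E)%E &
    forall s, S k <= s -> mu ([set w | (2^-1) ^+ k < `|M s w - M (S k) w|] `\` B) = 0%E].
  move=> k.
  have [|B [mB muB h]] := @doob_essential (S k) ((2^-1) ^+ k) (g \- M (S k))
      (fun s => M s \- M (S k)) (S0 k) (a0 k).
    move=> s Ss; have s0 := le_trans (S0 k) Ss; apply: (condexpB (Fm s0)).
      exact: (condexp_tower s0 fg (fM _ s0)).
    have [_ lk mk _] := fM _ (S0 k).
    exact: condexp_self lk (smeas_filtration FF (S0 k) Ss mk).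
  exists B; split => //; apply: (le_trans muB); rewrite lee_fin mul1r ler_pdivrMr//.
  rewrite norm1_sym -exprMn; apply: le_trans (mg k) _.
  by rewrite (_ : 2^-1 * 2^-1 = 4^-1 :> R)//; field.
have bc : \forall w \ae mu, exists m, forall k, (m <= k)%N -> ~ B k w.
  by apply: (borel_cantelli (c := 1)) => // k; case: (hB k).
(* The null sets left over by Doob's inequality depend on [s] and cannot be united. Each [M s] is
   modified on its own null set, where it takes the value of the limit. *)
pose bad s w := exists2 k, S k <= s & (2^-1) ^+ k < `|M s w - M (S k) w| /\ ~ B k w.
exists (fun s w => if pselect (bad s w) then g w else M s w); split.
  move=> s s0.
  have : \forall w \ae mu, forall k, ~ (S k <= s /\ (2^-1) ^+ k < `|M s w - M (S k) w| /\ ~ B k w).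
    apply: ae_foralln => k; have [Ss|nSs] := boolP (S k <= s); last by apply: nearW => w [].
    have [mB _ /(_ _ Ss) h0] := hB k; exists ([set w | (2^-1) ^+ k < `|M s w - M (S k) w|] `\` B k).
    split => //; last by move=> w /= /contrapT[_ []].
    apply: measurableD => //; apply: measurable_lt_set => //; apply: smeas_norm.
    by apply: smeasB; [case: (lM _ s0)|case: (lM _ (S0 k))].
  apply: filterS => w h; case: pselect => // -[k Ss hk].
  by case: (h k).
apply: filterS2 aeM bc => w cM [m hm].
apply/cvgrPdist_lt => eps e0; have e20 : 0 < eps / 2 by rewrite divr_gt0.
have c2 : ((2^-1 : R) ^+ k) @[k --> \oo] --> (0 : R).
  by apply: cvg_expr; rewrite ger0_norm ?invr_ge0// invf_lt1// ltr1n.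
have [n1 _ h1] := cvgr_lt _ c2 _ e20.
have /cvgrPdist_lt/(_ _ e20)[n2 _ h2] := cM.
pose k := maxn m (maxn n1 n2).
have mk : (m <= k)%N by rewrite leq_maxl.
have k1 := h1 k; have k2 := h2 k; rewrite /= !leq_max !leqnn ?orbT in k1 k2.
have := nbhs_pinfty_ge (num_real (S k)); apply: filterS => s Ss.
case: (pselect (bad s w)) => [b|nb] /=; first by rewrite subrr normr0.
have h3 : `|M s w - M (S k) w| <= (2^-1) ^+ k.
  by rewrite leNgt; apply/negP => h; apply: nb; exists k => //; split => //; exact: hm.
have := ler_distD (M (S k) w) (g w) (M s w); rewrite (distrC (M (S k) w) (M s w)).
have := k1 isT; have := k2 isT; lra.
Qed.

End martingale.

(** * Slices of product measures, dyadic times *)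

Section product_sections.
Context {R : realType} {d1 d2 : measure_display} {T1 : measurableType d1}
  {T2 : measurableType d2} (m1 : {sigma_finite_measure set T1 -> \bar R})
  (m2 : {sigma_finite_measure set T2 -> \bar R}).

Lemma null_integral_ae d (T : measurableType d) (mu : {measure set T -> \bar R})
    (f : T -> \bar R) : measurable_fun setT f -> (forall w, 0 <= f w)%E ->
  (\int[mu]_w f w = 0)%E -> \forall w \ae mu, f w = 0%E.
Proof.
move=> mf f0 If; have : ae_eq mu setT f (cst 0%E).
  by apply/ae_eq_integral_abs => //; under eq_integral do rewrite gee0_abs//.
by apply: filterS => w; exact.
Qed.

Lemma ae_slices (P : T1 * T2 -> Prop) : (\forall z \ae (m1 \x m2)%E, P z) ->
  (\forall y \ae m2, \forall x \ae m1, P (x, y)) /\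
  (\forall x \ae m1, \forall y \ae m2, P (x, y)).
Proof.
move=> [N [mN N0 NP]].
have mi : measurable_fun setT (fun z => (\1_N z : R)%:E).
  by apply/measurable_EFinP; exact: measurable_indic.
have i0 z : (0 <= (\1_N z : R)%:E)%E by rewrite lee_fin.
have I0 : (\int[(m1 \x m2)%E]_z (\1_N z)%:E = 0 :> \bar R)%E.
  by rewrite integral_indic// setIT.
have aux d (T : measurableType d) (mu : {measure set T -> \bar R}) (p : T -> T1 * T2) :
    measurable_fun setT p -> (\int[mu]_x (\1_N (p x))%:E = 0 :> \bar R)%E ->
    \forall x \ae mu, P (p x).
  move=> mp /null_integral_ae h.
  have {h} : \forall x \ae mu, (\1_N (p x) : R)%:E = 0%E.
    by apply: h => [|x]; [exact: (measurableT_comp mi mp)|exact: i0].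
  apply: filterS => x [/eqP]; rewrite indicE pnatr_eq0 eqb0 => Nx.
  by apply: contrapT => nP; move/negP: Nx; apply; rewrite inE; exact: NP.
split.
  move: I0; rewrite fubini_tonelli2// => /null_integral_ae h.
  have {h} := h (measurable_fun_fubini_tonelli_G _ mi i0) _.
  move=> /(_ (fun y => integral_ge0 _ _)) h; have {h} := h (fun y x _ => i0 (x, y)).
  by apply: filterS => y; exact: aux (measurable_fun_pair _ _).
move: I0; rewrite fubini_tonelli1// => /null_integral_ae h.
have {h} := h (measurable_fun_fubini_tonelli_F _ mi i0) _.
move=> /(_ (fun x => integral_ge0 _ _)) h; have {h} := h (fun x y _ => i0 (x, y)).
by apply: filterS => x; exact: aux (measurable_fun_pair _ _).
Qed.

Context {X : completeNormedModType R}.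
Implicit Types h : T1 * T2 -> X.

Lemma smeas_slice1 h y : smeas h -> smeas (fun x => h (x, y)).
Proof. by apply: smeas_comp; exact: measurable_fun_pair. Qed.

Lemma tonelli_norm h D : smeas h -> measurable D ->
  measurable_fun setT (fun y => (\int[m1]_(x in D) (`|h (x, y)|)%:E)%E) /\
  (\int[m2]_y \int[m1]_(x in D) (`|h (x, y)|)%:E =
   \int[m1]_(x in D) \int[m2]_y (`|h (x, y)|)%:E)%E.
Proof.
move=> mh mD.
have mDT : measurable (D `*` [set: T2]) by exact: measurableX.
pose k := cut0 (D `*` [set: T2]) h.
have mk : measurable_fun setT (fun z => (`|k z|)%:E) by apply: smeas_normE; exact: smeas_cut0.
have k0 z : (0 <= (`|k z|)%:E)%E by rewrite lee_fin.
have kE x y : (`|k (x, y)|)%:E = ((fun x => (`|h (x, y)|)%:E) \_ D) x.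
  rewrite /k /cut0 patchE; have [xD|xD] := boolP (x \in D).
    by rewrite mem_set//; split => //; rewrite inE in xD.
  by rewrite memNset ?normr0// => -[/= Dx _]; move/negP: xD; apply; rewrite inE.
have E1 y : (\int[m1]_(x in D) (`|h (x, y)|)%:E = \int[m1]_x (`|k (x, y)|)%:E)%E.
  by rewrite integral_mkcond; apply: eq_integral => x _; rewrite kE.
have -> : (fun y => \int[m1]_(x in D) (`|h (x, y)|)%:E)%E =
    (fun y => \int[m1]_x (`|k (x, y)|)%:E)%E by apply/funext => y.
split; first exact: (measurable_fun_fubini_tonelli_G _ mk k0).
rewrite -(fubini_tonelli _ mk k0) [RHS]integral_mkcond.
apply: eq_integral => x _; rewrite patchE; case: ifPn => xD.
  by apply: eq_integral => y _; rewrite kE patchE xD.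
rewrite (eq_integral (cst 0%E)) ?integral0// => y _.
by rewrite kE patchE (negbTE xD).
Qed.

(** This gives joint measurability of [(t, w) |-> S (r t) f w] when [r] rounds the time to countably
    many values. *)
Lemma smeas_pieces (u : nat -> T2 -> X) (q : T1 -> nat) : (forall j, smeas (u j)) ->
  (forall j, measurable [set x | q x = j]) -> smeas (fun z => u (q z.1) z.2).
Proof.
move=> mu_ mq; have [c hc] := choice mu_.
exists (fun n => if unpickle n is Some (i, j) then c i j else 0); split => [n|z].
  suff h x : measurable_fun setT (fun z : T1 * T2 => `|u (q z.1) z.2 - x|) by exact: h.
  move=> _ B mB; rewrite setTI.
  rewrite (_ : _ @^-1` B = \bigcup_j ([set x | q x = j] `*` ((fun w => `|u j w - x|) @^-1` B))).
    apply: bigcup_measurable => j _; apply: measurableX => //.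
    by rewrite -[X in measurable X]setTI; apply: (smeas_dist x (mu_ j)).
  apply/seteqP; split => [z Bz|z [j _ [/= <-]]] //.
  by exists (q z.1).
move=> eps e0; have [n hn] := (hc (q z.1)).2 z.2 _ e0.
by exists (pickle (q z.1, n)); rewrite pickleK.
Qed.

End product_sections.

Section dyadic_ceiling.
Context {R : realType}.

(** The absolute value only produces a natural number: for [t > 0] this is the ceiling itself.
    Rounding upwards keeps the rounded time at least [t], hence away from 0. *)
Definition dyadic_ceil (n : nat) (t : R) : nat := `|Num.ceil (t * 2 ^+ n)|%N.

Lemma dyadic_ceil_itv n t : 0 < t ->
  t <= (dyadic_ceil n t)%:R / 2 ^+ n < t + (2^-1) ^+ n.
Proof.
move=> t0; have n0 : 0 < 2 ^+ n :> R by rewrite exprn_gt0.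
have c0 : 0 < Num.ceil (t * 2 ^+ n) by rewrite ceil_gt0 mulr_gt0.
have -> : (dyadic_ceil n t)%:R = (Num.ceil (t * 2 ^+ n))%:~R :> R.
  by rewrite /dyadic_ceil natr_absz gtr0_norm.
have /andP[h1 h2] := ceil_itv (t * 2 ^+ n).
rewrite ler_pdivlMr// h2 ltr_pdivrMr// mulrDl exprVn mulVf ?gt_eqF//.
by rewrite -ltrBlDr -[X in _ - X]/(1%:~R) -intrB.
Qed.

Lemma measurable_dyadic_ceil n j :
  measurable [set t : measurableTypeR R | dyadic_ceil n t = j].
Proof.
have mI (a b : R) : measurable [set t : measurableTypeR R | a < t * 2 ^+ n <= b].
  have mt : measurable_fun setT (fun t : measurableTypeR R => t * 2 ^+ n : R).
    by apply: measurable_funM => //; exact: measurable_cst.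
  have := mt measurableT `]a, b]%classic (measurable_itv _); rewrite setTI.
  by rewrite (_ : _ @^-1` _ = [set t | a < t * 2 ^+ n <= b])//; apply/seteqP;
    split => t /=; rewrite in_itv.
have mz (z : int) : measurable [set t : measurableTypeR R | Num.ceil (t * 2 ^+ n) = z].
  rewrite (_ : [set _ | _] = [set t | (z - 1)%:~R < t * 2 ^+ n <= z%:~R])//.
  by apply/seteqP; split => t /=; rewrite -ceil_eq => /eqP.
rewrite (_ : [set _ | _] = [set t : measurableTypeR R | Num.ceil (t * 2 ^+ n) = j%:Z] `|`
   [set t : measurableTypeR R | Num.ceil (t * 2 ^+ n) = - j%:Z]); first exact: measurableU.
apply/seteqP; split => t /=; rewrite /dyadic_ceil.
  by move=> <-; case: (Num.ceil _) => k; [left|right].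
by move=> [->|->]; rewrite ?abszN.
Qed.

End dyadic_ceiling.

(** * Contraction semigroups and their averages *)

Section contractions.
Context {R : realType} {X : completeNormedModType R} {d : measure_display}
  {W : measurableType d} (mu : {finite_measure set W -> \bar R}).
Implicit Types (f g h : W -> X) (K L : (W -> X) -> W -> X).

(** A contraction of both [L_1] and [L_oo], linear up to null sets. The semigroup, the averages, the
    conditional expectations, their compositions and their limits all have this form, so that the
    passage to [L_p] is made once. *)
Definition L1_contraction K :=
  [/\ forall f, inL1 mu f -> inL1 mu (K f),
      forall (a : R) f g, inL1 mu f -> inL1 mu g ->
        \forall w \ae mu, K (fun w => a *: f w + g w) w = a *: K f w + K g w,
      forall f, inL1 mu f -> norm1 mu (K f) <= norm1 mu f &
      forall f (M : R), inL1 mu f -> (\forall w \ae mu, `|f w| <= M) ->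
        \forall w \ae mu, `|K f w| <= M].

Lemma norm1_eq0_ae f : (\forall w \ae mu, f w = 0) -> norm1 mu f = 0.
Proof.
move=> f0; rewrite (norm1_ae (g := cst 0))// /norm1.
by under eq_integral do rewrite normr0; rewrite integral0.
Qed.

Lemma contractionB K f g : L1_contraction K -> inL1 mu f -> inL1 mu g ->
  \forall w \ae mu, K (f \- g) w = K f w - K g w.
Proof.
move=> [_ lK _ _] lf lg; have := lK (-1) g f lg lf.
rewrite (_ : (fun w => -1 *: g w + f w) = f \- g); last first.
  by apply/funext => w; rewrite scaleN1r addrC.
by apply: filterS => w ->; rewrite scaleN1r addrC.
Qed.

Lemma L1_contraction_dist K f g : L1_contraction K -> inL1 mu f -> inL1 mu g ->
  norm1 mu (K f \- K g) <= norm1 mu (f \- g).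
Proof.
move=> cK lf lg; have [_ _ nK _] := cK.
rewrite -(norm1_ae (contractionB cK lf lg)); apply: nK; exact: inL1B.
Qed.

(** Compatibility with equality almost everywhere follows from linearity and the norm bound. *)
Lemma contraction_ae K f g : L1_contraction K -> inL1 mu f -> inL1 mu g ->
  (\forall w \ae mu, f w = g w) -> \forall w \ae mu, K f w = K g w.
Proof.
move=> cK lf lg fg; have [iK _ _ _] := cK; apply: norm1_eqP; [exact: iK|exact: iK|].
apply/eqP; rewrite eq_le norm1_ge0 andbT.
apply: le_trans (L1_contraction_dist cK lf lg) _; rewrite norm1_eq0_ae//.
by apply: filterS fg => w /= ->; rewrite subrr.
Qed.

Lemma contraction0 K : L1_contraction K -> \forall w \ae mu, K (cst 0) w = 0.
Proof.
move=> cK; have l0 := @inL1_cst _ X _ _ mu 0.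
have := contractionB cK l0 l0; rewrite (_ : cst 0 \- cst 0 = cst 0).
  by apply: filterS => w ->; rewrite subrr.
by apply/funext => w; rewrite /= subrr.
Qed.

Lemma contractionZ K f (a : R) : L1_contraction K -> inL1 mu f ->
  \forall w \ae mu, K (fun w => a *: f w) w = a *: K f w.
Proof.
move=> cK lf; have [_ lK _ _] := cK; have l0 := @inL1_cst _ X _ _ mu 0.
have := lK a f (cst 0) lf l0.
rewrite (_ : (fun w => a *: f w + cst 0 w) = (fun w => a *: f w)); last first.
  by apply/funext => w; rewrite addr0.
by apply: filterS2 (contraction0 cK) => w -> ->; rewrite addr0.
Qed.

Lemma contractionD K f g : L1_contraction K -> inL1 mu f -> inL1 mu g ->
  \forall w \ae mu, K (f \+ g) w = K f w + K g w.
Proof.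
move=> [_ lK _ _] lf lg; have := lK 1 f g lf lg.
rewrite (_ : (fun w => 1 *: f w + g w) = f \+ g); last first.
  by apply/funext => w; rewrite scale1r.
by apply: filterS => w ->; rewrite scale1r.
Qed.

Lemma contraction_sum K (f : nat -> W -> X) n : L1_contraction K -> (forall i, inL1 mu (f i)) ->
  \forall w \ae mu, K (fun w => \sum_(i < n) f i w) w = \sum_(i < n) K (f i) w.
Proof.
move=> cK lf; elim: n => [|n ih].
  have := contraction0 cK; rewrite (_ : (fun w => _) = cst 0).
    by apply: filterS => w ->; rewrite big_ord0.
  by apply/funext => w; rewrite big_ord0.
rewrite (_ : (fun w => _) = (fun w => \sum_(i < n) f i w) \+ f n); last first.
  by apply/funext => w; rewrite big_ord_recr.
have ln : inL1 mu (fun w => \sum_(i < n) f i w) by exact: inL1_sum.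
have := contractionD cK ln (lf n).
by apply: filterS2 ih => w e ->; rewrite e big_ord_recr.
Qed.

Lemma contraction_comp K L : L1_contraction K -> L1_contraction L -> L1_contraction (K \o L).
Proof.
move=> cK cL; have [iK lK nK bK] := cK; have [iL lL nL bL] := cL.
split => [f /iL/iK //|a f g lf lg|f lf|f M lf /(bL _ _ lf)]; last exact/bK/iL.
  have h1 := lL a f g lf lg.
  have l1 : inL1 mu (fun w => a *: f w + g w) by exact: inL1D (inL1Z a lf) lg.
  have l2 : inL1 mu (fun w => a *: L f w + L g w).
    exact: inL1D (inL1Z a (iL _ lf)) (iL _ lg).
  have h2 := contraction_ae cK (iL _ l1) l2 h1.
  by apply: filterS2 h2 (lK a _ _ (iL _ lf) (iL _ lg)) => w /= -> ->.
exact: le_trans (nK _ (iL _ lf)) (nL _ lf).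
Qed.

End contractions.

Section semigroups.
Context {R : realType} {X : completeNormedModType R} {d : measure_display}
  {W : measurableType d} (mu : {finite_measure set W -> \bar R}).
Implicit Types (f g h : W -> X) (s t : R).

Definition contraction_semigroup (S : R -> (W -> X) -> W -> X) :=
  [/\ forall t, 0 <= t -> L1_contraction mu (S t),
      forall f, inL1 mu f -> \forall w \ae mu, S 0 f w = f w,
      forall s t f, 0 < s -> 0 < t -> inL1 mu f ->
        \forall w \ae mu, S s (S t f) w = S (s + t) f w &
      forall t f (eps : R), 0 < t -> inL1 mu f -> 0 < eps ->
        exists2 delta, 0 < delta & forall s, 0 < s -> `|s - t| < delta ->
          norm1 mu (S s f \- S t f) < eps].

(** [S t f] is a chosen representative of the class [T t f], for each pair [(t, f)]. The bound [M]
    in [L1_contraction] may have any sign while the [L_oo] norm is nonnegative, hence the detour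
    through [Num.max M 0]. *)
Lemma semigroup_rep (T : R -> (W -> X) -> W -> X) :
  strongly_continuous_semigroup mu T ->
  (forall t, 0 <= t -> L1_Linfty_contraction mu (T t)) ->
  exists2 S, contraction_semigroup S &
    forall t f, 0 <= t -> inL1 mu f -> \forall w \ae mu, T t f w = S t f w.
Proof.
move=> [linT T0 TD Tc] cT.
have /choice[S hS] : forall tf : R * (W -> X), exists g,
    Lp mu 1 (T tf.1 tf.2) -> inL1 mu g /\ \forall w \ae mu, T tf.1 tf.2 w = g w.
  move=> tf; have [/Lp1P[g lg hg]|nL] := pselect (Lp mu 1 (T tf.1 tf.2)).
    by exists g.
  by exists (cst 0).
have TL t f : 0 <= t -> inL1 mu f -> Lp mu 1 (T t f).
  by move=> /linT[h _ _] /inL1_Lp/h.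
have lS t f : 0 <= t -> inL1 mu f -> inL1 mu (S (t, f)).
  by move=> t0 lf; case: (hS (t, f) (TL _ _ t0 lf)).
have TS t f : 0 <= t -> inL1 mu f -> \forall w \ae mu, T t f w = S (t, f) w.
  by move=> t0 lf; case: (hS (t, f) (TL _ _ t0 lf)).
exists (fun t f => S (t, f)) => //; split => [t t0|f lf|s t f s0 t0 lf|t f eps t0 lf e0].
- have [_ cp lin] := linT _ t0; split => [f lf|a f g lf lg|f lf|f M lf fM].
  + exact: lS.
  + have h := lin a _ _ (inL1_Lp lf) (inL1_Lp lg).
    have l1 : inL1 mu (fun w => a *: f w + g w) by exact: inL1D (inL1Z a lf) lg.
    have h1 := TS t _ t0 l1; have h2 := TS t _ t0 lf; have h3 := TS t _ t0 lg.
    near=> w.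
    have <- : T t (fun w => a *: f w + g w) w = S (t, fun w => a *: f w + g w) w by near: w.
    have <- : T t f w = S (t, f) w by near: w.
    have <- : T t g w = S (t, g) w by near: w.
    by near: w; apply: filterS h => w' ->.
  + have [h _] := cT _ t0 _ (inL1_Lp lf).
    rewrite -(norm1_ae (TS t f t0 lf)) -lee_fin -!norm1_Xnorm//; first exact: inL1_Lp.
    exact: TL.
  + have M0 : (\forall w \ae mu, `|f w| <= Num.max M 0).
      by apply: filterS fM => w h; rewrite le_max h.
    have [_ h] := cT _ t0 _ (inL1_Lp lf).
    have m0 : 0 <= Num.max M 0 by rewrite le_max lexx orbT.
    have := le_trans h ((Xnorm_inftyP mu f m0).2 M0).
    move=> /(Xnorm_inftyP mu _ m0) h1.
    have := TS t f t0 lf; apply: filterS3 h1 fM => w h1 fM h2; rewrite -h2.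
    by move: h1; rewrite max_l// (le_trans _ fM).
- by apply: filterS2 (TS 0 f (lexx _) lf) (T0 _ (inL1_Lp lf)) => w <- ->.
- have s0' := ltW s0; have t0' := ltW t0.
  have [_ cp _] := linT _ s0'.
  have h1 : T s (T t f) = T s (S (t, f)) %[ae mu].
    apply: cp; [exact: TL|exact/inL1_Lp/lS|].
    by apply: filterS (TS _ _ t0' lf) => w ->.
  have h2 := TS s _ s0' (lS _ _ t0' lf).
  have h3 := TS (s + t) _ (addr_ge0 s0' t0') lf.
  have h4 := TD s t _ s0 t0 (inL1_Lp lf).
  have h1' : \forall w \ae mu, T s (S (t, f)) w = T s (T t f) w.
    by apply: filterS h1 => w ->.
  near=> w.
  have <- : T s (S (t, f)) w = S (s, S (t, f)) w by near: w.
  have <- : T (s + t) f w = S (s + t, f) w by near: w.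
  have <- : T s (T t f) w = T (s + t) f w by near: w; apply: filterS h4 => w' ->.
  by near: w; exact: h1'.
- have := Tc _ _ t0 (inL1_Lp lf) => /fine_cvgP[_] /cvgrPdist_lt/(_ _ e0) /nbhs_ballP[r /= r0 hr].
  exists r => // s s0 st; have := hr s; rewrite /ball/= sub0r normrN distrC => /(_ st).
  have TLs := TL _ _ (ltW s0) lf; have TLt := TL _ _ (ltW t0) lf.
  apply: le_lt_trans; apply: le_trans (ler_norm _).
  rewrite /comp Xnorm1E -/(norm1 mu _).
  rewrite (@norm1_ae _ _ _ _ _ (S (s, f) \- S (t, f)) (T s f \- T t f))//.
  by apply: filterS2 (TS s f (ltW s0) lf) (TS t f (ltW t0) lf) => w /= -> ->.
Unshelve. all: by end_near. Qed.

Variable S : R -> (W -> X) -> W -> X.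
Hypothesis sgS : contraction_semigroup S.

Lemma semigroup_contraction t : 0 <= t -> L1_contraction mu (S t).
Proof. by move=> t0; case: sgS => h _ _ _; exact: h. Qed.

Lemma semigroup_inL1 t f : 0 <= t -> inL1 mu f -> inL1 mu (S t f).
Proof. by move=> t0; case: (semigroup_contraction t0) => h _ _ _; exact: h. Qed.

Lemma semigroup_norm1 t f : 0 <= t -> inL1 mu f -> norm1 mu (S t f) <= norm1 mu f.
Proof. by move=> t0; case: (semigroup_contraction t0) => _ _ h _; exact: h. Qed.

Lemma semigroupD s t f : 0 <= s -> 0 <= t -> inL1 mu f ->
  \forall w \ae mu, S s (S t f) w = S (s + t) f w.
Proof.
move=> s0 t0 lf; have [_ S0 SD _] := sgS.
move: s0; rewrite le_eqVlt => /orP[/eqP <-|s0].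
  by rewrite add0r; apply: S0; exact: semigroup_inL1.
move: t0; rewrite le_eqVlt => /orP[/eqP <-|t0]; last exact: SD.
rewrite addr0; apply: contraction_ae (S0 _ lf) => //.
- exact/semigroup_contraction/ltW.
- exact: semigroup_inL1.
Qed.

(** The contraction [S (t - t0)] carries the increment from [t0] to [t0 + h] to that from [t] to
    [t + h]: continuity at the single time [t0] is uniform to the right of [t0]. *)
Lemma semigroup_unif t0 f (eps : R) : 0 < t0 -> inL1 mu f -> 0 < eps ->
  exists2 delta, 0 < delta & forall t (h : R), t0 <= t -> 0 <= h < delta ->
    norm1 mu (S (t + h) f \- S t f) < eps.
Proof.
move=> t00 lf e0; have [_ _ _ Sc] := sgS; have [r r0 hr] := Sc _ _ _ t00 lf e0.
exists r => // t h tt /andP[h0 hh].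
have th : 0 < t0 + h by rewrite ltr_wpDr.
have h1 := hr _ th; rewrite addrAC subrr add0r ger0_norm// in h1.
have tt0 : 0 <= t - t0 by rewrite subr_ge0.
have l1 := semigroup_inL1 (ltW th) lf; have l2 := semigroup_inL1 (ltW t00) lf.
have := L1_contraction_dist (semigroup_contraction tt0) l1 l2.
have e1 := semigroupD tt0 (ltW th) lf; have e2 := semigroupD tt0 (ltW t00) lf.
rewrite addrA subrK in e1; rewrite subrK in e2.
rewrite (@norm1_ae _ _ _ _ _ _ (S (t + h) f \- S t f)).
  by move/le_lt_trans; apply; exact: h1.
by apply: filterS2 e1 e2 => w /= -> ->.
Qed.

(** At stage [k] times are rounded up on a grid so fine that the [L_1] error is at most [4^-k] for
    all times from [2^-k] on. The rounded functions are jointly measurable and, for fixed [t > 0],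
    converge almost everywhere. *)
Lemma semigroup_joint f : inL1 mu f ->
  exists2 G : measurableTypeR R * W -> X, smeas G &
    forall t, 0 < t -> \forall w \ae mu, G (t, w) = S t f w.
Proof.
move=> lf.
have /choice[n hn] : forall k : nat, exists n : nat, forall t (h : R), (2^-1) ^+ k <= t ->
    0 <= h < (2^-1) ^+ n -> norm1 mu (S (t + h) f \- S t f) <= (4^-1) ^+ k.
  move=> k; have t0 : 0 < (2^-1 : R) ^+ k by rewrite exprn_gt0// invr_gt0.
  have e0 : 0 < (4^-1 : R) ^+ k by rewrite exprn_gt0// invr_gt0.
  have [r r0 hr] := semigroup_unif t0 lf e0.
  have c2 : ((2^-1 : R) ^+ k) @[k --> \oo] --> (0 : R).
    by apply: cvg_expr; rewrite ger0_norm ?invr_ge0// invf_lt1// ltr1n.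
  have [m _ hm] := cvgr_lt _ c2 _ r0; exists m => t h tt /andP[h0 hh].
  by apply/ltW/hr => //; rewrite h0 (lt_trans hh)//; exact: (hm m (leqnn m)).
pose h (k : nat) (z : measurableTypeR R * W) :=
  S ((dyadic_ceil (n k) z.1)%:R / 2 ^+ n k) f z.2.
have lh k j : inL1 mu (S (j%:R / 2 ^+ n k) f).
  by apply: semigroup_inL1 => //; rewrite divr_ge0.
have mh k : smeas (h k).
  apply: (@smeas_pieces _ _ _ _ _ _ (fun j => S (j%:R / 2 ^+ n k) f) (dyadic_ceil (n k))).
    by move=> j; case: (lh k j).
  exact: measurable_dyadic_ceil.
have [G mG hG] := smeas_limit mh; exists G => // t t0.
have c2 : ((2^-1 : R) ^+ k) @[k --> \oo] --> (0 : R).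
  by apply: cvg_expr; rewrite ger0_norm ?invr_ge0// invf_lt1// ltr1n.
(* From stage [m] on, [t] exceeds [2^-k] and the estimate [hn] applies; the earlier stages are
   skipped by a shift. *)
have [m _ hm] := cvgr_lt _ c2 _ t0.
have ae : \forall w \ae mu, h (k + m)%N (t, w) @[k --> \oo] --> S t f w.
  apply: (@fast_ae_cvg _ _ _ _ mu (fun k w => h (k + m)%N (t, w))).
  - by move=> k; exact: (lh (k + m)%N (dyadic_ceil (n (k + m)%N) t)).
  - exact: semigroup_inL1 (ltW t0) lf.
  - move=> k; have /andP[c1 c3] := dyadic_ceil_itv (n (k + m)%N) t0.
    have := hn (k + m)%N t ((dyadic_ceil (n (k + m)%N) t)%:R / 2 ^+ n (k + m)%N - t).
    rewrite (addrC t) subrK => /(_ (ltW (hm _ (leq_addl _ _)))).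
    rewrite subr_ge0 c1 ltrBlDl c3 => /(_ isT)/le_trans; apply.
    by rewrite exprD ler_piMr// ?exprn_ge0 ?invr_ge0// exprn_ile1 ?invr_ge0// invf_le1// ler1n.
apply: filterS ae => w cw.
have cw' : h k (t, w) @[k --> \oo] --> S t f w by rewrite -(@cvg_shiftn m _ (fun k => h k (t, w))).
exact: (cvg_unique _ (hG (t, w) (cvgP _ cw')) cw').
Qed.

End semigroups.

(** * Integrals in time and their Riemann sums *)

Section time_integrals.
Context {R : realType} {X : completeNormedModType R}.
Local Notation lam := (@lebesgue_measure R).
Implicit Types (g : measurableTypeR R -> X) (a b c h : R).

Lemma bochner_integral_null d (T : measurableType d) (mu : {measure set T -> \bar R}) D
    (f : T -> X) : measurable D -> mu D = 0%E -> norm_integrable mu D f ->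
  bochner_integral mu D f = 0.
Proof.
move=> mD D0 lf; have Doo : (mu D < +oo)%E by rewrite D0.
apply: dual_separates => x' dx; rewrite (bochner_integral_dual mD Doo lf dx) (dual0 dx).
rewrite /Rintegral (_ : (\int[mu]_(w in D) (x' (f w))%:E = 0)%E)//.
apply: null_set_integral => //.
by have /integrableP[] := integrable_dual mD dx lf.
Qed.

Lemma lam_itv_oc a b : a <= b -> lam `]a, b]%classic = (b - a)%:E.
Proof.
rewrite le_eqVlt => /orP[/eqP ->|ab]; rewrite lebesgue_measure_itv/= lte_fin.
  by rewrite ltxx subrr.
by rewrite ab.
Qed.

Lemma lam_itv_cc c : 0 <= c -> lam `[0, c]%classic = c%:E.
Proof.
rewrite le_eqVlt => /orP[/eqP <-|c0]; rewrite lebesgue_measure_itv/= lte_fin.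
  by rewrite ltxx.
by rewrite c0 -EFinB subr0.
Qed.

Lemma fine_le_id (x : \bar R) : (0 <= x -> (fine x)%:E <= x)%E.
Proof. by case: x => [r| |]. Qed.

Lemma itv_ccD a b : 0 <= a -> `[0, b]%classic `\` `[0, a]%classic = `]a, b]%classic :> set R.
Proof.
move=> a0; apply/seteqP; split => t /=; rewrite !in_itv /=.
  by move=> [/andP[t0 tb]] /negP; rewrite t0/= -ltNge => ->.
move=> /andP[at_ tb]; rewrite tb (le_trans a0 (ltW at_)); split => //.
by apply/negP; rewrite -ltNge.
Qed.

Lemma bochner_integral_itv_dist g a b x : 0 <= a -> a <= b ->
  norm_integrable lam `[0, b]%classic g ->
  ((`|bochner_integral lam `[0, b] g - bochner_integral lam `[0, a] g - (b - a) *: x|)%:E <=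
   \int[lam]_(t in `]a, b]%classic) (`|g t - x|)%:E)%E.
Proof.
move=> a0 ab lg.
have Doo : (lam `[0%R, b]%classic < +oo)%E by rewrite lam_itv_cc ?ltry// (le_trans a0).
have sub : `[0, a]%classic `<=` (`[0, b]%classic : set R).
  by move=> t /=; rewrite !in_itv /= => /andP[-> ta]; exact: le_trans ab.
have := @bochner_integral_setD _ _ _ _ lam _ _ g x (measurable_itv _) Doo (measurable_itv _) sub lg.
rewrite (itv_ccD _ a0) (congr1 fine (lam_itv_oc ab)) => h.
apply: (@le_trans _ _ (fine (\int[lam]_(t in `]a, b]%classic) (`|g t - x|)%:E))%:E) => //.
by apply: fine_le_id; apply: integral_ge0.
Qed.

Definition itv_step h (i : nat) : set R := `]i%:R * h, i.+1%:R * h]%classic.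

(** The values [x i] are arbitrary, and the error is bounded by scalar integrals step by step;
    measurability in [w] can then be discussed for the bound in place of the vector integral. *)
Lemma riemann_dist g (x : nat -> X) h q : 0 < h ->
  (forall c, norm_integrable lam `[0, c]%classic g) ->
  ((`|bochner_integral lam `[0, q%:R * h] g - h *: \sum_(i < q) x i|)%:E <=
   \sum_(i < q) \int[lam]_(t in itv_step h i) (`|g t - x i|)%:E)%E.
Proof.
move=> h0 lg; elim: q => [|q ih].
  rewrite !big_ord0 scaler0 subr0 mul0r bochner_integral_null ?normr0//.
  exact: (lam_itv_cc (lexx 0)).
rewrite !big_ord_recr /=.
have q0 : 0 <= q%:R * h by rewrite mulr_ge0// ltW.
have qq : q%:R * h <= q.+1%:R * h by rewrite ler_wpM2r ?ler_nat// ltW.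
have := bochner_integral_itv_dist (x q) q0 qq (lg _).
rewrite -mulrBl -natrB// subSnn mul1r => h1.
apply: le_trans (leeD ih h1); rewrite -EFinD lee_fin scalerDr.
apply: le_trans (ler_normD _ _); rewrite le_eqVlt; apply/orP; left; apply/eqP; congr (`|_|).
have subr_telescope (u v y z : X) : u - (y + z) = v - y + (u - v - z).
  by rewrite (addrAC u) [RHS]addrC subrKA opprD addrA addrAC.
exact: subr_telescope.
Qed.

End time_integrals.

#[global] Instance ae_lebesgue_filter {R : realType} :
  Filter (nbhs (almost_everywhere (@lebesgue_measure R))).
Proof. exact: (@ae_filter_ringOfSetsType _ (measurableTypeR R) R (@lebesgue_measure R)). Qed.

Section average_processes.
Context {R : realType} {X : completeNormedModType R} {d : measure_display}
  {W : measurableType d} (mu : {finite_measure set W -> \bar R}).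
Local Notation lam := (@lebesgue_measure R).
Variable S : R -> (W -> X) -> W -> X.
Hypothesis sgS : contraction_semigroup mu S.
Implicit Types (f g : W -> X) (s t c : R) (G : measurableTypeR R * W -> X).

Definition dyadic (k i : nat) : R := i%:R * (2^-1) ^+ k.

Lemma dyadic_ge0 k i : 0 <= dyadic k i.
Proof. by rewrite mulr_ge0// exprn_ge0// invr_ge0. Qed.

Lemma dyadic_gt0 k i : (0 < i)%N -> 0 < dyadic k i.
Proof. by move=> i0; rewrite mulr_gt0 ?ltr0n// exprn_gt0// invr_gt0. Qed.

Lemma dyadic_refine k j i : dyadic (k + j) (i * 2 ^ j) = dyadic k i.
Proof.
by rewrite /dyadic natrM natrX exprD mulrACA -exprMn mulfV// expr1n mulr1.
Qed.

Lemma dyadicD k i j : dyadic k i + dyadic k j = dyadic k (i + j).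
Proof. by rewrite /dyadic natrD mulrDl. Qed.

(** Right endpoints are sampled, so only times [> 0] occur. *)
Definition riemann f (k q : nat) : W -> X :=
  fun w => (2^-1) ^+ k *: \sum_(i < q) S (dyadic k i.+1) f w.

Lemma semigroup_dyadic_inL1 f k i : inL1 mu f -> inL1 mu (S (dyadic k i) f).
Proof. by apply: (semigroup_inL1 sgS); exact: dyadic_ge0. Qed.

Lemma riemann_inL1 f k q : inL1 mu f -> inL1 mu (riemann f k q).
Proof.
by move=> lf; apply: inL1Z; apply: inL1_sum => i; exact: semigroup_dyadic_inL1.
Qed.

(** Equality for almost every time: an everywhere measurable version of a jointly measurable choice
    of representatives agrees with that choice, by Fubini's theorem, for almost every [t]. *)
Definition represents G f := smeas G /\
  \forall t \ae lam, 0 <= t -> \forall w \ae mu, G (t, w) = S t f w.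

Lemma integral_norm_represents G f g (D : set (measurableTypeR R)) (c : R) : represents G f -> inL1 mu f -> inL1 mu g ->
  measurable D -> (forall t : R, D t -> 0 <= t) ->
  (forall t, D t -> norm1 mu (S t f \- g) <= c) ->
  measurable_fun setT (fun w => \int[lam]_(t in D) (`|G (t, w) - g w|)%:E)%E /\
  (\int[mu]_w \int[lam]_(t in D) (`|G (t, w) - g w|)%:E <= c%:E * lam D)%E.
Proof.
move=> [mG GS] lf lg mD D0 hc.
have mG' : smeas (fun z : measurableTypeR R * W => G z - g z.2).
  by apply: smeasB => //; apply: smeas_comp (lg.1); exact: measurable_snd.
have [h ->] := tonelli_norm lam mu mG' mD; split => //=.
have [D00|c0] := pselect (D = set0).
  by rewrite D00 integral_set0 measure0 mule0.
have {}c0 : 0 <= c.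
  have /set0P[t Dt] : D != set0 by apply/eqP.
  exact: le_trans (norm1_ge0 _ _) (hc t Dt).
rewrite -(integral_cst lam mD).
apply: ge0_ae_le_integral; [by []|by move=> t; exact: integral_ge0|by move=> t; rewrite lee_fin|].
apply: filterS GS => t Gt Dt; have t0 := D0 _ Dt.
apply: (@le_trans _ _ (norm1 mu (S t f \- g))%:E); last by rewrite lee_fin hc.
rewrite norm1E; last by apply: inL1B => //; exact: (semigroup_inL1 sgS).
by apply: ge0_ae_le_integral => //; apply: filterS (Gt t0) => w -> _.
Qed.

(** Integrability on the intervals [[0, n]] costs countably many null sets and covers all [c]. *)
Lemma represents_integrable G f : represents G f -> inL1 mu f ->
  \forall w \ae mu, forall c, norm_integrable lam `[0, c]%classic (fun t => G (t, w)).
Proof.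
move=> rG lf; have l0 := @inL1_cst _ X _ _ mu 0.
have : \forall w \ae mu, forall n : nat,
    (\int[lam]_(t in `[0%R, n%:R]%classic) (`|G (t, w)|)%:E < +oo)%E.
  apply: ae_foralln => n.
  have sub (t : R) : (`[0, n%:R]%classic : set R) t -> 0 <= t.
    by rewrite /= in_itv /= => /andP[].
  have [|mh h] := integral_norm_represents rG lf l0 (measurable_itv _) sub
      (c := norm1 mu f).
    move=> t Dt; rewrite (@norm1_ae _ _ _ _ _ _ (S t f)); last first.
      by apply: nearW => w; rewrite /= subr0.
    by apply: (semigroup_norm1 sgS) => //; exact: sub Dt.
  have hoo : (\int[mu]_w \int[lam]_(t in `[0%R, n%:R]%classic) (`|G (t, w) - cst 0 w|)%:E < +oo)%E.
    by apply: le_lt_trans h _; rewrite (lam_itv_cc (ler0n _ _)) -EFinM ltry.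
  have i0 w : (0 <= \int[lam]_(t in `[0%R, n%:R]%classic) (`|G (t, w) - cst 0 w|)%:E)%E.
    exact: integral_ge0.
  have : mu.-integrable setT
      (fun w => \int[lam]_(t in `[0%R, n%:R]%classic) (`|G (t, w) - cst 0 w|)%:E)%E.
    by apply/integrableP; split => //; under eq_integral do rewrite gee0_abs//.
  move/(integrable_ae measurableT); apply: filterS => w /(_ I).
  rewrite ge0_fin_numE//.
  by under eq_integral do rewrite subr0.
apply: filterS => w hw c; split; first exact: smeas_slice1 rG.1.
have [n cn] : exists n : nat, c <= n%:R.
  exists (Num.bound `|c|).
  exact: le_trans (ler_norm _) (ltW (archi_boundP (normr_ge0 c))).
apply: le_lt_trans (hw n); apply: ge0_subset_integral => //.
- by apply/measurable_funTS; apply: smeas_normE; exact: smeas_slice1 rG.1.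
- by move=> t /=; rewrite !in_itv /= => /andP[-> tc]; exact: le_trans cn.
Qed.

Lemma sum_lt_ord (n q : nat) : (\sum_(i < q) (i < n) <= n)%N.
Proof.
suff -> : (\sum_(i < q) (i < n) = minn q n)%N by exact: geq_minr.
elim: q => [|q ih]; first by rewrite big_ord0 min0n.
rewrite big_ord_recr /= ih.
have [qn|] := boolP (q < n)%N; first by rewrite (minn_idPl (ltnW qn)) (minn_idPl qn) addn1.
by rewrite -leqNgt => qn; rewrite (minn_idPr qn) (minn_idPr (leqW qn)) addn0.
Qed.

Lemma expr2V_small (eps : R) : 0 < eps -> exists J, forall k, (J <= k)%N -> (2^-1) ^+ k < eps.
Proof.
move=> e0; have c2 : ((2^-1 : R) ^+ k) @[k --> \oo] --> (0 : R).
  by apply: cvg_expr; rewrite ger0_norm ?invr_ge0// invf_lt1// ltr1n.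
by have [J _ h] := cvgr_lt _ c2 _ e0; exists J => k /h.
Qed.

(** Steps beyond time [2^-M] are handled by [semigroup_unif]. The first [2^(k - M)] steps, near time
    0, are estimated by the size of [f]; their total length is only [2^-M]. *)
Lemma integral_steps_small G f (l m : nat) (eps : R) : represents G f -> inL1 mu f ->
  (0 < m)%N -> 0 < eps -> exists J, forall j, (J <= j)%N ->
  (forall i, measurable_fun setT (fun w =>
     \int[lam]_(t in itv_step ((2^-1) ^+ (l + j)) i)
       (`|G (t, w) - S (dyadic (l + j) i.+1) f w|)%:E)%E) /\
  (\sum_(i < m * 2 ^ j) \int[mu]_w
    \int[lam]_(t in itv_step ((2^-1)%R ^+ (l + j)) i)
      (`|G (t, w) - S (dyadic (l + j) i.+1) f w|)%:E <= eps%:E)%E.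
Proof.
move=> rG lf m0 e0; set N := norm1 mu f; have N0 : 0 <= N := norm1_ge0 _ _.
pose c := dyadic l m; have c0 : 0 < c := dyadic_gt0 l m0.
have N1 : 0 < eps / (4 * (N + 1)) by rewrite divr_gt0// mulr_gt0// ltr_wpDl.
have [M hM] := expr2V_small N1; have {}hM := hM _ (leqnn M).
have t0 : 0 < (2^-1 : R) ^+ M by rewrite exprn_gt0// invr_gt0.
have ec : 0 < eps / (2 * c) by rewrite divr_gt0// mulr_gt0.
have [r r0 hr] := semigroup_unif sgS t0 lf ec.
have [J hJ] := expr2V_small r0; exists (maxn J M) => j; rewrite geq_max => /andP[Jj Mj].
set k := (l + j)%N; have Mk : (M <= k)%N by rewrite (leq_trans Mj)// leq_addl.
have hk : (2^-1) ^+ k < r by apply: hJ; rewrite (leq_trans Jj)// leq_addl.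
set h := (2^-1 : R) ^+ k in hk *; have h0 : 0 < h by rewrite exprn_gt0// invr_gt0.
have hq : (2 ^ (k - M))%:R * h = (2^-1) ^+ M.
  have := dyadic_refine M (k - M) 1; rewrite subnKC// mul1n /dyadic mul1r => ->.
  by [].
(* The first term, over the total length [c], gives [eps / 2]. The second occurs over the length
   [2^-M] and gives at most [eps / 2] by the choice of [M]. *)
pose e i : R := eps / (2 * c) + (i < 2 ^ (k - M))%N%:R * (2 * N).
have key i : measurable_fun setT (fun w => \int[lam]_(t in itv_step h i)
      (`|G (t, w) - S (dyadic k i.+1) f w|)%:E)%E /\
    (\int[mu]_w \int[lam]_(t in itv_step h i) (`|G (t, w) - S (dyadic k i.+1) f w|)%:E
      <= (e i * h)%:E)%E.
  have ih : 0 <= i%:R * h by rewrite mulr_ge0// ltW.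
  have sub (t : R) : itv_step h i t -> 0 <= t.
    by rewrite /itv_step /= in_itv /= => /andP[/ltW ht _]; exact: le_trans ht.
  have ls := semigroup_dyadic_inL1 k i.+1 lf.
  have [||mh hh] := integral_norm_represents (c := e i) rG lf ls _ sub.
  - exact: measurable_itv.
  - move=> t Dt; have t1 := sub _ Dt; rewrite /e.
    move: Dt; rewrite /itv_step /= in_itv /= => /andP[ht th].
    case: (ltnP i (2 ^ (k - M))) => iM.
      apply: le_trans (norm1B (semigroup_inL1 sgS t1 lf) ls) _.
      have s1 := semigroup_norm1 sgS t1 lf.
      have s2 := semigroup_norm1 sgS (dyadic_ge0 k i.+1) lf.
      by move: s1 s2 (ltW ec); rewrite mul1r /N; lra.
    rewrite mul0r addr0 norm1_sym.
    have -> : dyadic k i.+1 = t + (i.+1%:R * h - t) by rewrite addrC subrK.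
    apply/ltW/hr.
      rewrite -hq; apply: le_trans (ltW ht); rewrite ler_wpM2r ?ler_nat//; exact: ltW.
    rewrite subr_ge0 th; apply: le_lt_trans hk.
    by rewrite lerBlDr -natr1 mulrDl mul1r addrC lerD2l ltW.
  split => //; apply: le_trans hh _; rewrite /itv_step lam_itv_oc.
    by rewrite -mulrBl -natrB// subSnn mul1r EFinM.
  by rewrite ler_wpM2r ?ler_nat// ltW.
split => [i|]; first by case: (key i).
apply: (@le_trans _ _ (\sum_(i < m * 2 ^ j) (e i * h)%:E)%E).
  by apply: lee_sum => i _; case: (key i).
rewrite sumEFin lee_fin -mulr_suml big_split /= sumr_const card_ord -mulr_suml mulrDl.
have -> : (eps / (2 * c)) *+ (m * 2 ^ j) * h = eps / 2.
  rewrite -mulr_natr -mulrA -[_ * h]/(dyadic k (m * 2 ^ j)) dyadic_refine -/c.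
  by field; rewrite gt_eqF.
have -> : \sum_(i < m * 2 ^ j) (i < 2 ^ (k - M))%N%:R =
    (\sum_(i < m * 2 ^ j) (i < 2 ^ (k - M)))%N%:R :> R by rewrite natr_sum.
have := sum_lt_ord (2 ^ (k - M)) (m * 2 ^ j); rewrite -(ler_nat R).
move: (_%:R : R) => a; move: hq; set b := _%:R => hq ab.
have abh : a * h <= (2^-1) ^+ M by rewrite -hq ler_wpM2r// ltW.
have : a * (2 * N) * h <= (2^-1) ^+ M * (2 * N).
  by rewrite mulrAC ler_wpM2r// mulr_ge0.
have : (2^-1) ^+ M * (2 * N) <= eps / (4 * (N + 1)) * (2 * N).
  by rewrite ler_wpM2r// ?mulr_ge0// ltW.
have : eps / (4 * (N + 1)) * (2 * N) <= eps / 2.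
  rewrite mulrAC ler_pdivrMr ?mulr_gt0 ?ltr_wpDl//.
  by nra.
lra.
Qed.

End average_processes.

Lemma le_fine_id {R : realDomainType} (x : \bar R) (c : R) :
  (0 <= x)%E -> (x <= c%:E)%E -> fine x <= c.
Proof. by case: x => [r| |] //= _; rewrite lee_fin. Qed.

Section time_continuity.
Context {R : realType} {X : completeNormedModType R}.
Local Notation lam := (@lebesgue_measure R).

(** Increments are dominated by those of the integral of the scalar function [|g|], which is
    continuous in its endpoint. *)
Lemma bochner_integral_continuous (g : measurableTypeR R -> X) (t : R) : 0 < t ->
  (forall c : R, norm_integrable lam `[0, c]%classic g) ->
  bochner_integral lam `[0, s] g @[s --> t] --> bochner_integral lam `[0, t] g.
Proof.
move=> t0 lg; pose phi (s : R) := parameterized_integral lam 0 s (fun s => `|g s|).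
have mg : measurable_fun setT (fun s => (`|g s|)%:E) := smeas_normE (lg 0).1.
have t1 : 0 < t + 1 by rewrite addr_gt0.
have intg : lam.-integrable `[0, t + 1] (EFin \o (fun s => `|g s|)).
  apply/integrableP; split; first exact/measurable_funTS.
  by under eq_integral do rewrite /= normr_id; exact: (lg _).2.
have cphi : phi s @[s --> t] --> phi t.
  have /(continuous_within_itvP _ t1)[h _ _] := parameterized_integral_continuous (ltW t1) intg.
  by apply: h; rewrite in_itv /= t0 ltrDl ltr01.
have itvU a b : 0 <= a -> a <= b -> (`[0, b]%classic : set R) = `[0, a]%classic `|` `]a, b]%classic.
  move=> a0 ab; apply/seteqP; split => s /=; rewrite !in_itv /=.
    by move=> /andP[s0 sb]; case: (leP s a) => sa; [left; rewrite s0|right].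
  by move=> [/andP[-> sa]|/andP[as_ ->]]; rewrite ?andbT; [exact: le_trans ab|exact: ltW (le_lt_trans a0 as_)].
have fin c : (\int[lam]_(s in `[0%R, c]%classic) (`|g s|)%:E)%E \is a fin_num.
  exact: norm_integrable_fin (lg c).
have dist a b : 0 <= a -> a <= b ->
    `|bochner_integral lam `[0, b] g - bochner_integral lam `[0, a] g| <= phi b - phi a.
  move=> a0 ab; have := bochner_integral_itv_dist 0 a0 ab (lg b).
  rewrite scaler0 subr0; under eq_integral do rewrite subr0.
  move: (`|_ - bochner_integral lam `[0, a] g|) => z h.
  rewrite lerBrDr -lee_fin EFinD /phi /parameterized_integral /Rintegral !fineK//.
  rewrite (itvU a b a0 ab) ge0_integral_setU//; first by rewrite addeC; exact: leeD2l h.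
  - exact/measurable_funTS.
  - rewrite /disj_set; apply/eqP/seteqP; split => // s /=; rewrite !in_itv /=.
    by move=> [/andP[_ sa] /andP[as_ _]]; have := lt_le_trans as_ sa; rewrite ltxx.
have dist' a b : 0 <= a -> 0 <= b ->
    `|bochner_integral lam `[0, b] g - bochner_integral lam `[0, a] g| <= `|phi b - phi a|.
  move=> a0 b0; case: (leP a b) => ab; first exact: le_trans (dist _ _ a0 ab) (ler_norm _).
  by rewrite distrC (distrC (phi b)); exact: le_trans (dist _ _ b0 (ltW ab)) (ler_norm _).
apply/cvgrPdist_lt => e e0; have /cvgrPdist_lt/(_ _ e0) h := cphi.
have p : \forall s \near t, 0 < s by exact: lt_nbhsr.
apply: filterS2 h p => s h s0.
exact: le_lt_trans (dist' _ _ (ltW s0) (ltW t0)) h.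
Qed.

End time_continuity.

Section average_existence.
Context {R : realType} {X : completeNormedModType R} {d : measure_display}
  {W : measurableType d} (mu : {finite_measure set W -> \bar R}).
Local Notation lam := (@lebesgue_measure R).
Variable S : R -> (W -> X) -> W -> X.
Hypothesis sgS : contraction_semigroup mu S.
Implicit Types (f g : W -> X) (s t c : R) (G : measurableTypeR R * W -> X).

(** The averages characterised without a vector integral: continuity in [t] at every [w], and at
    dyadic times a limit of Riemann sums, to be compared with [t] times the average. Linearity and
    bounds are read off the sums and carried to all times by continuity. *)
Definition average f (A : R -> W -> X) :=
  [/\ forall t, 0 < t -> inL1 mu (A t),
      forall w t, 0 < t -> A s w @[s --> t] --> A t w &
      forall l m, (0 < m)%N ->
        norm1 mu (riemann S f (l + j) (m * 2 ^ j) \- (fun w => dyadic l m *: A (dyadic l m) w))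
          @[j --> \oo] --> (0 : R)].

Lemma riemann_norm1 f k q : inL1 mu f -> norm1 mu (riemann S f k q) <= dyadic k q * norm1 mu f.
Proof.
move=> lf; have ls i := semigroup_dyadic_inL1 sgS k i lf.
rewrite /riemann norm1Z; last by apply: smeas_sum => i; case: (ls i.+1).
rewrite ger0_norm ?exprn_ge0 ?invr_ge0// /dyadic -mulrA mulrCA ler_wpM2l ?exprn_ge0 ?invr_ge0//.
elim: q => [|q ih].
  by rewrite mul0r norm1_eq0_ae//; apply: nearW => w; rewrite big_ord0.
rewrite (_ : (fun w => _) = (fun w => \sum_(i < q) S (dyadic k i.+1) f w) \+ S (dyadic k q.+1) f).
  apply: le_trans (norm1D _ (ls q.+1)) _; first by apply: inL1_sum => i; exact: ls.
  rewrite -natr1 mulrDl mul1r lerD//.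
  by apply: (semigroup_norm1 sgS) => //; exact: dyadic_ge0.
by apply/funext => w; rewrite big_ord_recr.
Qed.

Lemma dyadic_dense t : 0 < t -> exists2 m : nat -> nat, (forall n, (0 < m n)%N) &
  dyadic n (m n) @[n --> \oo] --> t.
Proof.
move=> t0; exists (dyadic_ceil^~ t) => [n|].
  have /andP[h _] := dyadic_ceil_itv n t0; rewrite lt0n; apply/eqP => m0.
  by move: h; rewrite m0 mul0r leNgt t0.
apply/cvgrPdist_lt => e e0; have [J hJ] := expr2V_small e0; exists J => // n /= /hJ hn.
have /andP[h1 h2] := dyadic_ceil_itv n t0.
rewrite distrC /dyadic exprVn ger0_norm ?subr_ge0//.
by rewrite ltrBlDl (lt_le_trans h2)// lerD2l ltW.
Qed.

(** The integral in time is not measurable in [w] by construction. Its measurable version [b] is the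
    pointwise limit of Riemann sums along a subsequence for which the scalar error bound [H] tends
    to 0 almost everywhere. *)
Lemma average_at G f l m : represents mu S G f -> inL1 mu f -> (0 < m)%N -> exists b,
  [/\ inL1 mu b,
      \forall w \ae mu, b w = bochner_integral lam `[0, dyadic l m] (fun t => G (t, w)) &
      norm1 mu (riemann S f (l + j) (m * 2 ^ j) \- b) @[j --> \oo] --> (0 : R)].
Proof.
move=> rG lf m0.
pose H j w := (\sum_(i < m * 2 ^ j) \int[lam]_(t in itv_step ((2^-1)%R ^+ (l + j)) i)
   (`|G (t, w) - S (dyadic (l + j) i.+1) f w|)%:E)%E.
pose v j := riemann S f (l + j) (m * 2 ^ j).
have lv j : inL1 mu (v j) by exact: riemann_inL1.
pose I w := bochner_integral lam `[0, dyadic l m] (fun t => G (t, w)).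
have H0 j w : (0 <= H j w)%E by apply: sume_ge0 => i _; exact: integral_ge0.
have Hsmall (eps : R) : 0 < eps -> exists J, forall j, (J <= j)%N ->
    measurable_fun setT (H j) /\ (\int[mu]_w H j w <= eps%:E)%E.
  move=> e0; have [J hJ] := integral_steps_small sgS l rG lf m0 e0.
  exists J => j /hJ[mH iH]; split; first by apply: emeasurable_fun_sum => i.
  rewrite /H ge0_integral_sum// => i w _; exact: integral_ge0.
have dist : \forall w \ae mu, forall j, ((`|v j w - I w|)%:E <= H j w)%E.
  apply: filterS (represents_integrable sgS rG lf) => w hw j.
  have h0 : 0 < (2^-1 : R) ^+ (l + j) by rewrite exprn_gt0// invr_gt0.
  have := riemann_dist (fun i => S (dyadic (l + j) i.+1) f w) (m * 2 ^ j) h0 hw.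
  by rewrite -/(dyadic (l + j) (m * 2 ^ j)) dyadic_refine distrC.
have /choice[jj hjj] : forall k : nat, exists j, measurable_fun setT (H j) /\
    (\int[mu]_w H j w <= ((4^-1 : R) ^+ k)%:E)%E.
  move=> k; have e0 : 0 < (4^-1 : R) ^+ k by rewrite exprn_gt0// invr_gt0.
  by have [J hJ] := Hsmall _ e0; exists J; exact: hJ.
pose eta k : W -> R^o := fun w => fine (H (jj k) w).
have Hfin : \forall w \ae mu, forall k, (H (jj k) w \is a fin_num).
  apply: ae_foralln => k; have [mH iH] := hjj k.
  have : mu.-integrable setT (H (jj k)).
    apply/integrableP; split => //; under eq_integral do rewrite gee0_abs//.
    by apply: le_lt_trans iH _; rewrite ltry.
  by move/(integrable_ae measurableT); apply: filterS => w; apply.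
have ieta k : (\int[mu]_w (`|eta k w|)%:E <= ((4^-1 : R) ^+ k)%:E)%E.
  apply: le_trans (hjj k).2; apply: ge0_ae_le_integral => //.
  apply: filterS Hfin => w /(_ k) hw _; rewrite ger0_norm ?fine_ge0//.
  by rewrite /eta fineK.
have leta k : inL1 mu (eta k).
  split; last by apply: le_lt_trans (ieta k) _; rewrite ltry.
  apply: measurable_fun_smeas; apply: measurableT_comp => //; exact: (hjj k).1.
have etacvg : \forall w \ae mu, eta k w @[k --> \oo] --> (0 : R^o).
  apply: (@fast_ae_cvg _ _ _ _ mu eta (cst 0)) => //; first exact: inL1_cst.
  move=> k; rewrite (@norm1_ae _ _ _ _ _ _ (eta k)); last first.
    by apply: nearW => w; rewrite /= subr0.
  by apply: le_fine_id; [exact: integral_ge0|exact: ieta].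
have vcvg : \forall w \ae mu, v (jj k) w @[k --> \oo] --> I w.
  apply: filterS3 dist Hfin etacvg => w dw fw ew.
  apply/cvgrPdist_lt => e e0; have [K _ hK] := cvgr_lt _ ew _ e0.
  exists K => // k /= Kk; rewrite distrC; apply: le_lt_trans (hK _ Kk).
  by rewrite -lee_fin /eta fineK// dw.
have [b mb hb] := smeas_limit (fun k => (lv (jj k)).1).
have bI : \forall w \ae mu, b w = I w.
  apply: filterS vcvg => w vw; exact: (cvg_unique _ (hb w (cvgP _ vw)) vw).
have vb j : (\int[mu]_w (`|(v j \- b) w|)%:E <= \int[mu]_w H j w)%E.
  apply: ge0_ae_le_integral => //.
  by apply: filterS2 dist bI => w dw bw _ /=; rewrite bw.
have lb : inL1 mu b.
  have [J hJ] := Hsmall 1 ltr01; have [_ iJ] := hJ _ (leqnn J).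
  have : inL1 mu (v J \- b).
    split; first by apply: smeasB => //; case: (lv J).
    by apply: le_lt_trans (vb J) _; apply: le_lt_trans iJ _; rewrite ltry.
  move=> l1; have bE : v J \- (v J \- b) = b by apply/funext => w; rewrite /= opprB addrC subrK.
  by rewrite -bE; exact: inL1B (lv J) l1.
exists b; split => //.
apply/cvgrPdist_le => e e0; have [J hJ] := Hsmall _ e0; exists J => // j /= Jj.
rewrite sub0r normrN ger0_norm ?norm1_ge0//.
have [_ ij] := hJ _ Jj; apply: le_fine_id; first exact: integral_ge0.
exact: le_trans (vb j) ij.
Qed.

(** The countably many dyadic times cost one null set [N], on which the averages are put equal to 0;
    continuity in [t] then holds at every [w]. At other times, membership in [L_1] follows by
    continuity and Fatou's lemma. *)
Lemma average_exists G f : represents mu S G f -> inL1 mu f -> exists2 A, average f A &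
  \forall w \ae mu, forall t, 0 < t ->
    norm_integrable lam `[0, t]%classic (fun s => G (s, w)) /\
    A t w = t^-1 *: bochner_integral lam `[0, t] (fun s => G (s, w)).
Proof.
move=> rG lf.
have /choice[b hb] : forall lm : nat * nat, exists b, (0 < lm.2)%N ->
    [/\ inL1 mu b,
      \forall w \ae mu, b w = bochner_integral lam `[0, dyadic lm.1 lm.2] (fun t => G (t, w)) &
      norm1 mu (riemann S f (lm.1 + j) (lm.2 * 2 ^ j) \- b) @[j --> \oo] --> (0 : R)].
  move=> [l [|m]] /=; first by exists (cst 0).
  by have [//|b hb] := @average_at G f l m.+1 rG lf; exists b.
have good : \forall w \ae mu, (forall c, norm_integrable lam `[0, c]%classic (fun t => G (t, w))) /\
    forall l m, (0 < m)%N -> b (l, m) w = bochner_integral lam `[0, dyadic l m] (fun t => G (t, w)).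
  have h : \forall w \ae mu, forall l m, (0 < m)%N ->
      b (l, m) w = bochner_integral lam `[0, dyadic l m] (fun t => G (t, w)).
    apply: ae_foralln => l; apply: ae_foralln => m.
    case: m => [|m]; first exact: nearW.
    by have [_ h _] := hb (l, m.+1) isT; apply: filterS h.
  by apply: filterS2 (represents_integrable sgS rG lf) h.
have [N [mN N0 NG]] := good.
have gN w : w \in ~` N -> (forall c, norm_integrable lam `[0, c]%classic (fun t => G (t, w))) /\
    forall l m, (0 < m)%N -> b (l, m) w = bochner_integral lam `[0, dyadic l m] (fun t => G (t, w)).
  rewrite inE => nN; apply: contrapT => nh; apply: nN; exact: NG.
pose A t := cut0 (~` N) (fun w => t^-1 *: bochner_integral lam `[0, t] (fun s => G (s, w))).
have nN : \forall w \ae mu, w \in ~` N.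
  by exists N; split => // w /= nw; apply: contrapT => nNw; apply: nw; rewrite inE.
have AD l m : (0 < m)%N -> A (dyadic l m) = cut0 (~` N) (fun w => (dyadic l m)^-1 *: b (l, m) w).
  move=> m0; apply/funext => w; rewrite /A /cut0; case: ifPn => // /gN[_ h].
  by rewrite h.
have mN' : measurable (~` N) by exact: measurableC.
have lAD l m : (0 < m)%N -> inL1 mu (A (dyadic l m)).
  by move=> m0; rewrite AD//; apply: inL1_cut0 => //; apply: inL1Z; case: (hb (l, m) m0).
have Ab l m : (0 < m)%N -> \forall w \ae mu, dyadic l m *: A (dyadic l m) w = b (l, m) w.
  move=> m0; apply: filterS nN => w wN; rewrite AD// /cut0 wN scalerA divff ?scale1r//.
  by rewrite gt_eqF// dyadic_gt0.
have Ar l m : (0 < m)%N ->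
    norm1 mu (riemann S f (l + j) (m * 2 ^ j) \- (fun w => dyadic l m *: A (dyadic l m) w))
      @[j --> \oo] --> (0 : R).
  move=> m0; have [_ _ h] := hb (l, m) m0.
  rewrite (_ : (fun j => _) = (fun j => norm1 mu (riemann S f (l + j) (m * 2 ^ j) \- b (l, m))))//.
  apply/funext => j; apply: norm1_ae; apply: filterS (Ab l m m0) => w /= ->.
  by [].
have cA w t : 0 < t -> A s w @[s --> t] --> A t w.
  move=> t0; rewrite /A /cut0; case: ifPn => [/gN[lG _]|_]; last exact: cvg_cst.
  apply: cvgZ; last exact: bochner_integral_continuous.
  by apply: cvgV; [rewrite gt_eqF|exact: cvg_id].
have nAD l m : (0 < m)%N -> norm1 mu (A (dyadic l m)) <= norm1 mu f.
  move=> m0; have c0 : 0 < dyadic l m :> R := dyadic_gt0 l m0.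
  have := Ar l m m0; set z := (fun w => dyadic l m *: A (dyadic l m) w) => cz.
  have lz : inL1 mu z by apply: inL1Z; exact: lAD.
  have : norm1 mu z <= dyadic l m * norm1 mu f.
    apply/ler_addgt0Pr => e e0; have [J _ /(_ J (leqnn J)) hJ] := cvgr_lt _ cz _ e0.
    have lr := riemann_inL1 sgS (l + J) (m * 2 ^ J) lf.
    apply: le_trans (norm1_dist lz lr) _; rewrite norm1_sym addrC lerD// ?(ltW hJ)//.
    by apply: le_trans (riemann_norm1 _ _ lf) _; rewrite dyadic_refine.
  rewrite /z norm1Z; last by case: (lAD l m m0).
  by rewrite gtr0_norm// ler_pM2l.
exists A; last first.
  apply: filterS nN => w wN t t0; have [h _] := gN w wN; split; first exact: h.
  by rewrite /A /cut0 wN.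
split => // t t0.
have [m mP mc] := dyadic_dense t0.
have cv w : A (dyadic n (m n)) w @[n --> \oo] --> A t w.
  exact: (cvg_comp _ _ mc (cA w t t0)).
have [] // := @fatou_norm1 _ _ _ _ mu (fun n => A (dyadic n (m n))) (A t) (norm1 mu f).
- by move=> n; exact: lAD.
- by apply: (@smeas_lim _ _ _ _ (fun n => A (dyadic n (m n)))) => // n; case: (lAD n (m n) (mP n)).
- exact: nearW.
- by apply: nearW => n; exact: nAD.
Qed.

End average_existence.

Section average_operator.
Context {R : realType} {X : completeNormedModType R} {d : measure_display}
  {W : measurableType d} (mu : {finite_measure set W -> \bar R}).
Local Notation lam := (@lebesgue_measure R).
Variable S : R -> (W -> X) -> W -> X.
Hypothesis sgS : contraction_semigroup mu S.
Implicit Types (f g : W -> X) (s t c : R).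

(** A Riemann sum over the window of steps from [a] to [b]; the semigroup acts on it by shifting the
    window. *)
Definition rsum f (k a b : nat) : W -> X :=
  fun w => (2^-1) ^+ k *: \sum_(a <= i < b) S (dyadic k i.+1) f w.

Lemma riemannE f k q : riemann S f k q = rsum f k 0 q.
Proof. by apply/funext => w; rewrite /riemann /rsum big_mkord. Qed.

Lemma rsum_inL1 f k a b : inL1 mu f -> inL1 mu (rsum f k a b).
Proof. by move=> lf; apply: inL1Z; apply: inL1_sum => i; exact: semigroup_dyadic_inL1. Qed.

Lemma rsum_cat f k a b (c : nat) w : (a <= b <= c)%N -> rsum f k a c w = rsum f k a b w + rsum f k b c w.
Proof.
by move=> /andP[ab bc]; rewrite /rsum -scalerDr (@big_cat_nat _ _ _ b).
Qed.

Lemma rsum_bounded f (M : R) k a b : inL1 mu f -> (\forall w \ae mu, `|f w| <= M) ->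
  \forall w \ae mu, `|rsum f k a b w| <= dyadic k (b - a) * M.
Proof.
move=> lf fM; have : \forall w \ae mu, forall i, `|S (dyadic k i) f w| <= M.
  apply: ae_foralln => i.
  by have [_ _ _] := semigroup_contraction sgS (dyadic_ge0 k i); apply.
apply: filterS => w hw; rewrite /rsum normrZ ger0_norm ?exprn_ge0 ?invr_ge0//.
have -> : dyadic k (b - a) * M = (2^-1) ^+ k * ((b - a)%:R * M).
  by rewrite /dyadic mulrAC mulrC.
rewrite ler_wpM2l ?exprn_ge0 ?invr_ge0//.
apply: le_trans (ler_norm_sum _ _ _) _.
apply: (@le_trans _ _ (\sum_(a <= i < b) M)); first by apply: ler_sum => i _; exact: hw.
by rewrite sumr_const_nat mulr_natl.
Qed.

Lemma rsum_norm1 f k a b : inL1 mu f -> norm1 mu (rsum f k a b) <= dyadic k (b - a) * norm1 mu f.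
Proof.
move=> lf; have ls i := semigroup_dyadic_inL1 sgS k i lf.
rewrite /rsum norm1Z; last by apply: smeas_sum => i; case: (ls i.+1).
rewrite ger0_norm ?exprn_ge0 ?invr_ge0// /dyadic -mulrA mulrCA ler_wpM2l ?exprn_ge0 ?invr_ge0//.
have [ab|ba] := leqP a b; last first.
  rewrite (eqP (ltnW ba : (b - a == 0)%N)) mul0r norm1_eq0_ae//.
  by apply: nearW => w; rewrite big_geq// ltnW.
rewrite -{1}(subnKC ab); elim: (b - a)%N => [|q ih].
  by rewrite mul0r addn0 norm1_eq0_ae//; apply: nearW => w; rewrite big_geq.
rewrite (_ : (fun w => _) = (fun w => \sum_(a <= i < a + q) S (dyadic k i.+1) f w) \+
    S (dyadic k (a + q).+1) f).
  apply: le_trans (norm1D _ (ls _)) _; first by apply: inL1_sum => i; exact: ls.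
  rewrite -natr1 mulrDl mul1r lerD//.
  by apply: (semigroup_norm1 sgS) => //; exact: dyadic_ge0.
by apply/funext => w; rewrite addnS big_nat_recr// leq_addr.
Qed.

Lemma semigroup_rsum f k i a b : inL1 mu f ->
  \forall w \ae mu, S (dyadic k i) (rsum f k a b) w = rsum f k (i + a) (i + b) w.
Proof.
move=> lf; have cS := semigroup_contraction sgS (dyadic_ge0 k i).
have ls j := semigroup_dyadic_inL1 sgS k j lf.
have h1 : \forall w \ae mu, S (dyadic k i) (rsum f k a b) w =
    (2^-1) ^+ k *: S (dyadic k i) (fun w => \sum_(a <= j < b) S (dyadic k j.+1) f w) w.
  by apply: contractionZ => //; apply: inL1_sum => j; exact: ls.
have h2 : \forall w \ae mu, S (dyadic k i) (fun w => \sum_(j < b - a) S (dyadic k (a + j).+1) f w) w =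
    \sum_(j < b - a) S (dyadic k i) (S (dyadic k (a + j).+1) f) w.
  by apply: (@contraction_sum _ _ _ _ mu _ (fun j => S (dyadic k (a + j).+1) f) _ cS) => j.
have h3 : \forall w \ae mu, forall j, S (dyadic k i) (S (dyadic k (a + j).+1) f) w =
    S (dyadic k (i + a + j).+1) f w.
  apply: ae_foralln => j; have := semigroupD sgS (dyadic_ge0 k i) (dyadic_ge0 k (a + j).+1) lf.
  by apply: filterS => w ->; rewrite dyadicD addnS addnA.
have e0 : (fun w => \sum_(a <= j < b) S (dyadic k j.+1) f w) =
    (fun w => \sum_(j < b - a) S (dyadic k (a + j).+1) f w).
  apply/funext => w; rewrite -{1}[a]add0n big_addn big_mkord.
  by apply: eq_bigr => j _; rewrite addnC.
rewrite e0 in h1; apply: filterS3 h1 h2 h3 => w -> -> h3; rewrite /rsum; congr (_ *: _).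
rewrite -{1}[(i + a)%N]add0n big_addn subnDl big_mkord; apply: eq_bigr => j _.
by rewrite h3 addnC.
Qed.

Lemma rsum_semigroup f k i a b : inL1 mu f ->
  \forall w \ae mu, rsum (S (dyadic k i) f) k a b w = rsum f k (i + a) (i + b) w.
Proof.
move=> lf; have : \forall w \ae mu, forall j, S (dyadic k j) (S (dyadic k i) f) w =
    S (dyadic k (i + j)) f w.
  apply: ae_foralln => j; have := semigroupD sgS (dyadic_ge0 k j) (dyadic_ge0 k i) lf.
  by apply: filterS => w ->; rewrite dyadicD addnC.
apply: filterS => w hw; rewrite /rsum; congr (_ *: _).
rewrite -{1}[a]add0n -{1}[(i + a)%N]add0n !big_addn subnDl !big_mkord.
by apply: eq_bigr => j _; rewrite hw addnS addnCA.
Qed.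

(** The common window cancels and two windows of length [i] remain, whatever [q]. This telescoping
    gives both the bound for coboundaries and the almost invariance of averages. *)
Lemma rsum_shift f k i q w : rsum f k 0 q w - rsum f k i (i + q) w =
  rsum f k 0 i w - rsum f k q (q + i) w.
Proof.
have := @rsum_cat f k 0 q (q + i) w; rewrite leq0n leq_addr => /(_ isT).
have := @rsum_cat f k 0 i (i + q) w; rewrite leq0n leq_addr => /(_ isT).
rewrite (addnC q) => -> /eqP; rewrite -subr_eq => /eqP <-.
by rewrite addrAC addrK.
Qed.

Lemma riemann_linear f g (a : R) k q : inL1 mu f -> inL1 mu g ->
  \forall w \ae mu, riemann S (fun w => a *: f w + g w) k q w =
    a *: riemann S f k q w + riemann S g k q w.
Proof.
move=> lf lg; have : \forall w \ae mu, forall i, S (dyadic k i) (fun w => a *: f w + g w) w =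
    a *: S (dyadic k i) f w + S (dyadic k i) g w.
  apply: ae_foralln => i.
  by have [_ h _ _] := semigroup_contraction sgS (dyadic_ge0 k i); exact: h.
apply: filterS => w hw; rewrite /riemann scalerA mulrC -scalerA -scalerDr.
congr (_ *: _); rewrite scaler_sumr -big_split /=.
by apply: eq_bigr => i _; rewrite hw.
Qed.

Lemma dyadic_lim_unique f g (v : nat -> W -> X) : (forall j, inL1 mu (v j)) -> inL1 mu f ->
  inL1 mu g -> norm1 mu (v j \- f) @[j --> \oo] --> (0 : R) ->
  norm1 mu (v j \- g) @[j --> \oo] --> (0 : R) -> \forall w \ae mu, f w = g w.
Proof.
by move=> lv lf lg; apply: (@L1_cvg_unique _ _ _ _ mu nat \oo v f g) => //; exact: nearW.
Qed.

Lemma average_eq_dyadic (A B : R -> W -> X) :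
  (forall w t, 0 < t -> A s w @[s --> t] --> A t w) ->
  (forall w t, 0 < t -> B s w @[s --> t] --> B t w) ->
  (forall l m, (0 < m)%N -> \forall w \ae mu, A (dyadic l m) w = B (dyadic l m) w) ->
  \forall w \ae mu, forall t, 0 < t -> A t w = B t w.
Proof.
move=> cA cB AB; have : \forall w \ae mu, forall l m, (0 < m)%N -> A (dyadic l m) w = B (dyadic l m) w.
  apply: ae_foralln => l; apply: ae_foralln => m; have [m0|m0] := boolP (0 < m)%N.
    by apply: filterS (AB l m m0) => w.
  exact: nearW.
apply: filterS => w hw t t0; have [m mP mt] := dyadic_dense t0.
have h1 : A (dyadic n (m n)) w @[n --> \oo] --> A t w by exact: cvg_comp mt (cA w t t0).
have h2 : B (dyadic n (m n)) w @[n --> \oo] --> B t w by exact: cvg_comp mt (cB w t t0).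
have e : (fun n => A (dyadic n (m n)) w) = (fun n => B (dyadic n (m n)) w).
  by apply/funext => n; exact: hw.
by rewrite -e in h2; exact: (cvg_unique _ h1 h2).
Qed.

Lemma average_linear f g (a : R) A B C : inL1 mu f -> inL1 mu g ->
  average mu S f A -> average mu S g B -> average mu S (fun w => a *: f w + g w) C ->
  \forall w \ae mu, forall t, 0 < t -> C t w = a *: A t w + B t w.
Proof.
move=> lf lg [lA cA rA] [lB cB rB] [lC cC rC].
apply: (average_eq_dyadic (B := fun t w => a *: A t w + B t w)) => //.
  by move=> w t t0; apply: cvgD; [apply: cvgZr; exact: cA|exact: cB].
move=> l m m0; have c0 : 0 < dyadic l m :> R := dyadic_gt0 l m0.
have rl j : inL1 mu (riemann S (fun w => a *: f w + g w) (l + j) (m * 2 ^ j)).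
  by apply: riemann_inL1 => //; exact: inL1D (inL1Z a lf) lg.
have {lA} lA : inL1 mu (fun w => dyadic l m *: A (dyadic l m) w) by apply/inL1Z/lA.
have {lB} lB : inL1 mu (fun w => dyadic l m *: B (dyadic l m) w) by apply/inL1Z/lB.
have {lC} lC : inL1 mu (fun w => dyadic l m *: C (dyadic l m) w) by apply/inL1Z/lC.
set A' := (fun w => dyadic l m *: A (dyadic l m) w) in lA.
set B' := (fun w => dyadic l m *: B (dyadic l m) w) in lB.
have lAB : inL1 mu (fun w => a *: A' w + B' w) by exact: inL1D (inL1Z a lA) lB.
have := dyadic_lim_unique rl lC lAB (rC l m m0).
have lim : norm1 mu (riemann S (fun w => a *: f w + g w) (l + j) (m * 2 ^ j) \-
    (fun w => a *: A' w + B' w)) @[j --> \oo] --> (0 : R).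
  have c1 : `|a| * norm1 mu (riemann S f (l + j) (m * 2 ^ j) \- A') +
      norm1 mu (riemann S g (l + j) (m * 2 ^ j) \- B') @[j --> \oo] --> (0 : R).
    rewrite -[X in _ --> X](addr0 0) -[X in _ --> X + _](mulr0 `|a|).
    by apply: cvgD; [apply: cvgMr; exact: rA|exact: rB].
  apply: (squeeze_cvgr _ (cvg_cst (0 : R)) c1); apply: nearW => j; rewrite norm1_ge0/=.
  have l1 := inL1B (riemann_inL1 sgS (l + j) (m * 2 ^ j) lf) lA.
  have l2 := inL1B (riemann_inL1 sgS (l + j) (m * 2 ^ j) lg) lB.
  rewrite -norm1Z; last by case: l1.
  apply: le_trans (norm1D (inL1Z a l1) l2); rewrite le_eqVlt; apply/orP; left; apply/eqP.
  apply: norm1_ae; apply: filterS (riemann_linear a (l + j) (m * 2 ^ j) lf lg) => w /= ->.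
  by rewrite scalerBr opprD addrACA.
move/(_ lim); apply: filterS => w; rewrite /A' /B' /= => e.
by apply: (scalerI (lt0r_neq0 c0)); rewrite e scalerDr !scalerA (mulrC a).
Qed.

Lemma average_total f : inL1 mu f -> exists A, average mu S f A.
Proof.
move=> lf; have [G mG hG] := semigroup_joint sgS lf.
suff rG : represents mu S G f by have [A hA _] := average_exists sgS rG lf; exists A.
split => //; have h0 : \forall t \ae lam, t != 0 :> R.
  exists [set 0]; split; [exact: measurable_set1|exact: lebesgue_measure_set1|].
  by move=> t /= /negP; rewrite negbK => /eqP.
by apply: filterS h0 => t t0 t1; apply: hG; rewrite lt_neqAle eq_sym t0.
Qed.

(** The two contraction bounds hold for Riemann sums, pass to dyadic times as [L_1] limits, and to
    all times by continuity in [t]: through Fatou's lemma for [L_1], pointwise for [L_oo]. *)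
Lemma average_operator : exists Av : (W -> X) -> R -> W -> X,
  (forall f, inL1 mu f -> average mu S f (Av f)) /\
  forall t, 0 < t -> L1_contraction mu (fun f => Av f t).
Proof.
have /choice[Av hAv] : forall f, exists A, inL1 mu f -> average mu S f A.
  move=> f; have [lf|nl] := pselect (inL1 mu f); last by exists (fun=> cst 0).
  by have [A hA] := average_total lf; exists A.
exists Av; split => // t t0; split => [f lf|a f g lf lg|f lf|f M lf fM].
- by case: (hAv _ lf) => h _ _; exact: h.
- have l1 : inL1 mu (fun w => a *: f w + g w) by exact: inL1D (inL1Z a lf) lg.
  have := average_linear lf lg (hAv _ lf) (hAv _ lg) (hAv _ l1).
  by apply: filterS => w; exact.
- have [lA cA rA] := hAv _ lf.
  have [m mP mt] := dyadic_dense t0.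
  have h : forall w, Av f (dyadic n (m n)) w @[n --> \oo] --> Av f t w.
    by move=> w; exact: cvg_comp mt (cA w t t0).
  have [||||//] := @fatou_norm1 _ _ _ _ mu (fun n => Av f (dyadic n (m n))) (Av f t) (norm1 mu f).
  + by move=> n; apply: lA; exact: dyadic_gt0.
  + by case: (lA t t0).
  + exact: nearW.
  + apply: nearW => n; have c0 : 0 < dyadic n (m n) :> R by exact: dyadic_gt0.
    have la : inL1 mu (fun w => dyadic n (m n) *: Av f (dyadic n (m n)) w) by apply/inL1Z/lA.
    rewrite -(ler_pM2l c0) -[X in X * _](gtr0_norm c0) -norm1Z; last by case: (lA _ c0).
    apply/ler_addgt0Pr => e e0.
    have [J _ /(_ J (leqnn J)) hJ] := cvgr_lt _ (rA n (m n) (mP n)) _ e0.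
    have lr := riemann_inL1 sgS (n + J) (m n * 2 ^ J) lf.
    apply: le_trans (norm1_dist la lr) _; rewrite norm1_sym addrC lerD// ?(ltW hJ)//.
    by apply: le_trans (riemann_norm1 sgS _ _ lf) _; rewrite dyadic_refine.
- have [lA cA rA] := hAv _ lf.
  have : \forall w \ae mu, forall l m, (0 < m)%N -> `|Av f (dyadic l m) w| <= M.
    apply: ae_foralln => l; apply: ae_foralln => m; have [m0|m0] := boolP (0 < m)%N; last exact: nearW.
    have c0 : 0 < dyadic l m :> R by exact: dyadic_gt0.
    have la : inL1 mu (fun w => dyadic l m *: Av f (dyadic l m) w) by apply/inL1Z/lA.
    have : \forall w \ae mu, `|dyadic l m *: Av f (dyadic l m) w| <= dyadic l m * M.
      apply: (ae_bounded_closure la) => e e0.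
      have [J _ /(_ J (leqnn J)) hJ] := cvgr_lt _ (rA l m m0) _ e0.
      exists (riemann S f (l + J) (m * 2 ^ J)); split; [exact: riemann_inL1|exact: ltW hJ|].
      rewrite riemannE; have := rsum_bounded (l + J) 0 (m * 2 ^ J) lf fM.
      by rewrite subn0 dyadic_refine.
    by apply: filterS => w; rewrite normrZ gtr0_norm// ler_pM2l.
  apply: filterS => w hw; have [m mP mt] := dyadic_dense t0.
  have h : Av f (dyadic n (m n)) w @[n --> \oo] --> Av f t w by exact: cvg_comp mt (cA w t t0).
  have h' : `|Av f (dyadic n (m n)) w| @[n --> \oo] --> `|Av f t w| by exact: cvg_norm.
  rewrite -(cvg_lim (@Rhausdorff R) h'); apply: limr_le; first exact: cvgP h'.
  by apply: nearW => n; exact: hw.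
Qed.

End average_operator.

(** * Maximal inequality and ergodic theorem *)

Section filling_scheme.
Context {R : realType} {X : completeNormedModType R} {d : measure_display}
  {W : measurableType d} (mu : {finite_measure set W -> \bar R}).
Variables (K : (W -> X) -> W -> X) (a : R).
Hypotheses (cK : L1_contraction mu K) (a0 : 0 < a).
Implicit Types (f g w : W -> X).

(* [(m, w)]: [m] is the mass already absorbed by the obstacle of height [a] and
   [w] the flow that still moves; the fraction [fill] of [w] gets absorbed. *)
Definition fill (s : (W -> R) * (W -> X)) (x : W) : R :=
  Num.min 1 ((a - s.1 x) * `|s.2 x| `^ (-1)).

Fixpoint flow f (k : nat) : (W -> R) * (W -> X) :=
  if k is k'.+1 then
    let s := flow f k' in
    (fun x => s.1 x + fill s x * `|s.2 x|, K (fun x => (1 - fill s x) *: s.2 x))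
  else (cst 0, f).

(** [m] is the mass absorbed before step [k] and [w] the flow arriving at that step; [q] and [u] are
    the absorbed and the remaining part of [w]. *)
Let m f k := (flow f k).1.
Let w f k := (flow f k).2.
Let th f k := fill (flow f k).
Let u f k : W -> X := fun x => (1 - th f k x) *: w f k x.
Let q f k : W -> X := fun x => th f k x *: w f k x.

Lemma fill_mass s x : s.1 x <= a ->
  [/\ 0 <= fill s x <= 1, s.1 x + fill s x * `|s.2 x| <= a &
      s.1 x + fill s x * `|s.2 x| < a -> s.2 x = 0 \/ fill s x = 1].
Proof.
move=> sa; rewrite /fill; have [->|x0] := eqVneq (s.2 x) 0.
  rewrite normr0 mulr0 addr0; split => //; last by left.
  rewrite ge_min lexx le_min ler01 /= mulr_ge0 ?subr_ge0// powR_ge0.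
have n0 : 0 < `|s.2 x| by rewrite normr_gt0.
rewrite powR_inv1 ?normr_ge0//.
have h0 : 0 <= (a - s.1 x) / `|s.2 x| by rewrite divr_ge0// subr_ge0.
have [h|h] := ltP 1 ((a - s.1 x) / `|s.2 x|).
  have := h; rewrite ltr_pdivlMr// mul1r => h'.
  split; [by rewrite ler01 lexx|by lra|by right].
split; [by rewrite h0 h|by rewrite divfK ?gt_eqF// addrC subrK|].
by rewrite divfK ?gt_eqF// addrC subrK ltxx.
Qed.

Lemma flow_bounds f k x : 0 <= m f k x <= a.
Proof.
elim: k => [|k /andP[ih1 ih2]]; first by rewrite /m /= lexx ltW.
have [/andP[h0 h1] h2 _] := @fill_mass (flow f k) x ih2.
by rewrite /m /= h2 andbT addr_ge0// mulr_ge0.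
Qed.

Lemma fill_bounds f k x : 0 <= th f k x <= 1.
Proof. by have /andP[_ h] := flow_bounds f k x; have [] := @fill_mass (flow f k) x h. Qed.

Lemma flow_measurable f k : inL1 mu f ->
  [/\ measurable_fun setT (m f k), inL1 mu (w f k) & measurable_fun setT (th f k)].
Proof.
move=> lf; have [iK _ _ _] := cK.
have mth j : measurable_fun setT (m f j) -> inL1 mu (w f j) -> measurable_fun setT (th f j).
  move=> mm [mw _]; apply: measurable_minr; first exact: measurable_cst.
  apply: measurable_funM; first by apply: measurable_funB => //; exact: measurable_cst.
  apply: (@measurableT_comp _ _ _ _ _ _ (fun r : R => r `^ (-1))) => //.
  exact: smeas_norm.
elim: k => [|k [mm lw mt]].
  have m0 : measurable_fun setT (m f 0) by exact: measurable_cst.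
  by split => //; exact: mth.
have mm' : measurable_fun setT (m f k.+1).
  apply: measurable_funD => //; apply: measurable_funM => //; apply: smeas_norm; case: lw => //.
have lu : inL1 mu (u f k).
  apply: (inL1_le _ lw); first by apply: smeasM => //; [apply: measurable_funB => //; exact: measurable_cst|case: lw].
  apply: nearW => x; rewrite /u normrZ; have /andP[t0 t1] := fill_bounds f k x.
  by rewrite ger0_norm ?subr_ge0// ler_piMl// lerBlDr lerDl.
have lw' : inL1 mu (w f k.+1) by exact: (iK _ lu).
by split => //; exact: mth.
Qed.

Lemma flow_inL1 f k : inL1 mu f -> inL1 mu (u f k) /\ inL1 mu (q f k).
Proof.
move=> lf; have [mm lw mt] := flow_measurable k lf.
have mt' : measurable_fun setT (fun x => 1 - th f k x).
  by apply: measurable_funB => //; exact: measurable_cst.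
split; apply: (inL1_le _ lw).
- by apply: smeasM => //; case: lw.
- apply: nearW => x; rewrite /u normrZ; have /andP[t0 t1] := fill_bounds f k x.
  by rewrite ger0_norm ?subr_ge0// ler_piMl// lerBlDr lerDl.
- by apply: smeasM => //; case: lw.
- apply: nearW => x; rewrite /q normrZ; have /andP[t0 t1] := fill_bounds f k x.
  by rewrite ger0_norm// ler_piMl.
Qed.

Lemma flow_split f k : inL1 mu f -> norm1 mu (w f k) = norm1 mu (q f k) + norm1 mu (u f k).
Proof.
move=> lf; have [_ lw _] := flow_measurable k lf; have [lu lq] := flow_inL1 k lf.
apply: EFin_inj; rewrite EFinD !norm1E// -ge0_integralD//; last 2 first.
- exact: smeas_normE lq.1.
- exact: smeas_normE lu.1.
apply: eq_integral => x _; rewrite -EFinD /q /u !normrZ; congr EFin.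
have /andP[t0 t1] := fill_bounds f k x.
by rewrite !ger0_norm ?subr_ge0// -mulrDl addrC subrK mul1r.
Qed.

(** Absorbed mass plus moving flow starts at [norm1 f] and cannot increase, [K] being an [L_1]
    contraction. *)
Lemma flow_mass f k : inL1 mu f -> (\int[mu]_x (m f k x)%:E <= (norm1 mu f)%:E)%E.
Proof.
move=> lf; have [_ _ nK _] := cK.
suff h : (\int[mu]_x (m f k x)%:E + (norm1 mu (w f k))%:E <= (norm1 mu f)%:E)%E.
  by apply: le_trans h; rewrite leeDl// lee_fin norm1_ge0.
elim: k => [|k ih].
  rewrite (_ : (\int[mu]_x (m f 0 x)%:E = 0)%E) ?add0e//.
  by rewrite /m /=; under eq_integral do rewrite /=; rewrite integral0.
have [lu lq] := flow_inL1 k lf; have [mm lw mt] := flow_measurable k lf.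
have -> : (\int[mu]_x (m f k.+1 x)%:E = \int[mu]_x (m f k x)%:E + (norm1 mu (q f k))%:E)%E.
  rewrite norm1E// -ge0_integralD//.
  - apply: eq_integral => x _; rewrite -EFinD /q normrZ ger0_norm//.
    by case/andP: (fill_bounds f k x).
  - by move=> x _; rewrite lee_fin; case/andP: (flow_bounds f k x).
  - exact/measurable_EFinP.
  - exact: smeas_normE lq.1.
apply: le_trans ih; rewrite -addeA leeD2l// -EFinD lee_fin (flow_split k lf) lerD2l.
exact: nK.
Qed.

Let v f k : W -> X := fun x => \sum_(i < k.+1) q f i x.

(** [m] adds the norms of the absorbed pieces, so it dominates the norm of their sum, and it never
    exceeds [a]. This replaces positivity. *)
Lemma norm_filled f k x : `|v f k x| <= a.
Proof.
suff h j : \sum_(i < j) `|q f i x| <= m f j x.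
  apply: le_trans (ler_norm_sum _ _ _) _; apply: le_trans (h k.+1) _.
  by case/andP: (flow_bounds f k.+1 x).
elim: j => [|j ih]; first by rewrite big_ord0 /m.
rewrite big_ord_recr /= /m /= lerD//.
by rewrite /q normrZ ger0_norm//; case/andP: (fill_bounds f j x).
Qed.

Lemma iter_inL1 f l : inL1 mu f -> inL1 mu (iter l K f).
Proof. by move=> lf; have [iK _ _ _] := cK; elim: l => // l; exact: iK. Qed.

Lemma iter_contraction l : L1_contraction mu (iter l K).
Proof.
elim: l => [|l ih]; last first.
  by rewrite (_ : iter l.+1 K = K \o iter l K)//; exact: contraction_comp.
split => // a' f g _ _; exact: nearW.
Qed.

(** Iteration of [w = q + u] and [w f k.+1 = K (u f k)]: the piece absorbed at step [n - l] would
    have been moved on [l] times. *)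
Lemma filling_term f n : inL1 mu f -> \forall x \ae mu,
  iter n K f x = \sum_(l < n.+1) iter l K (q f (n - l)) x + u f n x.
Proof.
move=> lf; elim: n => [|n ih].
  apply: nearW => x; rewrite big_ord_recr big_ord0 /= add0r /q /u -scalerDl.
  by rewrite addrC subrK scale1r.
have lq j : inL1 mu (q f j) by case: (flow_inL1 j lf).
have lu : inL1 mu (u f n) by case: (flow_inL1 n lf).
have ls : inL1 mu (fun x => \sum_(l < n.+1) iter l K (q f (n - l)) x).
  by apply: inL1_sum => l; exact: iter_inL1.
have h1 := contraction_ae cK (iter_inL1 n lf) (inL1D ls lu) ih.
have h2 := contractionD cK ls lu.
have h3 : \forall x \ae mu, K (fun x => \sum_(l < n.+1) iter l K (q f (n - l)) x) x =
    \sum_(l < n.+1) K (iter l K (q f (n - l))) x.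
  by apply: (@contraction_sum _ _ _ _ mu _ (fun l => iter l K (q f (n - l))) _ cK) => l;
    exact: iter_inL1.
apply: filterS3 h1 h2 h3 => x e1 e2 e3; rewrite iterS e1 e2 e3.
rewrite [in RHS]big_ord_recl /= subn0 [RHS]addrAC addrC; congr (_ + _).
by rewrite -/(w f n.+1) /q /u -scalerDl addrC subrK scale1r.
Qed.

(** The sum of [filling_term] over the steps, regrouped by the number [l] of applications of [K]:
    the pieces absorbed up to step [n - 1 - l] add up to a [v]. As [|v| <= a] and [K] contracts
    [L_oo], each term of the first sum is at most [a]. *)
Lemma filling_sum f n : inL1 mu f -> \forall x \ae mu,
  \sum_(l < n) iter l K f x =
  \sum_(l < n) iter l K (v f (n.-1 - l)) x + \sum_(j < n) u f j x.
Proof.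
move=> lf; have lq j : inL1 mu (q f j) by case: (flow_inL1 j lf).
have lv j : inL1 mu (v f j) by exact: inL1_sum.
elim: n => [|n ih]; first by apply: nearW => x; rewrite !big_ord0 addr0.
have h : \forall x \ae mu, forall l j : nat, iter l K (v f j.+1) x = iter l K (v f j) x + iter l K (q f j.+1) x.
  apply: ae_foralln => l; apply: ae_foralln => j.
  have := contractionD (iter_contraction l) (lv j) (lq j.+1).
  rewrite (_ : v f j \+ q f j.+1 = v f j.+1)//.
  by apply/funext => x; rewrite /v /= [in RHS]big_ord_recr.
have h0 : \forall x \ae mu, forall l, iter l K (v f 0) x = iter l K (q f 0) x.
  apply: ae_foralln => l; apply: nearW => x; congr (iter l K _ x).
  by apply/funext => y; rewrite /v big_ord_recr big_ord0 /= add0r.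
apply: filterS3 ih (filling_term n lf) (filterI h h0) => x e1 e2 [hx h0x].
rewrite big_ord_recr /= e1 e2 [in X in _ = _ + X]big_ord_recr /= !addrA; congr (_ + _).
rewrite addrAC; congr (_ + _); rewrite ![in RHS]big_ord_recr /= !big_ord_recr /= !subnn h0x addrA.
congr (_ + _); rewrite -big_split /=; apply: eq_bigr => l _.
have n0 : (0 < n)%N := leq_ltn_trans (leq0n l) (ltn_ord l).
have ln : (l <= n.-1)%N by rewrite -ltnS prednK.
have nl : (n - l = (n.-1 - l).+1)%N by rewrite -{1}(prednK n0) subSn.
by rewrite nl hx.
Qed.

(* Where the mass stays below [a], everything has been absorbed: [u] vanishes. *)
Lemma filling_maximal f : inL1 mu f -> exists B, [/\ measurable B,
  (mu B <= (norm1 mu f / a)%:E)%E &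
  \forall x \ae mu, ~ B x -> forall n : nat, `|\sum_(l < n) iter l K f x| <= a * n%:R].
Proof.
move=> lf; have lq j : inL1 mu (q f j) by case: (flow_inL1 j lf).
have lv j : inL1 mu (v f j) by exact: inL1_sum.
pose B n := [set x | a <= m f n x].
have mB n : measurable (B n).
  by apply: measurable_le_set; [exact: measurable_cst|case: (flow_measurable n lf)].
have muB n : (mu (B n) <= (norm1 mu f / a)%:E)%E.
  rewrite -[leLHS]fineK ?fin_num_measure// lee_fin ler_pdivlMr// -lee_fin EFinM fineK ?fin_num_measure//.
  apply: le_trans (flow_mass n lf); rewrite muleC -integral_cst//.
  have [mm _ _] := flow_measurable n lf.
  apply: (@le_trans _ _ (\int[mu]_(x in B n) (m f n x)%:E)%E).
    apply: ge0_le_integral => //.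
    - by move=> x _; rewrite lee_fin ltW.
    - by apply/measurable_funTS/measurable_EFinP.
  apply: ge0_subset_integral => //; first exact/measurable_EFinP.
  by move=> x _; rewrite lee_fin; case/andP: (flow_bounds f n x).
have BS n : B n `<=` B n.+1.
  move=> x; rewrite /B /= => h; apply: le_trans h _; rewrite /m /= lerDl mulr_ge0//.
  by case/andP: (fill_bounds f n x).
have mono : {homo B : n m / (n <= m)%N >-> (n <= m)%O}.
  by apply: homo_leq => [//|? ? ?|n]; [exact: le_trans|apply/subsetPset].
have mU : measurable (\bigcup_n B n) by exact: bigcup_measurable.
exists (\bigcup_n B n); split => //.
  have lim := nondecreasing_cvg_mu (mu := mu) mB mU mono.
  rewrite -(cvg_lim (@ereal_hausdorff R) lim); apply: lime_le; first exact: cvgP lim.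
  exact: nearW.
have h1 : \forall x \ae mu, forall n, \sum_(l < n) iter l K f x =
    \sum_(l < n) iter l K (v f (n.-1 - l)) x + \sum_(j < n) u f j x.
  by apply: ae_foralln => n; exact: filling_sum.
have h2 : \forall x \ae mu, forall l j, `|iter l K (v f j) x| <= a.
  apply: ae_foralln => l; apply: ae_foralln => j; have [_ _ _ bK] := iter_contraction l.
  by apply: bK => //; apply: nearW => x; exact: norm_filled.
apply: filterS2 h1 h2 => x e1 e2 nB n; rewrite e1 [X in _ + X]big1 ?addr0.
  apply: le_trans (ler_norm_sum _ _ _) _.
  apply: (@le_trans _ _ (\sum_(l < n) a)); first by apply: ler_sum => l _; exact: e2.
  by rewrite sumr_const card_ord mulr_natr.
move=> j _; have : m f j.+1 x < a by rewrite ltNge; apply/negP => h; apply: nB; exists j.+1.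
have /andP[_ ma] := flow_bounds f j x.
have [_ _ h] := @fill_mass (flow f j) x ma; move=> /h[]; rewrite /u /w /th.
  by move=> ->; rewrite scaler0.
by move=> ->; rewrite subrr scale0r.
Qed.

End filling_scheme.

Section ergodic_theorem.
Context {R : realType} {X : completeNormedModType R} {d : measure_display}
  {W : measurableType d} (mu : {finite_measure set W -> \bar R}).
Variable S : R -> (W -> X) -> W -> X.
Hypothesis sgS : contraction_semigroup mu S.
Variable Av : (W -> X) -> R -> W -> X.
Hypothesis hAv : forall f, inL1 mu f -> average mu S f (Av f).
Hypothesis cAv : forall t, 0 < t -> L1_contraction mu (fun f => Av f t).
Implicit Types (f g u v : W -> X) (s t c : R).

Lemma norm1_sum (g : nat -> W -> X) (c : R) n : (forall i, inL1 mu (g i)) ->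
  (forall i, norm1 mu (g i) <= c) -> norm1 mu (fun w => \sum_(i < n) g i w) <= c * n%:R.
Proof.
move=> lg gc; elim: n => [|n ih].
  by rewrite mulr0 norm1_eq0_ae//; apply: nearW => w; rewrite big_ord0.
rewrite (_ : (fun w => _) = (fun w => \sum_(i < n) g i w) \+ g n); last first.
  by apply/funext => w; rewrite big_ord_recr.
apply: le_trans (norm1D _ (lg n)) _; first exact: inL1_sum.
by rewrite -natr1 mulrDr mulr1 lerD.
Qed.

Lemma iter_semigroup f l j : inL1 mu f ->
  \forall w \ae mu, iter j (S (dyadic l 1)) f w = S (dyadic l j) f w.
Proof.
move=> lf; have cS := semigroup_contraction sgS (dyadic_ge0 l 1).
elim: j => [|j ih].
  have [_ S0 _ _] := sgS; rewrite /dyadic mul0r /=.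
  by apply: filterS (S0 f lf) => w ->.
have h1 := contraction_ae cS (iter_inL1 cS j lf) (semigroup_dyadic_inL1 sgS l j lf) ih.
have h2 := semigroupD sgS (dyadic_ge0 l 1) (dyadic_ge0 l j) lf.
by apply: filterS2 h1 h2 => w; rewrite iterS => -> ->; rewrite dyadicD add1n.
Qed.

(** A Riemann sum over [n] blocks is a sum of shifted Riemann sums over one block. Averages in
    continuous time thus become Cesaro means of the single contraction [S (dyadic l 1)], to which
    the filling scheme applies. *)
Lemma average_block f l n : inL1 mu f -> (0 < n)%N ->
  \forall w \ae mu, n%:R *: Av f (dyadic l n) w = \sum_(i < n) S (dyadic l i) (Av f (dyadic l 1)) w.
Proof.
move=> lf n0; have [lA _ rA] := hAv lf.
have d1 : 0 < dyadic l 1 :> R by exact: dyadic_gt0.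
have dn : 0 < dyadic l n :> R by exact: dyadic_gt0.
have lA1 := lA _ d1.
pose z := fun w => dyadic l 1 *: Av f (dyadic l 1) w.
have lz : inL1 mu z by exact: inL1Z.
pose r j := riemann S f (l + j) (1 * 2 ^ j).
have lr j : inL1 mu (r j) by exact: riemann_inL1.
have lS g i : inL1 mu g -> inL1 mu (S (dyadic l i) g) by exact: semigroup_dyadic_inL1.
have lsum g : inL1 mu g -> inL1 mu (fun w => \sum_(i < n) S (dyadic l i) g w).
  by move=> lg; apply: inL1_sum => i; exact: lS.
have blocks j : \forall w \ae mu, riemann S f (l + j) (n * 2 ^ j) w =
    \sum_(i < n) S (dyadic l i) (r j) w.
  have h : \forall w \ae mu, forall i, S (dyadic l i) (r j) w =
      rsum S f (l + j) (i * 2 ^ j) (i.+1 * 2 ^ j) w.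
    apply: ae_foralln => i; rewrite /r riemannE -(@dyadic_refine _ l j i).
    have := semigroup_rsum sgS (l + j) (i * 2 ^ j) 0 (1 * 2 ^ j) lf.
    by apply: filterS => w ->; rewrite addn0 mul1n mulSnr.
  apply: filterS h => w hw; rewrite riemannE; elim: n {n0 dn lsum} => [|n ih].
    by rewrite big_ord0 mul0n /rsum big_geq// scaler0.
  rewrite big_ord_recr /= -ih hw.
  by apply: rsum_cat; rewrite leq0n leq_mul2r leqnSn orbT.
have lim : norm1 mu (riemann S f (l + j) (n * 2 ^ j) \-
    (fun w => \sum_(i < n) S (dyadic l i) z w)) @[j --> \oo] --> (0 : R).
  have c1 : norm1 mu (r j \- z) * n%:R @[j --> \oo] --> (0 : R).
    by rewrite -[X in _ --> X](mul0r n%:R); apply: cvgMl; exact: (rA l 1%N isT).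
  apply: (squeeze_cvgr _ (cvg_cst (0 : R)) c1); apply: nearW => j; rewrite norm1_ge0/=.
  apply: le_trans (norm1_sum (g := fun i => S (dyadic l i) (r j \- z)) _ _ _); last 2 first.
  - by move=> i; apply: lS; exact: inL1B.
  - by move=> i; apply: (semigroup_norm1 sgS); [exact: dyadic_ge0|exact: inL1B].
  have h : \forall w \ae mu, forall i, S (dyadic l i) (r j \- z) w =
      S (dyadic l i) (r j) w - S (dyadic l i) z w.
    apply: ae_foralln => i.
    exact: (contractionB (semigroup_contraction sgS (dyadic_ge0 l i)) (lr j) lz).
  rewrite le_eqVlt; apply/orP; left; apply/eqP; apply: norm1_ae.
  apply: filterS2 (blocks j) h => w /= -> hw; rewrite -sumrB.
  by apply: eq_bigr => i _; rewrite hw.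
have lAn : inL1 mu (fun w => dyadic l n *: Av f (dyadic l n) w) by exact/inL1Z/lA.
have lrn j : inL1 mu (riemann S f (l + j) (n * 2 ^ j)) by exact: riemann_inL1.
have e1 := dyadic_lim_unique lrn lAn (lsum _ lz) (rA l n n0) lim.
have e2 : \forall w \ae mu, forall i, S (dyadic l i) z w =
    dyadic l 1 *: S (dyadic l i) (Av f (dyadic l 1)) w.
  apply: ae_foralln => i.
  exact: (contractionZ _ (semigroup_contraction sgS (dyadic_ge0 l i)) lA1).
apply: filterS2 e1 e2 => w e1 e2; apply: (scalerI (lt0r_neq0 d1)).
have -> : dyadic l 1 *: (\sum_(i < n) S (dyadic l i) (Av f (dyadic l 1)) w) =
    \sum_(i < n) S (dyadic l i) z w by rewrite scaler_sumr; apply: eq_bigr => i _; rewrite e2.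
rewrite scalerA -e1.
by congr (_ *: _); rewrite /dyadic mul1r mulrC.
Qed.

(** On each dyadic grid this is [filling_maximal] for the average over one step, whose norm is at
    most that of [f]. The exceptional sets increase as the grid is refined and keep the same bound;
    continuity in [t] covers the other times. *)
Lemma average_maximal f (a : R) : inL1 mu f -> 0 < a -> exists E, [/\ measurable E,
  (mu E <= (norm1 mu f / a)%:E)%E &
  forall w, ~ E w -> forall t, 0 < t -> `|Av f t w| <= a].
Proof.
move=> lf a0; have [lA cA rA] := hAv lf.
have dg l n : 0 < dyadic l n.+1 :> R by exact: dyadic_gt0.
pose E l := \bigcup_n [set w | a < `|Av f (dyadic l n.+1) w|].
have mE l : measurable (E l).
  apply: bigcup_measurable => n _; apply: measurable_lt_set; first exact: measurable_cst.
  by apply: smeas_norm; case: (lA _ (dg l n)).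
have muE l : (mu (E l) <= (norm1 mu f / a)%:E)%E.
  have l1 := lA _ (dg l 0%N).
  have cS := semigroup_contraction sgS (dyadic_ge0 l 1).
  have [B [mB muB hB]] := filling_maximal cS a0 l1.
  have : \forall w \ae mu, ~ (E l `\` B) w.
    have h1 : \forall w \ae mu, forall n, n.+1%:R *: Av f (dyadic l n.+1) w =
        \sum_(i < n.+1) S (dyadic l i) (Av f (dyadic l 1)) w.
      by apply: ae_foralln => n; exact: average_block.
    have h2 : \forall w \ae mu, forall j, iter j (S (dyadic l 1)) (Av f (dyadic l 1)) w =
        S (dyadic l j) (Av f (dyadic l 1)) w.
      by apply: ae_foralln => j; exact: iter_semigroup.
    apply: filterS3 hB h1 h2 => w hw e1 e2 [[n _ /= an] nB].
    have := hw nB n.+1.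
    have -> : \sum_(i < n.+1) iter i (S (dyadic l 1)) (Av f (dyadic l 1)) w =
        \sum_(i < n.+1) S (dyadic l i) (Av f (dyadic l 1)) w by apply: eq_bigr => i _.
    rewrite -e1 normrZ normr_nat mulrC.
    by rewrite ler_pM2r ?ltr0n// leNgt an.
  move=> h; have EB0 : mu (E l `\` B) = 0%E.
    have [N [mN N0 sub]] := h; apply/eqP; rewrite eq_le measure_ge0 andbT -N0.
    apply: le_measure; rewrite ?inE//; first exact: measurableD.
    by move=> w Ew; apply: sub => /=; apply.
  apply: le_trans (le_trans muB _); last first.
    by rewrite lee_fin ler_pM2r ?invr_gt0//; case: (cAv (dg l 0%N)) => _ _ h' _; exact: h'.
  apply: (@le_trans _ _ (mu (B `|` (E l `\` B)))).
    apply: le_measure; rewrite ?inE//; first by apply: measurableU => //; exact: measurableD.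
    by move=> w Ew; have [Bw|nBw] := pselect (B w); [left|right].
  apply: le_trans (measureU2 _ mB (measurableD (mE l) mB)) _.
  by rewrite [X in (_ + X <= _)%E]EB0 adde0.
have ES l : E l `<=` E l.+1.
  move=> w [n _ /= an]; exists (n.*2.+1) => //=.
  by rewrite -doubleS -muln2 -addn1 (dyadic_refine l 1 n.+1).
have mono : {homo E : n m / (n <= m)%N >-> (n <= m)%O}.
  by apply: homo_leq => [//|? ? ?|n]; [exact: le_trans|apply/subsetPset].
have mU : measurable (\bigcup_l E l) by exact: bigcup_measurable.
exists (\bigcup_l E l); split => //.
  have lim := nondecreasing_cvg_mu (mu := mu) mE mU mono.
  rewrite -(cvg_lim (@ereal_hausdorff R) lim); apply: lime_le; first exact: cvgP lim.
  exact: nearW.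
move=> w nE t t0; have [m mP mt] := dyadic_dense t0.
have h : Av f (dyadic n (m n)) w @[n --> \oo] --> Av f t w by exact: cvg_comp mt (cA w t t0).
have h' : `|Av f (dyadic n (m n)) w| @[n --> \oo] --> `|Av f t w| by exact: cvg_norm.
rewrite -(cvg_lim (@Rhausdorff R) h'); apply: limr_le; first exact: cvgP h'.
apply: nearW => n; rewrite leNgt; apply/negP => an; apply: nE; exists n => //.
by exists (m n).-1 => //=; rewrite prednK.
Qed.

(** [t A_t v] stays bounded. Coboundaries [f - S s f] of bounded functions have this property, and
    it is stable under linear combinations. *)
Definition coboundary_like v := inL1 mu v /\ exists C : R, forall l m, (0 < m)%N ->
  \forall w \ae mu, `|dyadic l m *: Av v (dyadic l m) w| <= C.

Lemma coboundary_average v : coboundary_like v ->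
  exists2 C : R, 0 <= C & \forall w \ae mu, forall t, 0 < t -> `|Av v t w| <= C / t.
Proof.
move=> [lv [C hC]]; have [lA cA rA] := hAv lv.
exists `|C| => //; have : \forall w \ae mu, forall l m, (0 < m)%N -> `|dyadic l m *: Av v (dyadic l m) w| <= C.
  apply: ae_foralln => l; apply: ae_foralln => m; have [m0|m0] := boolP (0 < m)%N.
    by apply: filterS (hC l m m0).
  exact: nearW.
apply: filterS => w hw t t0; have [m mP mt] := dyadic_dense t0.
have h : Av v (dyadic n (m n)) w @[n --> \oo] --> Av v t w by exact: cvg_comp mt (cA w t t0).
have h' : `|dyadic n (m n) *: Av v (dyadic n (m n)) w| @[n --> \oo] --> `|t *: Av v t w|.
  by apply: cvg_norm; exact: cvgZ.
rewrite ler_pdivlMr// mulrC -[X in X * _](gtr0_norm t0) -normrZ.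
rewrite -(cvg_lim (@Rhausdorff R) h'); apply: limr_le; first exact: cvgP h'.
by apply: nearW => n; rewrite (le_trans (hw _ _ (mP n)))// ler_norm.
Qed.

Lemma coboundary_ae v v' : inL1 mu v' -> (\forall w \ae mu, v w = v' w) ->
  coboundary_like v -> coboundary_like v'.
Proof.
move=> lv' vv' [lv [C hC]]; split => //; exists C => l m m0.
have h := contraction_ae (cAv (dyadic_gt0 l m0)) lv lv' vv'.
by apply: filterS2 h (hC l m m0) => w ->.
Qed.

Lemma coboundary_linear (a : R) v v' : coboundary_like v -> coboundary_like v' ->
  coboundary_like (fun w => a *: v w + v' w).
Proof.
move=> [lv [C hC]] [lv' [C' hC']]; split; first exact: inL1D (inL1Z a lv) lv'.
exists (`|a| * C + C') => l m m0.
have [_ lin _ _] := cAv (@dyadic_gt0 R l m m0).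
apply: filterS3 (lin a v v' lv lv') (hC l m m0) (hC' l m m0) => w -> h1 h2.
rewrite scalerDr; apply: le_trans (ler_normD _ _) _; apply: lerD => //.
by rewrite scalerA mulrC -scalerA normrZ ler_wpM2l.
Qed.

(** After cancellation two windows of length [dyadic k i] remain, each bounded by [M] times this
    length. *)
Lemma shift_coboundary f (M : R) k i l m : inL1 mu f -> (\forall w \ae mu, `|f w| <= M) ->
  (0 < m)%N -> \forall w \ae mu,
  `|dyadic l m *: Av (f \- S (dyadic k i) f) (dyadic l m) w| <= 2 * M * dyadic k i.
Proof.
move=> lf fM m0; have ls := semigroup_dyadic_inL1 sgS k i lf.
have lfs := inL1B lf ls; have [lA _ rA] := hAv lfs.
apply: ae_bounded_closure; first exact/inL1Z/lA/dyadic_gt0.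
move=> e e0; have [J _ hJ] := cvgr_lt _ (rA l m m0) _ e0.
(* The grid is refined until [dyadic k i] is a multiple of its mesh. *)
pose j := (J + k)%N; have Jj : (J <= j)%N by rewrite leq_addr.
have kj : (k <= l + j)%N by rewrite /j addnA leq_addl.
pose q := (m * 2 ^ j)%N; pose i' := (i * 2 ^ (l + j - k))%N.
exists (riemann S (f \- S (dyadic k i) f) (l + j) q); split.
- exact: riemann_inL1.
- exact: ltW (hJ j Jj).
have di : dyadic k i = dyadic (l + j) i' :> R by rewrite /i' -{1}(subnKC kj) dyadic_refine.
have h1 := riemann_linear sgS (-1) (l + j) q ls lf.
have h2 := rsum_semigroup sgS (l + j) i' 0 q lf; rewrite -di addn0 in h2.
have h3 := rsum_bounded sgS (l + j) 0 i' lf fM.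
have h4 := rsum_bounded sgS (l + j) q (q + i') lf fM.
rewrite (_ : f \- _ = (fun w => -1 *: S (dyadic k i) f w + f w)); last first.
  by apply/funext => w; rewrite scaleN1r addrC.
apply: filterS2 h1 (filterI h2 (filterI h3 h4)) => w -> [h2w [h3w h4w]].
rewrite scaleN1r addrC !riemannE h2w rsum_shift di.
rewrite subn0 in h3w; rewrite addKn in h4w.
apply: le_trans (ler_normB _ _) _; apply: le_trans (lerD h3w h4w) _; lra.
Qed.

(** [f - A_t f] is a limit of means of coboundaries [f - S s f] with [s <= t]. Their bounds [2 M s]
    are at most [2 M t], uniformly along the limit. *)
Lemma average_coboundary f (M : R) l m : inL1 mu f -> 0 <= M ->
  (\forall w \ae mu, `|f w| <= M) -> (0 < m)%N -> coboundary_like (f \- Av f (dyadic l m)).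
Proof.
move=> lf M0 fM m0; have [lA _ rA] := hAv lf; set t := dyadic l m.
have t0 : 0 < t by exact: dyadic_gt0.
have lv : inL1 mu (f \- Av f t) by exact: inL1B (lA _ t0).
split => //; exists (2 * M * t) => l' m' m0'; set r := dyadic l' m'.
have r0 : 0 < r by exact: dyadic_gt0.
have cr := cAv r0.
apply: ae_bounded_closure; first by apply: inL1Z; case: cr => h _ _ _; exact: h.
(* The mean [v] below differs from [f - A_t f] by the Riemann error divided by [t], and [r A_r]
   multiplies norms by at most [r]; hence the tolerance [e / r * t]. *)
move=> e e0; have er : 0 < e / r * t by rewrite mulr_gt0// divr_gt0.
have [j _ /(_ j (leqnn j)) hj] := cvgr_lt _ (rA l m m0) _ er.
set k := (l + j)%N in hj; set q := (m * 2 ^ j)%N in hj.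
have tq : dyadic k q = t by rewrite /k /q dyadic_refine.
have q0 : (0 < q)%N by rewrite muln_gt0 m0 expn_gt0.
have qR : 0 < q%:R :> R by rewrite ltr0n.
pose D i := f \- S (dyadic k i.+1) f.
have lD i : inL1 mu (D i) by apply: inL1B => //; exact: semigroup_dyadic_inL1.
pose v := fun w => q%:R^-1 *: \sum_(i < q) D i w.
have lsD : inL1 mu (fun w => \sum_(i < q) D i w) by exact: inL1_sum.
have lvj : inL1 mu v by exact: inL1Z.
have vE w : v w = f w - t^-1 *: riemann S f k q w.
  have e' : \sum_(i < q) D i w = q%:R *: f w - \sum_(i < q) S (dyadic k i.+1) f w.
    by rewrite /D /= sumrB sumr_const card_ord scaler_nat.
  rewrite /v e' scalerBr scalerA mulVf ?gt_eqF// scale1r.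
  by rewrite /riemann scalerA -tq /dyadic invfM mulfVK// gt_eqF// exprn_gt0// invr_gt0.
exists (fun w => r *: Av v r w); split.
- by apply: inL1Z; case: cr => h _ _ _; exact: h.
- have l1 : inL1 mu (Av v r \- Av (f \- Av f t) r).
    by case: cr => h _ _ _; apply: inL1B; exact: h.
  rewrite (_ : _ \- _ = (fun w => r *: (Av v r \- Av (f \- Av f t) r) w)); last first.
    by apply/funext => w; rewrite /= scalerBr.
  rewrite norm1Z; last by case: l1.
  rewrite gtr0_norm// mulrC -ler_pdivlMr//; apply: le_trans (L1_contraction_dist cr lvj lv) _.
  have lz := inL1B (riemann_inL1 sgS k q lf) (inL1Z t (lA _ t0)).
  rewrite (@norm1_ae _ _ _ _ _ _ (fun w => - t^-1 *: (riemann S f k q \- (fun w => t *: Av f t w)) w)).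
    rewrite norm1Z; last by case: lz.
    by rewrite normrN gtr0_norm ?invr_gt0// mulrC ler_pdivrMr// ltW.
  apply: nearW => w /=; rewrite vE scalerBr !scaleNr (scalerA t^-1 t) mulVf ?gt_eqF// scale1r opprK.
  by rewrite opprB addrC subrKA addrC.
have h1 := contractionZ q%:R^-1 cr lsD.
have h2 := contraction_sum q cr lD.
have h3 : \forall w \ae mu, forall i, `|r *: Av (D i) r w| <= 2 * M * dyadic k i.+1.
  by apply: ae_foralln => i; exact: shift_coboundary.
apply: filterS3 h1 h2 h3 => w; rewrite -/v => -> -> h3.
rewrite scalerA mulrC -scalerA normrZ gtr0_norm ?invr_gt0// mulrC ler_pdivrMr//.
rewrite scaler_sumr; apply: le_trans (ler_norm_sum _ _ _) _.
apply: (@le_trans _ _ (\sum_(i < q) (2 * M * t))); last first.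
  by rewrite sumr_const card_ord mulr_natr.
apply: ler_sum => i _; apply: le_trans (h3 i) _; rewrite ler_wpM2l ?mulr_ge0// -tq.
by rewrite /dyadic ler_wpM2r ?ler_nat// exprn_ge0// invr_ge0.
Qed.

(** The same cancellation measured in [L_1]: [t A_t f] moves by at most two windows of length
    [dyadic k i], and division by [t] makes this small for long times. *)
Lemma average_almost_invariant f l m k i : inL1 mu f -> (0 < m)%N ->
  norm1 mu (Av f (dyadic l m) \- S (dyadic k i) (Av f (dyadic l m))) <=
  dyadic k i * (2 * norm1 mu f / dyadic l m).
Proof.
move=> lf m0; have [lA _ rA] := hAv lf; set t := dyadic l m.
have t0 : 0 < t by exact: dyadic_gt0.
have lt := lA _ t0; have cS := semigroup_contraction sgS (@dyadic_ge0 R k i).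
pose z := fun w => t *: Av f t w; have lz : inL1 mu z by exact: inL1Z.
have lSz : inL1 mu (S (dyadic k i) z) by case: cS => h _ _ _; exact: h.
have lSt : inL1 mu (S (dyadic k i) (Av f t)) by case: cS => h _ _ _; exact: h.
suff h : norm1 mu (z \- S (dyadic k i) z) <= dyadic k i * (2 * norm1 mu f).
  rewrite mulrA ler_pdivlMr// mulrC -[X in X * _](gtr0_norm t0) -norm1Z; last first.
    by case: (inL1B lt lSt).
  rewrite (@norm1_ae _ _ _ _ _ _ (z \- S (dyadic k i) z))//.
  by apply: filterS (contractionZ t cS lt) => w e; rewrite /= -/z e scalerBr.
apply/ler_addgt0Pr => e e0; have e20 : 0 < e / 2 by rewrite divr_gt0.
have [J _ hJ] := cvgr_lt _ (rA l m m0) _ e20.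
pose j := (J + k)%N; have Jj : (J <= j)%N by rewrite leq_addr.
have kj : (k <= l + j)%N by rewrite /j addnA leq_addl.
have {}hJ := hJ j Jj.
set q := (m * 2 ^ j)%N in hJ; pose i' := (i * 2 ^ (l + j - k))%N.
set y := riemann S f (l + j) q in hJ.
have ly : inL1 mu y by exact: riemann_inL1.
have lSy : inL1 mu (S (dyadic k i) y) by case: cS => h _ _ _; exact: h.
have di : dyadic k i = dyadic (l + j) i' :> R by rewrite /i' -{1}(subnKC kj) dyadic_refine.
have h1 : norm1 mu (y \- S (dyadic k i) y) <= dyadic k i * (2 * norm1 mu f).
  rewrite (@norm1_ae _ _ _ _ _ _ (rsum S f (l + j) 0 i' \- rsum S f (l + j) q (q + i'))).
    have lr a b : inL1 mu (rsum S f (l + j) a b) by exact: rsum_inL1.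
    apply: le_trans (norm1B (lr _ _) (lr _ _)) _.
    have := rsum_norm1 sgS (l + j) 0 i' lf; have := rsum_norm1 sgS (l + j) q (q + i') lf.
    by rewrite subn0 addKn -di; lra.
  have := semigroup_rsum sgS (l + j) i' 0 q lf; rewrite -riemannE -di addn0.
  by apply: filterS => w /= ->; rewrite /y riemannE rsum_shift.
have h2 := L1_contraction_dist cS ly lz.
have := norm1_triangle lz ly lSz; have := norm1_triangle ly lSy lSz.
rewrite (norm1_sym mu z y); move: h1 h2 hJ; rewrite -/z; lra.
Qed.

Definition invariant_class u := inL1 mu u /\
  forall k i, \forall w \ae mu, S (dyadic k i) u w = u w.

Lemma invariant_average u : invariant_class u ->
  \forall w \ae mu, forall t, 0 < t -> Av u t w = u w.
Proof.
move=> [lu Su]; have [lA cA rA] := hAv lu.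
apply: (average_eq_dyadic (B := fun _ => u)) => // [w t t0|l m m0]; first exact: cvg_cst.
have d0 : 0 < dyadic l m :> R by exact: dyadic_gt0.
have lr j : inL1 mu (riemann S u (l + j) (m * 2 ^ j)) by exact: riemann_inL1.
have lAm : inL1 mu (fun w => dyadic l m *: Av u (dyadic l m) w) by exact/inL1Z/lA.
have ldu : inL1 mu (fun w => dyadic l m *: u w) by exact: inL1Z.
have lim : norm1 mu (riemann S u (l + j) (m * 2 ^ j) \- (fun w => dyadic l m *: u w))
    @[j --> \oo] --> (0 : R).
  apply: cvg_near_cst; apply: nearW => j; apply: norm1_eq0_ae.
  have : \forall w \ae mu, forall i, S (dyadic (l + j) i) u w = u w.
    by apply: ae_foralln => i; exact: Su.
  apply: filterS => w hw /=; rewrite /riemann.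
  rewrite (eq_bigr (fun=> u w)) => [|i _]; last exact: hw.
  rewrite sumr_const card_ord -[X in _ *: X]scaler_nat scalerA mulrC -[_ * _]/(dyadic (l + j) (m * 2 ^ j)).
  by rewrite dyadic_refine subrr.
have := dyadic_lim_unique lr lAm ldu (rA l m m0) lim.
by apply: filterS => w; exact: (scalerI (lt0r_neq0 d0)).
Qed.

End ergodic_theorem.

Section mean_ergodic.
Context {R : realType} {X : completeNormedModType R} {d : measure_display}
  {W : measurableType d} (mu : {finite_measure set W -> \bar R}).
Hypothesis reflX : reflexive_space X.
Variable S : R -> (W -> X) -> W -> X.
Hypothesis sgS : contraction_semigroup mu S.
Variable Av : (W -> X) -> R -> W -> X.
Hypothesis hAv : forall f, inL1 mu f -> average mu S f (Av f).
Hypothesis cAv : forall t, 0 < t -> L1_contraction mu (fun f => Av f t).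
Implicit Types (f g u v : W -> X) (s t c : R).

(* Smulian's theorem applied to the sets of bounded [g] with [f \- g] coboundary-like
   and [g] more and more invariant; they contain the averages of [f]. *)
Lemma mean_ergodic_bounded f (M eps : R) : inL1 mu f -> 0 <= M ->
  (\forall w \ae mu, `|f w| <= M) -> 0 < eps -> exists u v,
  [/\ invariant_class mu S u, coboundary_like mu Av v &
      norm1 mu (fun w => f w - u w - v w) < eps].
Proof.
move=> lf M0 fM e0.
pose C n := [set g | [/\ smeas g, forall w, `|g w| <= M, coboundary_like mu Av (f \- g) &
  forall k i, norm1 mu (g \- S (dyadic k i) g) <= dyadic k i * (2^-1) ^+ n]].
have bl g : smeas g -> (forall w, `|g w| <= M) -> inL1 mu g.
  by move=> mg gM; apply: (inL1_bounded mg (M := M) _).1; exact: nearW.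
have Cn0 n : C n !=set0.
  (* For a long enough time [t], the semigroup moves [A_t f] by at most [2^-n] per unit of time. *)
  have [m] : exists m, (0 < m)%N /\ 2 * norm1 mu f / dyadic 0 m <= (2^-1 : R) ^+ n.
    have n0 := norm1_ge0 mu f.
    pose m := (Num.bound (2 * norm1 mu f * 2 ^+ n)).+1; exists m; split => //.
    have d0 : 0 < dyadic 0 m :> R by exact: dyadic_gt0.
    rewrite ler_pdivrMr// exprVn [leRHS]mulrC ler_pdivlMr ?exprn_gt0//.
    rewrite /dyadic expr0 mulr1; apply: le_trans (ltW (archi_boundP _)) _.
      by rewrite !mulr_ge0 ?exprn_ge0.
    by rewrite ler_nat /m leqnSn.
  move=> [m0 hm]; set t := dyadic 0 m in hm.
  have t0 : 0 < t by exact: dyadic_gt0.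
  have [lA _ _] := hAv lf; have lt := lA _ t0.
  have [_ _ _ /(_ f M lf fM) bA] := cAv t0.
  (* The average is bounded by [M] almost everywhere; it is put equal to 0 elsewhere since members
     of [C n] are bounded at every point. *)
  pose B := [set w | `|Av f t w| <= M].
  have mB : measurable B.
    by apply: measurable_le_set; [apply: smeas_norm; case: lt|exact: measurable_cst].
  pose g := cut0 B (Av f t).
  have gE : \forall w \ae mu, Av f t w = g w.
    by apply: filterS bA => w h; rewrite /g /cut0 mem_set.
  have lg : inL1 mu g by exact: inL1_cut0.
  exists g; split.
  - by case: lg.
  - move=> w; rewrite /g /cut0; case: ifPn; last by rewrite normr0.
    by rewrite inE.
  - have := average_coboundary sgS hAv cAv 0 lf M0 fM m0; apply: coboundary_ae => //.
      exact: inL1B.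
    by apply: filterS gE => w /= ->.
  - move=> k i; have cS := semigroup_contraction sgS (@dyadic_ge0 R k i).
    have := average_almost_invariant sgS hAv 0 k i lf m0; rewrite -/t.
    have h := contraction_ae cS lt lg gE.
    rewrite (@norm1_ae _ _ _ _ _ _ (g \- S (dyadic k i) g)); last first.
      by apply: filterS2 gE h => w /= -> ->.
    by move/le_trans; apply; rewrite ler_wpM2l// dyadic_ge0.
have Cdec n : C n.+1 `<=` C n.
  move=> g [mg gM cg hg]; split => // k i; apply: le_trans (hg k i) _.
  rewrite ler_wpM2l ?dyadic_ge0// exprS ler_piMl ?exprn_ge0 ?invr_ge0//.
  by rewrite invf_le1// ler1n.
have [||||u lu hu] := @smulian _ _ _ _ mu C M reflX => //.
- by move=> n g [].
- move=> n a g h /andP[a0 a1] [mg gM cg hg] [mh hM ch hh].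
  have b0 : 0 <= 1 - a by rewrite subr_ge0.
  have lg := bl g mg gM; have lh := bl h mh hM.
  have ml : smeas (fun w => a *: g w + (1 - a) *: h w) by apply: smeasD; exact: smeasZ.
  split => //.
  + move=> w; apply: le_trans (ler_normD _ _) _; rewrite !normrZ !ger0_norm//.
    have := ler_wpM2l a0 (gM w); have := ler_wpM2l b0 (hM w); lra.
  + have c0 : coboundary_like mu Av (fun w => (1 - a) *: (f \- h) w + (fun=> 0) w).
      apply: coboundary_linear => //; split; first exact: inL1_cst.
      exists 0 => l m m0; have := contraction0 (cAv (@dyadic_gt0 R l m m0)).
      by apply: filterS => w ->; rewrite scaler0 normr0.
    have := coboundary_linear cAv a cg c0; apply: coboundary_ae => //.
      by apply: inL1B => //; split => //; case: (inL1D (inL1Z a lg) (inL1Z (1 - a) lh)).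
    apply: nearW => w /=; rewrite addr0 !scalerBr addrACA -scalerDl addrC [a + _]addrC subrK.
    by rewrite scale1r addrC opprD.
  + move=> k i; have cS := semigroup_contraction sgS (@dyadic_ge0 R k i).
    have [iS lS _ _] := cS.
    have l1 := inL1B lg (iS _ lg); have l2 := inL1B lh (iS _ lh).
    rewrite (@norm1_ae _ _ _ _ _ _ ((fun w => a *: (g \- S (dyadic k i) g) w) \+
        (fun w => (1 - a) *: (h \- S (dyadic k i) h) w))).
      apply: le_trans (norm1D (inL1Z _ l1) (inL1Z _ l2)) _.
      rewrite (norm1Z _ _ l1.1) (norm1Z _ _ l2.1) !ger0_norm//.
      have := ler_wpM2l a0 (hg k i); have := ler_wpM2l b0 (hh k i); lra.
    apply: filterS2 (lS a g _ lg (inL1Z (1 - a) lh)) (contractionZ (1 - a) cS lh) => w /= -> ->.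
    by rewrite !scalerBr opprD addrACA.
(* [u] is approximated by members of [C n] for every [n], and the defect of invariance is continuous
   in [L_1]. *)
have iu : invariant_class mu S u.
  split => // k i; have cS := semigroup_contraction sgS (@dyadic_ge0 R k i).
  have [iS _ _ _] := cS; apply: norm1_eqP => //; first exact: iS.
  apply/eqP; rewrite eq_le norm1_ge0 andbT norm1_sym; apply/ler_addgt0Pr => e e1; rewrite add0r.
  have s0 : 0 <= dyadic k i :> R by exact: dyadic_ge0.
  have e3 : 0 < e / (3 * (dyadic k i + 1)) by rewrite divr_gt0// mulr_gt0// ltr_wpDl.
  have [n /(_ n (leqnn n)) hn] := expr2V_small e3.
  have e4 : 0 < e / 3 by rewrite divr_gt0.
  have [g [mg gM _ hg] gu] := hu n _ e4.
  have lg := bl g mg gM.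
  have h1 := norm1_triangle lu lg (iS _ lu); have h2 := norm1_triangle lg (iS _ lg) (iS _ lu).
  have h3 := L1_contraction_dist cS lg lu; have h4 := hg k i.
  have h5 : dyadic k i * (2^-1) ^+ n <= e / 3.
    apply: (@le_trans _ _ ((dyadic k i + 1) * (e / (3 * (dyadic k i + 1))))).
      by apply: ler_pM; rewrite ?exprn_ge0 ?invr_ge0// ?lerDl// ltW.
    rewrite le_eqVlt; apply/orP; left; apply/eqP; field.
    by rewrite gt_eqF// ltr_wpDl.
  rewrite (norm1_sym mu u g) in h1; move: h1 h2 h3 h4 h5 gu; lra.
have [g [mg gM cg _] gu] := hu 0%N _ e0.
exists u, (f \- g); split => //.
rewrite (@norm1_ae _ _ _ _ _ _ (g \- u))//; apply: nearW => w /=.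
by rewrite opprB addrC addrA subrK.
Qed.

Lemma mean_ergodic f (eps : R) : inL1 mu f -> 0 < eps -> exists u v,
  [/\ invariant_class mu S u, coboundary_like mu Av v &
      norm1 mu (fun w => f w - u w - v w) < eps].
Proof.
move=> lf e0; have e20 : 0 < eps / 2 by rewrite divr_gt0.
have [h [fh hf]] := norm1_approx lf e20.
have [M hM] := finitely_valued_bounded fh; have lh := finitely_valued_inL1 mu fh.
have [|u [v [iu cv hn]]] := @mean_ergodic_bounded h `|M| (eps / 2) lh (normr_ge0 _) _ e20.
  by apply: nearW => w; exact: le_trans (hM w) (ler_norm _).
exists u, v; split => //; have [lu _] := iu; have [lv _] := cv.
rewrite (_ : (fun w => _) = (f \- h) \+ (fun w => h w - u w - v w)); last first.
  by apply/funext => w; rewrite /= !addrA subrK.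
apply: le_lt_trans (norm1D (inL1B lf lh) (inL1B (inL1B lh lu) lv)) _.
move: hf hn; lra.
Qed.

(** With [f = u k + v k + z k] and [norm1 (z k) < 4^-k], [A_t f] is [u k], plus a term of order
    [1 / t], plus [A_t (z k)]. For large [t] this makes [A_t f] close to every [u k] in [L_1], so
    the [u k] are Cauchy; pointwise, [average_maximal] at level [2^-k] makes [A_t (z k)] small for
    all [t] at once. *)
Lemma ergodic_theorem f : inL1 mu f -> exists2 fbar, inL1 mu fbar &
  (\forall w \ae mu, Av f t w @[t --> +oo] --> fbar w) /\
  forall eps : R, 0 < eps -> exists2 t0, 0 < t0 & forall t, t0 <= t ->
    norm1 mu (Av f t \- fbar) < eps.
Proof.
move=> lf.
have /choice[uv huv] : forall k : nat, exists uv : (W -> X) * (W -> X),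
    [/\ invariant_class mu S uv.1, coboundary_like mu Av uv.2 &
      norm1 mu (fun w => f w - uv.1 w - uv.2 w) < (4^-1) ^+ k].
  move=> k; have e0 : 0 < (4^-1 : R) ^+ k by rewrite exprn_gt0// invr_gt0.
  by have [u [v h]] := mean_ergodic lf e0; exists (u, v).
pose u k := (uv k).1; pose v k := (uv k).2; pose z k := fun w => f w - u k w - v k w.
have iu k : invariant_class mu S (u k) by case: (huv k).
have lu k : inL1 mu (u k) by case: (iu k).
have cv k : coboundary_like mu Av (v k) by case: (huv k).
have lv k : inL1 mu (v k) by case: (cv k).
have lz k : inL1 mu (z k) := inL1B (inL1B lf (lu k)) (lv k).
have zk k : norm1 mu (z k) < (4^-1) ^+ k by case: (huv k).
have split_ t : 0 < t -> \forall w \ae mu, forall k,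
    Av f t w = u k w + Av (v k) t w + Av (z k) t w.
  move=> t0; apply: ae_foralln => k; have cA := cAv t0.
  have h1 := contractionD cA (inL1D (lu k) (lv k)) (lz k).
  have h2 := contractionD cA (lu k) (lv k).
  rewrite (_ : (u k \+ v k) \+ z k = f) in h1; last first.
    by apply/funext => w; rewrite /z /= addrC (addrC (u k w)) addrA !subrK.
  by apply: filterS3 h1 h2 (invariant_average sgS hAv (iu k)) => w -> -> /(_ t t0) ->.
have splitA : \forall w \ae mu, forall k t, 0 < t -> Av f t w = u k w + Av (v k) t w + Av (z k) t w.
  apply: ae_foralln => k; apply: (average_eq_dyadic (mu := mu)
    (B := fun t w => u k w + Av (v k) t w + Av (z k) t w)).
  - by case: (hAv lf).
  - move=> w t t0; have [_ c1 _] := hAv (lv k); have [_ c2 _] := hAv (lz k).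
    by apply: cvgD; [apply: cvgD; [exact: cvg_cst|exact: c1]|exact: c2].
  - by move=> l m m0; apply: filterS (split_ _ (@dyadic_gt0 R l m m0)) => w.
have /choice[C hC] : forall k : nat, exists C : R, 0 <= C /\
    \forall w \ae mu, forall t, 0 < t -> `|Av (v k) t w| <= C / t.
  by move=> k; have [C C0 h] := coboundary_average hAv (cv k); exists C.
have norm_u k eps : 0 < eps -> exists2 t0, 0 < t0 & forall t, t0 <= t ->
    norm1 mu (Av f t \- u k) < (4^-1) ^+ k + eps.
  move=> e0; have ms0 : 0 <= mass mu by apply: fine_ge0.
  have [C0 hk] := hC k.
  exists ((C k * mass mu + 1) / eps); first by rewrite divr_gt0// ltr_wpDl// mulr_ge0.
  move=> t tt; have t0 : 0 < t.
    by apply: lt_le_trans tt; rewrite divr_gt0// ltr_wpDl// mulr_ge0.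
  have [iA _ nA _] := cAv t0.
  rewrite (@norm1_ae _ _ _ _ _ _ (Av (v k) t \+ Av (z k) t)); last first.
    by apply: filterS splitA => w /(_ k t t0) /= ->; rewrite addrAC (addrAC (u k w)) subrr add0r.
  apply: le_lt_trans (norm1D (iA _ (lv k)) (iA _ (lz k))) _.
  have h1 : norm1 mu (Av (v k) t) <= C k / t * mass mu.
    apply: (inL1_bounded (iA _ (lv k)).1 _).2.
    by apply: filterS hk => w; exact.
  have h2 : C k / t * mass mu < eps.
    rewrite mulrAC ltr_pdivrMr// (mulrC eps); move: tt; rewrite ler_pdivrMr// => tt.
    by apply: lt_le_trans tt; rewrite ltrDl.
  have := nA _ (lz k); have := zk k; move: h1 h2; lra.
have uu k j : norm1 mu (u k \- u j) <= (4^-1) ^+ k + (4^-1) ^+ j.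
  apply/ler_addgt0Pr => e e0; have e20 : 0 < e / 2 by rewrite divr_gt0.
  have [t1 t10 h1] := norm_u k _ e20; have [t2 t20 h2] := norm_u j _ e20.
  have tm0 : 0 < Num.max t1 t2 by rewrite lt_max t10.
  have {}h1 := h1 (Num.max t1 t2); have {}h2 := h2 (Num.max t1 t2).
  have [iA _ _ _] := cAv tm0.
  have := norm1_triangle (lu k) (iA _ lf) (lu j); rewrite (norm1_sym mu (u k) (Av f _)).
  by move: h1 h2; rewrite !le_max !lexx orbT => /(_ isT) + /(_ isT); lra.
have p4 k : (4^-1 : R) ^+ k.+1 = (4^-1) ^+ k / 4 by rewrite exprS mulrC.
have q0 k : 0 < (4^-1 : R) ^+ k by rewrite exprn_gt0// invr_gt0.
(* The index shifts absorb constants: [4^-(k+1) + 4^-(k+2)] is below [4^-k], and so is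
   [2 * 4^-(k+1)]. *)
have [||fbar lfbar hfbar] := @L1_complete_fast _ _ _ _ mu (fun k => u k.+1).
- by move=> k; exact: lu.
- by move=> k; apply: le_trans (uu _ _) _; rewrite !p4; have := q0 k; lra.
have uf k : norm1 mu (u k.+2 \- fbar) <= (4^-1) ^+ k.
  by apply: le_trans (hfbar k.+1) _; rewrite p4; have := q0 k; lra.
have c4 : ((4^-1 : R) ^+ k) @[k --> \oo] --> (0 : R).
  by apply: cvg_expr; rewrite ger0_norm ?invr_ge0// invf_lt1// ltr1n.
exists fbar => //; split; last first.
  move=> e e0; have e30 : 0 < e / 3 by rewrite divr_gt0.
  have [k _ /(_ k (leqnn k)) hk] := cvgr_lt _ c4 _ e30.
  have [t0 t00 ht] := norm_u k.+2 _ e30; exists t0 => // t tt.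
  have [iA _ _ _] := cAv (lt_le_trans t00 tt).
  have := norm1_triangle (iA _ lf) (lu k.+2) lfbar.
  have := ht t tt; have := uf k; have := q0 k; rewrite !p4; move: hk => /=; lra.
have aeu := fast_ae_cvg (fun k => lu k.+2) lfbar uf.
have /choice[E hE] : forall k : nat, exists E, [/\ measurable E,
    (mu E <= (1 * (2^-1 : R) ^+ k)%:E)%E &
    forall w, ~ E w -> forall t, 0 < t -> `|Av (z k) t w| <= (2^-1) ^+ k].
  move=> k; have a0 : 0 < (2^-1 : R) ^+ k by rewrite exprn_gt0// invr_gt0.
  have [E [mE muE h]] := average_maximal sgS hAv cAv (lz k) a0; exists E; split => //.
  apply: (le_trans muE); rewrite lee_fin mul1r ler_pdivrMr// -exprMn.
  by rewrite (_ : 2^-1 * 2^-1 = 4^-1 :> R) ?ltW//; field.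
have bc : \forall w \ae mu, exists m, forall k, (m <= k)%N -> ~ E k w.
  by apply: (borel_cantelli (c := 1)) => // k; case: (hE k).
have hCa : \forall w \ae mu, forall k t, 0 < t -> `|Av (v k) t w| <= C k / t.
  by apply: ae_foralln => k; case: (hC k).
apply: filterS3 (filterI splitA hCa) aeu bc => w [sw Cw] uw [m hm].
apply/cvgrPdist_lt => e e0; have e40 : 0 < e / 4 by rewrite divr_gt0.
have /cvgrPdist_lt/(_ _ e40)[n1 _ h1] := uw.
have [n2 h2] := expr2V_small e40.
pose n := maxn m (maxn n1 n2); pose k := n.+2.
have nk : (n <= k)%N by rewrite /k (leq_trans (leqnSn n)).
have mk : (m <= k)%N by apply: leq_trans nk; rewrite leq_maxl.
have hu1 : `|fbar w - u k w| < e / 4 by apply: (h1 n); rewrite /= /n !leq_max leqnn orbT.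
have hz : (2^-1 : R) ^+ k < e / 4.
  by apply: h2; apply: leq_trans nk; rewrite !leq_max leqnn !orbT.
have [_ _ /(_ w (hm k mk)) hEk] := hE k.
have [C0 _] := hC k.
have T0 : 0 < C k / (e / 4) + 1 by rewrite ltr_wpDl// divr_ge0// ltW.
have := nbhs_pinfty_ge (num_real (C k / (e / 4) + 1)); apply: filterS => t tt.
have t0 : 0 < t := lt_le_trans T0 tt.
have hv : `|Av (v k) t w| <= e / 4.
  apply: le_trans (Cw k t t0) _; rewrite ler_pdivrMr// mulrC -ler_pdivrMr//.
  by apply: le_trans tt; rewrite lerDl.
rewrite (sw k t t0) -addrA opprD addrA.
apply: le_lt_trans (ler_normB _ _) _; have := ler_normD (Av (v k) t w) (Av (z k) t w).
have := hEk t t0; move: hv hz hu1; lra.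
Qed.

End mean_ergodic.

(** * From L_1 to L_p *)

Section power_majorization.
Context {R : realType}.
Variable q : R.
Hypothesis q0 : 0 <= q.
Implicit Types x y : R.

Lemma ler_pow x y : 0 <= x -> x <= y -> x `^ q <= y `^ q.
Proof. by move=> x0 xy; apply: ge0_ler_powR => //; rewrite nnegrE// (le_trans x0). Qed.

Lemma powRS x : 0 <= x -> x `^ (q + 1) = x `^ q * x.
Proof.
move=> x0; rewrite powRD ?powRr1//; apply/implyP => /eqP e.
by have : 0 < q + 1 by [rewrite ltr_wpDl|]; rewrite e ltxx.
Qed.

(** The slope of [hinges] on [[j, j + 1]], of the order of the derivative of the power [q + 1];
    [jump j] is the increase of the slope at [j]. For [q = 0] the slope at 0 is already 1. *)
Definition slope (j : nat) : R := j%:R `^ q.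

Definition jump (j : nat) : R := if j is i.+1 then slope j - slope i else slope 0.

Lemma jump_ge0 j : 0 <= jump j.
Proof.
case: j => [|j]; first exact: powR_ge0.
by rewrite subr_ge0; apply: ler_pow; rewrite ?ler_nat.
Qed.

Lemma sum_jump m : \sum_(j < m.+1) jump j = slope m.
Proof.
elim: m => [|m ih]; first by rewrite big_ord_recr big_ord0 /= add0r.
by rewrite big_ord_recr ih /= addrC subrK.
Qed.

(* A positive combination of the functions [x |-> (x - a)^+] comparable to [x `^ (q + 1)]. *)
Definition hinges (N : nat) x : R := \sum_(j < N.+1) jump j * Num.max (x - j%:R) 0.

Lemma hinge_ge0 j x : 0 <= jump j * Num.max (x - j%:R) 0.
Proof. by rewrite mulr_ge0 ?jump_ge0// le_max lexx orbT. Qed.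

Lemma hinges_ge0 N x : 0 <= hinges N x.
Proof. by apply: sumr_ge0 => j _; exact: hinge_ge0. Qed.

Lemma hinges_ge N m x : (m <= N)%N -> slope m * (x - m%:R) <= hinges N x.
Proof.
move=> mN; apply: (@le_trans _ _ (hinges m x)).
  rewrite -sum_jump mulr_suml; apply: ler_sum => j _; rewrite ler_wpM2l ?jump_ge0//.
  by rewrite le_max lerD2l lerN2 ler_nat -ltnS ltn_ord.
rewrite -(subnKC mN); elim: (N - m)%N => [|k ih]; first by rewrite addn0.
rewrite addnS [leRHS]/hinges big_ord_recr; apply: le_trans ih _.
by rewrite lerDl; exact: hinge_ge0.
Qed.

Lemma hinges_le N x : 0 <= x -> hinges N x <= x `^ q * x.
Proof.
move=> x0; elim: N => [|N ih].
  rewrite /hinges big_ord_recr big_ord0 /= add0r subr0 max_l// ler_wpM2r//.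
  by apply: ler_pow.
case: (leP (N.+1%:R) x) => Nx; last first.
  rewrite /hinges big_ord_recr /= -/(hinges N x) (max_r (x := x - _)) ?mulr0 ?addr0//.
  by rewrite subr_le0 ltW.
apply: (@le_trans _ _ (slope N.+1 * x)); last by rewrite ler_wpM2r// ler_pow.
rewrite -sum_jump mulr_suml; apply: ler_sum => j _; rewrite ler_wpM2l ?jump_ge0//.
by rewrite ge_max x0 gerBl ler0n.
Qed.

(** For [x <= 4] the linear term is enough. Otherwise [m = floor (x / 2)] is at least [x / 4], and
    [hinges] is at least [slope m * (x - m)], where [x - m >= x / 2]; this explains the factors
    [4^q] and 2. The condition [x <= 2 N] ensures [m <= N]. *)
Lemma pow_le_hinges N x : 0 <= x -> x <= 2 * N%:R ->
  x `^ (q + 1) <= 2 * 4 `^ q * (x + hinges N x).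
Proof.
move=> x0 xN; have h0 := hinges_ge0 N x; have p0 : 0 <= (4 : R) `^ q by exact: powR_ge0.
rewrite powRS//; case: (leP x 4) => x4.
  apply: (@le_trans _ _ (4 `^ q * x)); first by rewrite ler_wpM2r// ler_pow.
  rewrite -[leRHS]mulrA mulrDr; have a0 : 0 <= 4 `^ q * x by rewrite mulr_ge0.
  have b0 : 0 <= 4 `^ q * hinges N x by rewrite mulr_ge0.
  by lra.
have /andP[f1 f2] := floor_itv (x / 2).
have fl0 : 0 <= Num.floor (x / 2) by rewrite floor_ge0 divr_ge0.
pose m := `|Num.floor (x / 2)|%N.
have mE : (Num.floor (x / 2))%:~R = m%:R :> R by rewrite /m natr_absz ger0_norm.
rewrite intrD mE in f1 f2.
have f3 : x / 2 < m%:R + 1 by rewrite -[1]/(1%:~R).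
have mN : (m <= N)%N.
  by rewrite -(ler_nat R); apply: le_trans f1 _; lra.
have := hinges_ge x mN; rewrite /slope => hm.
have hs : (x / 4) `^ q <= m%:R `^ q by apply: ler_pow; [rewrite divr_ge0|lra].
have x4E : x `^ q = 4 `^ q * (x / 4) `^ q.
  by rewrite -powRM ?divr_ge0// mulrC divfK.
have l1 : (x / 4) `^ q * (x / 2) <= hinges N x.
  apply: le_trans hm; apply: ler_pM => //; rewrite ?powR_ge0 ?divr_ge0//; lra.
rewrite x4E -!mulrA [leRHS]mulrCA ler_wpM2l//.
apply: (@le_trans _ _ (2 * hinges N x)); last by rewrite ler_wpM2l// lerDr.
by move: l1; rewrite [_ * (x / 2)]mulrA; lra.
Qed.

End power_majorization.

Section interpolation.
Context {R : realType} {X : completeNormedModType R} {d : measure_display}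
  {W : measurableType d} (mu : {finite_measure set W -> \bar R}).
Variable q : R.
Hypothesis q0 : 0 <= q.
Implicit Types (f g h : W -> X) (K : (W -> X) -> W -> X).

(** The [p]-th power of the [L_p] norm, with [p = q + 1]. *)
Definition pmass f : \bar R := (\int[mu]_w (`|f w| `^ (q + 1))%:E)%E.

Lemma pmass_ge0 f : (0 <= pmass f)%E.
Proof. by apply: integral_ge0 => w _; rewrite lee_fin powR_ge0. Qed.

Lemma measurable_pow f : smeas f -> measurable_fun setT (fun w => (`|f w| `^ (q + 1))%:E).
Proof.
move=> mf; apply/measurable_EFinP.
by apply: (@measurableT_comp _ _ _ _ _ _ (fun r : R => r `^ (q + 1))) => //; exact: smeas_norm.
Qed.

Lemma measurable_hinge f (a : R) : smeas f ->
  measurable_fun setT (fun w => Num.max (`|f w| - a) 0).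
Proof.
move=> mf; apply: measurable_maxr; last exact: measurable_cst.
by apply: measurable_funB; [exact: smeas_norm|exact: measurable_cst].
Qed.

(* The radial truncation [g] of [f] at height [a] satisfies [|f - g| = (|f| - a)^+],
   and [|K f| <= a + |K (f - g)|]. *)
Lemma contraction_hinge K f (a : R) : L1_contraction mu K -> inL1 mu f -> 0 <= a ->
  (\int[mu]_w (Num.max (`|K f w| - a) 0)%:E <= \int[mu]_w (Num.max (`|f w| - a) 0)%:E)%E.
Proof.
move=> cK lf a0; have [iK _ nK bK] := cK.
pose r w := Num.min 1 (a * `|f w| `^ (-1)).
pose g w := r w *: f w.
have rf w : `|g w| <= a /\ `|f w - g w| = Num.max (`|f w| - a) 0.
  have r0 : 0 <= r w by rewrite le_min ler01 mulr_ge0 ?powR_ge0.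
  have r1 : 0 <= 1 - r w by rewrite subr_ge0 ge_min lexx.
  rewrite /g -[X in X - _]scale1r -scalerBl !normrZ !ger0_norm//.
  rewrite mulrBl mul1r.
  have [f0|f0] := eqVneq `|f w| 0.
    by rewrite f0 !mulr0 !sub0r oppr0 max_r ?oppr_le0.
  have n0 : 0 < `|f w| by rewrite lt0r f0 normr_ge0.
  rewrite /r powR_inv1 ?normr_ge0//.
  have [h|h] := ltP 1 (a / `|f w|).
    have {}h : `|f w| < a by move: h; rewrite ltr_pdivlMr// mul1r.
    by rewrite ?mul1r; split; [exact: ltW|rewrite subrr max_r// subr_le0 ltW].
  have {}h : a <= `|f w| by move: h; rewrite ler_pdivrMr// mul1r.
  by rewrite divfK//; split => //; rewrite max_l// subr_ge0.
have mg : smeas g.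
  apply: smeasM; last by case: lf.
  apply: measurable_minr; first exact: measurable_cst.
  apply: measurable_funM; first exact: measurable_cst.
  apply: (@measurableT_comp _ _ _ _ _ _ (fun r : R => r `^ (-1))) => //.
  by apply: smeas_norm; case: lf.
have ga : \forall w \ae mu, `|g w| <= a by apply: nearW => w; case: (rf w).
have [lg _] := inL1_bounded mg ga.
have lfg := inL1B lf lg.
apply: (@le_trans _ _ (\int[mu]_w (`|K (f \- g) w|)%:E)%E).
  apply: ge0_ae_le_integral; [by []|by move=> w; rewrite lee_fin le_max lexx orbT|by []|].
  have h := contractionD cK lfg lg.
  rewrite (_ : (f \- g) \+ g = f) in h; last by apply/funext => w; rewrite /= subrK.
  apply: filterS2 h (bK _ _ lg ga) => w -> hb _; rewrite lee_fin ge_max normr_ge0 andbT.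
  by rewrite lerBlDr; apply: le_trans (ler_normD _ _) _; rewrite lerD2l.
rewrite -norm1E; last exact: iK.
apply: (@le_trans _ _ (norm1 mu (f \- g))%:E); first by rewrite lee_fin nK.
rewrite norm1E// le_eqVlt; apply/orP; left; apply/eqP.
by apply: eq_integral => w _; case: (rf w) => _ <-.
Qed.

Lemma contraction_hinges K f N : L1_contraction mu K -> inL1 mu f ->
  (\int[mu]_w (hinges q N `|K f w|)%:E <= \int[mu]_w (hinges q N `|f w|)%:E)%E.
Proof.
move=> cK lf; have [iK _ _ _] := cK; have lKf := iK _ lf.
have E g : smeas g -> (\int[mu]_w (hinges q N `|g w|)%:E =
    \sum_(j < N.+1) (jump q j)%:E * \int[mu]_w (Num.max (`|g w| - j%:R) 0)%:E)%E.
  move=> mg; transitivity (\int[mu]_w (\sum_(j < N.+1) (jump q j)%:E * (Num.max (`|g w| - j%:R) 0)%:E))%E.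
    by apply: eq_integral => w _; rewrite /hinges sumEFin.
  rewrite ge0_integral_sum//; last 2 first.
  - move=> j; apply/measurable_EFinP; apply: measurable_funM; first exact: measurable_cst.
    exact: measurable_hinge.
  - by move=> j w _; rewrite lee_fin hinge_ge0.
  apply: eq_bigr => j _; rewrite ge0_integralZl//.
  - by apply/measurable_EFinP; exact: measurable_hinge.
  - by rewrite lee_fin jump_ge0.
rewrite (E _ lKf.1) (E _ lf.1); apply: lee_sum => j _.
by apply: lee_wpmul2l; [rewrite lee_fin jump_ge0|exact: contraction_hinge].
Qed.

(** [hinges q N] controls the power only up to height [2 N], hence the sets [A N] and monotone
    convergence. The constant is the same for all contractions, and this uniformity is what the
    convergence argument uses. *)
Lemma contraction_pmass K f : L1_contraction mu K -> inL1 mu f ->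
  (pmass (K f) <= (2 * 4 `^ q)%:E * ((norm1 mu f)%:E + pmass f))%E.
Proof.
move=> cK lf; have [iK _ nK _] := cK; have lKf := iK _ lf.
have C0 : 0 <= 2 * 4 `^ q :> R by rewrite mulr_ge0// powR_ge0.
pose A (N : nat) := [set w | `|K f w| <= 2 * N%:R].
have mA N : measurable (A N).
  by apply: measurable_le_set; [apply: smeas_norm; case: lKf|exact: measurable_cst].
have mono : nondecreasing_seq A.
  move=> n m nm; apply/subsetPset => w; rewrite /A /= => h; apply: le_trans h _.
  by rewrite ler_wpM2l// ler_nat.
have AT : \bigcup_N A N = setT.
  apply/seteqP; split => // w _; exists (Num.bound `|K f w|) => //; rewrite /A /=.
  apply: le_trans (ltW (archi_boundP _)) _ => //.
  by rewrite ler_peMl// ler1n.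
have mK := measurable_pow lKf.1.
have K0 N w : A N w -> (0 <= (`|K f w| `^ (q + 1))%:E)%E by rewrite lee_fin powR_ge0.
have lim := ge0_nondecreasing_set_cvg_integral mono mA (fun N => measurable_funTS mK) K0.
rewrite AT in lim; rewrite /pmass -(cvg_lim (@ereal_hausdorff R) (lim mu)).
apply: lime_le; first exact: cvgP (lim mu).
apply: nearW => N.
have mh g : smeas g -> measurable_fun setT (fun w => (hinges q N `|g w|)%:E).
  move=> mg; apply/measurable_EFinP; apply: measurable_sum => j.
  by apply: measurable_funM; [exact: measurable_cst|exact: measurable_hinge].
apply: (@le_trans _ _ (\int[mu]_w ((2 * 4 `^ q)%:E * ((`|K f w|)%:E + (hinges q N `|K f w|)%:E)))%E).
  apply: (@le_trans _ _ (\int[mu]_(w in A N) ((2 * 4 `^ q)%:E * ((`|K f w|)%:E + (hinges q N `|K f w|)%:E)))%E).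
    apply: ge0_ae_le_integral; [by []|by move=> w; rewrite lee_fin powR_ge0| |].
      by move=> w; rewrite -EFinD -EFinM lee_fin mulr_ge0// addr_ge0// hinges_ge0.
    by apply: nearW => w Aw; rewrite -EFinD -EFinM lee_fin; exact: pow_le_hinges.
  apply: ge0_subset_integral => //.
    apply: measurable_funeM; apply: emeasurable_funD; first exact: smeas_normE lKf.1.
    exact: mh lKf.1.
  by move=> w _; rewrite -EFinD -EFinM lee_fin mulr_ge0// addr_ge0// hinges_ge0.
rewrite ge0_integralZl//; last 2 first.
- apply: emeasurable_funD; first exact: smeas_normE lKf.1.
  exact: mh lKf.1.
- by move=> w _; rewrite -EFinD lee_fin addr_ge0// hinges_ge0.
apply: lee_wpmul2l; first by rewrite lee_fin.
rewrite ge0_integralD//; last 3 first.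
- exact: smeas_normE lKf.1.
- by move=> w _; rewrite lee_fin hinges_ge0.
- exact: mh lKf.1.
apply: leeD; first by rewrite -norm1E// lee_fin nK.
apply: le_trans (contraction_hinges N cK lf) _.
apply: ge0_ae_le_integral; [by []|by move=> w; rewrite lee_fin hinges_ge0| |].
  by move=> w; rewrite lee_fin powR_ge0.
by apply: nearW => w _; rewrite lee_fin powRS// hinges_le.
Qed.

End interpolation.

Section Lp_convergence.
Context {R : realType} {X : completeNormedModType R} {d : measure_display}
  {W : measurableType d} (mu : {finite_measure set W -> \bar R}).
Implicit Types (f g h : W -> X).

(** The limit operator must be a contraction of both spaces for [contraction_pmass] to apply to it
    as well. *)
Lemma limit_contraction (I : Type) (FF : set_system I) (K : I -> (W -> X) -> W -> X) :
  ProperFilter FF -> (\forall i \near FF, L1_contraction mu (K i)) ->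
  (forall f, inL1 mu f -> exists2 g, inL1 mu g & norm1 mu (K i f \- g) @[i --> FF] --> (0 : R)) ->
  exists2 G, L1_contraction mu G &
    forall f, inL1 mu f -> norm1 mu (K i f \- G f) @[i --> FF] --> (0 : R).
Proof.
move=> PF cK limK.
have /choice[G hG] : forall f, exists g, inL1 mu f ->
    inL1 mu g /\ norm1 mu (K i f \- g) @[i --> FF] --> (0 : R).
  move=> f; have [lf|nl] := pselect (inL1 mu f); last by exists f.
  by have [g lg h] := limK f lf; exists g.
have lG f : inL1 mu f -> inL1 mu (G f) by move=> /hG[].
exists G => [|f /hG[]//]; split => // [a f g lf lg|f lf|f M lf fM].
- have l1 : inL1 mu (fun w => a *: f w + g w) by exact: inL1D (inL1Z a lf) lg.
  have l2 : inL1 mu (fun w => a *: G f w + G g w).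
    exact: inL1D (inL1Z a (lG _ lf)) (lG _ lg).
  have [_ c1] := hG _ l1; have [_ cf] := hG _ lf; have [_ cg] := hG _ lg.
  apply: (L1_cvg_unique PF (lG _ l1) l2 _ c1).
    by apply: filterS cK => i [h _ _ _]; exact: h.
  have c2 : `|a| * norm1 mu (K i f \- G f) + norm1 mu (K i g \- G g) @[i --> FF] --> (0 : R).
    rewrite -[X in _ --> X](addr0 0) -[X in _ --> X + _](mulr0 `|a|).
    by apply: cvgD => //; apply: cvgMr.
  apply: (squeeze_cvgr _ (cvg_cst (0 : R)) c2); apply: filterS cK => i [iK lK _ _].
  rewrite norm1_ge0 /=.
  have h1 := inL1B (iK _ lf) (lG _ lf); have h2 := inL1B (iK _ lg) (lG _ lg).
  rewrite -(norm1Z _ _ h1.1); apply: le_trans (norm1D (inL1Z a h1) h2).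
  rewrite le_eqVlt; apply/orP; left; apply/eqP; apply: norm1_ae.
  by apply: filterS (lK a f g lf lg) => w /= ->; rewrite scalerBr opprD addrACA.
- have [_ c1] := hG _ lf; apply/ler_addgt0Pr => e e0.
  have [i [[iK _ nK _] hi]] := filter_ex (filterI cK (cvgr_lt _ c1 _ e0)).
  apply: le_trans (norm1_dist (lG _ lf) (iK _ lf)) _.
  by rewrite norm1_sym addrC lerD ?nK// ltW.
- have [_ c1] := hG _ lf; apply: (ae_bounded_closure (lG _ lf)) => e e0.
  have [i [[iK _ _ bK] hi]] := filter_ex (filterI cK (cvgr_lt _ c1 _ e0)).
  by exists (K i f); split; [exact: iK|exact: ltW|exact: bK].
Qed.

Variable q : R.
Hypothesis q0 : 0 <= q.
Local Notation pmass := (pmass mu q).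

Lemma pmass_ae f g : (\forall w \ae mu, f w = g w) -> pmass f = pmass g.
Proof.
move=> fg; apply: ge0_ae_eq_integral_nonmeasurable => //.
by apply: filterS fg => w ->.
Qed.

Lemma XnormE f : Xnorm mu (q + 1)%:E f = ((pmass f) `^ (q + 1)^-1)%E.
Proof.
rewrite /Xnorm unlock; congr (_ `^ _)%E; apply: eq_integral => w _.
by rewrite abse_EFin normr_id poweR_EFin.
Qed.

Lemma Xnorm_lty f : (Xnorm mu (q + 1)%:E f < +oo)%E <-> (pmass f < +oo)%E.
Proof.
rewrite XnormE; split; last exact: poweR_lty.
by apply: lty_poweRy; rewrite invr_eq0 gt_eqF// ltr_wpDl.
Qed.

Lemma Xnorm_le f (e : R) : 0 <= e -> (pmass f <= (e `^ (q + 1))%:E)%E ->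
  (Xnorm mu (q + 1)%:E f <= e%:E)%E.
Proof.
move=> e0 h; have q1 : 0 < q + 1 by rewrite ltr_wpDl.
rewrite XnormE; have -> : e%:E = (((e `^ (q + 1))%:E) `^ (q + 1)^-1)%E.
  by rewrite poweR_EFin -powRrM mulfV ?gt_eqF// powRr1.
apply: gt0_ler_poweR => //; first by rewrite invr_ge0 ltW.
- by rewrite in_itv /= leey andbT; exact: pmass_ge0.
- by rewrite in_itv /= leey andbT lee_fin powR_ge0.
Qed.

Lemma pmass_inL1 f : smeas f -> (pmass f < +oo)%E -> inL1 mu f.
Proof.
move=> mf pf; split => //.
apply: (@le_lt_trans _ _ (\int[mu]_w (1%:E + (`|f w| `^ (q + 1))%:E))%E).
  apply: ge0_ae_le_integral; [by []|by []| |].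
    by move=> w; rewrite -EFinD lee_fin addr_ge0// powR_ge0.
  apply: nearW => w _; rewrite -EFinD lee_fin.
  have [h|h] := leP `|f w| 1; first by rewrite (le_trans h)// lerDl powR_ge0.
  rewrite powRS//; apply: (@le_trans _ _ (`|f w| `^ q * `|f w|)); last by rewrite lerDr.
  rewrite ler_peMl//; have := ler_pow q0 ler01 (ltW h).
  by rewrite powR1.
rewrite ge0_integralD//; last exact: measurable_pow.
by rewrite lte_add_pinfty// integral_cst// mul1e finite_measure_lty.
Qed.

Lemma pmass_bounded f (M : R) : inL1 mu f -> (\forall w \ae mu, `|f w| <= M) ->
  (pmass f <= (M `^ q * norm1 mu f)%:E)%E.
Proof.
move=> lf fM; rewrite EFinM norm1E// -ge0_integralZl//; last 2 first.
- exact: smeas_normE lf.1.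
- by rewrite lee_fin powR_ge0.
apply: ge0_ae_le_integral; [by []|by move=> w; rewrite lee_fin powR_ge0| |].
  by move=> w; rewrite -EFinM lee_fin mulr_ge0// powR_ge0.
apply: filterS fM => w h _; rewrite -EFinM lee_fin powRS// ler_wpM2r//.
exact: ler_pow.
Qed.

Lemma pow_sum3 (x y z : R) : 0 <= x -> 0 <= y -> 0 <= z ->
  (x + y + z) `^ (q + 1) <= 3 `^ (q + 1) * (x `^ (q + 1) + y `^ (q + 1) + z `^ (q + 1)).
Proof.
move=> x0 y0 z0; have q1 : 0 <= q + 1 by rewrite addr_ge0.
pose m := Num.max x (Num.max y z).
have m0 : 0 <= m by rewrite le_max x0.
have hs : x + y + z <= 3 * m.
  have hx : x <= m by rewrite le_max lexx.
  have hy : y <= m by rewrite !le_max lexx orbT.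
  have hz : z <= m by rewrite !le_max lexx !orbT.
  lra.
apply: le_trans (ler_pow q1 _ hs) _; first by rewrite !addr_ge0.
rewrite powRM// ler_wpM2l ?powR_ge0//.
have px := powR_ge0 x (q + 1); have py := powR_ge0 y (q + 1); have pz := powR_ge0 z (q + 1).
by rewrite /m; case: (leP x _) => _; [case: (leP y z) => _|]; lra.
Qed.

Lemma pmass_sum3 f g h : smeas f -> smeas g -> smeas h ->
  (pmass (fun w => (f w + g w) + h w)%R <= (3 `^ (q + 1))%:E * (pmass f + pmass g + pmass h))%E.
Proof.
move=> mf mg mh; have q1 : 0 <= q + 1 by rewrite addr_ge0.
have p0 (k : W -> X) w : (0 <= (`|k w| `^ (q + 1))%:E)%E by rewrite lee_fin powR_ge0.
have pf := measurable_pow q mf; have pg := measurable_pow q mg; have ph := measurable_pow q mh.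
have pfg := emeasurable_funD pf pg; have pfgh := emeasurable_funD pfg ph.
have fg0 w : setT w -> (0 <= (`|f w| `^ (q + 1))%:E + (`|g w| `^ (q + 1))%:E)%E.
  by move=> _; rewrite adde_ge0.
have fgh0 w : setT w -> (0 <= (`|f w| `^ (q + 1))%:E + (`|g w| `^ (q + 1))%:E +
    (`|h w| `^ (q + 1))%:E)%E by move=> _; rewrite !adde_ge0.
have c0 : (0 <= (3 `^ (q + 1) : R)%:E)%E by rewrite lee_fin powR_ge0.
rewrite /pmass -ge0_integralD// -ge0_integralD// -ge0_integralZl//.
apply: ge0_ae_le_integral; [by []|by move=> w; rewrite lee_fin powR_ge0| |].
  by move=> w; rewrite mule_ge0// fgh0.
apply: nearW => w _; rewrite -!EFinD -EFinM lee_fin.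
apply: le_trans (pow_sum3 _ _ _) => //; apply: ler_pow => //.
by apply: le_trans (ler_normD _ _) _; rewrite lerD2r ler_normD.
Qed.

(** One [h] close to [f] in [L_1] and in [L_p] at once, by dominated convergence: the approximation
    satisfies [|f - h n| <= |f|]. *)
Lemma pmass_approx f (e : R) : inL1 mu f -> (pmass f < +oo)%E -> 0 < e ->
  exists h, [/\ finitely_valued h, norm1 mu (f \- h) < e & (pmass (f \- h)%R < e%:E)%E].
Proof.
move=> lf pf e0; have [h [fh hle hf nh]] := inL1_approx lf.
have lh n : inL1 mu (h n) by exact: finitely_valued_inL1.
have [||||| _ _] := @dominated_convergence _ _ _ mu setT measurableT
  (fun n w => (`|(f \- h n) w| `^ (q + 1))%:E) (cst 0%E) (fun w => (`|f w| `^ (q + 1))%:E).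
- by move=> n; apply: measurable_pow; case: (inL1B lf (lh n)).
- exact: measurable_cst.
- apply: nearW => w _; apply: cvg_EFin; first exact: nearW.
  have c0 : `|f w| `^ q * `|f w - h n w| @[n --> \oo] --> (0 : R).
    rewrite -[X in _ --> X](mulr0 (`|f w| `^ q)); apply: cvgMr.
    rewrite -[X in _ --> X](normr0 X) -(subrr (f w)); apply: cvg_norm.
    by apply: cvgB => //; exact: cvg_cst.
  apply: (squeeze_cvgr _ (cvg_cst (0 : R)) c0); apply: nearW => n /=.
  by rewrite powR_ge0 /= powRS// ler_wpM2r// ler_pow.
- apply/integrableP; split; first by apply: measurable_pow; case: lf.
  by under eq_integral do rewrite gee0_abs ?lee_fin ?powR_ge0//.
- apply: nearW => w n _; rewrite gee0_abs ?lee_fin ?powR_ge0//.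
  by apply: ler_pow => //; [rewrite addr_ge0|exact: hle].
rewrite integral_cst// mul0e => c0.
have {c0} c0 : (pmass (f \- h n)%R @[n --> \oo] --> 0%E)%E := c0.
have /fine_cvgP[fin c1] := c0.
have [n [[fn h1] h2]] := filter_ex (filterI (filterI fin (cvgr_lt _ c1 _ e0)) (cvgr_lt _ nh _ e0)).
by exists (h n); split => //; rewrite -(fineK fn) lte_fin.
Qed.

(** Let [h] be finitely valued and close to [f]. Replacing [f] by [h] costs little, uniformly in [i]
    and in the limit operator [G]; and [K i h - G h] is bounded by [2 M], so that its [L_1]
    convergence implies [L_p] convergence. *)
Lemma Lp_convergence (I : Type) (FF : set_system I) (K : I -> (W -> X) -> W -> X) f g :
  ProperFilter FF -> (\forall i \near FF, L1_contraction mu (K i)) ->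
  (forall f, inL1 mu f -> exists2 g, inL1 mu g & norm1 mu (K i f \- g) @[i --> FF] --> (0 : R)) ->
  inL1 mu f -> (pmass f < +oo)%E -> inL1 mu g -> norm1 mu (K i f \- g) @[i --> FF] --> (0 : R) ->
  (pmass g < +oo)%E /\
  forall e : R, 0 < e -> \forall i \near FF, (pmass (K i f \- g)%R <= e%:E)%E.
Proof.
move=> PF cK limK lf pf lg fg.
have [G cG hG] := limit_contraction PF cK limK.
have [iG _ _ bG] := cG.
have gG : \forall w \ae mu, g w = G f w.
  apply: (L1_cvg_unique PF lg (iG _ lf) _ fg (hG _ lf)).
  by apply: filterS cK => i [h _ _ _]; exact: h.
split.
  rewrite (pmass_ae gG); apply: le_lt_trans (contraction_pmass q0 cG lf) _.
  by rewrite lte_mul_pinfty ?lee_fin ?mulr_ge0 ?powR_ge0// lte_add_pinfty// ltry.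
move=> e e0; pose C : R := 2 * 4 `^ q; pose c3 : R := 3 `^ (q + 1).
have C0 : 0 < C by rewrite mulr_gt0// powR_gt0.
have c30 : 0 < c3 by rewrite powR_gt0.
(* Three terms, and the constant [3^(q+1)] of the inequality for the power of a sum of three. *)
pose eta := e / (3 * c3); have eta0 : 0 < eta by rewrite divr_gt0// mulr_gt0.
have a0 : 0 < eta / (2 * C) by rewrite divr_gt0// mulr_gt0.
have [h [fh h1 h2]] := pmass_approx lf pf a0.
have lh := finitely_valued_inL1 mu fh; have lfh := inL1B lf lh.
have [M hM] := finitely_valued_bounded fh.
have hMae : \forall w \ae mu, `|h w| <= M by exact: nearW.
have small K' : L1_contraction mu K' -> (pmass (K' f \- K' h)%R <= eta%:E)%E.
  move=> cK'; rewrite -(pmass_ae (contractionB cK' lf lh)).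
  apply: le_trans (contraction_pmass q0 cK' lfh) _; rewrite -/C.
  apply: (@le_trans _ _ (C%:E * ((eta / (2 * C))%:E + (eta / (2 * C))%:E))%E).
    by apply: lee_wpmul2l; [rewrite lee_fin ltW|apply: leeD; [rewrite lee_fin ltW|exact: ltW]].
  rewrite -EFinD -EFinM lee_fin le_eqVlt; apply/orP; left; apply/eqP.
  by field; rewrite gt_eqF.
have b0 : 0 < eta / ((2 * M) `^ q + 1) by rewrite divr_gt0// ltr_wpDl// powR_ge0.
apply: filterS2 cK (cvgr_lt _ (hG _ lh) _ b0) => i cKi hi.
have [iK _ _ bK] := cKi.
have lKf := iK _ lf; have lKh := iK _ lh; have lGf := iG _ lf; have lGh := iG _ lh.
rewrite (@pmass_ae _ (fun w => ((K i f \- K i h) w + (K i h \- G h) w) + (G h \- G f) w)); last first.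
  by apply: filterS gG => w /= ->; rewrite !addrA !subrK.
apply: le_trans (pmass_sum3 (inL1B lKf lKh).1 (inL1B lKh lGh).1 (inL1B lGh lGf).1) _.
have p2 : (pmass (K i h \- G h)%R <= eta%:E)%E.
  have bd : \forall w \ae mu, `|(K i h \- G h) w| <= 2 * M.
    apply: filterS2 (bK _ _ lh hMae) (bG _ _ lh hMae) => w k1 k2.
    by apply: le_trans (ler_normB _ _) _; lra.
  apply: le_trans (pmass_bounded (inL1B lKh lGh) bd) _; rewrite lee_fin.
  have qM : 0 <= (2 * M) `^ q by exact: powR_ge0.
  apply: (@le_trans _ _ (((2 * M) `^ q + 1) * (eta / ((2 * M) `^ q + 1)))).
    by apply: ler_pM => //; [exact: norm1_ge0|rewrite lerDl|exact: ltW].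
  by rewrite mulrC divfK// gt_eqF// ltr_wpDl.
have p3 : (pmass (G h \- G f)%R <= eta%:E)%E.
  rewrite (_ : pmass _ = pmass (G f \- G h)); first exact: small.
  by apply: eq_integral => w _; rewrite /= distrC.
apply: (@le_trans _ _ (c3%:E * (eta%:E + eta%:E + eta%:E))%E).
  apply: lee_wpmul2l; first by rewrite lee_fin ltW.
  exact: (leeD (leeD (small _ cKi) p2) p3).
rewrite -!EFinD -EFinM lee_fin le_eqVlt; apply/orP; left; apply/eqP.
by rewrite /eta; field; rewrite gt_eqF.
Qed.

End Lp_convergence.

(** * Identification of the ergodic averages *)

Section ergodic_averages.
Context {R : realType} {X : completeNormedModType R} {d : measure_display}
  {W : measurableType d} (mu : {finite_measure set W -> \bar R}).
Local Notation lam := (@lebesgue_measure R).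
Variables (T S : R -> (W -> X) -> W -> X).
Hypothesis sgS : contraction_semigroup mu S.
Hypothesis linT : forall t, 0 <= t -> L1_linear mu (T t).
Hypothesis TS : forall t f, 0 <= t -> inL1 mu f -> \forall w \ae mu, T t f w = S t f w.
Implicit Types (f g : W -> X) (s t : R).

Lemma average_unique f (A B : R -> W -> X) : inL1 mu f -> average mu S f A -> average mu S f B ->
  \forall w \ae mu, forall t, 0 < t -> A t w = B t w.
Proof.
move=> lf [lA cA rA] [lB cB rB]; apply: average_eq_dyadic => // l m m0.
have d0 : 0 < dyadic l m :> R by exact: dyadic_gt0.
have lr j : inL1 mu (riemann S f (l + j) (m * 2 ^ j)) by exact: riemann_inL1.
have := dyadic_lim_unique lr (inL1Z (dyadic l m) (lA _ d0)) (inL1Z (dyadic l m) (lB _ d0))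
  (rA l m m0) (rB l m m0).
by apply: filterS => w; exact: (scalerI (lt0r_neq0 d0)).
Qed.

Lemma semigroup_class f0 f t : 0 <= t -> inL1 mu f -> (\forall w \ae mu, f0 w = f w) ->
  \forall w \ae mu, T t f0 w = S t f w.
Proof.
move=> t0 lf ff; have [_ cp _] := linT t0.
have L0 : Lp mu 1 f0 by apply/Lp1P; exists f.
have h : T t f0 = T t f %[ae mu].
  by apply: cp => //; [exact: inL1_Lp|apply: filterS ff => w ->].
by apply: filterS2 h (TS t0 lf) => w -> // ->.
Qed.

Lemma ergodic_average_exists f0 f : inL1 mu f -> (\forall w \ae mu, f0 w = f w) ->
  exists a, is_ergodic_average mu T f0 a.
Proof.
move=> lf ff; have [G mG hG] := semigroup_joint sgS lf.
have n0 : \forall t \ae lam, t != 0 :> R.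
  exists [set 0]; split; [exact: measurable_set1|exact: lebesgue_measure_set1|].
  by move=> t /= /negP; rewrite negbK => /eqP.
have rG : represents mu S G f.
  split => //; apply: filterS n0 => t t0 t1; apply: hG.
  by rewrite lt_neqAle eq_sym t0.
(* [G] gives the orbit for [t > 0]; the value at [t = 0] is inserted by hand, on a null set of
   times. *)
pose g (t : R) := if t == 0 then T 0 f0 else fun w => G (t, w).
exists (fun t w => t^-1 *: bochner_integral lam `[0, t] (g ^~ w)), g; split.
- apply: (smeas_strongly_measurable mG); exists ([set 0] `*` setT); split.
  + by apply: measurableX => //; exact: measurable_set1.
  + have h := product_measure1E lam mu (measurable_set1 (0 : R)) (@measurableT _ W).
    apply: etrans h _.
    exact: etrans (congr1 (fun x => (x * mu setT)%E) (lebesgue_measure_set1 (0 : R))) (mul0e _).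
  + move=> [t w] /= h; split => //=; apply: contrapT => t0; apply: h.
    by rewrite /g; case: eqP.
- move=> t t0; rewrite /g; case: eqP => [->|/eqP tn]; first exact: nearW.
  have tp : 0 < t by rewrite lt_neqAle eq_sym tn.
  have h1 := hG t tp; have h2 := semigroup_class t0 lf ff.
  by apply: filterS2 h1 h2 => w -> ->.
- have [A _ hA] := average_exists sgS rG lf.
  apply: filterS hA => w hw t t0; have [nG _] := hw t t0; split => //.
  have Doo : (lam `[0%R, t]%classic < +oo)%E by rewrite lam_itv_cc ?ltry// ltW.
  have [x hx] := @bochner_exists _ _ _ _ lam _ _ (measurable_itv _) Doo nG.
  exists x; apply: (@is_bochner_integral_ae _ _ _ _ lam _ (fun s => G (s, w))) hx => //.
  by apply: filterS n0 => s s0; rewrite /g (negbTE s0).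
Qed.

(** [ergodic_average] is one choice among the admissible processes. Whatever joint representative it
    comes from, a measurable version of it represents the orbit, and two averages agree almost
    everywhere for all [t] at once. *)
Lemma ergodic_averageE f0 f (A : R -> W -> X) : inL1 mu f -> average mu S f A ->
  (\forall w \ae mu, f0 w = f w) ->
  \forall w \ae mu, forall t, 0 < t -> ergodic_average mu T f0 t w = A t w.
Proof.
move=> lf avA ff; have [a0 ha0] := ergodic_average_exists lf ff.
have : is_ergodic_average mu T f0 (ergodic_average mu T f0).
  rewrite /ergodic_average; case: xgetP => [a _|h] //.
  by have := h a0.
move: (ergodic_average mu T f0) => a [g [mg gT ha]].
have [G mG gG] := strongly_measurable_smeas mg.
have [G1 G2] := ae_slices gG.
have rG : represents mu S G f.
  split => //; apply: filterS G2 => t Gt t0.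
  apply: filterS3 Gt (gT t t0) (semigroup_class t0 lf ff) => w /= <- -> //.
have [B avB hB] := average_exists sgS rG lf.
apply: filterS3 (filterI G1 ha) hB (average_unique lf avA avB) => w [Gw aw] Bw AB t t0.
have [_ ea] := aw t t0; have [_ eb] := Bw t t0.
rewrite (AB t t0); apply: etrans ea (etrans _ (esym eb)); congr (_ *: _).
by apply: (@bochner_integral_ae _ _ _ _ lam).
Qed.

End ergodic_averages.

(** * Joint limits in time and filtration *)

Section joint_convergence.
Context {R : realType} {X : completeNormedModType R} {d : measure_display}
  {W : measurableType d} (mu : {finite_measure set W -> \bar R}).
Implicit Types (f g : W -> X) (s t : R).

Lemma condexp_operator (F : set (set W)) : sigma_algebra setT F -> F `<=` measurable ->
  exists2 E, (forall f, inL1 mu f -> condexp mu F f (E f)) & L1_contraction mu E.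
Proof.
move=> sF Fm.
have /choice[E hE] : forall f, exists g, inL1 mu f -> condexp mu F f g.
  move=> f; have [lf|nl] := pselect (inL1 mu f); last by exists f.
  by have [g fg] := condexp_exists sF Fm lf; exists g.
exists E => //; split => [f lf|a f g lf lg|f lf|f M lf fM].
- by have [] := hE f lf.
- apply: (condexp_unique sF Fm (hE _ _) (condexp_linear Fm a (hE _ lf) (hE _ lg))).
  exact: inL1D (inL1Z a lf) lg.
- exact: (condexp_norm1 sF Fm (hE _ lf)).
- exact: (condexp_bounded sF Fm (hE _ lf) fM).
Qed.

Lemma near_joint (P : R -> R -> Prop) (t0 s0 : R) :
  (forall t s, t0 <= t -> s0 <= s -> P t s) ->
  \forall ts \near filter_prod (pinfty_nbhs R) (pinfty_nbhs R), P ts.1 ts.2.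
Proof.
move=> h; exists ([set t | t0 <= t], [set s | s0 <= s]).
  by split; exact: nbhs_pinfty_ge (num_real _).
by move=> [t s] [/= tt ss]; exact: h.
Qed.

Lemma Xnorm_cvg0 (q : R) (I : Type) (FF : set_system I) (u : I -> W -> X) : 0 <= q ->
  ProperFilter FF ->
  (forall e : R, 0 < e -> \forall i \near FF, (pmass mu q (u i) <= e%:E)%E) ->
  Xnorm mu (q + 1)%:E (u i) @[i --> FF] --> 0%E.
Proof.
move=> q0 PF h.
have {}h (e : R) : 0 < e -> \forall i \near FF, (Xnorm mu (q + 1)%:E (u i) <= e%:E)%E.
  move=> e0; have := h _ (powR_gt0 (q + 1) e0); apply: filterS => i hi.
  by apply: Xnorm_le => //; exact: ltW.
have X0 i : (0 <= Xnorm mu (q + 1)%:E (u i))%E by exact: Lnorm_ge0.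
apply/fine_cvgP; split.
  apply: filterS (h 1 ltr01) => i hi; rewrite ge0_fin_numE//.
  exact: le_lt_trans hi (ltry _).
apply/cvgrPdist_le => e e0; apply: filterS (h e e0) => i hi.
by rewrite sub0r normrN ger0_norm ?fine_ge0//; exact: le_fine_id.
Qed.

Variable F : R -> set (set W).
Hypothesis FF : filtration F.
Variable Es : R -> (W -> X) -> W -> X.
Hypothesis hE : forall s, 0 <= s ->
  (forall f, inL1 mu f -> condexp mu (F s) f (Es s f)) /\ L1_contraction mu (Es s).
Variable Av : (W -> X) -> R -> W -> X.
Hypothesis cAv : forall t, 0 < t -> L1_contraction mu (fun f => Av f t).

Let joint := filter_prod (pinfty_nbhs R) (pinfty_nbhs R).

Lemma joint_contraction1 :
  \forall ts \near joint, L1_contraction mu (fun f => Es ts.2 (Av f ts.1)).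
Proof.
apply: (near_joint (P := fun t s => L1_contraction mu (fun f => Es s (Av f t))) (t0 := 1) (s0 := 0)).
move=> t s t1 s0; have [_ cE] := hE s0.
exact: (contraction_comp cE (cAv (lt_le_trans ltr01 t1))).
Qed.

Lemma joint_contraction2 :
  \forall ts \near joint, L1_contraction mu (fun f => Av (Es ts.2 f) ts.1).
Proof.
apply: (near_joint (P := fun t s => L1_contraction mu (fun f => Av (Es s f) t)) (t0 := 1) (s0 := 0)).
move=> t s t1 s0; have [_ cE] := hE s0.
exact: (contraction_comp (cAv (lt_le_trans ltr01 t1)) cE).
Qed.

Lemma joint_cvg1 f fbar g : inL1 mu f -> inL1 mu fbar ->
  (forall e : R, 0 < e -> exists2 t0, 0 < t0 & forall t, t0 <= t -> norm1 mu (Av f t \- fbar) < e) ->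
  condexp mu (filtration_infty F) fbar g ->
  norm1 mu (Es ts.2 (Av f ts.1) \- g) @[ts --> joint] --> (0 : R).
Proof.
move=> lf lfb hA fg; have [_ lg _ _] := fg.
apply/cvgrPdist_lt => e e0; have e20 : 0 < e / 2 by rewrite divr_gt0.
have [t0 t00 ht] := hA _ e20; have [S S0 hS] := condexp_cvg FF fg e20.
apply: (near_joint (P := fun t s => `|0 - norm1 mu (Es s (Av f t) \- g)| < e) (t0 := t0) (s0 := S)).
move=> t s tt Ss; rewrite sub0r normrN ger0_norm ?norm1_ge0//.
have s0 := le_trans S0 Ss; have tp := lt_le_trans t00 tt.
have [hEs cE] := hE s0; have [iE _ _ _] := cE; have [iA _ _ _] := cAv tp.
have := norm1_triangle (iE _ (iA _ lf)) (iE _ lfb) lg.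
have := L1_contraction_dist cE (iA _ lf) lfb.
have := ht t tt; have := hS s _ Ss (hEs _ lfb); lra.
Qed.

Lemma joint_cvg2 f g gbar : inL1 mu f -> inL1 mu gbar ->
  condexp mu (filtration_infty F) f g ->
  (forall e : R, 0 < e -> exists2 t0, 0 < t0 & forall t, t0 <= t -> norm1 mu (Av g t \- gbar) < e) ->
  norm1 mu (Av (Es ts.2 f) ts.1 \- gbar) @[ts --> joint] --> (0 : R).
Proof.
move=> lf lgb fg hA; have [_ lg _ _] := fg.
apply/cvgrPdist_lt => e e0; have e20 : 0 < e / 2 by rewrite divr_gt0.
have [t0 t00 ht] := hA _ e20; have [S S0 hS] := condexp_cvg FF fg e20.
apply: (near_joint (P := fun t s => `|0 - norm1 mu (Av (Es s f) t \- gbar)| < e) (t0 := t0) (s0 := S)).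
move=> t s tt Ss; rewrite sub0r normrN ger0_norm ?norm1_ge0//.
have s0 := le_trans S0 Ss; have tp := lt_le_trans t00 tt.
have [hEs cE] := hE s0; have [iE _ _ _] := cE; have cA := cAv tp; have [iA _ _ _] := cA.
have := norm1_triangle (iA _ (iE _ lf)) (iA _ lg) lgb.
have := L1_contraction_dist cA (iE _ lf) lg.
have := ht t tt; have := hS s _ Ss (hEs _ lf); lra.
Qed.

End joint_convergence.

Theorem theorem3p1 (R : realType) (X : completeNormedModType R)
    (d : measure_display) (W : measurableType d)
    (mu : {finite_measure set W -> \bar R})
    (T : R -> (W -> X) -> (W -> X)) (F : R -> set (set W))
    (p : R) (f : W -> X) :
  reflexive_space X ->
  strongly_continuous_semigroup mu T ->
  (forall t, 0 <= t -> L1_Linfty_contraction mu (T t)) ->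
  filtration F ->
  1 <= p ->
  Lp mu p%:E f ->
  (exists f_infty f_upper : W -> X,
    [/\ Lp mu 1 f_infty,
        ergodic_average_ae_cvg mu T f f_infty,
        cond_exp_ae_cvg mu F f_infty f_upper,
        Lp mu p%:E f_upper &
        Lp_joint_cvg mu p%:E
          (fun t s => cond_exp mu (F s) (ergodic_average mu T f t)) f_upper]) /\
  (exists f_lower : W -> X,
    [/\ ergodic_average_ae_cvg mu T (cond_exp mu (filtration_infty F) f) f_lower,
        Lp mu p%:E f_lower &
        Lp_joint_cvg mu p%:E
          (fun t s => ergodic_average mu T (cond_exp mu (F s) f) t) f_lower]).
Proof.
move=> reflX sgT cT FF p1 [mf nf].
have [S sgS TS] := semigroup_rep sgT cT; have [linT _ _ _] := sgT.
have [Av [hAv cAv]] := average_operator sgS.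
have [sF Fm _] := FF.
have sFoo := filtration_infty_sigma F; have Foom := filtration_infty_measurable FF.
pose q := p - 1; have q0 : 0 <= q by rewrite subr_ge0.
have pE : p = q + 1 by rewrite subrK.
rewrite pE in nf *.
have [f' mf' ff'] := strongly_measurable_smeas mf.
have pf : (pmass mu q f' < +oo)%E by rewrite -(pmass_ae q ff'); apply/Xnorm_lty.
have lf := pmass_inL1 q0 mf' pf.
have LpE g : inL1 mu g -> (pmass mu q g < +oo)%E -> Lp mu (q + 1)%:E g.
  by move=> /inL1_Lp[mg _] pg; split => //; apply/Xnorm_lty.
(* [F s] is a sigma-algebra for [s >= 0] only; the identity is a dummy value for negative [s]. *)
have /choice[Es hEs] : forall s : R, exists E : (W -> X) -> W -> X, 0 <= s ->
    (forall f, inL1 mu f -> condexp mu (F s) f (E f)) /\ L1_contraction mu E.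
  move=> s; have [s0|_] := boolP (0 <= s); last by exists id.
  have [E h1 h2] := @condexp_operator R X d W mu (F s) (sF s s0) (Fm s s0).
  by exists E => _; split.
have [Eoo hEoo cEoo] := @condexp_operator _ X _ _ mu _ sFoo Foom.
have lEoo g : inL1 mu g -> inL1 mu (Eoo g) by case: cEoo => h _ _ _; exact: h.
have erg := ergodic_theorem reflX sgS hAv cAv.
have avE := ergodic_averageE sgS linT TS.
split.
- have [fbar lfbar [aefbar hfbar]] := erg f' lf.
  have cvg1 g gbar : inL1 mu g -> inL1 mu gbar -> _ -> _ :=
    fun lg lgb hg => joint_cvg1 FF hEs cAv lg lgb hg (hEoo _ lgb).
  have [|pg hg] := Lp_convergence q0 _ (joint_contraction1 hEs cAv) _ lf pf (lEoo _ lfbar)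
      (cvg1 _ _ lf lfbar hfbar).
    move=> g lg; have [gbar lgb [_ hgb]] := erg g lg.
    by exists (Eoo gbar); [exact: lEoo|exact: cvg1].
  exists fbar, (Eoo fbar); split.
  + exact: inL1_Lp.
  + apply: filterS2 aefbar (avE f f' _ lf (hAv _ lf) ff') => w cw ew.
    apply: cvg_trans cw; apply: near_eq_cvg.
    have := nbhs_pinfty_gt (num_real (0 : R)); apply: filterS => t t0.
    by rewrite ew.
  + have [e [eM ecvg]] := martingale_ae FF (hEoo _ lfbar) (fun s s0 => (hEs s s0).1 _ lfbar).
    exists e; split => // s s0.
    have h : \forall w \ae mu, fbar w = fbar w by exact: nearW.
    by apply: filterS2 (eM s s0) (cond_expE (sF s s0) (Fm s s0) h ((hEs s s0).1 _ lfbar)) => w -> ->.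
  + exact: LpE (lEoo _ lfbar) pg.
  + apply: (@Xnorm_cvg0 R X d W mu q _ _
      (fun ts => cond_exp mu (F ts.2) (ergodic_average mu T f ts.1) \- Eoo fbar) q0) => e e0.
    (* The identification of classes is available for [t > 0] and [s >= 0]; the thresholds 1 and 0
       ensure it. *)
    have := hg e e0; have := @near_joint R (fun t s => 0 < t /\ 0 <= s) 1 0.
    move=> /(_ (fun t s t1 s0 => conj (lt_le_trans ltr01 t1) s0)).
    apply: filterS2 => -[t s] [/= t0 s0] h.
    rewrite (@pmass_ae _ _ _ _ _ _ _ (Es s (Av f' t) \- Eoo fbar))//.
    have lA : inL1 mu (Av f' t) by case: (cAv t t0) => i _ _ _; exact: i.
    have h1 : \forall w \ae mu, ergodic_average mu T f t w = Av f' t w.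
      by apply: filterS (avE f f' _ lf (hAv _ lf) ff') => w; exact.
    have := cond_expE (sF s s0) (Fm s s0) h1 ((hEs s s0).1 _ lA).
    by apply: filterS => w /= ->.
- have [gbar lgbar [aegbar hgbar]] := erg (Eoo f') (lEoo _ lf).
  have [|pg hg] := Lp_convergence q0 _ (joint_contraction2 hEs cAv) _ lf pf lgbar
      (joint_cvg2 FF hEs cAv lf lgbar (hEoo _ lf) hgbar).
    move=> g lg; have [h lh [_ hh]] := erg (Eoo g) (lEoo _ lg).
    by exists h => //; exact: (joint_cvg2 FF hEs cAv lg lh (hEoo _ lg) hh).
  have eE := cond_expE sFoo Foom ff' (hEoo _ lf).
  exists gbar; split.
  + apply: filterS2 aegbar (avE _ _ _ (lEoo _ lf) (hAv _ (lEoo _ lf)) eE) => w cw ew.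
    apply: cvg_trans cw; apply: near_eq_cvg.
    have := nbhs_pinfty_gt (num_real (0 : R)); apply: filterS => t t0.
    by rewrite ew.
  + exact: LpE lgbar pg.
  + apply: (@Xnorm_cvg0 R X d W mu q _ _
      (fun ts => ergodic_average mu T (cond_exp mu (F ts.2) f) ts.1 \- gbar) q0) => e e0.
    have := hg e e0; have := @near_joint R (fun t s => 0 < t /\ 0 <= s) 1 0.
    move=> /(_ (fun t s t1 s0 => conj (lt_le_trans ltr01 t1) s0)).
    apply: filterS2 => -[t s] [/= t0 s0] h.
    rewrite (@pmass_ae _ _ _ _ _ _ _ (Av (Es s f') t \- gbar))//.
    have fE := (hEs s s0).1 _ lf; have [_ lE _ _] := fE.
    have h1 := cond_expE (sF s s0) (Fm s s0) ff' fE.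
    by apply: filterS (avE _ _ _ lE (hAv _ lE) h1) => w /= ->.
Qed.
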